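(* Let $N$ be a squarefree positive integer with $\gcd(N,6)=1$. Then $$f_{\theta_{N-1}}(z)=1+\sum_{d\mid N}C(d,N)(N/d)^{(N-3)/2}\frac{1-N}{B_{(N-1)/2,\chi_N}}\sum_{n\ge1}\sigma_{(N-3)/2}(\chi_{N/d},\chi_d;n)q^n+C_3(z)$$ for some cusp form $C_3(z)\in S_{(N-1)/2}(\Gamma_0(N),\chi_N)$.
   Context: $q=e^{2\pi iz}$; $\theta_m(x)=\sum_{i=1}^mx_i^2+\sum_{1\le i<j\le m}x_ix_j$ and $f_{\theta_m}(z)=\sum_{x\in\mathbb{Z}^m}q^{\theta_m(x)}$ ($f_{\theta_0}=1$). For an odd squarefree positive integer $a$ and $b\in\mathbb{Z}$, $\chi_a(b)$ is the Kronecker symbol $\left(\frac{(-1)^{(a-1)/2}a}{b}\right)$. $S_k(\Gamma_0(N),\chi_N)$ is the space of cusp forms of weight $k$ on $\Gamma_0(N)$ with character $\chi_N$. $\sigma_{k-1}(\chi_{N/d},\chi_d;n)=\sum_{1\le t\mid n}\chi_{N/d}(n/t)\chi_d(t)t^{k-1}$. $B_{k,\chi_N}$ is defined by $\sum_{k\ge0}B_{k,\chi_N}t^k/k!=\sum_{a=1}^N\chi_N(a)te^{at}/(e^{Nt}-1)$. $\epsilon_c=1$ if $c\equiv1\pmod4$, $\epsilon_c=i$ if $c\equiv3\pmod4$; $A(d,N)=(-1)^{(d+1)(N/d-1)/4}\epsilon_{N/d}$; $C(d,N)=i^{(1-Nd)/2}/A(d,N)$. *)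

(* Defs.v *)
From HB Require Import structures.
From mathcomp Require Import all_boot all_order all_algebra finmap.
From mathcomp Require Import all_classical all_reals all_analysis.
From mathcomp Require Import complex summability.

Set Implicit Arguments.
Unset Strict Implicit.
Unset Printing Implicit Defensive.

Import Order.TTheory GRing.Theory Num.Theory numFieldNormedType.Exports.

Local Open Scope ring_scope.
Local Open Scope classical_set_scope.
Local Open Scope complex_scope.

Definition squarefree (n : nat) : Prop :=
  forall d : nat, (d ^ 2 %| n)%N -> d = 1%N.

Definition legendre (D : int) (p : nat) : int :=
  if (p %| D)%Z then 0
  else if [exists x : 'F_p, x ^+ 2 == D%:~R] then 1 else -1.

Definition kronecker2 (D : int) : int :=
  if (2 %| D)%Z then 0
  else if ((D %% 8)%Z == 1) || ((D %% 8)%Z == 7) then 1 else -1.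

Definition kronecker_prime (D : int) (p : nat) : int :=
  if p == 2 then kronecker2 D else legendre D p.

Definition kronecker_sign (D b : int) : int :=
  if (b < 0) && (D < 0) then -1 else 1.

Definition kronecker (D b : int) : int :=
  if b == 0 then (`|D|%N == 1%N)%:Z
  else kronecker_sign D b *
       \prod_(p <- primes `|b|%N) kronecker_prime D p ^+ logn p `|b|%N.

Definition chi (a : nat) (b : int) : int :=
  kronecker ((-1) ^+ (a.-1 %/ 2) * a%:Z) b.

(* A sequence [f : nat -> F] stands for the formal power series
   [\sum_n f n * t ^ n]. *)
Section FormalPowerSeries.
Variable F : fieldType.
Implicit Types f g : nat -> F.

Definition fps_mul f g : nat -> F :=
  fun n => \sum_(i < n.+1) f i * g (n - i)%N.

(* The first [n] coefficients of [1 / f]. *)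
Fixpoint fps_inv_seq f n : seq F :=
  if n is m.+1 then
    let s := fps_inv_seq f m in
    rcons s (((m == 0)%:R - \sum_(i < m) s`_i * f (m - i)%N) / f 0%N)
  else [::].

Definition fps_inv f : nat -> F := fun n => (fps_inv_seq f n.+1)`_n.

Lemma size_fps_inv_seq f n : size (fps_inv_seq f n) = n.
Proof. by elim: n => //= n IHn; rewrite size_rcons IHn. Qed.

Lemma nth_fps_inv_seq f n i : (i < n)%N -> (fps_inv_seq f n)`_i = fps_inv f i.
Proof.
elim: n => // n IHn; rewrite ltnS leq_eqVlt => /predU1P[->//|ltin] /=.
by rewrite nth_rcons size_fps_inv_seq ltin IHn.
Qed.

Lemma fps_mulVr f : f 0%N != 0 ->
  fps_mul (fps_inv f) f = fun n => (n == 0)%:R.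
Proof.
move=> f0; apply/funext => n; rewrite /fps_mul big_ord_recr /= subnn.
rewrite {2}/fps_inv /= nth_rcons size_fps_inv_seq ltnn eqxx divfK //.
under [X in _ - X]eq_bigr => i _ do rewrite nth_fps_inv_seq //.
by rewrite addrC subrK.
Qed.

Lemma coef_fps_mul f g n k : (k <= n)%N ->
  (\poly_(i < n.+1) f i * \poly_(i < n.+1) g i)`_k = fps_mul f g k.
Proof.
move=> lekn; rewrite coefM; apply: eq_bigr => -[i /=]; rewrite ltnS => leik _.
rewrite !coef_poly !ltnS (leq_trans leik lekn).
by rewrite (leq_trans (leq_subr _ _) lekn).
Qed.

Lemma fps_mulA f g h : fps_mul f (fps_mul g h) = fps_mul (fps_mul f g) h.
Proof.
apply/funext => n; pose P u := \poly_(i < n.+1) u i : {poly F}.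
transitivity ((P f * (P g * P h))`_n).
  rewrite coefM; apply: eq_bigr => -[i /=]; rewrite ltnS => lein _.
  by rewrite coef_poly ltnS lein coef_fps_mul ?leq_subr.
rewrite mulrA coefM; apply: eq_bigr => -[i /=]; rewrite ltnS => lein _.
by rewrite [(P h)`__]coef_poly ltnS leq_subr coef_fps_mul.
Qed.

Definition fps_exp (c : F) : nat -> F := fun n => c ^+ n / n`!%:R.

(* [\sum_k B_k t^k / k! = \sum_(1 <= a <= N) psi a * t * e^(a t) / (e^(N t) - 1)]
   where the right-hand side is computed as the product of
   [\sum_(1 <= a <= N) psi a * e^(a t)] and the inverse of [(e^(N t) - 1) / t]. *)
Definition gen_bernoulli (psi : int -> int) (N k : nat) : F :=
  k`!%:R *
  fps_mul (fun n => \sum_(1 <= a < N.+1) (psi a)%:~R * fps_exp a%:R n)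
          (fps_inv (fun n => fps_exp N%:R n.+1)) k.

End FormalPowerSeries.

Lemma gen_bernoulliP (F : numFieldType) (psi : int -> int) (N : nat) :
  (0 < N)%N ->
  fps_mul (fun k => gen_bernoulli F psi N k / k`!%:R)
          (fun n => fps_exp N%:R n - (n == 0)%:R)
  = fps_mul (fun n => (n == 1%N)%:R)
      (fun n => \sum_(1 <= a < N.+1) (psi a)%:~R * fps_exp a%:R n).
Proof.
move=> N0; pose E n := fps_exp (N%:R : F) n.+1.
set S := fun n => \sum_(1 <= a < N.+1) (psi a)%:~R * fps_exp (a%:R : F) n.
have BE : (fun k => gen_bernoulli F psi N k / k`!%:R) = fps_mul S (fps_inv E).
  apply/funext => k; rewrite /gen_bernoulli mulrC mulKf //.
have E0 : E 0%N != 0.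
  by rewrite /E /fps_exp expr1 divr1 pnatr_eq0 -lt0n.
have XE (f : nat -> F) n : fps_mul (fun n => (n == 1%N)%:R) f n =
    if n is m.+1 then f m else 0.
  rewrite /fps_mul; case: n => [|n]; first by rewrite big_ord1 mul0r.
  rewrite big_ord_recl mul0r add0r big_ord_recl mul1r subSS subn0.
  by rewrite big1 ?addr0 // => i _; rewrite mul0r.
have -> : (fun n => fps_exp (N%:R : F) n - (n == 0)%:R) =
    fps_mul E (fun n => (n == 1%N)%:R).
  apply/funext => -[|n].
    by rewrite /fps_mul big_ord1 mulr0 /fps_exp expr0 divr1 subrr.
  rewrite subr0 /fps_mul big_ord_recr /= subnn mulr0 addr0.
  rewrite big_ord_recr /= subSnn mulr1 big1 ?add0r // => i _.
  by rewrite gtn_eqF ?mulr0 // subSn ?ltnS ?subn_gt0 // ltnW.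
rewrite BE -fps_mulA (fps_mulA (fps_inv E)) fps_mulVr //.
have mul1 (f : nat -> F) : fps_mul (fun n => (n == 0)%:R) f = f.
  apply/funext => n; rewrite /fps_mul big_ord_recl mul1r subn0.
  by rewrite big1 ?addr0 // => i _; rewrite mul0r.
rewrite mul1; apply/funext => n; rewrite XE /fps_mul; case: n => [|n].
  by rewrite big_ord1 mulr0.
rewrite big_ord_recr /= subnn mulr0 addr0.
rewrite big_ord_recr /= subSnn mulr1 big1 ?add0r // => i _.
by rewrite gtn_eqF ?mulr0 // subSn ?ltnS ?subn_gt0 // ltnW.
Qed.

HB.instance Definition _ (R : rcfType) := NormedModule.copy R[i] R[i]^o.

Section ModularForms.
Variable R : realType.
Implicit Types (z : R[i]) (f : R[i] -> R[i]).

Definition cexp z : R[i] :=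
  (expR (complex.Re z) * cos (complex.Im z)) +i*
  (expR (complex.Re z) * sin (complex.Im z)).

(* [nome z] is [q = e^(2 pi i z)]. *)
Definition nome z : R[i] := cexp ((2 * pi)*i * z).

Definition upper_half_plane : set R[i] := [set z | 0 < complex.Im z].

Definition SL2Z : set 'M[int]_2 := [set g | \det g = 1].

Definition Gamma0 (N : nat) : set 'M[int]_2 :=
  [set g | SL2Z g /\ (N %| g 1%R 0%R)%Z].

Definition automorphy (g : 'M[int]_2) z : R[i] :=
  (g 1 0)%:~R * z + (g 1 1)%:~R.

Definition moebius (g : 'M[int]_2) z : R[i] :=
  ((g 0 0)%:~R * z + (g 0 1)%:~R) / automorphy g z.

Definition slash (k : nat) f (g : 'M[int]_2) z : R[i] :=
  automorphy g z ^- k * f (moebius g z).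

(* The level [N] and a character [psi] modulo [N] being given, every [f | g],
   with [g] in SL_2(Z), is [N]-periodic, so that its Fourier expansion is in
   powers of [e^(2 pi i z / N)]; [f] is cuspidal when all these expansions have
   only terms of positive exponent. *)
Definition cusp_form (k N : nat) (psi : int -> int) f : Prop :=
  [/\ forall z, upper_half_plane z -> derivable f z 1,
      forall g z, Gamma0 N g -> upper_half_plane z ->
        f (moebius g z) = (psi (g 1 1))%:~R * automorphy g z ^+ k * f z
    & forall g, SL2Z g -> exists2 a : nat -> R[i], a 0%N = 0 &
        forall z, upper_half_plane z ->
          series (fun n => a n * nome (z / N%:R) ^+ n) @ \oo
            --> slash k f g z].

Definition theta (m : nat) (x : 'rV[int]_m) : int :=
  \sum_(i < m) x 0 i ^+ 2 +
  \sum_(i < m) \sum_(j < m | (i < j)%N) x 0 i * x 0 j.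

(* [sum] is the limit of the finite partial sums along the inclusion of finite
   subsets of the index type. *)
Definition f_theta (m : nat) z : R[i] :=
  sum (fun x : 'rV[int]_m => nome z ^ theta x).

(* [sigma e psi phi n] is the twisted divisor sum with [t ^ e]; the exponent is
   an integer because [e = -1] occurs for [N = 1]. *)
Definition sigma (e : int) (psi phi : int -> int) (n : nat) : R[i] :=
  \sum_(t <- divisors n)
    (psi (n %/ t)%N)%:~R * (phi t)%:~R * t%:R ^ e.

Definition epsilon (c : nat) : R[i] := if (c %% 4)%N == 1%N then 1 else 'i.

Definition A_coef (d N : nat) : R[i] :=
  (-1) ^+ ((d + 1) * (N %/ d - 1) %/ 4) * epsilon (N %/ d).

Definition C_coef (d N : nat) : R[i] :=
  'i ^ ((1 - (N * d)%:Z) %/ 2)%Z / A_coef d N.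

End ModularForms.

(* Main.v *)
Require Import Defs.
From mathcomp Require Import all_boot all_order all_algebra finmap.
From mathcomp Require Import all_classical all_reals all_analysis.
From mathcomp Require Import complex summability.
From mathcomp Require Import ring lra zify.
From mathcomp Require cyclic finfield.

(* Write k = (N-1)/2.  Poisson summation for Gaussians over the root lattice
   A_(N-1) gives the behaviour of f_theta under SL_2(Z) with quadratic Gauss
   sums as coefficients; these sums evaluate to chi_N on Gamma_0(N), so f_theta
   has weight k and character chi_N, and at the cusp 1/d (d | N) its constant
   term is i^((1-Nd)/2) (N/d)^(-1/2).  For every d | N, the Eisenstein series
   with weights chi_(N/d)(c/d) chi_d(j) on the pairs (c, j) with d | c
   transforms in the same way, has by Lipschitz' formula the Fourier
   coefficients sigma_(k-1)(chi_(N/d), chi_d; n) up to a scalar, and its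
   constant term vanishes at every cusp but 1/d, where it is an L-value
   expressed by B_(k, chi_N).  Since N is squarefree every cusp is equivalent
   to some 1/d, so the combination matching f_theta at all of them leaves a
   cusp form.  For k = 2 the lattice sums converge only conditionally; the
   weights having sum zero, they are summed after subtracting the term of the
   zero class. *)

Set Implicit Arguments.
Unset Strict Implicit.
Unset Printing Implicit Defensive.

Import Order.TTheory GRing.Theory Num.Theory numFieldNormedType.Exports.

Local Open Scope ring_scope.
Local Open Scope classical_set_scope.
Local Open Scope complex_scope.

(** No integral and no contour occurs. Poisson summation and Lipschitz' formula are both limits, by
    dominated convergence, of exact finite identities: sampling with denominator [2 n + 1] turns
    them into orthogonality of roots of unity, and the Gaussian integral is replaced by Riemann sums
    whose independence of the parameters is a telescoping argument. Quadratic reciprocity is a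
    consequence of modularity here, not an ingredient. The Gauss sums are at first evaluated only
    for moduli prime to [N], where the Kronecker symbol enters as a product over the primes of its
    argument. Comparing two group elements that differ by a translation then shows that [chi N] is
    periodic, and comparing constant terms at infinity gives reciprocity and the sign of the Gauss
    sum. The functional equation is bypassed as well: the divergent sums of [chi(m) m^j] are
    regularised by [q^m] along [z = i / (t + 1)], where Lipschitz' formula links them to the L-value
    and a recursion links them to the Bernoulli numbers. *)

Section ComplexAbs.
Variable R : realType.
Implicit Types z w : R[i].

(** The norm of [R[i]] takes its values in [R[i]]; this real-valued modulus lets [lra], [nra] and
    suprema apply to estimates. *)
Definition cabs z : R := Num.sqrt (complex.Re z ^+ 2 + complex.Im z ^+ 2).

Lemma cabsE z : `|z| = (cabs z)%:C.
Proof. exact: normc_def. Qed.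

Lemma cabs_ge0 z : 0 <= cabs z. Proof. exact: sqrtr_ge0. Qed.
Hint Resolve cabs_ge0 : core.

Lemma cabs0 : cabs 0 = 0.
Proof. by apply: (@complexI R); rewrite -cabsE normr0. Qed.

Lemma cabs1 : cabs 1 = 1.
Proof. by apply: (@complexI R); rewrite -cabsE normr1. Qed.

Lemma cabsM z w : cabs (z * w) = cabs z * cabs w.
Proof. by apply: (@complexI R); rewrite rmorphM /= -!cabsE normrM. Qed.

Lemma cabsV z : cabs z^-1 = (cabs z)^-1.
Proof. by apply: (@complexI R); rewrite fmorphV /= -!cabsE normfV. Qed.

Lemma cabsX z n : cabs (z ^+ n) = cabs z ^+ n.
Proof. by apply: (@complexI R); rewrite rmorphXn /= -!cabsE normrX. Qed.

Lemma cabsN z : cabs (- z) = cabs z.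
Proof. by apply: (@complexI R); rewrite -!cabsE normrN. Qed.

Lemma cabs_dist z w : cabs (z - w) = cabs (w - z).
Proof. by rewrite -cabsN opprB. Qed.

Lemma cabsD z w : cabs (z + w) <= cabs z + cabs w.
Proof. by rewrite -lecR rmorphD /= -!cabsE ler_normD. Qed.

Lemma cabsB z w : cabs (z - w) <= cabs z + cabs w.
Proof. by rewrite -(cabsN w) cabsD. Qed.

Lemma cabs_tri x z w : cabs (z - w) <= cabs (z - x) + cabs (x - w).
Proof. by rewrite -[z - w](subrKA x) cabsD. Qed.

Lemma cabs_eq0 z : (cabs z == 0) = (z == 0).
Proof.
by rewrite -(inj_eq (@complexI R)) /= -cabsE normr_eq0.
Qed.

Lemma cabs_gt0 z : (0 < cabs z) = (z != 0).
Proof. by rewrite lt_neqAle cabs_ge0 andbT eq_sym cabs_eq0. Qed.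

Lemma cabsR (x : R) : cabs x%:C = `|x|.
Proof. by rewrite /cabs /= expr0n addr0 sqrtr_sqr. Qed.

Lemma cabs_nat n : cabs n%:R = n%:R.
Proof.
by rewrite -(rmorph_nat (@real_complex_def R (Phant R))) cabsR ger0_norm.
Qed.

Lemma cabs_int (n : int) : cabs n%:~R = `|n|%:~R.
Proof.
by rewrite -(rmorph_int (@real_complex_def R (Phant R))) cabsR intr_norm.
Qed.

Lemma cabs_sum (I : Type) (r : seq I) (P : pred I) (f : I -> R[i]) :
  cabs (\sum_(i <- r | P i) f i) <= \sum_(i <- r | P i) cabs (f i).
Proof.
elim/big_ind2: _ => [|x a y b xa yb|//]; first by rewrite cabs0.
by rewrite (le_trans (cabsD _ _)) // lerD.
Qed.

Lemma cabs_prod (I : Type) (r : seq I) (P : pred I) (f : I -> R[i]) :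
  cabs (\prod_(i <- r | P i) f i) = \prod_(i <- r | P i) cabs (f i).
Proof. exact: (big_morph _ cabsM cabs1). Qed.

Lemma Re_le_cabs z : `|complex.Re z| <= cabs z.
Proof. by rewrite -sqrtr_sqr ler_wsqrtr // lerDl sqr_ge0. Qed.

Lemma Im_le_cabs z : `|complex.Im z| <= cabs z.
Proof. by rewrite -sqrtr_sqr ler_wsqrtr // lerDr sqr_ge0. Qed.

Lemma cabs_le z : cabs z <= `|complex.Re z| + `|complex.Im z|.
Proof.
rewrite -(@ler_pXn2r _ 2) ?nnegrE ?addr_ge0 // sqr_sqrtr ?addr_ge0 ?sqr_ge0 //.
rewrite sqrrD !real_normK ?num_real // lerD2r lerDl.
by rewrite mulrn_wge0 // mulr_ge0.
Qed.

Lemma cabs_sqr z : cabs z ^+ 2 = complex.Re z ^+ 2 + complex.Im z ^+ 2.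
Proof. by rewrite sqr_sqrtr // addr_ge0 ?sqr_ge0. Qed.

(** * Convergence of complex sequences in terms of the real modulus *)

Definition cvs (u : nat -> R[i]) (l : R[i]) : Prop :=
  forall e : R, 0 < e -> exists n0 : nat, forall n, (n0 <= n)%N -> cabs (u n - l) < e.

Lemma cvs_cvg u l : cvs u l -> u @ \oo --> l.
Proof.
move=> ul; apply/cvgrPdist_lt => e e0.
have e0' := e0; rewrite ltcE /= in e0'; case/andP: e0' => /eqP ime ree.
have [n0 hn] := ul _ ree.
exists n0 => // n /= n0n; rewrite cabsE cabs_dist ltcE /= ime eqxx /=.
exact: hn.
Qed.

Lemma cvs_lim u l : cvs u l -> lim (u @ \oo) = l.
Proof. by move=> /cvs_cvg /cvg_lim; apply; exact: norm_hausdorff. Qed.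

Lemma cvs_unique u l l' : cvs u l -> cvs u l' -> l = l'.
Proof. by move=> /cvs_lim <- /cvs_lim <-. Qed.

Lemma cvsD u v l l' : cvs u l -> cvs v l' -> cvs (fun n => u n + v n) (l + l').
Proof.
move=> ul vl e e0; have e2 : 0 < e / 2 by rewrite divr_gt0.
have [n1 h1] := ul _ e2; have [n2 h2] := vl _ e2.
exists (maxn n1 n2) => n; rewrite geq_max => /andP[/h1 a /h2 b].
rewrite opprD addrACA (le_lt_trans (cabsD _ _)) //.
by rewrite [e]splitr ltrD.
Qed.

Lemma cvs_cst l : cvs (fun=> l) l.
Proof. by move=> e e0; exists 0%N => n _; rewrite subrr cabs0. Qed.

Lemma cvsZ c u l : cvs u l -> cvs (fun n => c * u n) (c * l).
Proof.
move=> ul e e0; have [|n0 hn] := ul (e / (cabs c + 1)); first by rewrite divr_gt0 // ltr_wpDl.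
exists n0 => n /hn; rewrite ltr_pdivlMr ?ltr_wpDl // => lt_e.
rewrite -mulrBr cabsM (le_lt_trans _ lt_e) // mulrC ler_wpM2l //.
by rewrite lerDl.
Qed.

Lemma cvsN u l : cvs u l -> cvs (fun n => - u n) (- l).
Proof. by move=> ul e /ul[n0 hn]; exists n0 => n /hn; rewrite -opprD cabsN. Qed.

Lemma cvsB u v l l' : cvs u l -> cvs v l' -> cvs (fun n => u n - v n) (l - l').
Proof. by move=> ul vl; apply: cvsD => //; exact: cvsN. Qed.

Lemma cvs_bounded u l : cvs u l -> exists K : R, forall n, cabs (u n) <= K.
Proof.
move=> /(_ 1 ltr01)[n0 hn].
exists (\sum_(i < n0) cabs (u i) + cabs l + 1) => n.
have [/hn ltn1|ltn] := leqP n0 n.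
  rewrite -[u n](subrK l) (le_trans (cabsD _ _)) // addrC.
  rewrite lerD //; last exact: ltW.
  by rewrite lerDr sumr_ge0.
rewrite (bigD1 (Ordinal ltn)) //= -!addrA lerDl !addr_ge0 // sumr_ge0 //.
Qed.

Lemma cvsM u v l l' : cvs u l -> cvs v l' -> cvs (fun n => u n * v n) (l * l').
Proof.
move=> ul vl; have [K hK] := cvs_bounded ul; move=> e e0.
have K0 : 0 <= K by apply: le_trans (hK 0%N).
have [|n1 h1] := vl (e / 2 / (K + 1)); first by rewrite !divr_gt0 // ltr_wpDl.
have [|n2 h2] := ul (e / 2 / (cabs l' + 1)); first by rewrite !divr_gt0 // ltr_wpDl.
exists (maxn n1 n2) => n; rewrite geq_max => /andP[/h1 a /h2 b].
have -> : u n * v n - l * l' = u n * (v n - l') + (u n - l) * l' by ring.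
rewrite (le_lt_trans (cabsD _ _)) // !cabsM [e]splitr ltrD //.
  move: a; rewrite ltr_pdivlMr ?ltr_wpDl // => a; apply: le_lt_trans a.
  by rewrite mulrC ler_wpM2l // (le_trans (hK n)) // lerDl.
move: b; rewrite ltr_pdivlMr ?ltr_wpDl // => b; apply: le_lt_trans b.
by rewrite ler_wpM2l // lerDl.
Qed.

Lemma cvsX u l k : cvs u l -> cvs (fun n => u n ^+ k) (l ^+ k).
Proof.
move=> ul; elim: k => [|k IHk]; first exact: cvs_cst.
rewrite exprS; under eq_fun do rewrite exprS; exact: cvsM.
Qed.

Lemma cvs_prod (I : Type) (r : seq I) (u : I -> nat -> R[i]) (l : I -> R[i]) :
  (forall i, cvs (u i) (l i)) -> cvs (fun n => \prod_(i <- r) u i n) (\prod_(i <- r) l i).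
Proof.
move=> ul; elim: r => [|i r IHr].
  by rewrite big_nil; under eq_fun do rewrite big_nil; exact: cvs_cst.
by rewrite big_cons; under eq_fun do rewrite big_cons; exact: cvsM.
Qed.

Lemma cvsV u l : l != 0 -> cvs u l -> cvs (fun n => (u n)^-1) l^-1.
Proof.
move=> l0 ul e e0; have cl0 : 0 < cabs l by rewrite cabs_gt0.
have [n1 h1] := ul (cabs l / 2) (divr_gt0 cl0 (ltr0Sn _ _)).
have [|n2 h2] := ul (e * (cabs l ^+ 2 / 2)); first by rewrite mulr_gt0 // divr_gt0 // exprn_gt0.
exists (maxn n1 n2) => n; rewrite geq_max => /andP[/h1 a /h2 b].
have cu : cabs l / 2 < cabs (u n).
  have := cabsD (l - u n) (u n); rewrite subrK cabs_dist.
  by move: a; lra.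
have cu0 : 0 < cabs (u n) by apply: lt_trans cu; rewrite divr_gt0.
have u0 : u n != 0 by rewrite -cabs_gt0.
have -> : (u n)^-1 - l^-1 = (l - u n) * ((u n)^-1 * l^-1).
  by field; rewrite l0 u0.
rewrite !cabsM !cabsV cabs_dist -invfM ltr_pdivrMr ?mulr_gt0 //.
apply: (lt_le_trans b); rewrite ler_wpM2l ?(ltW e0) //.
rewrite expr2 -mulrA mulrC -mulrA; rewrite [X in _ <= X]mulrC ler_wpM2l //.
by rewrite mulrC ltW.
Qed.

Lemma eq_cvs u v l : (exists n0, forall n, (n0 <= n)%N -> u n = v n) -> cvs u l -> cvs v l.
Proof.
move=> [n0 uv] ul e /ul[n1 h]; exists (maxn n0 n1) => n; rewrite geq_max.
by move=> /andP[/uv <- /h].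
Qed.

Lemma cvs_squeeze u (v : nat -> R) :
  (forall n, cabs (u n) <= v n) -> (forall e, 0 < e -> exists n0, forall n, (n0 <= n)%N -> v n < e) ->
  cvs u 0.
Proof.
move=> uv v0 e /v0[n0 h]; exists n0 => n /h; rewrite subr0; exact: le_lt_trans.
Qed.

End ComplexAbs.
#[global] Hint Extern 0 (is_true (@Order.le _ _ _ (cabs _))) => exact: cabs_ge0 : core.

(** * Unconditional sums over arbitrary index types *)

Section Summation.
Local Open Scope fset_scope.
Local Open Scope ring_scope.
Local Open Scope complex_scope.
Variable R : realType.

Lemma perm_fsetUD (T : choiceType) (A B : {fset T}) : A `<=` B ->
  perm_eq B (A ++ (B `\` A)).
Proof.
move=> AB; apply: uniq_perm => //.
  rewrite cat_uniq !fset_uniq /= andbT; apply/hasPn => x.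
  by rewrite in_fsetD => /andP[].
move=> x; rewrite mem_cat in_fsetD.
by have := fsubsetP AB x; case: (x \in A) => //= ->.
Qed.

Lemma fsum_split (V : zmodType) (T : choiceType) (A B : {fset T}) (f : T -> V) :
  A `<=` B -> \sum_(i <- B) f i = \sum_(i <- A) f i + \sum_(i <- B `\` A) f i.
Proof. by move=> AB; rewrite (perm_big _ (perm_fsetUD AB)) big_cat. Qed.

(** For a nonnegative [b] this is summability; such families serve as majorants throughout. *)
Definition rsm (T : choiceType) (b : T -> R) : Prop :=
  exists K : R, forall A : {fset T}, \sum_(i <- A) b i <= K.

Definition absum (T : choiceType) (f : T -> R[i]) : Prop := rsm (fun i => cabs (f i)).

Definition hsum (T : choiceType) (f : T -> R[i]) (s : R[i]) : Prop :=
  forall e : R, 0 < e -> exists A : {fset T}, forall B : {fset T}, A `<=` B ->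
    cabs (\sum_(i <- B) f i - s) < e.

Lemma fsum_sub_le (T : choiceType) (b : T -> R) (A B : {fset T}) :
  (forall i, 0 <= b i) -> A `<=` B -> \sum_(i <- A) b i <= \sum_(i <- B) b i.
Proof. by move=> b0 AB; rewrite (fsum_split b AB) lerDl sumr_ge0. Qed.

Lemma rsm_sup (T : choiceType) (b : T -> R) : (forall i, 0 <= b i) -> rsm b ->
  exists s : R, (forall A : {fset T}, \sum_(i <- A) b i <= s) /\
    forall e, 0 < e -> exists A : {fset T}, s - e < \sum_(i <- A) b i.
Proof.
move=> b0 [K hK]; pose E := [set \sum_(i <- A) b i | A in [set: {fset T}]].
have hE : has_sup E.
  split; first by exists (\sum_(i <- fset0) b i); exists fset0.
  by exists K => _ [A _ <-].
exists (sup E); split=> [A|e e0].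
  by apply: sup_upper_bound => //; exists A.
by have [_ [A _ <-] lt_s] := sup_adherent e0 hE; exists A.
Qed.

Lemma rsm_tail (T : choiceType) (b : T -> R) : (forall i, 0 <= b i) -> rsm b ->
  forall e, 0 < e -> exists A : {fset T}, forall B : {fset T}, [disjoint A & B] ->
    \sum_(i <- B) b i < e.
Proof.
move=> b0 /(rsm_sup b0)[s [sub sad]] e /sad[A hA]; exists A => B dAB.
have := sub (A `|` B); rewrite (fsum_split b (fsubsetUl A B)).
suff -> : (A `|` B) `\` A = B by lra.
apply/fsetP => x; rewrite in_fsetD in_fsetU; case xA: (x \in A) => //=.
apply/esym/negbTE; by move/fdisjointP: dAB; apply.
Qed.

Lemma hsum_nneg (T : choiceType) (b : T -> R) : (forall i, 0 <= b i) -> rsm b ->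
  exists s, hsum (fun i => (b i)%:C) s.
Proof.
move=> b0 /(rsm_sup b0)[s [sub sad]]; exists s%:C => e /sad[A hA].
exists A => B AB; rewrite -rmorph_sum -rmorphB /= cabsR ler0_norm ?subr_le0 //.
by have := fsum_sub_le b0 AB; lra.
Qed.

Lemma hsumD (T : choiceType) (f g : T -> R[i]) s t :
  hsum f s -> hsum g t -> hsum (fun i => f i + g i) (s + t).
Proof.
move=> fs gt e e0; have e2 : 0 < e / 2 by rewrite divr_gt0.
have [A hA] := fs _ e2; have [B hB] := gt _ e2; exists (A `|` B) => D.
rewrite fsubUset => /andP[/hA a /hB b].
rewrite big_split opprD addrACA (le_lt_trans (cabsD _ _)) //.
by rewrite [e]splitr ltrD.
Qed.

Lemma hsumZ (T : choiceType) (c : R[i]) (f : T -> R[i]) s :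
  hsum f s -> hsum (fun i => c * f i) (c * s).
Proof.
move=> fs e e0; have [|A hA] := fs (e / (cabs c + 1)); first by rewrite divr_gt0 // ltr_wpDl.
exists A => B /hA; rewrite -mulr_sumr -mulrBr cabsM.
rewrite ltr_pdivlMr ?ltr_wpDl // => lt_e; apply: le_lt_trans lt_e.
by rewrite mulrC ler_wpM2l // lerDl.
Qed.

Lemma eq_hsum (T : choiceType) (f g : T -> R[i]) s :
  f =1 g -> hsum f s -> hsum g s.
Proof. by move=> /funext ->. Qed.

Lemma hsum_unique (T : choiceType) (f : T -> R[i]) s t : hsum f s -> hsum f t -> s = t.
Proof.
move=> fs ft; apply/eqP; rewrite -subr_eq0 -cabs_eq0; apply/eqP/le_anti.
rewrite cabs_ge0 andbT; apply/ler_addgt0Pl => e e0; rewrite addr0.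
have e2 : 0 < e / 2 by rewrite divr_gt0.
have [A hA] := fs _ e2; have [B hB] := ft _ e2.
have := hA _ (fsubsetUl A B); have := hB _ (fsubsetUr A B).
have := cabs_tri (\sum_(i <- A `|` B) f i) s t.
rewrite [cabs (s - \sum_(i <- _) _)]cabs_dist.
by lra.
Qed.

Lemma absum_le (T : choiceType) (f : T -> R[i]) (b : T -> R) :
  (forall i, cabs (f i) <= b i) -> rsm b -> absum f.
Proof.
by move=> fb [K hK]; exists K => A; apply: le_trans (hK A); exact: ler_sum.
Qed.

Lemma rsm_le (T : choiceType) (a b : T -> R) :
  (forall i, a i <= b i) -> rsm b -> rsm a.
Proof. by move=> ab [K hK]; exists K => A; apply: le_trans (hK A); exact: ler_sum. Qed.

Lemma rsmZ (T : choiceType) (b : T -> R) c : 0 <= c -> rsm b -> rsm (fun i => c * b i).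
Proof.
move=> c0 [K hK]; exists (c * K) => A; rewrite -mulr_sumr; exact: ler_wpM2l.
Qed.

Lemma rsmD (T : choiceType) (a b : T -> R) : rsm a -> rsm b -> rsm (fun i => a i + b i).
Proof. by move=> [K hK] [L hL]; exists (K + L) => A; rewrite big_split lerD. Qed.

Lemma absumD (T : choiceType) (f g : T -> R[i]) :
  absum f -> absum g -> absum (fun i => f i + g i).
Proof. by move=> af ag; apply: absum_le (rsmD af ag) => i; exact: cabsD. Qed.

Lemma absumZ (T : choiceType) (c : R[i]) (f : T -> R[i]) : absum f -> absum (fun i => c * f i).
Proof.
by move=> af; apply: absum_le (rsmZ (cabs_ge0 c) af) => i; rewrite cabsM.
Qed.

Lemma absumN (T : choiceType) (f : T -> R[i]) : absum f -> absum (fun i => - f i).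
Proof. by move=> af; apply: absum_le af => i; rewrite cabsN. Qed.

Lemma absumB (T : choiceType) (f g : T -> R[i]) :
  absum f -> absum g -> absum (fun i => f i - g i).
Proof. by move=> af ag; apply: absumD => //; exact: absumN. Qed.

Lemma absum0 (T : choiceType) : absum (fun _ : T => 0).
Proof. by exists 0 => A; rewrite big1 // => i _; rewrite cabs0. Qed.

Lemma absum_fsum (T : choiceType) (I : Type) (r : seq I) (f : I -> T -> R[i]) :
  (forall i, absum (f i)) -> absum (fun t => \sum_(i <- r) f i t).
Proof.
move=> af; elim: r => [|i r IHr].
  by under [fun t => _]eq_fun do rewrite big_nil; exact: absum0.
by under [fun t => _]eq_fun do rewrite big_cons; exact: absumD.
Qed.

Lemma hsum_exists (T : choiceType) (f : T -> R[i]) : absum f -> exists s, hsum f s.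
Proof.
move=> af.
have part (b : T -> R) : (forall i, `|b i| <= cabs (f i)) ->
    exists s, hsum (fun i => (b i)%:C) s.
  (* Positive and negative part are summed separately; complex families reduce to this through real
     and imaginary part. *)
  move=> bf; have [||s hs] := @hsum_nneg _ (fun i => Num.max (b i) 0).
  - by move=> i; rewrite le_max lexx orbT.
  - apply: rsm_le af => i; apply: le_trans (bf i).
    by rewrite ge_max ler_norm normr_ge0.
  have [||t ht] := @hsum_nneg _ (fun i => Num.max (- b i) 0).
  - by move=> i; rewrite le_max lexx orbT.
  - apply: rsm_le af => i; apply: le_trans (bf i).
    by rewrite ge_max -normrN ler_norm normr_ge0.
  exists (s + (-1) * t); apply: eq_hsum (hsumD hs (hsumZ (-1) ht)) => i.
  rewrite mulN1r -rmorphB /=; congr (_%:C).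
  by rewrite /Num.max; case: ltP => ?; case: ltP => ?; lra.
have [s hs] := part (fun i => complex.Re (f i)) (fun i => Re_le_cabs _).
have [t ht] := part (fun i => complex.Im (f i)) (fun i => Im_le_cabs _).
exists (s + 'i * t); apply: eq_hsum (hsumD hs (hsumZ 'i ht)) => i.
by rewrite -complexE.
Qed.

(** The value 0 is the default for families without a sum; by [hsum_unique] a sum that exists is the
    one chosen. *)
Definition csum (T : choiceType) (f : T -> R[i]) : R[i] := xget 0 [set s | hsum f s].

Lemma csumE (T : choiceType) (f : T -> R[i]) s : hsum f s -> csum f = s.
Proof.
move=> fs; rewrite /csum; case: xgetP => [t _ ft|/(_ s)]; last by [].
exact: hsum_unique ft fs.
Qed.

Lemma csumP (T : choiceType) (f : T -> R[i]) : absum f -> hsum f (csum f).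
Proof. by move=> /hsum_exists[s fs]; rewrite (csumE fs). Qed.

Lemma eq_csum (T : choiceType) (f g : T -> R[i]) : f =1 g -> csum f = csum g.
Proof. by move=> /funext ->. Qed.

Lemma csumD (T : choiceType) (f g : T -> R[i]) : absum f -> absum g ->
  csum (fun i => f i + g i) = csum f + csum g.
Proof. by move=> af ag; apply: csumE; apply: hsumD; exact: csumP. Qed.

Lemma csumZ (T : choiceType) (c : R[i]) (f : T -> R[i]) : absum f ->
  csum (fun i => c * f i) = c * csum f.
Proof. by move=> af; apply: csumE; apply: hsumZ; exact: csumP. Qed.

Lemma csumN (T : choiceType) (f : T -> R[i]) : absum f ->
  csum (fun i => - f i) = - csum f.
Proof. by move=> af; rewrite -mulN1r -csumZ //; apply: eq_csum => i; rewrite mulN1r. Qed.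

Lemma csumB (T : choiceType) (f g : T -> R[i]) : absum f -> absum g ->
  csum (fun i => f i - g i) = csum f - csum g.
Proof. by move=> af ag; rewrite csumD ?csumN //; exact: absumN. Qed.

Lemma hsum0 (T : choiceType) : hsum (fun _ : T => 0) 0.
Proof. by move=> e e0; exists fset0 => B _; rewrite big1 // subrr cabs0. Qed.

Lemma csum0 (T : choiceType) (f : T -> R[i]) : (forall i, f i = 0) -> csum f = 0.
Proof. by move=> f0; rewrite (eq_csum f0); apply: csumE; exact: hsum0. Qed.

Lemma csum_fsum (T : choiceType) (I : Type) (r : seq I) (f : I -> T -> R[i]) :
  (forall i, absum (f i)) ->
  csum (fun t => \sum_(i <- r) f i t) = \sum_(i <- r) csum (f i).
Proof.
move=> af; elim: r => [|i r IHr].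
  by rewrite big_nil csum0 // => t; rewrite big_nil.
rewrite big_cons -IHr -csumD //; last exact: absum_fsum.
by apply: eq_csum => t; rewrite big_cons.
Qed.

Lemma hsum_le (T : choiceType) (f : T -> R[i]) s (K : R) :
  hsum f s -> (forall A : {fset T}, cabs (\sum_(i <- A) f i) <= K) -> cabs s <= K.
Proof.
move=> fs fK; apply/ler_addgt0Pl => e /fs[A /(_ A (fsubset_refl A))].
have := fK A; have := cabsD (s - \sum_(i <- A) f i) (\sum_(i <- A) f i).
rewrite subrK cabs_dist.
by lra.
Qed.

Lemma csum_le (T : choiceType) (f : T -> R[i]) (b : T -> R) K :
  (forall i, cabs (f i) <= b i) -> (forall A : {fset T}, \sum_(i <- A) b i <= K) ->
  cabs (csum f) <= K.
Proof.
move=> fb bK; apply: (hsum_le (csumP _)); first by apply: absum_le fb _; exists K.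
move=> A; apply: le_trans (bK A); apply: le_trans (cabs_sum _ _ _) _.
exact: ler_sum.
Qed.

Lemma hsum_fin (T : choiceType) (f : T -> R[i]) (A : {fset T}) :
  (forall i, i \notin A -> f i = 0) -> hsum f (\sum_(i <- A) f i).
Proof.
move=> f0 e e0; exists A => B AB; rewrite (fsum_split f AB) addrC addKr.
rewrite big_seq big1 ?cabs0 // => i; rewrite in_fsetD => /andP[iA _].
exact: f0.
Qed.

Lemma csum_fin (T : choiceType) (f : T -> R[i]) (A : {fset T}) :
  (forall i, i \notin A -> f i = 0) -> csum f = \sum_(i <- A) f i.
Proof. by move=> f0; apply: csumE; exact: hsum_fin. Qed.

Lemma absum_fin (T : choiceType) (f : T -> R[i]) (A : {fset T}) :
  (forall i, i \notin A -> f i = 0) -> absum f.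
Proof.
move=> f0; exists (\sum_(i <- A) cabs (f i)) => B.
apply: (@le_trans _ _ (\sum_(i <- A `|` B) cabs (f i))).
  by apply: fsum_sub_le => //; exact: fsubsetUr.
rewrite (fsum_split _ (fsubsetUl A B)) gerDl big_seq big1 // => i.
by rewrite in_fsetD => /andP[/f0 -> _]; rewrite cabs0.
Qed.

Lemma csum_finType (T : finType) (f : T -> R[i]) : csum f = \sum_i f i.
Proof.
rewrite (@csum_fin _ _ [fset i | i in [set: T]%SET]); last first.
  by move=> i; rewrite !inE.
rewrite -big_enum /=; apply: perm_big; apply: uniq_perm; rewrite ?fset_uniq ?enum_uniq //.
by move=> i; rewrite mem_enum !inE.
Qed.

Lemma absum_finType (T : finType) (f : T -> R[i]) : absum f.
Proof.
apply: (@absum_fin _ _ [fset i | i in [set: T]%SET]) => i.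
by rewrite !inE.
Qed.

Lemma csum_pos_neq0 (T : choiceType) (f : T -> R[i]) (b : T -> R) i0 :
  (forall i, f i = (b i)%:C) -> (forall i, 0 <= b i) -> 0 < b i0 -> absum f -> csum f != 0.
Proof.
move=> fb b0 bi0 /csumP fs; apply/negP => /eqP s0; have [A hA] := fs _ bi0.
have := hA _ (fsubsetUl A [fset i0]); rewrite s0 subr0 (eq_bigr _ (fun i _ => fb i)).
rewrite -rmorph_sum /= cabsR ltNge => /negP[]; apply: le_trans (ler_norm _).
apply: (@le_trans _ _ (\sum_(i <- [fset i0]) b i)); first by rewrite big_seq_fset1.
by apply: fsum_sub_le => //; exact: fsubsetUr.
Qed.

(** Dominated convergence. Outside a finite [A] the majorant sums to less than [e / 4], so both
    [f n] and [l] contribute little there; on [A] only finitely many termwise limits are involved.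
    The index [n0] allows a bound that holds only eventually. *)
Lemma csum_cvs (T : choiceType) (f : nat -> T -> R[i]) (l : T -> R[i]) (b : T -> R) n0 :
  rsm b -> (forall n i, (n0 <= n)%N -> cabs (f n i) <= b i) ->
  (forall i, cvs (fun n => f n i) (l i)) ->
  absum l /\ cvs (fun n => csum (f n)) (csum l).
Proof.
move=> sb fb fl.
have lb i : cabs (l i) <= b i.
  apply/ler_addgt0Pl => e /(fl i)[n1 h].
  have := h _ (leq_maxr n0 n1); have := fb _ i (leq_maxl n0 n1).
  move: (f _ i) => x; have := cabsD (l i - x) x; rewrite subrK cabs_dist.
  by lra.
have b0 i : 0 <= b i by apply: le_trans (lb i); exact: cabs_ge0.
have al : absum l by apply: absum_le sb.
split=> // e e0; have e4 : 0 < e / 4 by rewrite divr_gt0.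
have [A hA] := rsm_tail b0 sb e4.
have [n1 h1] : exists n1, forall n, (n1 <= n)%N ->
    cabs (\sum_(i <- A) (f n i - l i)) < e / 4.
  have : cvs (fun n => \sum_(i <- A) (f n i - l i)) 0.
    elim: (enum_fset A) => [|i r IHr].
      by rewrite (_ : (fun n => _) = fun=> 0) ?funeqE => [|n]; [exact: cvs_cst | rewrite big_nil].
    rewrite (_ : (fun n => _) = fun n => (f n i - l i) + \sum_(j <- r) (f n j - l j)); last first.
      by rewrite funeqE => n; rewrite big_cons.
    rewrite -[X in cvs _ X]addr0; apply: cvsD => //; rewrite -(subrr (l i)).
    by apply: cvsB => //; exact: cvs_cst.
  by move=> /(_ _ e4)[n1 h]; exists n1 => n /h; rewrite subr0.
exists (maxn n0 n1) => n; rewrite geq_max => /andP[n0n n1n].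
have afn : absum (f n) by apply: absum_le sb => i; exact: fb.
rewrite -csumB //.
pose g i := f n i - l i.
have gs : hsum g (csum g) by apply: csumP; exact: absumB.
(* Enlarging [B] by [A] splits a partial sum close to the total into the part on [A] and a part to
   which the tail bound applies. *)
have [B hB] := gs _ e4; have := hB _ (fsubsetUr A B).
rewrite (fsum_split _ (fsubsetUl A B)) cabs_dist.
have tl : cabs (\sum_(i <- (A `|` B) `\` A) g i) <= 2 * (e / 4).
  apply: le_trans (cabs_sum _ _ _) _.
  apply: (@le_trans _ _ (\sum_(i <- (A `|` B) `\` A) 2 * b i)).
    apply: ler_sum => i _; apply: le_trans (cabsB _ _) _.
    by rewrite mulr_natl mulr2n lerD // fb.
  rewrite -mulr_sumr ler_wpM2l //; apply/ltW/hA.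
  by apply/fdisjointP => x xA; rewrite in_fsetD xA.
have := h1 _ n1n; move: tl; rewrite -/g -/(csum g).
move: (\sum_(i <- A) (f n i - l i)) (\sum_(i <- (A `|` B) `\` A) g i) (csum g) => x y s.
move=> hy hx hs; have := cabsD (s - (x + y)) (x + y); have := cabsD x y.
rewrite subrK; move: hs hx hy.
by lra.
Qed.

Definition fsetXX (T U : choiceType) (A : {fset T}) (B : {fset U}) : {fset T * U} :=
  [fset p | p in [seq (i, j) | i <- A, j <- B]].

Lemma in_fsetXX (T U : choiceType) (A : {fset T}) (B : {fset U}) p :
  (p \in fsetXX A B) = (p.1 \in A) && (p.2 \in B).
Proof.
rewrite !inE /=; apply/allpairsP/andP => [[[i j] /= [iA jB ->]]|[pA pB]] //.
by exists p; rewrite pA pB; case: p {pA pB}.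
Qed.

Lemma fsumXX (V : zmodType) (T U : choiceType) (A : {fset T}) (B : {fset U}) (f : T * U -> V) :
  \sum_(p <- fsetXX A B) f p = \sum_(i <- A) \sum_(j <- B) f (i, j).
Proof.
rewrite -big_allpairs; apply: perm_big; apply: uniq_perm => //.
  by rewrite allpairs_uniq // => -[? ?] [].
by move=> p; rewrite !inE.
Qed.

Lemma fsub_XX (T U : choiceType) (A : {fset T * U}) :
  A `<=` fsetXX [fset p.1 | p in A] [fset p.2 | p in A].
Proof.
apply/fsubsetP => p pA; rewrite in_fsetXX; apply/andP; split.
  by apply/imfsetP; exists p.
by apply/imfsetP; exists p.
Qed.

Lemma rsm_prod (T U : choiceType) (a : T -> R) (b : U -> R) :
  (forall i, 0 <= a i) -> (forall i, 0 <= b i) -> rsm a -> rsm b ->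
  rsm (fun p : T * U => a p.1 * b p.2).
Proof.
move=> a0 b0 [K hK] [L hL]; exists (K * L) => A.
apply: le_trans (fsum_sub_le _ (fsub_XX A)) _.
  by move=> p; rewrite mulr_ge0.
rewrite fsumXX /=; under eq_bigr do rewrite -mulr_sumr.
by rewrite -mulr_suml ler_pM ?sumr_ge0.
Qed.

Lemma absum_row (T U : choiceType) (f : T * U -> R[i]) t :
  absum f -> absum (fun u => f (t, u)).
Proof.
move=> [K hK]; exists K => A; apply: le_trans (hK (fsetXX [fset t] A)).
by rewrite fsumXX big_seq_fset1.
Qed.

(** Summation by rows. Finitely many rows are approximated at once: each row index in [B] supplies a
    finite set [Ct t], and the union [D0] serves all of them. *)
Lemma hsum_pair (T U : choiceType) (f : T * U -> R[i]) s (g : T -> R[i]) :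
  hsum f s -> (forall t, hsum (fun u => f (t, u)) (g t)) -> hsum g s.
Proof.
move=> fs fg e e0; have e2 : 0 < e / 2 by rewrite divr_gt0.
have [A hA] := fs _ e2; exists [fset p.1 | p in A] => B AB.
(* Row errors below [d] add up over the rows in [B] to at most [e / 2]; the [+ 1] covers an empty
   [B]. *)
set d := e / 2 / (#|` B|%:R + 1); have d0 : 0 < d by rewrite divr_gt0 // ltr_wpDl.
have /choice[Ct hC] : forall t, exists C : {fset U}, forall D : {fset U}, C `<=` D ->
  cabs (\sum_(u <- D) f (t, u) - g t) < d by move=> t; exact: fg.
pose D0 := [fset p.2 | p in A] `|` \big[fsetU/fset0]_(t <- B) Ct t.
have AD : A `<=` fsetXX B D0.
  apply: fsubset_trans (fsub_XX A) _; apply/fsubsetP => p.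
  rewrite !in_fsetXX => /andP[p1 p2]; rewrite (fsubsetP AB) //.
  by rewrite in_fsetU p2.
have := hA _ AD; rewrite fsumXX => lt1.
have lt2 : cabs (\sum_(t <- B) g t - \sum_(t <- B) \sum_(u <- D0) f (t, u)) <= e / 2.
  rewrite -sumrB; apply: le_trans (cabs_sum _ _ _) _.
  apply: (@le_trans _ _ (\sum_(t <- B) d)).
    rewrite big_seq [X in _ <= X]big_seq; apply: ler_sum => t tB.
    rewrite cabs_dist; apply/ltW/hC; apply: fsubset_trans (fsubsetUr _ _).
    by rewrite (big_fsetD1 t) //= fsubsetUl.
  rewrite big_const_seq count_predT iter_addr_0 -[X in X <= _]mulr_natl /d.
  rewrite mulrA ler_pdivrMr ?ltr_wpDl // [X in X <= _]mulrC.
  by rewrite ler_wpM2l ?(ltW e2) // lerDl.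
apply: le_lt_trans (cabs_tri (\sum_(t <- B) \sum_(u <- D0) f (t, u)) _ _) _.
by rewrite [e]splitr ler_ltD.
Qed.

Lemma csum_pair (T U : choiceType) (f : T * U -> R[i]) : absum f ->
  csum f = csum (fun t => csum (fun u => f (t, u))).
Proof.
move=> af; apply/esym/csumE; apply: hsum_pair (csumP af) _ => t.
by apply: csumP; exact: absum_row.
Qed.

(** Row sums are dominated by row sums of absolute values; finitely many of these merge into one sum
    over [U], whose partial sums are partial sums of the double family over a rectangle. *)
Lemma absum_csum (T U : choiceType) (f : T * U -> R[i]) : absum f ->
  absum (fun t => csum (fun u => f (t, u))).
Proof.
move=> af; have [K hK] := af; exists K => A.
have aff : absum (fun p => (cabs (f p))%:C).
  by exists K => B; under eq_bigr => i _ do rewrite cabsR (ger0_norm (cabs_ge0 _)); exact: hK.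
apply: (@le_trans _ _ (\sum_(t <- A) cabs (csum (fun u => (cabs (f (t, u)))%:C)))).
  apply: ler_sum => t _; apply: (hsum_le (csumP (absum_row t af))) => B.
  apply: le_trans (cabs_sum _ _ _) _.
  have := rsm_sup _ (absum_row t af) => -[|s [sub sad]]; first by [].
  apply: le_trans (sub B) _.
  apply: (@le_trans _ _ (cabs s%:C)); first by rewrite cabsR ler_norm.
  rewrite (_ : csum _ = s%:C) //; apply: csumE => e /sad[C hC]; exists C => D CD.
  rewrite -rmorph_sum -rmorphB /= cabsR ler0_norm ?subr_le0 //.
  have := @fsum_sub_le _ (fun u => cabs (f (t, u))) C D (fun _ => cabs_ge0 _) CD.
  by lra.
have -> : \sum_(t <- A) cabs (csum (fun u => (cabs (f (t, u)))%:C)) =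
   \sum_(t <- A) complex.Re (csum (fun u => (cabs (f (t, u)))%:C)).
  apply: eq_bigr => t _.
  have [|s [sub sad]] := rsm_sup _ (absum_row t af); first by [].
  have -> : csum (fun u => (cabs (f (t, u)))%:C) = s%:C.
    apply: csumE => e /sad[C hC]; exists C => D CD.
    rewrite -rmorph_sum -rmorphB /= cabsR ler0_norm ?subr_le0 //.
    have := @fsum_sub_le _ (fun u => cabs (f (t, u))) C D (fun _ => cabs_ge0 _) CD.
    by lra.
  by rewrite cabsR ger0_norm //; apply: le_trans (sub fset0); rewrite big_nil.
rewrite -(raddf_sum (@complex.Re R : {additive Rcomplex R -> R})) /=.
apply: le_trans (ler_norm _) _; apply: le_trans (Re_le_cabs _) _.
rewrite -(@csum_fsum _ _ (enum_fset A) (fun t u => (cabs (f (t, u)))%:C)); last first.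
  by move=> t; exact: (@absum_row _ _ (fun p => (cabs (f p))%:C)).
apply: (@csum_le _ _ (fun u => \sum_(t <- A) cabs (f (t, u)))).
  move=> u; rewrite -rmorph_sum /= cabsR ger0_norm ?sumr_ge0 //.
move=> B; rewrite exchange_big /=.
by have := hK (fsetXX A B); rewrite fsumXX.
Qed.

Lemma rsm_inj (T U : choiceType) (h : T -> U) (b : U -> R) :
  injective h -> (forall u, 0 <= b u) -> rsm b -> rsm (fun t => b (h t)).
Proof.
move=> hi b0 [K hK]; exists K => A; apply: le_trans (hK [fset h t | t in A]).
by rewrite big_imfset //= => x y _ _ /hi.
Qed.

Lemma absum_inj (T U : choiceType) (h : T -> U) (f : U -> R[i]) :
  injective h -> absum f -> absum (fun t => f (h t)).
Proof. by move=> hi; apply: (@rsm_inj _ _ h (fun u => cabs (f u))). Qed.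

Section Reindex.
Variables (T U : choiceType) (h : T -> U) (h' : U -> T).
Hypothesis hK : cancel h h'.

Let pre (B : {fset U}) : {fset T} := [fset h' u | u in B & h (h' u) == u].

Let fsum_pre (V : zmodType) (f : U -> V) (B : {fset U}) :
  (forall u, h (h' u) != u -> f u = 0) ->
  \sum_(u <- B) f u = \sum_(t <- pre B) f (h t).
Proof.
move=> f0; rewrite /pre big_imfset /=; last first.
  move=> x y /andP[_ /eqP hx] /andP[_ /eqP hy] e.
  by rewrite -hx e hy.
rewrite [RHS](_ : _ = \sum_(u <- [fset u in B | h (h' u) == u]) f u); last first.
  rewrite big_filter big_fset /=; apply: eq_big => // u /eqP -> //.
  rewrite (@fsum_split _ _ [fset u in B | h (h' u) == u] B); last first.
    by apply/fsubsetP => u; rewrite !inE => /andP[].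
  rewrite [X in _ + X]big_seq [X in _ + X]big1 ?addr0 // => u.
  rewrite in_fsetD !inE => /andP[+ uB]; rewrite uB /=; exact: f0.
Qed.

Lemma rsm_reindex (b : U -> R) : (forall u, h (h' u) != u -> b u = 0) ->
  rsm (fun t => b (h t)) -> rsm b.
Proof. by move=> b0 [K hKb]; exists K => B; rewrite fsum_pre. Qed.

Lemma absum_reindex (f : U -> R[i]) : (forall u, h (h' u) != u -> f u = 0) ->
  absum (fun t => f (h t)) -> absum f.
Proof.
by move=> f0; apply: (@rsm_reindex (fun u => cabs (f u))) => u /f0 ->; rewrite cabs0.
Qed.

(** Only one cancellation is assumed, so [h] may miss part of [U]; the points it misses are those
    with [h (h' u) != u], where [f] has to vanish. Sums supported on the multiples of an integer are
    reindexed in this way. *)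
Lemma csum_reindex (f : U -> R[i]) : (forall u, h (h' u) != u -> f u = 0) ->
  absum (fun t => f (h t)) -> csum f = csum (fun t => f (h t)).
Proof.
move=> f0 /csumP fs; apply: csumE => e /fs[A hA].
exists [fset h t | t in A] => B AB; rewrite fsum_pre //; apply: hA.
apply/fsubsetP => t tA; apply/imfsetP; exists (h t); rewrite ?hK //=.
by rewrite !inE hK eqxx andbT; apply: (fsubsetP AB); apply/imfsetP; exists t.
Qed.

End Reindex.

Lemma csum_bij (T U : choiceType) (h : T -> U) (h' : U -> T) (f : U -> R[i]) :
  cancel h h' -> cancel h' h -> absum f -> csum f = csum (fun t => f (h t)).
Proof.
move=> hK h'K af; apply: (csum_reindex hK) => [u|]; first by rewrite h'K eqxx.
apply: absum_inj af; exact: can_inj hK.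
Qed.

Lemma csum_swap (T U : choiceType) (f : T * U -> R[i]) : absum f ->
  csum (fun t => csum (fun u => f (t, u))) = csum (fun u => csum (fun t => f (t, u))).
Proof.
move=> af; pose sw U' T' (p : U' * T') := (p.2, p.1).
have af' : absum (fun p => f (@sw U T p)) by apply: absum_inj af => -[? ?] [? ?] [-> ->].
rewrite -csum_pair // (@csum_bij _ _ (@sw U T) (@sw T U)) //; last 2 first.
- by case.
- by case.
by rewrite csum_pair.
Qed.

Lemma hsum_nat (f : nat -> R[i]) s : hsum f s -> cvs (series f) s.
Proof.
move=> fs e /fs[A hA]; exists (\max_(i <- A) i).+1 => n An.
pose B := [fset i | i in iota 0 n].
have -> : series f n = \sum_(i <- B) f i.
  rewrite /series /= /index_iota subn0; apply: perm_big; apply: uniq_perm; rewrite ?fset_uniq ?iota_uniq //.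
  by move=> i; rewrite !inE.
apply: hA; apply/fsubsetP => i iA; rewrite /B in_fset /= mem_iota /= add0n.
apply: leq_trans An; rewrite ltnS; exact: (@leq_bigmax_seq _ _ xpredT id i iA).
Qed.

Lemma csum_nat (f : nat -> R[i]) : absum f -> cvs (series f) (csum f).
Proof. by move=> /csumP/hsum_nat. Qed.

Lemma sum_csum (T : choiceType) (f : T -> R[i]) : absum f -> sum f = csum f.
Proof.
move=> /csumP fs; have ? := @totally_filter T.
rewrite /sum; apply: cvg_lim; first exact: norm_hausdorff.
apply/cvgrPdist_lt => e e0; have := e0; rewrite ltcE /= => /andP[/eqP ime ree].
have [A hA] := fs _ ree; exists A => // B /= /hA.
rewrite /partial_sum -(@big_seq_fsetE _ _ _ _ B xpredT f).
by rewrite cabsE cabs_dist ltcE /= ime eqxx.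
Qed.

Lemma rsm_nat (b : nat -> R) K : (forall n, 0 <= b n) ->
  (forall n, \sum_(i < n) b i <= K) -> rsm b.
Proof.
move=> b0 bK; exists K => A; apply: le_trans (bK (\max_(i <- A) i).+1).
rewrite -(big_mkord xpredT) /index_iota subn0.
pose B := [fset i | i in iota 0 (\max_(i <- A) i).+1].
have -> : \sum_(i <- iota 0 (\max_(i <- A) i).+1) b i = \sum_(i <- B) b i.
  apply: perm_big; apply: uniq_perm; rewrite ?fset_uniq ?iota_uniq //.
  by move=> i; rewrite !inE.
apply: fsum_sub_le => //; apply/fsubsetP => i iA.
rewrite /B in_fset /= (mem_iota 0 (\max_(i <- A) i).+1) /= add0n ltnS.
by apply: (@leq_bigmax_seq _ _ xpredT id i iA).
Qed.

End Summation.

(** * Taylor estimates for the exponential and lower bounds for [1 - nome z] *)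

Section Exponential.
Variable R : realType.
Implicit Types (x y a b t : R) (z w : R[i]).

Lemma cos_sin2 x : 1 - cos x = 2 * sin (x / 2) ^+ 2.
Proof.
have -> : cos x = cos ((x / 2) *+ 2) by congr cos; rewrite -mulr_natr divfK.
by rewrite cos_mulr2n; have := cos2Dsin2 (x / 2); lra.
Qed.

Lemma sin_MVT x : 0 < x -> exists2 c, 0 < c < x & sin x = cos c * x.
Proof.
move=> x0; have cs : {within `[0, x], continuous (@sin R)}.
  by apply: continuous_subspaceT => y; exact: continuous_sin.
have [c cin e] := MVT x0 (fun y _ => is_derive_sin y) cs.
by exists c; move: cin e; rewrite ?in_itv // sin0 !subr0.
Qed.

Lemma abs_sin_le x : `|sin x| <= `|x|.
Proof.
wlog x0 : x / 0 < x => [H|].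
  have [x0|/H//|->] := ltgtP x 0; last by rewrite sin0.
  by have := H (- x); rewrite sinN !normrN oppr_gt0; apply.
have [c _ ->] := sin_MVT x0; rewrite normrM ler_piMl //; exact: cos_max.
Qed.

Lemma abs_cos1_le x : 1 - cos x <= x ^+ 2.
Proof.
rewrite cos_sin2 -(real_normK (num_real (sin _))).
have := abs_sin_le (x / 2); rewrite normrM (@ger0_norm _ 2^-1) ?invr_ge0 //.
have := normr_ge0 (sin (x / 2)); have := normr_ge0 x.
rewrite -[x ^+ 2]real_normK ?num_real //.
by move: (`|sin _|) (`|x|) => u v; nra.
Qed.

Lemma abs_sin_sub_le x : `|sin x - x| <= x ^+ 2.
Proof.
wlog x0 : x / 0 < x => [H|].
  have [x0|/H//|->] := ltgtP x 0; last by rewrite sin0 subr0 normr0 expr0n.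
  by have := H (- x); rewrite sinN -opprD normrN sqrrN oppr_gt0; apply.
have [c /andP[c0 cx] ->] := sin_MVT x0.
have -> : cos c * x - x = - ((1 - cos c) * x) by ring.
rewrite normrN normrM expr2 (gtr0_norm x0) ler_wpM2r ?(ltW x0) //.
rewrite ger0_norm; last by rewrite subr_ge0 cos_le1.
rewrite cos_sin2; have := abs_sin_le (c / 2); rewrite (@ger0_norm _ (c / 2)); last by lra.
have := sin_le1 (c / 2); have := sin_geN1 (c / 2).
rewrite -(real_normK (num_real (sin _))) => h1 h2.
have : `|sin (c / 2)| <= 1 by rewrite ler_norml h1.
by have := normr_ge0 (sin (c / 2)); nra.
Qed.

Lemma expR_sub1_le a : `|expR a - 1| <= `|a| * expR `|a|.
Proof.
have := expR_ge1Dx a; have := expR_ge1Dx (- a); rewrite expRN.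
have := expR_gt0 a; set E := expR a => E0 h1 h2; have hE : E = expR a by [].
have hV : E^-1 * E = 1 by rewrite mulVf // gt_eqF.
have [a0|a0] := leP 0 a.
  rewrite (ger0_norm a0) -hE ger0_norm; last by lra.
  by nra.
rewrite (ltr0_norm a0) expRN -hE ler0_norm; last first.
  by rewrite hE subr_le0 expR_le1 ltW.
have : 1 <= E^-1 by nra.
by nra.
Qed.

Lemma expR_taylor a : `|expR a - 1 - a| <= a ^+ 2 * expR `|a|.
Proof.
have h1 := expR_ge1Dx a; have := expR_ge1Dx (- a); rewrite expRN.
have := expR_gt0 a; move: h1; set E := expR a => h1 E0 h2; have hE : E = expR a by [].
have hV : E^-1 * E = 1 by rewrite mulVf // gt_eqF.
rewrite ger0_norm; last by lra.
have [a0|a0] := leP 0 a.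
  have h3 : E - 1 <= a * E by nra.
  by rewrite (ger0_norm a0) -hE expr2; nra.
have : 1 <= expR `|a| by rewrite -expR0 ler_expR normr_ge0.
by move=> h3; rewrite expr2; nra.
Qed.

Lemma ge1_expR x : 0 <= x -> 1 <= expR x.
Proof. by move=> x0; rewrite (le_trans _ (expR_ge1Dx _)) // lerDl. Qed.

Lemma cexpD z w : cexp (z + w) = cexp z * cexp w.
Proof.
case: z w => [a b] [c d]; rewrite /cexp /=; simpc.
rewrite expRD cosD sinD; congr (_ +i* _); ring.
Qed.

Lemma cexp0 : cexp (0 : R[i]) = 1.
Proof. by rewrite /cexp /= expR0 cos0 sin0 mulr1 mulr0. Qed.

Lemma cabs_cexp z : cabs (cexp z) = expR (complex.Re z).
Proof.
rewrite /cabs /cexp /= !exprMn -mulrDr cos2Dsin2 mulr1 sqrtr_sqr gtr0_norm //.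
exact: expR_gt0.
Qed.

Lemma cexp_neq0 z : cexp z != 0.
Proof. by rewrite -cabs_gt0 cabs_cexp expR_gt0. Qed.

Lemma cexpN z : cexp (- z) = (cexp z)^-1.
Proof.
by apply: (mulfI (cexp_neq0 z)); rewrite -cexpD subrr cexp0 divff ?cexp_neq0.
Qed.

(** Real and imaginary part of the remainder are each at most [2 r^2 e^r] with [r = cabs z]; the
    constant 6 leaves some room. *)
Lemma cexp_taylor z : cabs (cexp z - 1 - z) <= 6 * cabs z ^+ 2 * expR (cabs z).
Proof.
have ha := Re_le_cabs z; have hb := Im_le_cabs z.
have hE : expR `|complex.Re z| <= expR (cabs z) by rewrite ler_expR.
have hE0 : expR (complex.Re z) <= expR (cabs z).
  by rewrite ler_expR (le_trans (ler_norm _)).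
have E1 : 1 <= expR (cabs z) by rewrite -expR0 ler_expR.
have h1 := expR_taylor (complex.Re z); have h2 := expR_sub1_le (complex.Re z).
have h3 := abs_cos1_le (complex.Im z); have h3' := cos_le1 (complex.Im z).
have h4 := abs_sin_sub_le (complex.Im z).
have e0 := expR_gt0 (complex.Re z); have c0 := cabs_ge0 z.
apply: le_trans (cabs_le _) _; move: ha hb hE hE0 E1 h1 h2 h3 h3' h4 e0 c0.
case: z => [a b]; rewrite /cexp /=; rewrite !subr0.
move: (cabs _) => r; have := expR_ge0 `|a|; move: (expR r) (expR a) (expR `|a|) (cos b) (sin b) => E e e' co si e'0.
move=> ha hb he' he E1 h1 h2 h3 h3' h4 e0 r0.
have a2 : a ^+ 2 <= r ^+ 2.
  by rewrite -[a ^+ 2]real_normK ?num_real // ler_pXn2r ?nnegrE.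
have b2 : b ^+ 2 <= r ^+ 2.
  by rewrite -[b ^+ 2]real_normK ?num_real // ler_pXn2r ?nnegrE.
have r2 : 0 <= r ^+ 2 by exact: sqr_ge0.
have rE : 0 <= r ^+ 2 * E by rewrite mulr_ge0 // (le_trans _ E1).
have k1 : `|e * co - 1 - a| <= 2 * (r ^+ 2 * E).
  have -> : e * co - 1 - a = (e - 1 - a) - e * (1 - co) by ring.
  apply: le_trans (ler_normB _ _) _; rewrite [X in _ <= X]mulr_natl mulr2n lerD //.
    by apply: le_trans h1 _; rewrite ler_pM ?sqr_ge0.
  rewrite normrM (gtr0_norm e0) (ger0_norm (_ : 0 <= 1 - co)) ?subr_ge0 // mulrC.
  by apply: ler_pM; rewrite ?subr_ge0 // ?(ltW e0) // (le_trans h3).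
have k2 : `|e * si - b| <= 2 * (r ^+ 2 * E).
  have -> : e * si - b = e * (si - b) + b * (e - 1) by ring.
  apply: le_trans (ler_normD _ _) _; rewrite [X in _ <= X]mulr_natl mulr2n lerD //.
    rewrite normrM (gtr0_norm e0) mulrC ler_pM ?(ltW e0) //.
    exact: le_trans h4 b2.
  rewrite normrM; apply: le_trans (ler_wpM2l (normr_ge0 b) h2) _.
  rewrite mulrA expr2; apply: ler_pM; rewrite ?mulr_ge0 //.
  by apply: ler_pM.
by move: k1 k2; rewrite -mulrA; lra.
Qed.

Lemma tpi_neq0 : (2 * pi)*i != 0 :> R[i].
Proof. by rewrite eq_complex /= eqxx /= mulf_eq0 negb_or pnatr_eq0 /= gt_eqF ?pi_gt0. Qed.

Lemma tpiE : (2 * pi)*i = 2 * pi%:C * 'i :> R[i].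
Proof.
transitivity ((2 * pi)%:C * 'i : R[i]); first by simpc.
by rewrite rmorphM /= rmorph_nat.
Qed.

Lemma nomeE z : nome z = cexp (- (2 * pi * complex.Im z) +i* (2 * pi * complex.Re z)).
Proof. by rewrite /nome; congr cexp; case: z => a b /=; simpc; congr (_ +i* _); ring. Qed.

Lemma nomeD z w : nome (z + w) = nome z * nome w.
Proof. by rewrite /nome mulrDr cexpD. Qed.

Lemma nome0 : nome (0 : R[i]) = 1.
Proof. by rewrite /nome mulr0 cexp0. Qed.

Lemma nome_neq0 z : nome z != 0. Proof. exact: cexp_neq0. Qed.

Lemma nomeN z : nome (- z) = (nome z)^-1.
Proof. by rewrite /nome mulrN cexpN. Qed.

Lemma nomeB z w : nome (z - w) = nome z / nome w.
Proof. by rewrite nomeD nomeN. Qed.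

Lemma cabs_nome z : cabs (nome z) = expR (- (2 * pi * complex.Im z)).
Proof. by rewrite nomeE cabs_cexp. Qed.

Lemma nomeMn n z : nome (n%:R * z) = nome z ^+ n.
Proof.
elim: n => [|n IHn]; first by rewrite mul0r nome0.
by rewrite -natr1 mulrDl mul1r nomeD IHn exprSr.
Qed.

Lemma nomeMz (n : int) z : nome (n%:~R * z) = nome z ^ n.
Proof.
case: n => n; first exact: nomeMn.
by rewrite NegzE mulrNz mulNr nomeN nomeMn -exprnN.
Qed.

Lemma nome1 : nome (1 : R[i]) = 1.
Proof.
rewrite nomeE /cexp /= mulr0 oppr0 expR0 !mul1r mulr1 [2 * pi]mulr_natl.
by rewrite cos2pi sin2pi.
Qed.

Lemma nome_int (n : int) : nome (n%:~R : R[i]) = 1.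
Proof. by rewrite -[n%:~R]mulr1 nomeMz nome1 exp1rz. Qed.

Lemma nome_nat (n : nat) : nome (n%:R : R[i]) = 1.
Proof. exact: (nome_int n). Qed.

Lemma nomeDint z (n : int) : nome (z + n%:~R) = nome z.
Proof. by rewrite nomeD nome_int mulr1. Qed.

Lemma nome_taylor z : cabs (nome z - 1 - (2 * pi)*i * z) <=
  6 * (2 * pi * cabs z) ^+ 2 * expR (2 * pi * cabs z).
Proof.
have := cexp_taylor ((2 * pi)*i * z); rewrite cabsM.
have -> // : cabs (2 * pi)*i = 2 * pi :> R.
by rewrite /cabs /= expr0n add0r sqrtr_sqr ger0_norm // mulr_ge0 // pi_ge0.
Qed.

(** Up to [1/4] the mean value theorem applies, with a cosine of at least [1/2] and [pi >= 2];
    beyond it [cos (2 pi t) <= 0] forces the sine to be at least [1/2]. *)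
Lemma sin_pi_ge t : 0 <= t <= 2^-1 -> t <= sin (pi * t).
Proof.
move=> /andP[t0 t2]; have pi0 := pi_gt0 R; have pi2 := pi_ge2 R.
have hs := cos2Dsin2 (pi * t).
have h2 := cos_mulr2n (pi * t).
have [t4|t4] := leP t 4^-1; last first.
  have s0 : 0 <= sin (pi * t) by apply: sin_ge0_pi; apply/andP; split; nra.
  have c0 : cos ((pi * t) *+ 2) <= 0.
    have -> : pi * t *+ 2 = - (pi - pi * t *+ 2) + pi by ring.
    rewrite cosDpi cosN oppr_le0; apply: cos_ge0_pihalf.
    by rewrite -mulr_natl; apply/andP; split; nra.
  have : 2^-1 <= sin (pi * t) by nra.
  by lra.
have [->|tn0] := eqVneq t 0; first by rewrite mulr0 sin0.
have tp : 0 < pi * t by rewrite mulr_gt0 // lt_neqAle eq_sym tn0.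
have [c /andP[c0 cx] ->] := sin_MVT tp.
have c2 := cos_mulr2n c.
have : 0 <= cos (c *+ 2).
  by apply: cos_ge0_pihalf; rewrite -mulr_natl; apply/andP; split; nra.
have : 0 <= cos c by apply: cos_ge0_pihalf; apply/andP; split; nra.
move=> cc0 cc2; have : 2^-1 <= cos c by nra.
by nra.
Qed.

(** The range goes beyond [1/2] because the points [(x + j) / (2 n + 1)] with [|j| <= n] can exceed
    it; the factor [1/3] comes from [1 - t] at [t = 3/4]. *)
Lemma abs_sin_pi_ge t : `|t| <= 3 / 4 -> `|t| / 3 <= `|sin (pi * t)|.
Proof.
wlog t0 : t / 0 <= t => [H|].
  have [/H //|t0] := leP 0 t; have := H (- t); rewrite mulrN sinN !normrN; apply.
  by rewrite oppr_ge0 ltW.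
rewrite (ger0_norm t0) => t34.
have [t2|t2] := leP t 2^-1.
  rewrite (le_trans _ (ler_norm _)) // (le_trans _ (sin_pi_ge _)) ?t0 //; lra.
have := @sin_pi_ge (1 - t); rewrite mulrBr mulr1.
have -> : sin (pi - pi * t) = sin (pi * t).
  by rewrite sinD sinpi cospi sinN cosN; ring.
move=> h; have {}h : 1 - t <= sin (pi * t) by apply: h; apply/andP; split; lra.
by rewrite (le_trans _ (ler_norm _)) // (le_trans _ h) //; lra.
Qed.

(** A radial and an angular term, both nonnegative: either one alone gives a lower bound for the
    distance. *)
Lemma cabs_sub_nome z : cabs (1 - nome z) ^+ 2 =
  (1 - expR (- (2 * pi * complex.Im z))) ^+ 2
  + 4 * expR (- (2 * pi * complex.Im z)) * sin (pi * complex.Re z) ^+ 2.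
Proof.
rewrite cabs_sqr nomeE /cexp /=.
have := cos_sin2 (2 * pi * complex.Re z).
have -> : 2 * pi * complex.Re z / 2 = pi * complex.Re z by field.
have := cos2Dsin2 (2 * pi * complex.Re z); move: (2 * pi * complex.Re z) => u.
move: (sin (pi * _) ^+ 2) => s2; move: (expR _) (cos u) (sin u) => r c s h1 h2.
have -> : (1 - r * c) ^+ 2 + (0 - r * s) ^+ 2 = 1 - 2 * r * c + r ^+ 2 * (c ^+ 2 + s ^+ 2) by ring.
by rewrite h1; nra.
Qed.

Lemma cabs_sub_nome_real t : `|t| <= 2^-1 -> `|t| / 2 <= cabs (1 - nome t%:C).
Proof.
move=> t2; rewrite -(@ler_pXn2r _ 2) ?nnegrE ?divr_ge0 //.
rewrite cabs_sub_nome /= mulr0 oppr0 expR0 subrr expr0n add0r mulr1.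
have := @abs_sin_pi_ge t; rewrite -[X in _ <= 4 * X]real_normK ?num_real // => h.
have : `|t| / 3 <= `|sin (pi * t)| by apply: h; lra.
have := normr_ge0 t; move: (`|sin _|) (`|t|) => u v; nra.
Qed.

Lemma nome_real_eq1 t : 0 < t < 1 -> nome t%:C != 1.
Proof.
move=> /andP[t0 t1]; apply/negP => /eqP h.
have [t2|t2] := leP t 2^-1.
  have := @cabs_sub_nome_real t; rewrite h subrr cabs0 gtr0_norm // => /(_ t2).
  by lra.
have := @cabs_sub_nome_real (t - 1); rewrite rmorphB nomeB /= h nome1 divr1 subrr cabs0.
rewrite ltr0_norm; last by lra.
by move=> hh; have := hh _; lra.
Qed.

Lemma nome_div_eq1 (M : nat) (n : int) : (0 < M)%N ->
  (nome (n%:~R / M%:R : R[i]) == 1) = (M %| n)%Z.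
Proof.
move=> M0; have M0R : (M%:R : R[i]) != 0 by rewrite pnatr_eq0 -lt0n.
have M0Z : M%:Z != 0 by rewrite -lt0n.
apply/eqP/idP => [h|/dvdzP[q ->]]; last by rewrite rmorphM /= mulfK // nome_int.
have := divz_eq n M; have := modz_ge0 n M0Z; have := ltz_pmod n (_ : 0 < M%:Z).
move: (n %% M)%Z (n %/ M)%Z => r q /(_ M0) rM r0 nE.
move: h; rewrite {1}nE rmorphD rmorphM /= mulrDl mulfK // addrC nomeDint.
have [r1|r1] := eqVneq r 0; first by rewrite nE r1 addr0 dvdz_mull.
have -> : (r%:~R / M%:R : R[i]) = (r%:~R / M%:R)%:C.
  by rewrite rmorphM fmorphV /= rmorph_int rmorph_nat.
move/eqP; rewrite (negbTE (nome_real_eq1 _)) //; apply/andP; split.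
  by rewrite divr_gt0 ?ltr0z ?ltr0n // lt_neqAle eq_sym r1.
by rewrite ltr_pdivrMr ?ltr0n // mul1r -(ltr_int R) in rM *.
Qed.

Lemma sum_nome (M : nat) (n : int) : (0 < M)%N ->
  \sum_(j < M) nome (j%:R * (n%:~R / M%:R) : R[i]) = if (M %| n)%Z then M%:R else 0.
Proof.
move=> M0; have M0R : (M%:R : R[i]) != 0 by rewrite pnatr_eq0 -lt0n.
under eq_bigr do rewrite nomeMn.
have [/eqP h|h] := boolP (nome (n%:~R / M%:R : R[i]) == 1); rewrite -(nome_div_eq1 _ M0).
  rewrite h eqxx.
  by under eq_bigr do rewrite expr1n; rewrite sumr_const card_ord.
rewrite (negbTE h).
have := subrX1 (nome (n%:~R / M%:R : R[i])) M.
rewrite -nomeMn mulrC divfK // nome_int subrr => /esym/eqP.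
by rewrite mulf_eq0 subr_eq0 (negbTE h) => /eqP.
Qed.

End Exponential.

(** * Majorants: inverse squares and polynomials times exponentials *)

Section RealSummability.
Variable R : realType.

Lemma rsm_inv_sq : rsm (fun n : nat => (n.+1%:R ^+ 2)^-1 : R).
Proof.
apply: (@rsm_nat _ _ 2) => [n|n]; first by rewrite invr_ge0 sqr_ge0.
(* The correction [- 1 / (n + 1)] makes the bound inductive: its increments dominate the inverse
   squares. *)
suff H : \sum_(i < n.+1) (i.+1%:R ^+ 2)^-1 <= 2 - n.+1%:R^-1 :> R.
  rewrite big_ord_recr /= in H.
  have h1 : 0 <= (n.+1%:R ^+ 2)^-1 :> R by rewrite invr_ge0 sqr_ge0.
  have h2 : 0 <= n.+1%:R^-1 :> R by rewrite invr_ge0.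
  by apply: le_trans (_ : _ <= 2 - n.+1%:R^-1) _; [apply: le_trans H; rewrite lerDl | rewrite gerBl].
elim: n => [|n IHn]; first by rewrite big_ord_recr big_ord0 /= expr1n invr1; lra.
rewrite big_ord_recr /=; apply: le_trans (lerD IHn (lexx _)) _.
rewrite -addrA lerD2l.
have n0 : (0 : R) < n.+1%:R by rewrite ltr0n.
have -> : n.+2%:R = n.+1%:R + 1 :> R by rewrite natr1.
move: (n.+1%:R : R) n0 => x x0.
rewrite -subr_ge0.
have -> : - (x + 1)^-1 - (- x^-1 + ((x + 1) ^+ 2)^-1) = (x * (x + 1) ^+ 2)^-1.
  by field; rewrite !gt_eqF //; lra.
by rewrite invr_ge0 mulr_ge0 ?sqr_ge0 // ltW.
Qed.

Lemma rsm_int (b : int -> R) : (forall n, 0 <= b n) ->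
  rsm (fun n : nat => b n) -> rsm (fun n : nat => b (Negz n)) -> rsm b.
Proof.
move=> b0 b1 b2.
have : rsm (fun x : int => (if x is Posz _ then b x else 0) + (if x is Negz _ then b x else 0)).
  apply: rsmD.
    by apply: (@rsm_reindex _ _ _ Posz absz) => // -[n|n] //=; rewrite eqxx.
  apply: (@rsm_reindex _ _ _ Negz (fun x => if x is Negz n then n else 0%N)) => // -[n|n] //=.
  by rewrite eqxx.
by apply: rsm_le => -[n|n]; rewrite ?addr0 ?add0r.
Qed.

Lemma rsm_int_inv_sq : rsm (fun n : int => (1 + `|n|%:~R : R) ^- 2).
Proof.
apply: rsm_int => [n||]; first by rewrite invr_ge0 sqr_ge0.
- by apply: rsm_le rsm_inv_sq => n; rewrite addrC natr1.
- apply: rsm_le rsm_inv_sq => n; rewrite /= lef_pV2 ?posrE ?exprn_gt0 ?ltr0n ?ltr_wpDr ?ler0z //.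
  rewrite ler_pXn2r ?nnegrE ?addr_ge0 ?ler0n ?ler0z // NegzE normrN.
  by rewrite ger0_norm // lerDr.
Qed.

Lemma expR_ge_pow (x : R) n : 0 <= x -> x ^+ n / n`!%:R <= expR x.
Proof.
move=> x0; case: n => [|n]; first by rewrite expr0 divr1 -expR0 ler_expR.
by apply: le_trans (expR_ge1Dxn n x0); rewrite lerDr.
Qed.

Lemma polyexp_bound (a x : R) k : 0 < a -> 0 <= x ->
  x ^+ k * expR (- (a * x)) <= k`!%:R / a ^+ k.
Proof.
move=> a0 x0; have := @expR_ge_pow (a * x) k (mulr_ge0 (ltW a0) x0).
rewrite expRN ler_pdivrMr ?ltr0n ?fact_gt0 // => h.
rewrite ler_pdivlMr ?exprn_gt0 // mulrAC ler_pdivrMr ?expR_gt0 // [k`!%:R * _]mulrC.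
by rewrite mulrC -exprMn mulrC; move: h; rewrite [x * a]mulrC.
Qed.

(** Two extra powers in [polyexp_bound] leave the summable factor [(m + 1)^-2]; the shift from [m]
    to [m + 1] in the exponent costs [e^a]. *)
Lemma rsm_polyexp (a : R) k : 0 < a ->
  rsm (fun m : nat => m.+1%:R ^+ k * expR (- (a * m%:R))).
Proof.
move=> a0; have c0 : 0 <= expR a * ((k.+2)`!%:R / a ^+ k.+2).
  by rewrite mulr_ge0 ?expR_ge0 // divr_ge0 // exprn_ge0 // ltW.
apply: rsm_le (rsmZ c0 rsm_inv_sq).
move=> m; rewrite ler_pdivlMr ?exprn_gt0 ?ltr0n //.
have -> : m.+1%:R ^+ k * expR (- (a * m%:R)) * m.+1%:R ^+ 2 =
  expR a * (m.+1%:R ^+ k.+2 * expR (- (a * m.+1%:R))).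
  have -> : - (a * m%:R) = a + - (a * m.+1%:R) :> R by rewrite -natr1; ring.
  by rewrite expRD -[in RHS]addn2 exprD; ring.
by rewrite ler_wpM2l ?expR_ge0 // polyexp_bound.
Qed.

End RealSummability.

(** * Lipschitz' formula *)

Section Lipschitz.
Variable R : realType.
Implicit Types (z w : R[i]).

Lemma absum_geom_bin k (a : R) w : 0 < a -> cabs w <= expR (- a) ->
  absum (fun m : nat => ('C(m + k, k)%:R : R[i]) * w ^+ m).
Proof.
move=> a0 wa; apply: absum_le (rsm_polyexp k a0) => m.
rewrite cabsM cabsX cabs_nat ler_pM ?exprn_ge0 //.
  rewrite -natrX ler_nat; elim: k => [|k IHk]; first by rewrite bin0.
  rewrite -(@leq_pmul2l k.+1) // expnS addnS -mul_bin_diag mulnA.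
  by rewrite leq_mul // (leq_trans _ (_ : k.+1 + m * k.+1 <= _)%N) //; nia.
have -> : - (a * m%:R) = m%:R * - a by ring.
by rewrite expRM_natl lerXn2r ?nnegrE ?expR_ge0.
Qed.

(** Multiplication by [1 - w] takes differences of the coefficients, and Pascal's rule turns
    [C(m + k + 1, k + 1)] into [C(m + k, k)]. *)
Lemma csum_geom_bin k (a : R) w : 0 < a -> cabs w <= expR (- a) ->
  csum (fun m : nat => ('C(m + k, k)%:R : R[i]) * w ^+ m) = (1 - w) ^- k.+1.
Proof.
move=> a0 wa.
have w1 : 1 - w != 0.
  apply/negP; rewrite subr_eq0 => /eqP w1; move: wa; rewrite -w1 cabs1 leNgt.
  by rewrite expR_lt1 oppr_lt0 a0.
have shift (f : nat -> R[i]) : absum (fun m => f m * w ^+ m) ->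
    csum (fun m => (f m - (if m is m'.+1 then f m' else 0)) * w ^+ m) =
    (1 - w) * csum (fun m => f m * w ^+ m).
  move=> af; rewrite mulrBl mul1r -csumZ //.
  have e : forall m, (if m is m'.+1 then f m' else 0) * w ^+ m =
      (if m is m'.+1 then w * (f m' * w ^+ m') else 0).
    by case=> [|m]; rewrite ?mul0r // exprS mulrCA.
  have af' : absum (fun m : nat => if m is m'.+1 then w * (f m' * w ^+ m') else 0).
    by apply: (@absum_reindex _ _ _ S predn) => // [[|m]//|]; [rewrite eqxx | exact: absumZ].
  have -> : csum (fun m => w * (f m * w ^+ m)) =
      csum (fun m : nat => if m is m'.+1 then w * (f m' * w ^+ m') else 0).
    symmetry; apply: (@csum_reindex _ _ _ S predn) => // [[|m]//|]; first by rewrite eqxx.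
    exact: absumZ.
  by rewrite -csumB //; apply: eq_csum => m; rewrite mulrBl e.
elim: k => [|k IHk].
  have := shift (fun m => 'C(m + 0, 0)%:R) (absum_geom_bin 0 a0 wa).
  rewrite (@csum_fin _ _ _ [fset 0%N]%fset) => [|[|m]]; last 2 first.
  - by rewrite inE eqxx.
  - by rewrite !bin0 subrr mul0r.
  rewrite big_seq_fset1 /= bin0 subr0 mulr1 => e.
  by apply: (mulfI w1); rewrite -e expr1 divff.
have := shift (fun m => 'C(m + k.+1, k.+1)%:R) (absum_geom_bin k.+1 a0 wa).
rewrite (_ : csum _ = csum (fun m : nat => ('C(m + k, k)%:R : R[i]) * w ^+ m)); last first.
  apply: eq_csum => -[|m]; first by rewrite !add0n !binn subr0.
  by rewrite addSn binS natrD addrAC subrr add0r addSnnS.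
rewrite IHk => e; apply: (mulfI w1); rewrite -e [in RHS]exprS invfM mulrA divff //.
by rewrite mul1r.
Qed.

Lemma csum_symm n (F : int -> R[i]) :
  csum (fun j : int => if (`|j| <= n)%N then F j else 0) =
  \sum_(i < n.*2.+1) F (i%:Z - n%:Z).
Proof.
rewrite (@csum_reindex _ _ _ (fun i : 'I_n.*2.+1 => (i%:Z - n%:Z)%R)
  (fun j => inord `|j + n%:Z|)) => [|i|j|]; last 1 first.
- exact: absum_finType.
- rewrite csum_finType; apply: eq_bigr => i _; case: ifP => // /negP[].
  by have := ltn_ord i; lia.
- by apply: val_inj; rewrite /= subrK absz_nat inord_val.
case: ifP => // jn; rewrite inordK; last by lia.
by move/eqP => []; lia.
Qed.

Lemma absum_symm n (F : int -> R[i]) :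
  absum (fun j : int => if (`|j| <= n)%N then F j else 0).
Proof.
apply: (@absum_reindex _ _ _ (fun i : 'I_n.*2.+1 => (i%:Z - n%:Z)%R) (fun j => inord `|j + n%:Z|)) => [j|]; last exact: absum_finType.
case: ifP => // jn; rewrite inordK; last by lia.
by move/eqP => []; lia.
Qed.

Lemma cvs_odd_inv c : cvs (fun n => c / (n.*2.+1)%:R : R[i]) 0.
Proof.
apply: (@cvs_squeeze _ _ (fun n => cabs c / (n.*2.+1)%:R)) => [n|e e0].
  by rewrite cabsM cabsV cabs_nat.
exists (Num.truncn (cabs c / e)).+1 => n hn.
rewrite ltr_pdivrMr ?ltr0n // -ltr_pdivrMl // mulrC.
apply: lt_le_trans (truncnS_gt _) _; rewrite ler_nat.
by apply: leq_trans hn _; lia.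
Qed.

Lemma nome_deriv_cvs w :
  cvs (fun n => (n.*2.+1)%:R * (1 - nome (w / (n.*2.+1)%:R))) (- ((2 * pi)*i * w)).
Proof.
have -> : - ((2 * pi)*i * w) = - ((2 * pi)*i * w) + 0 by rewrite addr0.
pose r n := (n.*2.+1)%:R * (1 - nome (w / (n.*2.+1)%:R) + (2 * pi)*i * (w / (n.*2.+1)%:R)) : R[i].
have -> : (fun n => (n.*2.+1)%:R * (1 - nome (w / (n.*2.+1)%:R))) =
    fun n => - ((2 * pi)*i * w) + r n.
  apply/funext => n; rewrite /r; have : (n.*2.+1)%:R != 0 :> R[i] by rewrite pnatr_eq0.
  by move: (_%:R) => M M0; field.
apply: cvsD; first exact: cvs_cst.
set K : R := 6 * (2 * pi * cabs w) ^+ 2 * expR (2 * pi * cabs w).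
have K0 : 0 <= K by rewrite mulr_ge0 ?expR_ge0 // mulr_ge0 ?sqr_ge0.
apply: (@cvs_squeeze _ _ (fun n => cabs (K%:C / (n.*2.+1)%:R))) => [n|e e0]; last first.
  by have [n0 h] := cvs_odd_inv K%:C e0; exists n0 => n /h; rewrite subr0.
have M1 : 1 <= (n.*2.+1)%:R :> R by rewrite ler1n.
have -> : r n = - ((n.*2.+1)%:R * (nome (w / (n.*2.+1)%:R) - 1 - (2 * pi)*i * (w / (n.*2.+1)%:R))).
  by rewrite /r; ring.
rewrite cabsN cabsM cabs_nat; apply: le_trans (ler_wpM2l _ (nome_taylor _)) _ => //.
rewrite !cabsM !cabsV !cabs_nat cabsR (ger0_norm K0) /K.
have c0 := cabs_ge0 w; move: M1; move: (_%:R) => M M1; move: (cabs w) c0 => c c0.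
have M0 : 0 < M by lra.
have -> : M * (6 * (2 * pi * (c / M)) ^+ 2 * expR (2 * pi * (c / M))) =
  6 * (2 * pi * c) ^+ 2 * expR (2 * pi * (c / M)) / M.
  by field; rewrite gt_eqF.
have c2 : 0 <= 6 * (2 * pi * c) ^+ 2 by rewrite mulr_ge0 ?sqr_ge0.
rewrite ler_pM2r ?invr_gt0 // ler_wpM2l // ler_expR.
rewrite ler_wpM2l ?mulr_ge0 ?pi_ge0 // ler_pdivrMr //.
by rewrite ler_peMr.
Qed.

(** The source of the majorant for the finite form of Lipschitz' formula: the distances grow
    linearly in [j], uniformly in [n]. The radial part of [cabs_sub_nome] gives the constant bound
    [s1], the angular part the bound [s2 |x + j|]. *)
Lemma nome_dist_ge z : 0 < complex.Im z ->
  exists2 s : R, 0 < s & exists n0, forall n (j : int), (n0 <= n)%N -> (`|j| <= n)%N ->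
    s * (1 + `|j|%:~R) <= cabs ((n.*2.+1)%:R * (1 - nome ((z + j%:~R) / (n.*2.+1)%:R))).
Proof.
move=> y0; set y := complex.Im z in y0 *; set x := complex.Re z.
have pi0 := pi_gt0 R.
set s1 := 2 * pi * y / (1 + 2 * pi * y); set s2 := 2 / 3 * expR (- (pi * y)).
have py : 0 < 2 * pi * y by rewrite !mulr_gt0.
have s10 : 0 < s1 by rewrite divr_gt0 //; lra.
have s20 : 0 < s2 by rewrite mulr_gt0 ?expR_gt0 //; lra.
(* Obtained from [1 + |j| <= (1 + |x|) + |x + j|], each summand being bounded by a multiple of
   [D]. *)
exists (s2^-1 + (1 + `|x|) / s1)^-1.
  by rewrite invr_gt0 addr_gt0 ?invr_gt0 // divr_gt0 //; have := normr_ge0 x; lra.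
(* With [|x| <= n / 2] the real part [(x + j) / (2 n + 1)] stays within [3/4], the range of
   [abs_sin_pi_ge]. *)
exists (Num.truncn (2 * `|x|)).+1 => n j hn jn.
set M : R := (n.*2.+1)%:R; have M1 : 1 <= M by rewrite ler1n.
have M0 : 0 < M by lra.
set D := cabs _.
have imw : complex.Im ((z + j%:~R) / (n.*2.+1)%:R : R[i]) = y / M.
  rewrite -(rmorph_nat (@real_complex_def R (Phant R))) -fmorphV /=.
  rewrite -(rmorph_int (@real_complex_def R (Phant R))) /y.
  by case: (z) => a b /=; simpc; rewrite /= ?mulr0 ?addr0 ?add0r ?mul0r.
have rew : complex.Re ((z + j%:~R) / (n.*2.+1)%:R : R[i]) = (x + j%:~R) / M.
  rewrite -(rmorph_nat (@real_complex_def R (Phant R))) -fmorphV /=.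
  rewrite -(rmorph_int (@real_complex_def R (Phant R))) /x.
  by case: (z) => a b /=; simpc; rewrite /= ?mulr0 ?subr0.
have DE : D = M * cabs (1 - nome ((z + j%:~R) / (n.*2.+1)%:R)).
  by rewrite /D cabsM cabs_nat.
have := cabs_sub_nome ((z + j%:~R) / (n.*2.+1)%:R); rewrite imw rew.
set c := cabs _ in DE *; have c0 : 0 <= c by exact: cabs_ge0.
set t := 2 * pi * (y / M).
have tE : t = 2 * pi * y / M by rewrite /t; ring.
have t0 : 0 < t by rewrite tE divr_gt0.
have Mt : M * t = 2 * pi * y by rewrite tE mulrC divfK // gt_eqF.
set r := expR (- t) => cE.
have r0 : 0 < r by exact: expR_gt0.
have rt : r * (1 + t) <= 1.
  have := expR_ge1Dx t; rewrite /r expRN mulrC => h.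
  by rewrite ler_pdivrMr ?expR_gt0 // mul1r.
have c1 : 1 - r <= c.
  have r1 : r <= 1 by rewrite expR_le1 oppr_le0 ltW.
  rewrite -(@ler_pXn2r _ 2) ?nnegrE ?subr_ge0 // cE lerDl mulr_ge0 ?sqr_ge0 // mulr_ge0 //.
  exact: ltW.
have D1 : s1 <= D.
  rewrite DE /s1 ler_pdivrMr; last by lra.
  apply: le_trans (_ : M * (1 - r) * (1 + 2 * pi * y) <= _); last first.
    by rewrite ler_wpM2r ?ler_wpM2l ?(ltW M0) //; lra.
  rewrite -Mt.
  have h : t <= (1 - r) * (1 + t) by lra.
  have r1 : 0 <= 1 - r by rewrite subr_ge0 expR_le1 oppr_le0 ltW.
  apply: le_trans (ler_wpM2l (ltW M0) h) _; rewrite mulrA ler_wpM2l ?mulr_ge0 ?(ltW M0) //.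
  by rewrite lerD2l ler_peMl // ltW.
have nx : 2 * `|x| <= n%:R.
  by apply: le_trans (ltW (truncnS_gt _)) _; rewrite ler_nat.
have jR : `|j|%:~R <= n%:R :> R.
  by rewrite -abszE ler_nat.
have xjM : `|(x + j%:~R) / M| <= 3 / 4.
  rewrite normrM normfV (gtr0_norm M0) ler_pdivrMr //.
  apply: le_trans (ler_normD _ _) _; rewrite -intr_norm.
  have -> : M = n%:R * 2 + 1 by rewrite /M -natr1 -muln2 natrM.
  by lra.
have sn := abs_sin_pi_ge xjM.
have D2 : s2 * `|x + j%:~R| <= D.
  rewrite DE -(@ler_pXn2r _ 2) ?nnegrE ?mulr_ge0 // ?(ltW s20) ?(ltW M0) //.
  rewrite [X in _ <= X]exprMn cE.
  apply: le_trans (_ : M ^+ 2 * (4 * r * sin (pi * ((x + j%:~R) / M)) ^+ 2) <= _); last first.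
    by rewrite ler_wpM2l ?sqr_ge0 // lerDr sqr_ge0.
  have -> : M ^+ 2 * (4 * r * sin (pi * ((x + j%:~R) / M)) ^+ 2) =
    4 * r * (M * `|sin (pi * ((x + j%:~R) / M))|) ^+ 2.
    by rewrite exprMn real_normK ?num_real //; ring.
  rewrite /s2 exprMn exprMn.
  have e2r : expR (- (pi * y)) ^+ 2 <= r.
    rewrite -expRM_natl ler_expR mulrN lerN2 tE mulrA ler_pdivrMr //.
    by rewrite ler_peMr // ltW.
  have sn' : `|x + j%:~R| / 3 <= M * `|sin (pi * ((x + j%:~R) / M))|.
    move: sn; rewrite normrM normfV (gtr0_norm M0) mulrAC ler_pdivrMr //.
    by rewrite [_ * M]mulrC.
  have -> : (2 / 3) ^+ 2 * expR (- (pi * y)) ^+ 2 * `|x + j%:~R| ^+ 2 =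
    4 * expR (- (pi * y)) ^+ 2 * (`|x + j%:~R| / 3) ^+ 2 by field.
  apply: ler_pM; rewrite ?mulr_ge0 ?sqr_ge0 // ?ler_wpM2l //.
  by rewrite ler_pXn2r ?nnegrE ?divr_ge0 // mulr_ge0 // ltW.
rewrite mulrC ler_pdivrMr; last first.
  by rewrite addr_gt0 ?invr_gt0 // divr_gt0 //; have := normr_ge0 x; lra.
rewrite mulrDr.
have k2 : `|x + j%:~R| <= D * s2^-1 by rewrite ler_pdivlMr // mulrC.
have k1 : 1 + `|x| <= D * ((1 + `|x|) / s1).
  by rewrite mulrA ler_pdivlMr // [D * _]mulrC ler_wpM2l.
have : `|j|%:~R <= `|x + j%:~R| + `|x| :> R.
  rewrite intr_norm; have := ler_normB (x + j%:~R) x.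
  by rewrite [x + _ - x]addrAC subrr add0r.
by lra.
Qed.

Definition lipc (p : nat) : R[i] := (- (2 * pi)*i) ^+ p.+1 / p`!%:R.

(** For [M = 2 n + 1] the binomial series of [(1 - w)^(-p-1)] at the points
    [w = nome ((z + j) / M)], summed over a full residue system of [j], retains only the exponents
    divisible by [M]. After scaling by [M^(-p-1)] the left side tends termwise to
    [(-2 pi i (z + j))^(-p-1)] and the right side, up to [p!], to [m^p nome (m z)]. The limits are
    dominated through [nome_dist_ge] and by a polynomial times an exponential. *)
Lemma lipschitz p z : (0 < p)%N -> 0 < complex.Im z ->
  absum (fun n : int => (z + n%:~R) ^- p.+1) /\
  csum (fun n : int => (z + n%:~R) ^- p.+1) =
  lipc p * csum (fun m : nat => m%:R ^+ p * nome (m%:R * z)).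
Proof.
move=> p0 y0; have pi0 := pi_gt0 R.
have [s s0 [n0 hs]] := nome_dist_ge y0.
pose M n : R[i] := (n.*2.+1)%:R.
have M0 n : M n != 0 by rewrite pnatr_eq0.
pose f n (j : int) := if (`|j| <= n)%N then (M n * (1 - nome ((z + j%:~R) / M n))) ^- p.+1 else 0.
pose g n (m : nat) : R[i] := (p`! * 'C(n.*2.+1 * m + p, p))%:R / M n ^+ p * nome (m%:R * z).
have im0 n (j : int) : 0 < complex.Im ((z + j%:~R) / M n).
  rewrite /M -(rmorph_nat (@real_complex_def R (Phant R))) -fmorphV /=.
  rewrite -(rmorph_int (@real_complex_def R (Phant R))).
  move: y0; case: (z) => a b /=; simpc => b0; rewrite /= ?mulr0 ?addr0 ?add0r.
  by rewrite mulr_gt0 // invr_gt0 ltr0n.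
have fg n : csum (g n) = p`!%:R * csum (f n).
  rewrite csum_symm.
  pose a := 2 * pi * (complex.Im z / (n.*2.+1)%:R).
  have a0 : 0 < a by rewrite !mulr_gt0 // invr_gt0 ltr0n.
  have ne j : cabs (nome ((z + j%:~R) / M n)) <= expR (- a).
    rewrite cabs_nome ler_expR lerN2 /a /M.
    rewrite -(rmorph_nat (@real_complex_def R (Phant R))) -fmorphV /=.
    rewrite -(rmorph_int (@real_complex_def R (Phant R))).
    by case: (z) => u v /=; simpc; rewrite /= ?mulr0 ?addr0 ?add0r.
  rewrite (eq_bigr (fun i : 'I_n.*2.+1 => M n ^- p.+1 * csum (fun m : nat => ('C(m + p, p)%:R : R[i]) * nome ((z + (i%:Z - n%:Z)%:~R) / M n) ^+ m))); last first.
    by move=> i _; rewrite exprMn invfM (csum_geom_bin p a0 (ne _)).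
  rewrite -mulr_sumr -csum_fsum; last by move=> i; exact: absum_geom_bin a0 (ne _).
  (* The value of the sum over [j] by orthogonality: a factor [M] on the multiples of [M], zero
     elsewhere. *)
  pose G (t : nat) := if (n.*2.+1 %| t)%N then M n * ('C(t + p, p)%:R * nome (t%:R * z / M n)) else 0.
  rewrite [X in _ * (_ * X)](_ : _ = csum G); last first.
    apply: eq_csum => t; rewrite /G.
    have e (i : 'I_n.*2.+1) : 'C(t + p, p)%:R * nome ((z + (i%:Z - n%:Z)%:~R) / M n) ^+ t =
       'C(t + p, p)%:R * nome (t%:R * z / M n) * nome (- (n%:R * (t%:R / M n))) * nome (i%:R * ((t%:Z)%:~R / (n.*2.+1)%:R)).
      rewrite -nomeMn -!mulrA -!nomeD; congr (_ * nome _).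
      by rewrite rmorphB /= -!pmulrn; ring.
    under eq_bigr => i _ do rewrite e.
    rewrite -mulr_sumr sum_nome //.
    have -> : (n.*2.+1 %| t%:Z)%Z = (n.*2.+1 %| t)%N by [].
    case: ifP => [/dvdnP[q ->]|]; last by rewrite mulr0.
    have -> : n%:R * ((q * n.*2.+1)%:R / M n) = ((n * q)%N)%:R :> R[i].
      by rewrite natrM mulfK // natrM.
    by rewrite nomeN nome_nat invr1 mulr1 mulrC.
  pose G' t := M n * ('C(n.*2.+1 * t + p, p)%:R * nome (z / M n) ^+ (n.*2.+1 * t)).
  have GE t : G (n.*2.+1 * t)%N = G' t.
    by rewrite /G /G' dvdn_mulr // -nomeMn !mulrA.
  have aG' : absum G'.
    apply: absumZ.
    apply: (@absum_inj _ _ _ (fun t : nat => n.*2.+1 * t)%N (fun t => 'C(t + p, p)%:R * nome (z / M n) ^+ t)).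
      by move=> t u /eqP; rewrite eqn_pmul2l // => /eqP.
    by apply: absum_geom_bin a0 _; have := ne 0; rewrite addr0.
  have hK : cancel (fun m : nat => n.*2.+1 * m)%N (fun t => t %/ n.*2.+1)%N.
    by move=> m; rewrite mulKn.
  rewrite (@csum_reindex _ _ _ _ _ hK G); last first.
  - by rewrite (funext GE).
  - by move=> t; rewrite /G; case: ifP => // /dvdnP[q ->]; rewrite mulnK // mulnC eqxx.
  rewrite (funext GE).
  rewrite mulrA -csumZ //.
  apply: eq_csum => m; rewrite /G' /g natrM.
  have -> : nome (z / M n) ^+ (n.*2.+1 * m) = nome (m%:R * z).
    rewrite -nomeMn natrM -[n.*2.+1%:R]/(M n); congr nome.
    by have := M0 n; move: (M n) => X X0; field.
  rewrite exprS invfM; have := M0 n; move: (M n) => X X0.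
  have := expf_neq0 p X0; move: (X ^+ p) => Y Y0; field.
  by rewrite X0 Y0.
have fb n j : (n0 <= n)%N -> cabs (f n j) <= s ^- p.+1 * (1 + `|j|%:~R) ^- 2.
  move=> hn; have j1 : 1 <= 1 + `|j|%:~R :> R by rewrite lerDl ler0z.
  rewrite /f; case: ifP => jn; last first.
    by rewrite cabs0 mulr_ge0 // invr_ge0 exprn_ge0 // ?(ltW s0) // (le_trans _ j1).
  rewrite cabsV cabsX; have := hs n j hn jn; set D := cabs _ => hD.
  have sj0 : 0 < s * (1 + `|j|%:~R) by rewrite mulr_gt0 // (lt_le_trans _ j1).
  have D0 : 0 < D by exact: lt_le_trans hD.
  have sp2 : 0 < s ^+ p.+1 * (1 + `|j|%:~R) ^+ 2.
    by rewrite mulr_gt0 ?exprn_gt0 // (lt_le_trans _ j1).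
  rewrite -invfM lef_pV2 ?posrE ?exprn_gt0 //.
  apply: le_trans (_ : (s * (1 + `|j|%:~R)) ^+ p.+1 <= _); last first.
    by rewrite ler_pXn2r ?nnegrE ?(ltW sj0) ?(le_trans (ltW sj0)).
  by rewrite exprMn ler_wpM2l ?exprn_ge0 ?(ltW s0) // ler_weXn2l.
have zn0 (j : int) : - ((2 * pi)*i * (z + j%:~R)) != 0.
  rewrite oppr_eq0 mulf_neq0 ?tpi_neq0 //.
  apply/negP => /eqP h; move: y0; have : complex.Im (z + j%:~R) = 0 by rewrite h.
  rewrite -(rmorph_int (@real_complex_def R (Phant R))).
  by move: (z) => [u v]; simpc => /= ->; rewrite ltxx.
have fl j : cvs (fun n => f n j) ((- ((2 * pi)*i * (z + j%:~R))) ^- p.+1).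
  apply: (@eq_cvs _ (fun n => (M n * (1 - nome ((z + j%:~R) / M n))) ^- p.+1)).
    by exists `|j|%N => n jn; rewrite /f jn.
  by apply: cvsV; [exact: expf_neq0 | apply: cvsX; exact: nome_deriv_cvs].
have sp0 : 0 <= s ^- p.+1 by rewrite invr_ge0 exprn_ge0 // ltW.
have [af cf] := csum_cvs (rsmZ sp0 (rsm_int_inv_sq R)) fb fl.
(* As a product of [p] factors [m + (p - i) / M], the coefficient visibly tends to [m^p] and is
   bounded uniformly in [n]. *)
have gE n m : g n m = (\prod_(i < p) (m%:R + (p - i)%:R / M n)) * nome (m%:R * z).
  rewrite /g mulnC bin_ffact ffact_prod natr_prod; congr (_ * _).
  have -> : M n ^+ p = \prod_(i < p) M n by rewrite prodr_const card_ord.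
  rewrite -prodf_div; apply: eq_bigr => i _; have ip := ltn_ord i.
  rewrite -addnBA ?(ltnW ip) // natrD natrM -[n.*2.+1%:R]/(M n).
  by have := M0 n; move: (M n) => X X0; field.
have gb n m : (0 <= n)%N -> cabs (g n m) <= p.+1%:R ^+ p * (m.+1%:R ^+ p * expR (- (2 * pi * complex.Im z * m%:R))).
  move=> _; rewrite gE cabsM nomeMn mulrA; apply: ler_pM => //.
  - rewrite -exprMn cabs_prod -[X in _ <= _ ^+ X]card_ord -prodr_const.
    apply: ler_prod => i _; rewrite cabs_ge0 /=; apply: le_trans (cabsD _ _) _.
    rewrite cabsM cabsV !cabs_nat.
    apply: (@le_trans _ _ (m%:R + p%:R)).
      rewrite lerD2l ler_pdivrMr ?ltr0n // -natrM ler_nat.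
      by apply: leq_trans (leq_subr _ _) _; rewrite leq_pmulr.
    by rewrite -natrD -natrM ler_nat; nia.
  - by rewrite cabsX cabs_nome -expRM_natl ler_expR mulrN mulrC.
have gl m : cvs (fun n => g n m) (m%:R ^+ p * nome (m%:R * z)).
  rewrite (_ : (fun n => g n m) = fun n => (\prod_(i < p) (m%:R + (p - i)%:R / M n)) * nome (m%:R * z)); last first.
    by apply/funext => n; rewrite gE.
  apply: cvsM; last exact: cvs_cst.
  have -> : m%:R ^+ p = \prod_(i < p) (m%:R : R[i]) by rewrite prodr_const card_ord.
  apply: cvs_prod => i; rewrite -[X in cvs _ X]addr0; apply: cvsD; first exact: cvs_cst.
  exact: cvs_odd_inv.
have py : 0 < 2 * pi * complex.Im z by rewrite !mulr_gt0.
have pp0 : 0 <= p.+1%:R ^+ p :> R by rewrite exprn_ge0.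
have [ag cg] := csum_cvs (rsmZ pp0 (rsm_polyexp p py)) gb gl.
have lim2 : csum (fun m : nat => m%:R ^+ p * nome (m%:R * z)) =
    p`!%:R * csum (fun j : int => (- ((2 * pi)*i * (z + j%:~R))) ^- p.+1).
  apply: cvs_unique cg _; rewrite (_ : (fun n => csum (g n)) = fun n => p`!%:R * csum (f n)).
    exact: cvsZ.
  by apply/funext => n; exact: fg.
have ne0 : - (2 * pi)*i != 0 :> R[i] by rewrite oppr_eq0 tpi_neq0.
have eqs : (fun n : int => (z + n%:~R) ^- p.+1) =
    fun j : int => (- (2 * pi)*i) ^+ p.+1 * (- ((2 * pi)*i * (z + j%:~R))) ^- p.+1.
  apply/funext => j; rewrite -mulNr exprMn invfM mulrA divff ?mul1r //.
  exact: expf_neq0.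
rewrite eqs; split; first exact: absumZ.
rewrite csumZ // lim2 /lipc mulrA divfK // pnatr_eq0 -lt0n fact_gt0 //.
Qed.

End Lipschitz.

(** * Poisson summation for one Gaussian *)

Section GaussianPoisson.
Variable R : realType.
Implicit Types (a b y u w z : R[i]) (x d h : R).

Definition gau y : R[i] := cexp (- (pi%:C * y ^+ 2)).

(** What remains of [gau (y + u) / gau y] after its first-order expansion in [u]; it is of second
    order in [u]. *)
Definition gau_rem y u : R[i] :=
  cexp (- (pi%:C * (2 * y * u + u ^+ 2))) - 1 + 2 * pi%:C * y * u.

Lemma gauD y u : gau (y + u) = gau y * (1 - 2 * pi%:C * y * u + gau_rem y u).
Proof.
rewrite /gau_rem /gau.
have -> : 1 - 2 * pi%:C * y * u +
  (cexp (- (pi%:C * (2 * y * u + u ^+ 2))) - 1 + 2 * pi%:C * y * u) =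
  cexp (- (pi%:C * (2 * y * u + u ^+ 2))) by ring.
by rewrite -cexpD; congr cexp; ring.
Qed.

Lemma Re_sqr z : complex.Re (z ^+ 2) = complex.Re z ^+ 2 - complex.Im z ^+ 2.
Proof. by case: z => p q; rewrite expr2; simpc; rewrite /= -!expr2. Qed.

(** Decay that is uniform in the parameters, with the same [d] in the bound as in the hypothesis:
    completing the square loses half of [d], and [pi >= 2] restores it. *)
Lemma gau_bound d (A : R) : 0 < d -> 0 <= A -> exists2 C : R, 0 <= C &
  forall a b x, d <= complex.Re (a ^+ 2) -> cabs a <= A -> cabs b <= A ->
    cabs (gau (a * x%:C + b)) <= C * expR (- (d * (1 + `|x|) ^+ 2)).
Proof.
(* [2 d B] is chosen so that, once the cross terms are bounded below, only the square of
   [d |x| - (d + 2 A^2)] is left. *)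
move=> d0 A0; pose B := (d + 2 * A ^+ 2) ^+ 2 / (2 * d) + d / 2 + A ^+ 2.
have B0 : 0 <= B.
  rewrite !addr_ge0 ?sqr_ge0 //; last by lra.
  by rewrite divr_ge0 ?sqr_ge0 //; lra.
exists (expR (pi * B)) => [|a b x da aA bA]; first exact: expR_ge0.
have pi2 := pi_ge2 R.
rewrite /gau cabs_cexp -expRD ler_expR.
have -> : complex.Re (- (pi%:C * (a * x%:C + b) ^+ 2)) =
    - (pi * complex.Re ((a * x%:C + b) ^+ 2)).
  by move: ((a * _ + b) ^+ 2) => -[p q]; simpc.
have key : d / 2 * (1 + `|x|) ^+ 2 - B <= complex.Re ((a * x%:C + b) ^+ 2).
  have -> : (a * x%:C + b) ^+ 2 = a ^+ 2 * (x ^+ 2)%:C + 2 * (a * b) * x%:C + b ^+ 2.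
    by rewrite rmorphXn /=; ring.
  have -> : complex.Re (a ^+ 2 * (x ^+ 2)%:C + 2 * (a * b) * x%:C + b ^+ 2) =
      complex.Re (a ^+ 2) * x ^+ 2 + 2 * complex.Re (a * b) * x + complex.Re (b ^+ 2).
    move: (a ^+ 2) (a * b) (b ^+ 2) => [p q] [r s] [t v]; rewrite !mulr_natl !mulr2n; simpc.
    by rewrite /=; ring.
  have h1 := le_trans (Re_le_cabs (a * b)) (_ : cabs (a * b) <= A * A).
  have h2 := le_trans (Re_le_cabs (b ^+ 2)) (_ : cabs (b ^+ 2) <= A ^+ 2).
  have {}h1 : `|complex.Re (a * b)| <= A * A by apply: h1; rewrite cabsM ler_pM.
  have {}h2 : `|complex.Re (b ^+ 2)| <= A ^+ 2.
    by apply: h2; rewrite cabsX ler_pXn2r ?nnegrE.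
  have h3 : - (A * A * `|x|) <= complex.Re (a * b) * x.
    have : `|complex.Re (a * b) * x| <= A * A * `|x| by rewrite normrM ler_wpM2r.
    by rewrite ler_norml => /andP[].
  move: h2; rewrite ler_norml => /andP[h2 _].
  have h4 : d * x ^+ 2 <= complex.Re (a ^+ 2) * x ^+ 2 by rewrite ler_wpM2r ?sqr_ge0.
  have BE : B * (2 * d) = (d + 2 * A ^+ 2) ^+ 2 + d * d + 2 * d * A ^+ 2.
    by rewrite /B; field; rewrite gt_eqF.
  have xx : x ^+ 2 = `|x| ^+ 2 by rewrite real_normK ?num_real.
  have sq := sqr_ge0 (d * `|x| - (d + 2 * A ^+ 2)).
  move: h3 h4 sq BE; rewrite xx; move: (B) => B'; move: (`|x|) => v.
  rewrite -[2 * complex.Re (a * b) * x]mulrA.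
  move: (complex.Re (b ^+ 2)) (complex.Re (a * b) * x) (complex.Re (a ^+ 2) * v ^+ 2) h2 => r1 r2 r3.
  move=> h2 h3 h4 sq BE.
  suff : 0 <= 2 * d * (r3 + 2 * r2 + r1 - (d / 2 * (1 + v) ^+ 2 - B')).
    by rewrite pmulr_rge0 ?subr_ge0 ?mulr_gt0 //; lra.
  have -> : 2 * d * (r3 + 2 * r2 + r1 - (d / 2 * (1 + v) ^+ 2 - B')) =
    2 * d * (r3 - d * v ^+ 2) + 4 * d * (r2 + A * A * v) + 2 * d * (r1 + A ^+ 2)
    + ((d * v - (d + 2 * A ^+ 2)) ^+ 2 + (B' * (2 * d) - ((d + 2 * A ^+ 2) ^+ 2 + d * d + 2 * d * A ^+ 2))).
    by field.
  rewrite BE subrr addr0 !addr_ge0 //.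
  - by rewrite mulr_ge0 //; lra.
  - by rewrite mulr_ge0 //; lra.
  - by rewrite mulr_ge0 //; lra.
have : 0 <= (1 + `|x|) ^+ 2 by exact: sqr_ge0.
move: key; set V := (1 + `|x|) ^+ 2; move: (complex.Re _) => r key V0.
have k1 : pi * (d / 2 * V - B) <= pi * r by rewrite ler_wpM2l ?pi_ge0.
have k2 : 2 * (d / 2 * V) <= pi * (d / 2 * V) by rewrite ler_wpM2r // mulr_ge0 //; lra.
by lra.
Qed.

Lemma gau_rem_bound (A : R) y u (rho h : R) : 0 <= A -> 1 <= rho -> 0 <= h <= 1 ->
  cabs y <= A * rho -> cabs u <= h * (A * rho) ->
  cabs (gau_rem y u) <= h ^+ 2 * ((pi * A ^+ 2 + 6 * (3 * pi * A ^+ 2) ^+ 2) * rho ^+ 4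
     * expR (h * (3 * pi * A ^+ 2 * rho ^+ 2))).
Proof.
move=> A0 rho1 /andP[h0 h1] yA uA; have pi0 := pi_gt0 R.
pose w : R[i] := - (pi%:C * (2 * y * u + u ^+ 2)).
have -> : gau_rem y u = (cexp w - 1 - w) - pi%:C * u ^+ 2.
  by rewrite /gau_rem /w; ring.
have wb : cabs w <= h * (3 * pi * A ^+ 2 * rho ^+ 2).
  rewrite cabsN cabsM cabsR (gtr0_norm pi0).
  have -> : h * (3 * pi * A ^+ 2 * rho ^+ 2) =
     pi * (2 * (A * rho) * (h * (A * rho)) + h * (A * rho) * (A * rho)) by ring.
  rewrite ler_wpM2l ?pi_ge0 //; apply: le_trans (cabsD _ _) _; apply: lerD.
    rewrite !cabsM cabs_nat ler_pM ?mulr_ge0 // ler_wpM2l //.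
  rewrite cabsX expr2 ler_pM //; apply: le_trans uA _.
  by rewrite ler_piMl // mulr_ge0 //; lra.
apply: le_trans (cabsB _ _) _; rewrite cabsM cabsX cabsR (gtr0_norm pi0).
have E1 : 1 <= expR (h * (3 * pi * A ^+ 2 * rho ^+ 2)).
  by apply: ge1_expR; exact: le_trans (cabs_ge0 w) wb.
apply: le_trans (lerD (cexp_taylor w) (lexx _)) _.
have k1 : 6 * cabs w ^+ 2 * expR (cabs w) <= 6 * (h * (3 * pi * A ^+ 2 * rho ^+ 2)) ^+ 2 * expR (h * (3 * pi * A ^+ 2 * rho ^+ 2)).
  apply: ler_pM; rewrite ?expR_ge0 ?ler_expR //; first by rewrite mulr_ge0 ?sqr_ge0.
  by rewrite ler_wpM2l // ler_pXn2r ?nnegrE // (le_trans _ wb).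
have k2 : pi * cabs u ^+ 2 <= h ^+ 2 * (pi * A ^+ 2 * rho ^+ 4).
  apply: (@le_trans _ _ (pi * (h * (A * rho)) ^+ 2)).
    by rewrite ler_wpM2l ?pi_ge0 // ler_pXn2r ?nnegrE // (le_trans _ uA).
  have -> : h ^+ 2 * (pi * A ^+ 2 * rho ^+ 4) = pi * (h * (A * rho)) ^+ 2 * rho ^+ 2 by ring.
  rewrite ler_peMr ?exprn_ege1 //.
  by apply: mulr_ge0; [exact: pi_ge0 | exact: sqr_ge0].
apply: le_trans (lerD k1 k2) _.
move: E1; set E := expR _ => E1.
set P := h ^+ 2 * (pi * A ^+ 2 * rho ^+ 4).
have P0 : 0 <= P.
  apply: mulr_ge0; first exact: sqr_ge0.
  apply: mulr_ge0; last by apply: exprn_ge0; lra.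
  by apply: mulr_ge0; [exact: pi_ge0 | exact: sqr_ge0].
have : P <= P * E by rewrite ler_peMr.
have -> : h ^+ 2 * ((pi * A ^+ 2 + 6 * (3 * pi * A ^+ 2) ^+ 2) * rho ^+ 4 * E) =
  P * E + 6 * (h * (3 * pi * A ^+ 2 * rho ^+ 2)) ^+ 2 * E by rewrite /P; ring.
by lra.
Qed.

(* The factor [rho ^+ 5] and the exponential growth of the remainder are
   absorbed by the Gaussian as soon as [h] is small. *)
Lemma gau_err_bound d (A C B : R) : 0 < d -> 0 <= B -> 0 <= C ->
  exists2 K : R, 0 <= K & exists2 h0 : R, 0 < h0 & forall h rho (c e : R), 0 <= h <= h0 -> 1 <= rho ->
    0 <= c <= C * expR (- (d * rho ^+ 2)) ->
    0 <= e <= h ^+ 2 * (A * rho ^+ 5 * expR (h * (B * rho ^+ 2))) ->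
    c * e <= h ^+ 2 * (K * rho ^- 2).
Proof.
move=> d0 B0 C0; have d2 : 0 < d / 2 by lra.
pose A' : R := `|A|; pose K := C * A' * (7`!%:R / (d / 2) ^+ 7).
have K0 : 0 <= K.
  have h7 : 0 <= 7`!%:R / (d / 2) ^+ 7 by rewrite divr_ge0 // exprn_ge0 // ltW.
  by rewrite mulr_ge0 // mulr_ge0 // normr_ge0.
exists K => //; exists (d / (2 * (B + 1))).
  by rewrite divr_gt0 // mulr_gt0 //; lra.
move=> h rho c e /andP[h0 hh] rho1 /andP[c0 cC] /andP[e0 eA].
apply: le_trans (ler_pM c0 e0 cC eA) _.
have hB : h * B <= d / 2.
  move: hh; rewrite ler_pdivlMr; last by lra.
  by nra.
have r0 : 0 < rho by lra.
have -> : C * expR (- (d * rho ^+ 2)) * (h ^+ 2 * (A * rho ^+ 5 * expR (h * (B * rho ^+ 2)))) =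
  h ^+ 2 * (C * A * (rho ^+ 7 * (expR (- (d * rho ^+ 2)) * expR (h * (B * rho ^+ 2)))) * rho ^- 2).
  by field; rewrite gt_eqF.
rewrite ler_wpM2l ?sqr_ge0 // ler_wpM2r ?invr_ge0 ?sqr_ge0 // -expRD.
apply: (@le_trans _ _ (C * A' * (rho ^+ 7 * expR (- (d * rho ^+ 2) + h * (B * rho ^+ 2))))).
  rewrite ler_wpM2r ?mulr_ge0 ?exprn_ge0 ?expR_ge0 ?(ltW r0) // ler_wpM2l //.
  exact: ler_norm.
rewrite /K ler_wpM2l //; first by rewrite mulr_ge0 // normr_ge0.
apply: le_trans (polyexp_bound 7 d2 (ltW r0)).
rewrite ler_wpM2l ?exprn_ge0 ?(ltW r0) // ler_expR.
have : rho <= rho ^+ 2 by rewrite expr2 ler_peMl // ltW.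
have : h * B * rho ^+ 2 <= d / 2 * rho ^+ 2 by rewrite ler_wpM2r ?sqr_ge0.
rewrite mulrA; move: (rho ^+ 2) => v; nra.
Qed.

(** Sample points of mesh [1 / (2 n + 1)]. The odd denominator makes the frequencies [|m| <= n] a
    full residue system. *)
Definition xj n (j : int) : R := j%:~R / (n.*2.+1)%:R.

Definition hn n : R := (n.*2.+1)%:R^-1.

Lemma hn_gt0 n : 0 < hn n. Proof. by rewrite invr_gt0 ltr0n. Qed.

Lemma hn_le1 n : hn n <= 1. Proof. by rewrite invf_le1 ?ltr0n // ler1n. Qed.

Lemma hnM n : (n.*2.+1)%:R * hn n = 1.
Proof. by rewrite mulfV // pnatr_eq0. Qed.

Lemma hn_small (e : R) : 0 < e -> exists n0, forall n, (n0 <= n)%N -> hn n <= e.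
Proof.
move=> e0; have [n0 h] := @cvs_odd_inv R 1 e e0; exists n0 => n /h.
rewrite subr0 cabsM cabs1 mul1r cabsV cabs_nat; exact: ltW.
Qed.

Lemma xjD n j : xj n (j + 1) = xj n j + hn n.
Proof. by rewrite /xj rmorphD /= mulrDl mul1r. Qed.

Lemma xjB n j : xj n (j - 1) = xj n j - hn n.
Proof. by rewrite /xj rmorphB /= mulrBl mul1r. Qed.

(** The nodes are grouped by their integer part [t]: each class has [2 n + 1] nodes, on which the
    summand is at most [4 (1 + |t|)^-2]. *)
Lemma riemann_bound : exists2 K : R, 0 <= K & forall n (A : {fset int}),
  \sum_(j <- A) (1 + `|xj n j|) ^- 2 <= K * (n.*2.+1)%:R.
Proof.
have [K hK] := rsm_int_inv_sq R.
have K0 : 0 <= K by have := hK fset0; rewrite big_nil.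
exists (4 * K) => [|n A]; first by rewrite mulr_ge0.
set M := n.*2.+1.
pose phi (j : int) : int * 'I_M := ((j %/ M)%Z, inord `|(j %% M)%Z|).
pose b (q : int * 'I_M) : R := 4 * (1 + `|q.1|%:~R) ^- 2.
have b0 q : 0 <= b q by rewrite mulr_ge0 // invr_ge0 sqr_ge0.
have M0 : M%:Z != 0 by [].
have rlt (j : int) : (`|(j %% M)%Z| < M)%N.
  by have := ltz_pmod j (isT : 0 < M%:Z); have := modz_ge0 j M0; lia.
have phi_inj : injective phi.
  move=> i j [e1] /(congr1 (@nat_of_ord _)); rewrite !inordK // => e2.
  rewrite (divz_eq i M) (divz_eq j M) e1; congr (_ + _).
  by rewrite -(gez0_abs (modz_ge0 i M0)) e2 gez0_abs // modz_ge0.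
apply: (@le_trans _ _ (\sum_(j <- A) b (phi j))).
  apply: ler_sum => j _; rewrite /b /=.
  set t := (j %/ M)%Z.
  have tj : `|t|%:~R <= `|xj n j| + 1 :> R.
    have -> : xj n j = t%:~R + ((j %% M)%Z)%:~R / M%:R.
      rewrite /xj {1}(divz_eq j M) rmorphD rmorphM /= mulrDl mulfK //.
      by rewrite pnatr_eq0.
    set r := _ / M%:R.
    have : `|r| <= 1.
      rewrite /r normrM normfV (@ger0_norm _ M%:R) // ler_pdivrMr ?ltr0n // mul1r.
      by rewrite -intr_norm -abszE ler_nat ltnW.
    rewrite intr_norm; have := ler_normB (t%:~R + r) r.
    by rewrite addrK; move: (`|_|) (`|_|) (`|_|) => u v w; lra.
  have x0 := normr_ge0 (xj n j); have t0 : 0 <= `|t|%:~R :> R by rewrite ler0z.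
  rewrite -[4]invrK -invfM lef_pV2 ?posrE; last 2 first.
  - by rewrite exprn_gt0 //; lra.
  - by rewrite mulr_gt0 // exprn_gt0 //; lra.
  have -> : 4^-1 * (1 + `|t|%:~R) ^+ 2 = (2^-1 * (1 + `|t|%:~R)) ^+ 2 :> R by field.
  by rewrite ler_pXn2r ?nnegrE ?mulr_ge0 ?addr_ge0 //; lra.
have -> : \sum_(j <- A) b (phi j) = \sum_(q <- [fset phi j | j in A]%fset) b q.
  by rewrite big_imfset //= => i j _ _ /phi_inj.
apply: le_trans (fsum_sub_le b0 (fsub_XX _)) _.
rewrite fsumXX /=.
apply: (@le_trans _ _ (\sum_(t <- [fset p.1 | p in [fset phi j | j in A]%fset]%fset) (1 + `|t|%:~R) ^- 2 * (4 * M%:R))).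
  apply: ler_sum => t _; rewrite /b /= big_const_seq count_predT iter_addr_0.
  rewrite -[X in X <= _]mulr_natr [4 / _]mulrC -mulrA ler_wpM2l ?invr_ge0 ?sqr_ge0 //.
  rewrite ler_wpM2l // ler_nat.
  rewrite -[X in (_ <= X)%N](size_enum_ord M); apply: uniq_leq_size.
    exact: fset_uniq.
  by move=> i _; rewrite mem_enum.
by rewrite -mulr_suml [4 * K]mulrC -mulrA ler_wpM2r // mulr_ge0.
Qed.

Lemma rsm_riemann n : rsm (fun j : int => (1 + `|xj n j|) ^- 2).
Proof. by have [K _ hK] := riemann_bound; exists (K * (n.*2.+1)%:R); exact: hK. Qed.

Lemma gau_absumM n a b w v : 0 < complex.Re (a ^+ 2) ->
  absum (fun j : int => (w * (xj n j)%:C + v) * gau (a * (xj n j)%:C + b)).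
Proof.
move=> a0; have A0 : 0 <= cabs a + cabs b by rewrite addr_ge0.
have [C C0 hC] := gau_bound a0 A0.
pose d := complex.Re (a ^+ 2).
have K0 : 0 <= (cabs w + cabs v) * (C * (3`!%:R / d ^+ 3)).
  by rewrite mulr_ge0 ?addr_ge0 // mulr_ge0 // divr_ge0 // exprn_ge0 // ltW.
apply: absum_le (rsmZ K0 (rsm_riemann n)) => j.
rewrite cabsM -mulrA; apply: (@le_trans _ _ ((cabs w + cabs v) * (1 + `|xj n j|) * (C * expR (- (d * (1 + `|xj n j|) ^+ 2))))).
  apply: ler_pM => //; last by apply: hC; rewrite // ?lerDl ?lerDr.
  apply: le_trans (cabsD _ _) _; rewrite cabsM cabsR mulrDr mulr1 mulrDl.
  by have := normr_ge0 (xj n j); have := cabs_ge0 w; have := cabs_ge0 v; move: (cabs w) (cabs v) (`|_|) => u1 u2 u3; nra.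
rewrite -!mulrA ler_wpM2l ?addr_ge0 // mulrCA ler_wpM2l // [X in _ <= X]mulrA.
set rho := 1 + `|xj n j|; have rho1 : 1 <= rho by rewrite lerDl.
have r0 : 0 < rho by lra.
rewrite ler_pdivlMr ?exprn_gt0 //.
have -> : rho * expR (- (d * rho ^+ 2)) * rho ^+ 2 = rho ^+ 3 * expR (- (d * rho ^+ 2)) by ring.
apply: le_trans (polyexp_bound 3 a0 (ltW r0)).
rewrite ler_wpM2l ?exprn_ge0 ?(ltW r0) // ler_expR lerN2 ler_wpM2l ?(ltW a0) //.
by rewrite expr2 ler_peMl // ltW.
Qed.

Lemma gau_absum n a b : 0 < complex.Re (a ^+ 2) ->
  absum (fun j : int => gau (a * (xj n j)%:C + b)).
Proof.
move=> a0; have := @gau_absumM n a b 0 1 a0.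
by rewrite (_ : (fun j => _) = fun j : int => gau (a * (xj n j)%:C + b)) //;
  apply/funext => j; rewrite mul0r add0r mul1r.
Qed.

(** Riemann sum of [a e^(-pi (a x + b)^2)] over the real line; its limit 1 takes the place of the
    Gaussian integral. *)
Definition gau_riemann n a b : R[i] :=
  (hn n)%:C * csum (fun j : int => a * gau (a * (xj n j)%:C + b)).

Lemma csum_shift1 (f : int -> R[i]) : absum f -> csum (fun j : int => f (j + 1)) = csum f.
Proof.
move=> af; rewrite [RHS](@csum_bij _ _ _ (fun j : int => j + 1) (fun j => j - 1)) //.
- by move=> j; rewrite addrK.
- by move=> j; rewrite subrK.
Qed.

Lemma csum_shiftN1 (f : int -> R[i]) : absum f -> csum (fun j : int => f (j - 1)) = csum f.
Proof.
move=> af; rewrite [RHS](@csum_bij _ _ _ (fun j : int => j - 1) (fun j => j + 1)) //.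
- by move=> j; rewrite subrK.
- by move=> j; rewrite addrK.
Qed.

Lemma absum_shift (f : int -> R[i]) (k : int) : absum f -> absum (fun j : int => f (j + k)).
Proof. by apply: absum_inj; exact: addIr. Qed.

Definition hscale a n (i : nat) : R[i] := 1 + (i%:R * hn n)%:C * (a - 1).

Definition hshift b n (i : nat) : R[i] := (i%:R * hn n)%:C * b.

(* Along the path [a_p = 1 + p (a - 1)], [b_p = p b], the [p]-derivative of
   [a_p * gau (a_p x + b_p)] is the [x]-derivative of
   [((a - 1) x + b) * gau (a_p x + b_p)], whose Riemann sums telescope to 0. *)
Lemma gau_homotopy_step a b : 0 < complex.Re a -> 0 < complex.Re (a ^+ 2) ->
  exists2 K : R, 0 <= K & exists n0, forall n (i : nat), (n0 <= n)%N -> (i < n.*2.+1)%N ->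
    cabs (gau_riemann n (hscale a n i.+1) (hshift b n i.+1)
          - gau_riemann n (hscale a n i) (hshift b n i)) <= hn n ^+ 2 * K.
Proof.
(* On the path, [Re (a_p^2)] is at least [m0 ((1 - p)^2 + p^2)], hence at least [m0 / 2]; the mixed
   term is nonnegative since [Re a > 0]. *)
move=> ra ra2; pose m0 : R := Num.min 1 (complex.Re (a ^+ 2)).
have m00 : 0 < m0 by rewrite lt_min ltr01.
pose d : R := m0 / 2; have d0 : 0 < d by rewrite divr_gt0.
pose A : R := 1 + cabs a + cabs b + 1; have A1 : 1 <= A by rewrite /A; have := cabs_ge0 a; have := cabs_ge0 b; lra.
have A0 : 0 <= A by lra.
have [C C0 hC] := gau_bound d0 A0.
pose B := 3 * pi * A ^+ 2; pose K1 := pi * A ^+ 2 + 6 * B ^+ 2.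
have pi0 := pi_gt0 R.
have B0 : 0 <= B by rewrite mulr_ge0 ?sqr_ge0 // mulr_ge0 ?pi_ge0.
have K10 : 0 <= K1 by rewrite addr_ge0 // mulr_ge0 ?sqr_ge0 ?pi_ge0.
have [K K0 [h0 h00 hK]] := @gau_err_bound d (4 * A * K1 + 4 * pi * A ^+ 3) C B d0 B0 C0.
have [K2 K20 hK2] := riemann_bound.
have [n0 hn0] := hn_small h00.
exists (K * K2); first by rewrite mulr_ge0.
exists n0 => n i nn0 iM; pose al := hscale a n; pose be := hshift b n.
rewrite -/(al i) -/(al i.+1) -/(be i) -/(be i.+1).
have h0' := hn_gt0 n; have h1' := hn_le1 n; set h := hn n in h0' h1' *.
pose p : R := i%:R * h.
have p01 : 0 <= p /\ p <= 1 - h.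
  split; first by rewrite mulr_ge0 // ltW.
  rewrite /p lerBrDr -[X in _ + X]mul1r -mulrDl natr1 -[X in _ <= X](hnM n).
  by rewrite ler_wpM2r ?(ltW h0') // ler_nat.
have alS : al i.+1 = al i + h%:C * (a - 1).
  by rewrite /al /hscale -natr1 mulrDl mul1r rmorphD /=; ring.
have beS : be i.+1 = be i + h%:C * b.
  by rewrite /be /hshift -natr1 mulrDl mul1r rmorphD /=; ring.
have reA q : 0 <= q <= 1 -> d <= complex.Re ((1 + q%:C * (a - 1)) ^+ 2) /\ cabs (1 + q%:C * (a - 1)) <= A.
  move=> /andP[q0 q1]; split; last first.
    apply: le_trans (cabsD _ _) _; rewrite cabs1 /A -!addrA lerD2l cabsM cabsR ger0_norm //.
    apply: (@le_trans _ _ (cabs (a - 1))); first by rewrite ler_piMl.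
    by apply: le_trans (cabsB _ _) _; rewrite cabs1 lerD2l lerDr.
  have -> : (1 + q%:C * (a - 1)) ^+ 2 =
      ((1 - q) ^+ 2)%:C + (2 * q * (1 - q))%:C * a + (q ^+ 2)%:C * a ^+ 2.
    by rewrite !rmorphXn !rmorphM !rmorphB /= rmorph1 rmorph_nat; ring.
  have -> : complex.Re (((1 - q) ^+ 2)%:C + (2 * q * (1 - q))%:C * a + (q ^+ 2)%:C * a ^+ 2)
     = (1 - q) ^+ 2 + 2 * q * (1 - q) * complex.Re a + q ^+ 2 * complex.Re (a ^+ 2).
    by move: (a ^+ 2) (a) => [? ?] [? ?]; simpc; rewrite /=; ring.
  have k1 : 0 <= 2 * q * (1 - q) * complex.Re a.
    by rewrite mulr_ge0 ?(ltW ra) // mulr_ge0 ?mulr_ge0 // subr_ge0.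
  have k2 : m0 * q ^+ 2 <= q ^+ 2 * complex.Re (a ^+ 2).
    by rewrite mulrC ler_wpM2l ?sqr_ge0 // ge_min lexx orbT.
  have k3 : m0 * (1 - q) ^+ 2 <= (1 - q) ^+ 2.
    by rewrite ler_piMl ?sqr_ge0 // ge_min lexx.
  have k4 : m0 / 2 <= m0 * ((1 - q) ^+ 2 + q ^+ 2).
    by rewrite ler_wpM2l ?(ltW m00) //; have := sqr_ge0 (q - 2^-1); nra.
  by rewrite /d; lra.
have [re1 al1] : d <= complex.Re (al i ^+ 2) /\ cabs (al i) <= A.
  by rewrite /al /hscale -/p; apply: reA; apply/andP; split; lra.
have [re2 al2] : d <= complex.Re (al i.+1 ^+ 2) /\ cabs (al i.+1) <= A.
  by rewrite /al /hscale; apply: reA; rewrite -natr1 mulrDl mul1r -/h -/p; apply/andP; split; lra.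
have rp1 := lt_le_trans d0 re1; have rp2 := lt_le_trans d0 re2.
have beA : cabs (be i) <= A.
  rewrite /be /hshift -/p cabsM cabsR ger0_norm ?p01 //; last by case: p01.
  apply: (@le_trans _ _ (cabs b)); first by rewrite ler_piMl //; lra.
  by rewrite /A; have := cabs_ge0 a; lra.
have aA : cabs (a - 1) <= A.
  by apply: le_trans (cabsB _ _) _; rewrite cabs1 /A; have := cabs_ge0 b; lra.
have bA : cabs b <= A by rewrite /A; have := cabs_ge0 a; lra.
pose G (x : R) := ((a - 1) * x%:C + b) * gau (al i * x%:C + be i).
have aG : absum (fun j : int => G (xj n j)) by exact: gau_absumM.
have aF1 : absum (fun j : int => al i * gau (al i * (xj n j)%:C + be i)).
  by apply: absumZ; exact: gau_absum.
have aF2 : absum (fun j : int => al i.+1 * gau (al i.+1 * (xj n j)%:C + be i.+1)).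
  by apply: absumZ; exact: gau_absum.
have aG1 : absum (fun j : int => G (xj n (j + 1))) := absum_shift 1 aG.
(* The differences of [G] may be subtracted because they sum to zero; they cancel the first-order
   part of each summand. *)
have -> : gau_riemann n (al i.+1) (be i.+1) - gau_riemann n (al i) (be i) =
    h%:C * csum (fun j : int => (al i.+1 * gau (al i.+1 * (xj n j)%:C + be i.+1) - al i * gau (al i * (xj n j)%:C + be i)) - (G (xj n (j + 1)) - G (xj n j))).
  rewrite csumB ?csumB //; [|exact: absumB|exact: absumB].
  rewrite (csum_shift1 aG) subrr subr0 /gau_riemann -/h; ring.
rewrite cabsM cabsR (gtr0_norm h0').
have err j : cabs ((al i.+1 * gau (al i.+1 * (xj n j)%:C + be i.+1) - al i * gau (al i * (xj n j)%:C + be i)) - (G (xj n (j + 1)) - G (xj n j))) <= h ^+ 2 * (K * (1 + `|xj n j|) ^- 2).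
  set x := xj n j; set rho := 1 + `|x|; have rho1 : 1 <= rho by rewrite lerDl.
  set y := al i * x%:C + be i; set eta := (a - 1) * x%:C + b.
  have -> : al i.+1 * x%:C + be i.+1 = y + h%:C * eta.
    by rewrite alS beS /y /eta; ring.
  rewrite /G xjD -/x -/h.
  have -> : al i * (x + h)%:C + be i = y + h%:C * al i by rewrite rmorphD /= /y; ring.
  have -> : (a - 1) * (x + h)%:C + b = eta + h%:C * (a - 1) by rewrite rmorphD /= /eta; ring.
  rewrite -/y -/eta alS (gauD y (h%:C * eta)) (gauD y (h%:C * al i)).
  set r1 := gau_rem y (h%:C * eta); set r2 := gau_rem y (h%:C * al i).
  have -> : (al i + h%:C * (a - 1)) * (gau y * (1 - 2 * pi%:C * y * (h%:C * eta) + r1)) -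
    al i * gau y - ((eta + h%:C * (a - 1)) * (gau y * (1 - 2 * pi%:C * y * (h%:C * al i) + r2)) - eta * gau y) =
    gau y * (al i * r1 + h%:C * (a - 1) * r1 - eta * r2 - h%:C * (a - 1) * r2
      + h%:C * (a - 1) * (2 * pi%:C * y * (h%:C * al i)) - h%:C * (a - 1) * (2 * pi%:C * y * (h%:C * eta))) by ring.
  rewrite cabsM; apply: (hK h rho) => //.
  - by apply/andP; split; [exact: ltW | exact: hn0].
  - rewrite cabs_ge0 /=; exact: hC.
  rewrite cabs_ge0 /=.
  have h01 : 0 <= h <= 1 by rewrite h1' ltW.
  have xr : `|x| <= rho by rewrite lerDr.
  have Ar : A <= A * rho by rewrite ler_peMr.
  have lin u v : cabs u <= A -> cabs v <= A -> cabs (u * x%:C + v) <= A * rho.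
    move=> uA vA; apply: le_trans (cabsD _ _) _; rewrite cabsM cabsR /rho mulrDr mulr1 addrC.
    by rewrite lerD // ler_wpM2r.
  have yA : cabs y <= A * rho by exact: lin.
  have eA : cabs eta <= A * rho by exact: lin.
  have hE : cabs (h%:C : R[i]) = h by rewrite cabsR gtr0_norm.
  have r1b : cabs r1 <= h ^+ 2 * (K1 * rho ^+ 4 * expR (h * (B * rho ^+ 2))).
    by apply: gau_rem_bound => //; rewrite cabsM hE ler_wpM2l // ltW.
  have r2b : cabs r2 <= h ^+ 2 * (K1 * rho ^+ 4 * expR (h * (B * rho ^+ 2))).
    by apply: gau_rem_bound => //; rewrite cabsM hE ler_wpM2l ?(ltW h0') // (le_trans al1).
  set X := h ^+ 2 * _ in r1b r2b.
  have X0 : 0 <= X by apply: le_trans r1b.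
  have E1 : 1 <= expR (h * (B * rho ^+ 2)).
    by apply: ge1_expR; rewrite mulr_ge0 ?(ltW h0') // mulr_ge0 ?sqr_ge0.
  have t1 : cabs (al i * r1) <= A * rho * X.
    by rewrite cabsM ler_pM // (le_trans al1).
  have ha : cabs (h%:C * (a - 1)) <= A * rho.
    by rewrite cabsM hE (le_trans _ Ar) // -[A]mul1r ler_pM // ltW.
  have t2 : cabs (h%:C * (a - 1) * r1) <= A * rho * X by rewrite cabsM ler_pM.
  have t3 : cabs (eta * r2) <= A * rho * X by rewrite cabsM ler_pM.
  have t4 : cabs (h%:C * (a - 1) * r2) <= A * rho * X by rewrite cabsM ler_pM.
  have ha' : cabs (h%:C * (a - 1)) <= h * A by rewrite cabsM hE ler_wpM2l // ltW.
  have two : cabs (2 * pi%:C : R[i]) = 2 * pi by rewrite cabsM cabs_nat cabsR gtr0_norm.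
  have t5 : cabs (h%:C * (a - 1) * (2 * pi%:C * y * (h%:C * al i))) <= h * A * (2 * pi * (A * rho) * (h * (A * rho))).
    rewrite cabsM ler_pM // cabsM ler_pM //; first by rewrite cabsM two ler_wpM2l // mulr_ge0 ?pi_ge0.
    by rewrite cabsM hE ler_wpM2l ?(ltW h0') // (le_trans al1).
  have t6 : cabs (h%:C * (a - 1) * (2 * pi%:C * y * (h%:C * eta))) <= h * A * (2 * pi * (A * rho) * (h * (A * rho))).
    rewrite cabsM ler_pM // cabsM ler_pM //; first by rewrite cabsM two ler_wpM2l // mulr_ge0 ?pi_ge0.
    by rewrite cabsM hE ler_wpM2l ?(ltW h0').
  apply: (@le_trans _ _ (4 * (A * rho * X) + 2 * (h * A * (2 * pi * (A * rho) * (h * (A * rho)))))).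
    have := cabsB (al i * r1 + h%:C * (a - 1) * r1 - eta * r2 - h%:C * (a - 1) * r2
      + h%:C * (a - 1) * (2 * pi%:C * y * (h%:C * al i))) (h%:C * (a - 1) * (2 * pi%:C * y * (h%:C * eta))).
    have := cabsD (al i * r1 + h%:C * (a - 1) * r1 - eta * r2 - h%:C * (a - 1) * r2)
      (h%:C * (a - 1) * (2 * pi%:C * y * (h%:C * al i))).
    have := cabsB (al i * r1 + h%:C * (a - 1) * r1 - eta * r2) (h%:C * (a - 1) * r2).
    have := cabsB (al i * r1 + h%:C * (a - 1) * r1) (eta * r2).
    have := cabsD (al i * r1) (h%:C * (a - 1) * r1).
    by lra.
  have -> : h ^+ 2 * ((4 * A * K1 + 4 * pi * A ^+ 3) * rho ^+ 5 * expR (h * (B * rho ^+ 2))) =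
    4 * (A * rho * X) + 4 * pi * A ^+ 3 * rho ^+ 2 * h ^+ 2 * (rho ^+ 3 * expR (h * (B * rho ^+ 2))).
    by rewrite /X; ring.
  rewrite lerD2l.
  have -> : 2 * (h * A * (2 * pi * (A * rho) * (h * (A * rho)))) = 4 * pi * A ^+ 3 * rho ^+ 2 * h ^+ 2 by ring.
  rewrite ler_peMr //.
    by rewrite mulr_ge0 ?sqr_ge0 // mulr_ge0 ?sqr_ge0 // mulr_ge0 ?exprn_ge0 // mulr_ge0 ?pi_ge0.
  by rewrite -[1]mulr1 ler_pM // exprn_ege1.
apply: (@le_trans _ _ (h * (h ^+ 2 * (K * (K2 * (n.*2.+1)%:R))))).
  rewrite ler_wpM2l ?(ltW h0') //; apply: (csum_le err) => D.
  rewrite -mulr_sumr ler_wpM2l ?sqr_ge0 // -mulr_sumr ler_wpM2l //.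
have -> : h * (h ^+ 2 * (K * (K2 * (n.*2.+1)%:R))) = h ^+ 2 * (K * K2) * (h * (n.*2.+1)%:R) by ring.
by rewrite [h * _]mulrC hnM mulr1.
Qed.

(** The [2 n + 1] steps, each of size at most [h^2 K], add up to at most [h K], which tends to
    zero. *)
Lemma gau_riemann_cvs a b : 0 < complex.Re a -> 0 < complex.Re (a ^+ 2) ->
  cvs (fun n => gau_riemann n a b - gau_riemann n 1 0) 0.
Proof.
move=> ra ra2; have [K K0 [n0 hK]] := gau_homotopy_step b ra ra2.
have tele n : (n0 <= n)%N -> cabs (gau_riemann n a b - gau_riemann n 1 0) <= hn n * K.
  move=> nn0; pose u i := gau_riemann n (hscale a n i) (hshift b n i).
  have -> : gau_riemann n a b = u n.*2.+1.
    by rewrite /u /hscale /hshift hnM !mul1r addrC subrK.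
  have -> : gau_riemann n 1 0 = u 0%N by rewrite /u /hscale /hshift !mul0r addr0.
  have := telescope_sumr u (leq0n n.*2.+1); rewrite big_mkord => <-.
  apply: le_trans (cabs_sum _ _ _) _.
  apply: (@le_trans _ _ (\sum_(i < n.*2.+1) hn n ^+ 2 * K)).
    by apply: ler_sum => i _; exact: hK.
  rewrite sumr_const card_ord -[X in X <= _]mulr_natl.
  have -> : (n.*2.+1)%:R * (hn n ^+ 2 * K) = (n.*2.+1)%:R * hn n * (hn n * K) by ring.
  by rewrite hnM mul1r.
move=> e e0; have K10 : 0 < K + 1 by lra.
have [n1 h1] := hn_small (divr_gt0 e0 K10).
exists (maxn n0 n1) => n; rewrite geq_max subr0 => /andP[/tele t /h1 h].
apply: le_lt_trans t _; have := hn_gt0 n; move: h; rewrite ler_pdivlMr //.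
by nra.
Qed.

Definition gau_coef n a b (m : int) : R[i] :=
  (hn n)%:C * csum (fun j : int => gau (a * (xj n j)%:C + b) * nome (- (m%:~R * (xj n j)%:C))).

Lemma cabs_nome_real x : cabs (nome x%:C) = 1.
Proof. by rewrite cabs_nome /= mulr0 oppr0 expR0. Qed.

Lemma mul_int_real (m : int) x : m%:~R * x%:C = (m%:~R * x)%:C :> R[i].
Proof. by rewrite rmorphM /= rmorph_int. Qed.

Lemma cabs_nome_int_real (m : int) x : cabs (nome (- (m%:~R * x%:C))) = 1.
Proof.
rewrite mul_int_real (_ : - _ = (- (m%:~R * x))%:C); first exact: cabs_nome_real.
by rewrite rmorphN.
Qed.

Lemma gau_coef_absum n a b m : 0 < complex.Re (a ^+ 2) ->
  absum (fun j : int => gau (a * (xj n j)%:C + b) * nome (- (m%:~R * (xj n j)%:C))).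
Proof.
move=> a0; apply: absum_le (gau_absum n b a0) => j.
by rewrite cabsM cabs_nome_int_real mulr1.
Qed.

(** Poisson summation at finite level, exact for every [n]: summing over a residue system of
    frequencies keeps only the nodes that are integers, and [h (2 n + 1) = 1]. *)
Lemma gau_coef_sum n a b : 0 < complex.Re (a ^+ 2) ->
  csum (fun m : int => if (`|m| <= n)%N then gau_coef n a b m else 0) =
  csum (fun t : int => gau (a * t%:~R + b)).
Proof.
move=> a0; rewrite csum_symm /gau_coef -mulr_sumr -csum_fsum; last first.
  by move=> i; exact: gau_coef_absum.
set M := n.*2.+1; have M0 : M%:R != 0 :> R[i] by rewrite pnatr_eq0.
have xE j : (xj n j)%:C = j%:~R / M%:R :> R[i].
  by rewrite /xj rmorphM fmorphV /= rmorph_int rmorph_nat.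
pose G (j : int) := if (M %| j)%Z then M%:R * gau (a * (xj n j)%:C + b) else 0.
have -> : csum (fun j : int => \sum_(i < M) gau (a * (xj n j)%:C + b) * nome (- ((i%:Z - n%:Z)%:~R * (xj n j)%:C))) = csum G.
  apply: eq_csum => j; rewrite -mulr_sumr /G.
  have e (i : 'I_M) : nome (- ((i%:Z - n%:Z)%:~R * (xj n j)%:C)) =
     nome (n%:R * (xj n j)%:C) * nome (i%:R * ((- j)%:~R / M%:R)).
    by rewrite -nomeD; congr nome; rewrite xE rmorphB rmorphN /= -!pmulrn; ring.
  rewrite (eq_bigr _ (fun i _ => e i)) -mulr_sumr sum_nome //.
  have -> : (M %| - j)%Z = (M %| j)%Z by rewrite !dvdzE abszN.
  case: ifP => [/dvdzP[q ->]|]; last by rewrite !mulr0.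
  have -> : n%:R * (xj n (q * M))%:C = (n%:Z * q)%:~R :> R[i].
    by rewrite xE !rmorphM /= mulfK.
  by rewrite nome_int mul1r mulrC.
have hK : cancel (fun t : int => t * M%:Z) (fun j => (j %/ M)%Z) by move=> t; rewrite mulzK.
have GE t : G (t * M%:Z) = M%:R * gau (a * t%:~R + b).
  by rewrite /G dvdz_mull // xE rmorphM /= mulfK.
have aG : absum (fun t : int => gau (a * t%:~R + b)).
  have := absum_inj (_ : injective (fun t : int => t * M%:Z)) (gau_absum n b a0).
  rewrite (_ : (fun t => _) = fun t : int => gau (a * t%:~R + b)).
    by apply; exact: can_inj hK.
  by apply/funext => t; rewrite xE rmorphM /= mulfK.
rewrite (@csum_reindex _ _ _ _ _ hK G); last 2 first.
- move=> j; rewrite /G; case: ifP => // /dvdzP[q ->].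
  by rewrite mulzK // eqxx.
- by rewrite (funext GE); exact: absumZ.
rewrite (funext GE) csumZ // mulrA.
suff -> : (hn n)%:C * M%:R = 1 :> R[i] by rewrite mul1r.
have := congr1 (@real_complex_def R (Phant R)) (hnM n).
by rewrite rmorphM /= rmorph_nat mulrC.
Qed.

(** Summation by parts, twice: the second difference of the Gaussian is of order [h^2], while the
    character contributes [|1 - om|^2 >= (|m| h / 2)^2]. The powers of [h] cancel, so the decay in
    [m] is uniform in [n]. *)
Lemma gau_coef_bound a b : 0 < complex.Re (a ^+ 2) ->
  exists2 K : R, 0 <= K & exists n0, forall n (m : int), (n0 <= n)%N -> (`|m| <= n)%N ->
    cabs (gau_coef n a b m) <= K * (1 + `|m|%:~R) ^- 2.
Proof.
move=> a0; pose d := complex.Re (a ^+ 2).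
pose A : R := 1 + cabs a + cabs b; have A1 : 1 <= A by rewrite /A; have := cabs_ge0 a; have := cabs_ge0 b; lra.
have A0 : 0 <= A by lra.
have [C C0 hC] := gau_bound (a0 : 0 < d) A0.
pose B := 3 * pi * A ^+ 2; pose K1 := pi * A ^+ 2 + 6 * B ^+ 2.
have pi0 := pi_gt0 R.
have B0 : 0 <= B by apply: mulr_ge0; [rewrite mulr_ge0 ?pi_ge0 | exact: sqr_ge0].
have [K K0 [h0 h00 hK]] := @gau_err_bound d (2 * K1) C B a0 B0 C0.
have [K2 K20 hK2] := riemann_bound.
have [n0 hn0] := hn_small h00.
have gb n j : cabs (gau (a * (xj n j)%:C + b)) <= C * (2`!%:R / d ^+ 2) * (1 + `|xj n j|) ^- 2.
  set rho := 1 + `|xj n j|; have rho1 : 1 <= rho by rewrite lerDl.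
  have r0 : 0 < rho by lra.
  have {}hC : cabs (gau (a * (xj n j)%:C + b)) <= C * expR (- (d * rho ^+ 2)).
    apply: hC => //; rewrite /A; have := cabs_ge0 a; have := cabs_ge0 b; lra.
  apply: le_trans hC _; rewrite -mulrA ler_wpM2l // ler_pdivlMr ?exprn_gt0 // mulrC.
  apply: le_trans (polyexp_bound 2 a0 (ltW r0)).
  rewrite ler_wpM2l ?exprn_ge0 ?(ltW r0) // ler_expR lerN2 ler_wpM2l ?(ltW a0) //.
  by rewrite expr2 ler_peMl // ltW.
pose K3 := C * (2`!%:R / d ^+ 2) * K2.
have K30 : 0 <= K3.
  apply: mulr_ge0 => //; apply: mulr_ge0 => //; apply: divr_ge0 => //.
  by apply: exprn_ge0; exact: ltW.
exists (16 * (K * K2) + K3); first by rewrite addr_ge0 // mulr_ge0 // mulr_ge0.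
exists n0 => n m nn0 mn.
have h0' := hn_gt0 n; have h1' := hn_le1 n; set h := hn n in h0' h1' *.
have hM : h * (n.*2.+1)%:R = 1 by rewrite mulrC hnM.
have triv : cabs (gau_coef n a b m) <= K3.
  rewrite /gau_coef cabsM cabsR (gtr0_norm h0') -/h.
  apply: (@le_trans _ _ (h * (C * (2`!%:R / d ^+ 2) * (K2 * (n.*2.+1)%:R)))).
    rewrite ler_wpM2l ?(ltW h0') //.
    apply: (@csum_le _ _ _ (fun j => C * (2`!%:R / d ^+ 2) * (1 + `|xj n j|) ^- 2)).
      by move=> j; rewrite cabsM cabs_nome_int_real mulr1 gb.
    move=> D; rewrite -mulr_sumr ler_wpM2l //.
    apply: mulr_ge0 => //; apply: divr_ge0 => //.
    by apply: exprn_ge0; exact: ltW.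
  have -> : h * (C * (2`!%:R / d ^+ 2) * (K2 * (n.*2.+1)%:R)) = K3 * (h * (n.*2.+1)%:R) by rewrite /K3; ring.
  by rewrite hM mulr1.
have [m0|m0] := eqVneq m 0.
  rewrite {2}m0.
  by rewrite normr0 addr0 expr1n invr1 mulr1 (le_trans triv) // lerDr mulr_ge0 // mulr_ge0.
have m1 : 1 <= `|m|%:~R :> R by rewrite -abszE ler1n absz_gt0.
pose om : R[i] := nome (m%:~R * h%:C).
have om1 : cabs om = 1 by rewrite /om mul_int_real cabs_nome_real.
have om0 : om != 0 by exact: nome_neq0.
pose f j := gau (a * (xj n j)%:C + b).
pose e j : R[i] := nome (- (m%:~R * (xj n j)%:C)).
have eS j : e (j + 1) = e j / om.
  by rewrite /e /om xjD rmorphD /= mulrDr opprD nomeD !nomeN.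
have eP j : e (j - 1) = e j * om.
  by rewrite /e /om xjB rmorphB /= mulrBr opprB addrC nomeD mulrC.
have afe : absum (fun j => f j * e j) by exact: gau_coef_absum.
(* Both shifts of the index leave the sum unchanged and take a factor [om] or its inverse out of the
   character. *)
have second : (om + om^-1 - 2) * csum (fun j => f j * e j) =
    csum (fun j => (f (j + 1) + f (j - 1) - 2 * f j) * e j).
  have e1 j : f (j + 1) * e j = om * (f (j + 1) * e (j + 1)).
    by rewrite eS; field.
  have e2 j : f (j - 1) * e j = om^-1 * (f (j - 1) * e (j - 1)).
    by rewrite eP; field.
  have -> : csum (fun j => (f (j + 1) + f (j - 1) - 2 * f j) * e j) =
     csum (fun j => om * (f (j + 1) * e (j + 1)) + om^-1 * (f (j - 1) * e (j - 1)) - 2 * (f j * e j)).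
    by apply: eq_csum => j; rewrite -e1 -e2; ring.
  have a1 := absumZ om (absum_shift 1 afe); have a2 := absumZ om^-1 (absum_shift (-1) afe).
  have a3 := absumZ 2 afe.
  rewrite csumB ?csumD //; last exact: absumD.
  rewrite !csumZ //; [|exact: absum_shift (-1) afe|exact: absum_shift 1 afe].
  rewrite (csum_shift1 afe) (csum_shiftN1 afe); ring.
have err j : cabs ((f (j + 1) + f (j - 1) - 2 * f j) * e j) <= h ^+ 2 * (K * (1 + `|xj n j|) ^- 2).
  rewrite cabsM /e cabs_nome_int_real mulr1 /f xjD xjB -/h.
  set x := xj n j; set rho := 1 + `|x|; have rho1 : 1 <= rho by rewrite lerDl.
  set y := a * x%:C + b.
  have -> : a * (x + h)%:C + b = y + h%:C * a by rewrite rmorphD /= /y; ring.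
  have -> : a * (x - h)%:C + b = y + - (h%:C * a) by rewrite rmorphB /= /y; ring.
  rewrite (gauD y (h%:C * a)) (gauD y (- (h%:C * a))).
  set r1 := gau_rem y (h%:C * a); set r2 := gau_rem y (- (h%:C * a)).
  have -> : gau y * (1 - 2 * pi%:C * y * (h%:C * a) + r1) + gau y * (1 - 2 * pi%:C * y * - (h%:C * a) + r2) - 2 * gau y = gau y * (r1 + r2) by ring.
  rewrite cabsM; apply: (hK h rho) => //.
  - by apply/andP; split; [exact: ltW | exact: hn0].
  - rewrite cabs_ge0 /=; apply: hC => //; rewrite /A; have := cabs_ge0 a; have := cabs_ge0 b; lra.
  rewrite cabs_ge0 /=.
  have h01 : 0 <= h <= 1 by rewrite h1' ltW.
  have aA : cabs a <= A by rewrite /A; have := cabs_ge0 b; lra.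
  have Ar : A <= A * rho by rewrite ler_peMr.
  have yA : cabs y <= A * rho.
    apply: le_trans (cabsD _ _) _; rewrite cabsM cabsR /rho mulrDr mulr1 addrC.
    rewrite lerD // ?ler_wpM2r //; rewrite /A; have := cabs_ge0 a; lra.
  have ub : cabs (h%:C * a) <= h * (A * rho).
    by rewrite cabsM cabsR gtr0_norm // ler_wpM2l ?(ltW h0') // (le_trans aA).
  have r1b : cabs r1 <= h ^+ 2 * (K1 * rho ^+ 4 * expR (h * (B * rho ^+ 2))).
    exact: gau_rem_bound.
  have r2b : cabs r2 <= h ^+ 2 * (K1 * rho ^+ 4 * expR (h * (B * rho ^+ 2))).
    by apply: gau_rem_bound => //; rewrite cabsN.
  apply: le_trans (cabsD _ _) _.
  set X := h ^+ 2 * _ in r1b r2b.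
  have X0 : 0 <= X by apply: le_trans r1b.
  apply: (@le_trans _ _ (2 * X)); first by lra.
  have -> : h ^+ 2 * (2 * K1 * rho ^+ 5 * expR (h * (B * rho ^+ 2))) = 2 * X * rho by rewrite /X; ring.
  by rewrite ler_peMr // mulr_ge0.
have cb : cabs (csum (fun j => (f (j + 1) + f (j - 1) - 2 * f j) * e j)) <= h ^+ 2 * (K * (K2 * (n.*2.+1)%:R)).
  apply: (csum_le err) => D.
  by rewrite -mulr_sumr ler_wpM2l ?sqr_ge0 // -mulr_sumr ler_wpM2l.
have oms : cabs (om + om^-1 - 2) = cabs (1 - om) ^+ 2.
  have -> : om + om^-1 - 2 = om^-1 * (1 - om) ^+ 2 by field.
  by rewrite cabsM cabsV om1 invr1 mul1r cabsX.
(* The bound [cabs_sub_nome_real] needs [|m| h <= 1/2], which holds since [|m| <= n] and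
   [h = 1 / (2 n + 1)]. *)
have oml : `|m|%:~R * h / 2 <= cabs (1 - om).
  have mh : `|m%:~R * h| = `|m|%:~R * h by rewrite normrM (gtr0_norm h0') intr_norm.
  have := @cabs_sub_nome_real R (m%:~R * h); rewrite -mul_int_real -/om mh; apply.
  have mnR : `|m|%:~R <= n%:R :> R by rewrite -abszE ler_nat.
  have : h * (n%:R * 2 + 1) = 1.
    by rewrite -[RHS]hM; congr (_ * _); rewrite -[n.*2.+1]addn1 natrD -muln2 natrM.
  by nra.
have fin : (`|m|%:~R * h / 2) ^+ 2 * cabs (gau_coef n a b m) <= h ^+ 2 * (K * K2).
  apply: (@le_trans _ _ (cabs (1 - om) ^+ 2 * cabs (gau_coef n a b m))).
    rewrite ler_wpM2r // ler_pXn2r ?nnegrE // divr_ge0 // mulr_ge0 ?(ltW h0') //; lra.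
  rewrite -oms /gau_coef -cabsM mulrCA second cabsM cabsR (gtr0_norm h0').
  apply: le_trans (ler_wpM2l (ltW h0') cb) _.
  have -> : h * (h ^+ 2 * (K * (K2 * (n.*2.+1)%:R))) = h ^+ 2 * (K * K2) * (h * (n.*2.+1)%:R) by ring.
  by rewrite hM mulr1.
have mm : `|m|%:~R ^+ 2 * cabs (gau_coef n a b m) <= 4 * (K * K2).
  have h2 : 0 < h ^+ 2 by rewrite exprn_gt0.
  rewrite -(ler_pM2l h2); apply: le_trans (_ : 4 * (h ^+ 2 * (K * K2)) <= _); last by rewrite le_eqVlt; apply/orP; left; apply/eqP; ring.
  apply: le_trans (ler_wpM2l _ fin) => //.
  by rewrite le_eqVlt; apply/orP; left; apply/eqP; field.
rewrite ler_pdivlMr; last by rewrite exprn_gt0 //; lra.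
have : 0 <= cabs (gau_coef n a b m) by [].
move: mm m1; move: (cabs _) (`|m|%:~R : R) => g v mm v1 g0.
have : (1 + v) ^+ 2 <= 4 * v ^+ 2 by nra.
move: mm; move: ((1 + v) ^+ 2) (v ^+ 2) (K * K2) => p q r; nra.
Qed.

(** Up to the factor [1 / a], the Fourier transform of [gau (a x + b)] at [m]. *)
Definition gau_dual a b (m : int) : R[i] :=
  cexp ((2 * pi)*i * (m%:~R * (b / a)) - pi%:C * m%:~R ^+ 2 / a ^+ 2).

(** Completing the square absorbs the character into an imaginary shift of [b]; for this reason
    [gau_riemann] is studied for complex [b]. *)
Lemma gau_coefE n a b m : a != 0 -> 0 < complex.Re (a ^+ 2) ->
  gau_coef n a b m = gau_dual a b m * (a^-1 * gau_riemann n a (b + 'i * m%:~R / a)).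
Proof.
move=> a0 ra; rewrite /gau_coef /gau_riemann csumZ; last exact: gau_absum.
rewrite [a^-1 * _]mulrCA mulKf // mulrCA -(csumZ (gau_dual a b m)); last exact: gau_absum.
congr (_ * _); apply: eq_csum => j; move: (xj n j) => x.
rewrite /gau_dual /gau /nome -!cexpD; congr cexp.
have ii : 'i ^+ 2 = -1 :> R[i] by exact: sqr_i.
rewrite tpiE.
have -> : (a * x%:C + (b + 'i * m%:~R / a)) ^+ 2 = (a * x%:C + b) ^+ 2 + 2 * 'i * m%:~R * x%:C + 2 * 'i * m%:~R * (b / a) + 'i ^+ 2 * m%:~R ^+ 2 / a ^+ 2.
  by field.
by rewrite ii; field.
Qed.

Lemma csum_truncated (f : int -> R[i]) : absum f ->
  cvs (fun n => csum (fun m : int => if (`|m| <= n)%N then f m else 0)) (csum f).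
Proof.
move=> af; 
have fb n (m : int) : (0 <= n)%N -> cabs (if (`|m| <= n)%N then f m else 0) <= cabs (f m).
  by case: ifP => // _; rewrite cabs0.
have fl (m : int) : cvs (fun n => if (`|m| <= n)%N then f m else 0) (f m).
  by apply: eq_cvs (cvs_cst (f m)); exists `|m|%N => n ->.
by have [] := csum_cvs af fb fl.
Qed.

Lemma Re_sqr1 : complex.Re ((1 : R[i]) ^+ 2) = 1. Proof. by rewrite expr1n. Qed.

Lemma absum_gau_int : absum (fun t : int => gau t%:~R).
Proof.
have := @gau_absum 0 1 0; rewrite Re_sqr1 => /(_ ltr01).
rewrite (_ : (fun j => _) = fun t : int => gau t%:~R) //; apply/funext => t.
by rewrite mul1r addr0 /xj divr1 rmorph_int.
Qed.

Lemma gau_sum1_neq0 : csum (fun t : int => gau t%:~R) != 0.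
Proof.
have gE (t : int) : gau t%:~R = (expR (- (pi * t%:~R ^+ 2)))%:C.
  rewrite /gau -(rmorph_int (@real_complex_def R (Phant R))) -rmorphXn -rmorphM /=.
  by rewrite /cexp /= oppr0 cos0 sin0 mulr1 mulr0.
by apply: (csum_pos_neq0 (i0 := 0) gE); [move=> t; exact: expR_ge0 | exact: expR_gt0 | exact: absum_gau_int].
Qed.

Lemma gau_dual10 (m : int) : gau_dual 1 0 m = gau m%:~R.
Proof. by rewrite /gau_dual /gau mul0r mulr0 mulr0 add0r expr1n divr1. Qed.

(* Self-duality of the Gaussian at [a = 1] fixes the Gaussian integral. *)
Lemma gau_riemann_lim1 : cvs (fun n => gau_riemann n 1 0) 1.
Proof.
have r1 : 0 < complex.Re ((1 : R[i]) ^+ 2) by rewrite Re_sqr1.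
have r1' : 0 < complex.Re (1 : R[i]) by [].
pose th := csum (fun t : int => gau t%:~R).
have th0 : th != 0 by exact: gau_sum1_neq0.
pose S n := csum (fun m : int => if (`|m| <= n)%N then gau m%:~R else 0).
have Sth : cvs S th by apply: csum_truncated; exact: absum_gau_int.
have [K K0 [n0 hK]] := gau_coef_bound 0 r1.
have [L hL] : exists2 L : R, 0 <= L & exists n1, forall n, (n1 <= n)%N -> cabs (gau_riemann n 1 0) <= L.
  exists K => //; exists n0 => n nn0; have := hK n 0 nn0 (leq0n _).
  rewrite normr0 addr0 expr1n invr1 mulr1 gau_coefE ?oner_eq0 //.
  by rewrite gau_dual10 mulr0 mul0r addr0 invr1 mul1r /gau expr0n mulr0 oppr0 cexp0 mul1r.
move=> [n1 hn1].
(* Termwise this tends to zero by the homotopy in [b]. Summed over [m] it says that [th - R_n S_n]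
   tends to zero, where [R_n] is the Riemann sum and [S_n] the truncation of [th]; as [S_n] tends to
   [th], which is not zero, [R_n] tends to 1. *)
pose d n (m : int) := if (`|m| <= n)%N then gau_coef n 1 0 m - gau m%:~R * gau_riemann n 1 0 else 0.
have db n m : (maxn n0 n1 <= n)%N -> cabs (d n m) <= K * (1 + `|m|%:~R) ^- 2 + L * cabs (gau m%:~R).
  rewrite geq_max => /andP[nn0 nn1]; rewrite /d; case: ifP => mn.
    apply: le_trans (cabsB _ _) _; apply: lerD; first exact: hK.
    by rewrite cabsM mulrC ler_wpM2r // hn1.
  by rewrite cabs0 addr_ge0 // mulr_ge0 // invr_ge0 sqr_ge0.
have dl m : cvs (fun n => d n m) 0.
  apply: (@eq_cvs _ (fun n => gau m%:~R * (gau_riemann n 1 ('i * m%:~R) - gau_riemann n 1 0))).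
    exists `|m|%N => n mn; rewrite /d mn gau_coefE ?oner_eq0 // gau_dual10 invr1 mul1r add0r mulr1.
    by rewrite mulrBr.
  by rewrite -[X in cvs _ X](mulr0 (gau m%:~R)); apply: cvsZ; exact: gau_riemann_cvs.
have [_ dc] := csum_cvs (rsmD (rsmZ K0 (rsm_int_inv_sq R)) (rsmZ hL absum_gau_int)) db dl.
have {dc} dc : cvs (fun n => th - gau_riemann n 1 0 * S n) 0.
  rewrite -[X in cvs _ X](_ : csum (fun _ : int => 0) = 0); last by apply: csum0.
  rewrite (_ : (fun n => th - _) = fun n => csum (d n)) //; apply/funext => n.
  have at1 : absum (fun m : int => if (`|m| <= n)%N then gau_coef n 1 0 m else 0).
    exact: absum_symm.
  have at2 : absum (fun m : int => if (`|m| <= n)%N then gau m%:~R else 0).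
    by apply: absum_le absum_gau_int => m; case: ifP => // _; rewrite cabs0.
  have -> : th = csum (fun m : int => if (`|m| <= n)%N then gau_coef n 1 0 m else 0).
    rewrite gau_coef_sum //; apply: eq_csum => t; by rewrite mul1r addr0.
  rewrite /S -csumZ // -csumB //; last exact: absumZ.
  by apply: eq_csum => m; rewrite /d; case: ifP => _; rewrite ?mulr0 ?subr0 // [_ * gau _]mulrC.
have gS : cvs (fun n => gau_riemann n 1 0 * S n) th.
  have := cvsB (cvs_cst th) dc; rewrite subr0.
  by under eq_fun do rewrite opprB addrC subrK.
have := cvsM gS (cvsV th0 Sth); rewrite divff //.
apply: eq_cvs; have [|n2 h2] := Sth (cabs th); first by rewrite cabs_gt0.
exists n2 => n /h2 h; rewrite mulfK //; apply/negP => /eqP S0.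
by move: h; rewrite S0 sub0r cabsN ltxx.
Qed.

Lemma gau_riemann_lim a b : 0 < complex.Re a -> 0 < complex.Re (a ^+ 2) ->
  cvs (fun n => gau_riemann n a b) 1.
Proof.
move=> ra ra2; have := cvsD (gau_riemann_cvs b ra ra2) gau_riemann_lim1.
by rewrite add0r; under eq_fun do rewrite subrK.
Qed.

(** Limit of [gau_coef_sum]: its right side does not depend on [n], and [gau_coef_bound] dominates
    the left side. *)
Lemma poisson_gau a b : 0 < complex.Re a -> 0 < complex.Re (a ^+ 2) ->
  absum (gau_dual a b) /\
  csum (fun t : int => gau (a * t%:~R + b)) = a^-1 * csum (gau_dual a b).
Proof.
move=> ra ra2; have a0 : a != 0 by apply: contraTneq ra => ->; rewrite ltxx.
have [K K0 [n0 hK]] := gau_coef_bound b ra2.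
pose c n (m : int) := if (`|m| <= n)%N then gau_coef n a b m else 0.
have cb n m : (n0 <= n)%N -> cabs (c n m) <= K * (1 + `|m|%:~R) ^- 2.
  move=> nn0; rewrite /c; case: ifP => mn; first exact: hK.
  by rewrite cabs0 mulr_ge0 // invr_ge0 sqr_ge0.
have cl m : cvs (fun n => c n m) (a^-1 * gau_dual a b m).
  rewrite -[X in cvs _ X]mulr1.
  apply: (@eq_cvs _ (fun n => a^-1 * gau_dual a b m * gau_riemann n a (b + 'i * m%:~R / a))).
    by exists `|m|%N => n mn; rewrite /c mn gau_coefE //; ring.
  by apply: cvsZ; exact: gau_riemann_lim.
have [ad cc] := csum_cvs (rsmZ K0 (rsm_int_inv_sq R)) cb cl.
have ad' : absum (gau_dual a b).
  have := absumZ a ad; rewrite (_ : (fun i => _) = gau_dual a b) //.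
  by apply/funext => m; rewrite mulVKf.
split=> //; rewrite -csumZ //; apply: cvs_unique cc.
rewrite (_ : (fun n => csum (c n)) = fun=> csum (fun t : int => gau (a * t%:~R + b))).
  exact: cvs_cst.
by apply/funext => n; rewrite gau_coef_sum.
Qed.

End GaussianPoisson.

(** * Poisson summation for the quadratic forms [|v|^2 + lam (sum v)^2] *)

Section VectorPoisson.
Variable R : realType.
Implicit Types (tau z s w : R[i]).

Lemma half_plane_sqrt w : 0 < complex.Re w ->
  exists2 a : R[i], 0 < complex.Re a & a ^+ 2 = w.
Proof.
move=> w0; have sq := sqr_sqrtc w; set a := sqrtc w in sq.
have := w0; rewrite -sq Re_sqr => h.
have [a0|a0|a0] := ltgtP (complex.Re a) 0.
- by exists (- a); [case: (a) a0 => p q /=; rewrite oppr_gt0 | rewrite sqrrN].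
- by exists a.
- by move: h; rewrite a0 expr0n /= sub0r oppr_gt0 ltNge sqr_ge0.
Qed.

(** The square root [I] of [tau / i] is fixed before [r] and [s], so that the same root enters for
    every coordinate of a vector; in even dimension only [I^2] survives. *)
Lemma poisson1 tau : 0 < complex.Im tau -> exists2 I : R[i], I ^+ 2 = tau / 'i &
  forall (r : R) s, 0 < r ->
    absum (fun m : int => nome (m%:~R ^+ 2 * tau / (2 * r%:C) + m%:~R * s)) /\
    csum (fun t : int => nome (- (r%:C * (t%:~R + s) ^+ 2 / (2 * tau)))) =
    I / (Num.sqrt r)%:C * csum (fun m : int => nome (m%:~R ^+ 2 * tau / (2 * r%:C) + m%:~R * s)).
Proof.
move=> t0; have tau0 : tau != 0 by apply: contraTneq t0 => ->; rewrite ltxx.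
have i0 : 'i != 0 :> R[i] by rewrite eq_complex /= oner_eq0 andbF.
have ii : 'i ^+ 2 = -1 :> R[i] by exact: sqr_i.
have iV : 'i^-1 = - 'i :> R[i].
  by apply: (mulfI i0); rewrite divff // mulrN -expr2 ii opprK.
have [|a1 ra1 a1E] := @half_plane_sqrt ('i / tau).
  have : 0 < complex.Im tau / cabs tau ^+ 2 by rewrite divr_gt0 // exprn_gt0 // cabs_gt0.
  suff -> : complex.Re ('i / tau) = complex.Im tau / cabs tau ^+ 2 by [].
  by rewrite cabs_sqr; case: (tau) => p q /=; simpc.
have a10 : a1 != 0 by apply: contraTneq ra1 => ->; rewrite ltxx.
exists a1^-1 => [|r s r0].
  by rewrite exprVn a1E; field; rewrite i0 tau0.
set q := Num.sqrt r; have q0 : 0 < q by rewrite sqrtr_gt0.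
have q0' : q%:C != 0 :> R[i] by rewrite -cabs_gt0 cabsR gtr0_norm.
have qE : q%:C ^+ 2 = r%:C :> R[i] by rewrite -rmorphXn /= sqr_sqrtr // ltW.
have r0' : r%:C != 0 :> R[i] by rewrite -qE expf_neq0.
pose a := q%:C * a1.
have aE : a ^+ 2 = r%:C * ('i / tau) by rewrite exprMn qE a1E.
have Re_mulR (x : R) u : complex.Re (x%:C * u) = x * complex.Re u.
  by case: u => ? ?; simpc.
have ra : 0 < complex.Re a by rewrite Re_mulR mulr_gt0.
have ra2 : 0 < complex.Re (a ^+ 2).
  rewrite exprMn qE Re_mulR mulr_gt0 // a1E.
  have : 0 < complex.Im tau / cabs tau ^+ 2 by rewrite divr_gt0 // exprn_gt0 // cabs_gt0.
  suff -> : complex.Re ('i / tau) = complex.Im tau / cabs tau ^+ 2 by [].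
  by rewrite cabs_sqr; case: (tau) => p u /=; simpc.
have a0 : a != 0 by rewrite mulf_neq0.
have [ad cd] := poisson_gau (a * s) ra ra2.
have dE : gau_dual a (a * s) = fun m : int => nome (m%:~R ^+ 2 * tau / (2 * r%:C) + m%:~R * s).
  apply/funext => m; rewrite /gau_dual /nome; congr cexp; rewrite aE tpiE mulrC.
  have -> : a * s / a = s by field.
  rewrite !invfM invrK iV; field; exact: r0'.
rewrite -dE; split=> //.
have -> : a1^-1 / q%:C = a^-1 by rewrite /a invfM mulrC.
rewrite -cd; apply: eq_csum => t; rewrite /gau /nome; congr cexp.
have -> : (a * t%:~R + a * s) ^+ 2 = a ^+ 2 * (t%:~R + s) ^+ 2 by ring.
by rewrite aE tpiE; field.
Qed.

Lemma rsm_quad (d K : R) : 0 < d ->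
  rsm (fun x : int => expR (- (d * x%:~R ^+ 2) + K * `|x|%:~R)).
Proof.
move=> d0; pose C : R := (`|K| + 1) ^+ 2 / (4 * d) + 1.
have c0 : 0 <= expR C * (2`!%:R / 1 ^+ 2) by rewrite mulr_ge0 ?expR_ge0 // divr_ge0.
apply: rsm_le (rsmZ c0 (rsm_int_inv_sq R)) => x.
set v := `|x|%:~R : R; have v0 : 0 <= v by rewrite ler0z.
have xv : x%:~R ^+ 2 = v ^+ 2 by rewrite /v intr_norm real_normK ?num_real.
rewrite xv ler_pdivlMr ?exprn_gt0 //; last by lra.
apply: (@le_trans _ _ (expR C * ((1 + v) ^+ 2 * expR (- (1 * (1 + v)))))); last first.
  by rewrite ler_wpM2l ?expR_ge0 // polyexp_bound //; lra.
rewrite [X in _ <= X]mulrCA [X in X <= _]mulrC; apply: ler_wpM2l; first exact: sqr_ge0.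
rewrite -expRD ler_expR.
have CE : 4 * d * (C - 1) = (`|K| + 1) ^+ 2 by rewrite /C; field; rewrite gt_eqF.
have Kv : K * v <= `|K| * v by rewrite ler_wpM2r // ler_norm.
have sq := sqr_ge0 (2 * d * v - (`|K| + 1)).
suff : 0 <= 4 * d * (C - (1 * (1 + v)) + d * v ^+ 2 - `|K| * v).
  rewrite pmulr_rge0; last by lra.
  by lra.
have -> : 4 * d * (C - 1 * (1 + v) + d * v ^+ 2 - `|K| * v) =
  4 * d * (C - 1) - (`|K| + 1) ^+ 2 + (2 * d * v - (`|K| + 1)) ^+ 2 by ring.
by rewrite CE subrr add0r.
Qed.

Definition rcons0 m (p : int * 'rV[int]_m) : 'rV[int]_m.+1 :=
  \row_i (if unlift ord0 i is Some j then p.2 0 j else p.1).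

Definition runcons0 m (t : 'rV[int]_m.+1) : int * 'rV[int]_m :=
  (t 0 ord0, \row_j t 0 (lift ord0 j)).

Lemma rcons0K m : cancel (@rcons0 m) (@runcons0 m).
Proof.
case=> x t; rewrite /runcons0 /rcons0 mxE unlift_none; congr pair.
by apply/rowP => j; rewrite !mxE liftK.
Qed.

Lemma runcons0K m : cancel (@runcons0 m) (@rcons0 m).
Proof.
move=> t; apply/rowP => i; rewrite !mxE; case: unliftP => [j ->|->] //=.
by rewrite mxE.
Qed.

Lemma rcons0_ord0 m p : @rcons0 m p 0 ord0 = p.1.
Proof. by rewrite mxE unlift_none. Qed.

Lemma rcons0_lift m p j : @rcons0 m p 0 (lift ord0 j) = p.2 0 j.
Proof. by rewrite mxE liftK. Qed.

Lemma rsm_rV m (b : int -> R) : (forall x, 0 <= b x) -> rsm b ->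
  rsm (fun t : 'rV[int]_m => \prod_i b (t 0 i)).
Proof.
move=> b0 sb; elim: m => [|m IHm].
  exists 1 => A; apply: (@le_trans _ _ (\sum_(t <- [fset (0 : 'rV[int]_0)]%fset) \prod_i b (t 0 i))).
    apply: fsum_sub_le => [t|]; first by rewrite prodr_ge0.
    by apply/fsubsetP => t _; rewrite !inE [t]thinmx0.
  by rewrite big_seq_fset1 big_ord0.
apply: (@rsm_reindex R _ _ (@rcons0 m) (@runcons0 m) (fun t : 'rV[int]_m.+1 => \prod_i b (t 0 i))).
  by move=> u; rewrite runcons0K eqxx.
apply: rsm_le (rsm_prod b0 _ sb IHm) => [p|t]; last by rewrite prodr_ge0.
rewrite big_ord_recl rcons0_ord0 ler_wpM2l // le_eqVlt; apply/orP; left.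
by apply/eqP/eq_bigr => i _; congr b; exact: rcons0_lift.
Qed.

Definition vC m (t : 'rV[int]_m) : 'rV[R[i]]_m := map_mx intr t.

Definition vsum (T : nzRingType) m (s : 'rV[T]_m) : T := \sum_i s 0 i.

Definition vsq (T : nzRingType) m (s : 'rV[T]_m) : T := \sum_i s 0 i ^+ 2.

Definition vdot (T : nzRingType) m (s t : 'rV[T]_m) : T := \sum_i s 0 i * t 0 i.

(** The form has matrix [1 + lam J] with [J] the all-ones matrix. Its determinant is [1 + lam m] and
    its inverse [1 - mu J] with [mu = lam / (1 + lam m)], the matrix of the form in [gdual]. Theta
    is the case [lam = 1]; a general [lam] is carried along because splitting off a coordinate
    changes it. *)
Definition gprimal m (lam : R) tau (s : 'rV[R[i]]_m) (t : 'rV[int]_m) : R[i] :=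
  nome (- ((vsq (vC t + s) + lam%:C * vsum (vC t + s) ^+ 2) / (2 * tau))).

Definition gdual m (mu : R) tau (s : 'rV[R[i]]_m) (n : 'rV[int]_m) : R[i] :=
  nome (tau * (vsq (vC n) - mu%:C * vsum (vC n) ^+ 2) / 2 + vdot (vC n) s).

Lemma absum_quad_le m (f : 'rV[int]_m -> R[i]) (C d K : R) : 0 < d -> 0 <= C ->
  (forall t, cabs (f t) <= C * expR (\sum_i (- (d * (t 0 i)%:~R ^+ 2) + K * `|t 0 i|%:~R))) ->
  absum f.
Proof.
move=> d0 C0 fb; apply: absum_le (rsmZ C0 (rsm_rV m _ (rsm_quad K d0))) => [t|x].
  by apply: le_trans (fb t) _; rewrite ler_wpM2l // expR_sum.
exact: expR_ge0.
Qed.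

Lemma Im_mul z w : complex.Im (z * w) = complex.Re z * complex.Im w + complex.Im z * complex.Re w.
Proof. by case: z w => [a b] [c d]; simpc. Qed.

Lemma Re_add z w : complex.Re (z + w) = complex.Re z + complex.Re w.
Proof. by case: z w => [a b] [c d]. Qed.

Lemma Im_add z w : complex.Im (z + w) = complex.Im z + complex.Im w.
Proof. by case: z w => [a b] [c d]. Qed.

Lemma Im_sum (I : Type) (r : seq I) (f : I -> R[i]) :
  complex.Im (\sum_(i <- r) f i) = \sum_(i <- r) complex.Im (f i).
Proof. exact: (big_morph _ Im_add). Qed.

Lemma Im_int (n : int) : complex.Im (n%:~R : R[i]) = 0.
Proof. by rewrite -(rmorph_int (@real_complex_def R (Phant R))). Qed.

Lemma Re_int (n : int) : complex.Re (n%:~R : R[i]) = n%:~R.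
Proof. by rewrite -(rmorph_int (@real_complex_def R (Phant R))). Qed.

Lemma Im_realM (x : R) z : complex.Im (x%:C * z) = x * complex.Im z.
Proof. by case: z => a b; simpc. Qed.

Lemma gprimal_absum m (lam : R) tau (s : 'rV[R[i]]_m) : 0 <= lam -> 0 < complex.Im tau ->
  absum (gprimal lam tau s).
Proof.
move=> l0 t0; have tau0 : tau != 0 by apply: contraTneq t0 => ->; rewrite ltxx.
pose u := - tau^-1; pose y := complex.Im u; pose x := complex.Re u.
have y0 : 0 < y.
  have : 0 < complex.Im tau / cabs tau ^+ 2 by rewrite divr_gt0 // exprn_gt0 // cabs_gt0.
  suff -> : y = complex.Im tau / cabs tau ^+ 2 by [].
  by rewrite /y /u cabs_sqr; case: (tau) => p q /=; rewrite opprK.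
pose al i : R := complex.Re (s 0 i); pose be i : R := complex.Im (s 0 i).
pose K0 i : R := 2 * (y * `|al i| + `|x| * `|be i|).
pose C0 i : R := y * be i ^+ 2 + 2 * `|x| * `|al i| * `|be i|.
pose B := vsum (\row_i be i : 'rV[R]_m).
pose C1 := lam * (y * B ^+ 2 + (x * B) ^+ 2 / y).
pose K := pi * \sum_i K0 i.
have K00 i : 0 <= K0 i by rewrite mulr_ge0 // addr_ge0 // mulr_ge0 // ltW.
apply: (@absum_quad_le _ _ (expR (pi * (\sum_i C0 i + C1))) (pi * y) K).
- by rewrite mulr_gt0 ?pi_gt0.
- exact: expR_ge0.
move=> t; rewrite -expRD cabs_nome ler_expR.
have -> : - ((vsq (vC t + s) + lam%:C * vsum (vC t + s) ^+ 2) / (2 * tau)) =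
  (2^-1 : R)%:C * (u * vsq (vC t + s) + lam%:C * (u * vsum (vC t + s) ^+ 2)).
  by rewrite fmorphV /= rmorph_nat /u; field.
rewrite Im_realM Im_add Im_realM.
have ImS z : complex.Im (u * z ^+ 2) = y * (complex.Re z ^+ 2 - complex.Im z ^+ 2) + 2 * x * complex.Re z * complex.Im z.
  by rewrite Im_mul Re_sqr -/x -/y expr2 Im_mul; ring.
(* Completing the square in the real part of the coordinate sum bounds this term below by a
   constant. *)
have h1 : - C1 <= lam * complex.Im (u * vsum (vC t + s) ^+ 2).
  rewrite ImS /C1 -mulrN ler_wpM2l //.
  have -> : complex.Im (vsum (vC t + s)) = B.
    rewrite /vsum Im_sum /B /vsum; apply: eq_bigr => i _.
    by rewrite !mxE Im_add Im_int add0r.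
  move: (complex.Re _) => X; have sq := sqr_ge0 (y * X + x * B).
  rewrite -(ler_pM2l y0).
  have -> : y * - (y * B ^+ 2 + (x * B) ^+ 2 / y) = - (y ^+ 2 * B ^+ 2) - (x * B) ^+ 2.
    by field; rewrite gt_eqF.
  by nra.
have h2 : \sum_i (y * (t 0 i)%:~R ^+ 2 - K0 i * `|t 0 i|%:~R - C0 i) <= complex.Im (u * vsq (vC t + s)).
  rewrite /vsq mulr_sumr Im_sum; apply: ler_sum => i _.
  rewrite ImS !mxE Re_add Im_add Im_int Re_int add0r -/(al i) -/(be i).
  set v := `|t 0 i|%:~R; set T := (t 0 i)%:~R.
  have vT : v = `|T| by rewrite /v intr_norm.
  have k1 : - (v * `|al i|) <= T * al i.
    have : `|T * al i| <= v * `|al i| by rewrite normrM vT.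
    by rewrite ler_norml => /andP[].
  have k2 : - (`|x| * `|be i| * v) <= x * T * be i.
    have : `|x * T * be i| <= `|x| * `|be i| * v by rewrite !normrM vT mulrAC.
    by rewrite ler_norml => /andP[].
  have k3 : - (`|x| * `|al i| * `|be i|) <= x * al i * be i.
    have : `|x * al i * be i| <= `|x| * `|al i| * `|be i| by rewrite !normrM.
    by rewrite ler_norml => /andP[].
  have k1' : y * - (v * `|al i|) <= y * (T * al i) by rewrite ler_wpM2l // ltW.
  have k4 : 0 <= y * al i ^+ 2 by rewrite mulr_ge0 ?sqr_ge0 // ltW.
  rewrite /K0 /C0; move: k1' k2 k3 k4; clear; nra.
have h3 : \sum_i (- (pi * y * (t 0 i)%:~R ^+ 2) + K * `|t 0 i|%:~R) >=
    - (pi * \sum_i (y * (t 0 i)%:~R ^+ 2 - K0 i * `|t 0 i|%:~R)).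
  rewrite mulr_sumr -sumrN; apply: ler_sum => i _.
  have : pi * K0 i * `|t 0 i|%:~R <= K * `|t 0 i|%:~R.
    rewrite ler_wpM2r ?ler0z // /K ler_wpM2l ?pi_ge0 //.
    by rewrite (bigD1 i) //= lerDl sumr_ge0.
  by lra.
move: h2; rewrite sumrB; set S := \sum_i (_ - _) in h3 *.
have pi0 := pi_gt0 R.
move: h1 h3; set X := lam * _; set Y := complex.Im _; set Z := \sum_i _ => h1 h3 h2.
have : pi * (S - \sum_i C0 i - C1) <= pi * (Y + X) by rewrite ler_wpM2l ?pi_ge0 //; lra.
have -> : 2 * pi * (2^-1 * (Y + X)) = pi * (Y + X) by field.
have -> : pi * (S - \sum_i C0 i - C1) = pi * S - pi * (\sum_i C0 i + C1) by ring.
by lra.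
Qed.

Lemma gdual_absum m (lam : R) tau (s : 'rV[R[i]]_m) : 0 <= lam -> 0 < complex.Im tau ->
  absum (gdual (lam / (1 + lam * m%:R)) tau s).
Proof.
move=> l0 t0; set D := 1 + lam * m%:R; set mu := lam / D; pose y := complex.Im tau.
have D0 : 0 < D by rewrite ltr_pwDl // mulr_ge0.
have pi0 := pi_gt0 R.
pose K := 2 * pi * \sum_i `|complex.Im (s 0 i)|.
apply: (@absum_quad_le _ _ 1 (pi * y / D) K) => //.
  by rewrite divr_gt0 // mulr_gt0.
move=> t; rewrite mul1r cabs_nome ler_expR.
pose vR : 'rV[R]_m := map_mx intr t.
have -> : complex.Im (tau * (vsq (vC t) - mu%:C * vsum (vC t) ^+ 2) / 2 + vdot (vC t) s) =
   y * (vsq vR - mu * vsum vR ^+ 2) / 2 + \sum_i (t 0 i)%:~R * complex.Im (s 0 i).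
  rewrite Im_add; congr (_ + _).
    have -> : vsq (vC t) - mu%:C * vsum (vC t) ^+ 2 = (vsq vR - mu * vsum vR ^+ 2)%:C.
      have -> : vsq (vC t) = (vsq vR)%:C.
        by rewrite rmorph_sum; apply: eq_bigr => i _; rewrite rmorphXn !mxE /= rmorph_int.
      have -> : vsum (vC t) = (vsum vR)%:C.
        by rewrite rmorph_sum; apply: eq_bigr => i _; rewrite !mxE /= rmorph_int.
      by rewrite rmorphB (rmorphM _ mu) rmorphXn.
    set r := _ - _; have -> : tau * r%:C / 2 = (r / 2)%:C * tau.
      by rewrite rmorphM fmorphV /= rmorph_nat; ring.
    by rewrite Im_realM -/y; ring.
  rewrite /vdot Im_sum; apply: eq_bigr => i _.
  by rewrite !mxE -(rmorph_int (@real_complex_def R (Phant R))) Im_realM.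
(* The Cauchy-Schwarz inequality [(sum v)^2 <= m |v|^2] makes the dual form positive definite, at
   least [1 / D] times the Euclidean one. *)
have cs : vsq vR / D <= vsq vR - mu * vsum vR ^+ 2.
  have : m%:R * vsq vR - vsum vR ^+ 2 >= 0.
    case: (posnP m) => [m0|m0].
      have -> : vsum vR = 0 by rewrite /vsum; case: m {s K D mu D0 t} vR m0 => // vR _; rewrite big_ord0.
      have -> : m%:R = 0 :> R by rewrite m0.
      by rewrite mul0r expr0n subr0.
    have mR : 0 < m%:R :> R by rewrite ltr0n.
    have : 0 <= \sum_i (vR 0 i - vsum vR / m%:R) ^+ 2 by apply: sumr_ge0 => i _; exact: sqr_ge0.
    have -> : \sum_i (vR 0 i - vsum vR / m%:R) ^+ 2 = vsq vR - vsum vR ^+ 2 / m%:R.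
      have e i : (vR 0 i - vsum vR / m%:R) ^+ 2 = vR 0 i ^+ 2 - 2 * (vsum vR / m%:R) * vR 0 i + (vsum vR / m%:R) ^+ 2.
        by ring.
      rewrite (eq_bigr _ (fun i _ => e i)) big_split sumrB /= -mulr_sumr -/(vsum vR) sumr_const card_ord -/(vsq vR).
      by rewrite -[_ *+ m]mulr_natr; field; rewrite gt_eqF.
    rewrite subr_ge0 ler_pdivrMr // => h; by rewrite subr_ge0 mulrC.
  move=> cs0; rewrite -(ler_pM2r D0) divfK ?gt_eqF //.
  have -> : (vsq vR - mu * vsum vR ^+ 2) * D = vsq vR * D - lam * vsum vR ^+ 2.
    by rewrite /mu; field; rewrite gt_eqF.
  by rewrite /D; nra.
have h1 : - \sum_i `|complex.Im (s 0 i)| * `|t 0 i|%:~R <= \sum_i (t 0 i)%:~R * complex.Im (s 0 i).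
  rewrite -sumrN; apply: ler_sum => i _.
  have : `|(t 0 i)%:~R * complex.Im (s 0 i)| <= `|complex.Im (s 0 i)| * `|t 0 i|%:~R.
    by rewrite normrM mulrC intr_norm.
  by rewrite ler_norml => /andP[].
have h2 : 2 * pi * \sum_i `|complex.Im (s 0 i)| * `|t 0 i|%:~R <= \sum_i K * `|t 0 i|%:~R.
  rewrite mulr_sumr; apply: ler_sum => i _; rewrite mulrA ler_wpM2r ?ler0z //.
  rewrite /K ler_wpM2l ?mulr_ge0 ?pi_ge0 //.
  by rewrite (bigD1 i) //= lerDl sumr_ge0.
rewrite big_split /= sumrN -mulr_sumr.
have -> : \sum_i (t 0 i)%:~R ^+ 2 = vsq vR by apply: eq_bigr => i _; rewrite mxE.
move: h1 h2 cs; set S1 := \sum_i _; set S2 := \sum_i _; set S3 := \sum_i _ => h1 h2 cs.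
have : pi * y * (vsq vR / D) <= pi * y * (vsq vR - mu * vsum vR ^+ 2).
  by rewrite ler_wpM2l // mulr_ge0 ?pi_ge0 // ltW.
have : 2 * pi * - S1 <= 2 * pi * S2 by rewrite ler_wpM2l // mulr_ge0 ?pi_ge0.
have -> : pi * y / D * vsq vR = pi * y * (vsq vR / D) by ring.
by lra.
Qed.

(** Induction on the dimension. The first coordinate is summed with [r = 1 + lam]; completing the
    square leaves the form with [lam1 = lam / (1 + lam)] in the others, and the determinants
    multiply by [LD]. *)
Lemma poisson_vec tau I : 0 < complex.Im tau ->
  (forall (r : R) s, 0 < r ->
    absum (fun m : int => nome (m%:~R ^+ 2 * tau / (2 * r%:C) + m%:~R * s)) /\
    csum (fun t : int => nome (- (r%:C * (t%:~R + s) ^+ 2 / (2 * tau)))) =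
    I / (Num.sqrt r)%:C * csum (fun m : int => nome (m%:~R ^+ 2 * tau / (2 * r%:C) + m%:~R * s))) ->
  forall m (lam : R) (s : 'rV[R[i]]_m), 0 <= lam ->
  csum (gprimal lam tau s) = I ^+ m / (Num.sqrt (1 + lam * m%:R))%:C
    * csum (gdual (lam / (1 + lam * m%:R)) tau s).
Proof.
move=> t0 P1; have tau0 : tau != 0 by apply: contraTneq t0 => ->; rewrite ltxx.
elim=> [|m IHm] lam s l0.
  have u0 (t : 'rV[int]_0) : t \notin [fset (0 : 'rV[int]_0)]%fset -> False.
    by rewrite !inE [t]thinmx0 eqxx.
  rewrite !(@csum_fin _ _ _ [fset (0 : 'rV[int]_0)]%fset) ?big_seq_fset1; try by move=> t /u0.
  rewrite /gprimal /gdual /vsq /vsum /vdot !big_ord0 expr0n /=.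
  by rewrite !(mulr0, addr0, subr0, oppr0, mul0r, nome0, expr0, sqrtr1, invr1, mulr1).
pose lam1 := lam / (1 + lam); pose L := 1 + lam; pose D := 1 + lam * m.+1%:R.
have L0 : 0 < L by rewrite ltr_pwDl.
have D0 : 0 < D by rewrite ltr_pwDl // mulr_ge0.
have l10 : 0 <= lam1 by rewrite divr_ge0 // ltW.
have LD : L * (1 + lam1 * m%:R) = D.
  by rewrite /lam1 /L /D -[m.+1%:R]natr1; field; rewrite gt_eqF.
have D10 : 0 < 1 + lam1 * m%:R by rewrite ltr_pwDl // mulr_ge0.
pose mu := lam / D.
have mu1 : lam1 / (1 + lam1 * m%:R) = mu.
  have D0' : 1 + lam + lam * m%:R != 0.
    have -> : 1 + lam + lam * m%:R = D by rewrite /D -natr1; ring.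
    by rewrite gt_eqF.
  by rewrite /mu -LD /lam1 /L; field; rewrite D0' gt_eqF.
have cL : L%:C != 0 :> R[i] by rewrite -cabs_gt0 cabsR gtr0_norm.
have cD : D%:C != 0 :> R[i] by rewrite -cabs_gt0 cabsR gtr0_norm.
pose s1 := s 0 ord0; pose s' : 'rV[R[i]]_m := \row_j s 0 (lift ord0 j).
pose sg (t : 'rV[int]_m) := vsum (vC t + s').
have split_sum (t : int * 'rV[int]_m) : vsum (vC (rcons0 t) + s) = t.1%:~R + s1 + sg t.2.
  rewrite /vsum big_ord_recl !mxE unlift_none; congr (_ + _); apply: eq_bigr => j _.
  by rewrite !mxE liftK.
have split_sq (t : int * 'rV[int]_m) : vsq (vC (rcons0 t) + s) = (t.1%:~R + s1) ^+ 2 + vsq (vC t.2 + s').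
  rewrite /vsq big_ord_recl !mxE unlift_none; congr (_ + _); apply: eq_bigr => j _.
  by rewrite !mxE liftK.
have lam1C : lam1%:C = lam%:C / L%:C :> R[i] by rewrite rmorphM fmorphV.
have LC : L%:C = 1 + lam%:C :> R[i] by rewrite rmorphD.
have gp_split t1 t' : gprimal lam tau s (rcons0 (t1, t')) =
    nome (- (L%:C * (t1%:~R + (s1 + lam1%:C * sg t')) ^+ 2 / (2 * tau))) * gprimal lam1 tau s' t'.
  rewrite /gprimal split_sum split_sq -/(sg t') -nomeD; congr nome; rewrite /= lam1C.
  have cL' := cL; rewrite LC in cL' *.
  by field; rewrite cL' tau0.
have ap := gprimal_absum s l0 t0.
have ap' : absum (fun p : 'rV[int]_m * int => gprimal lam tau s (rcons0 (p.2, p.1))).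
  apply: (@absum_inj _ _ _ (fun p : 'rV[int]_m * int => rcons0 (p.2, p.1)) (gprimal lam tau s)) => //.
  by move=> [a b] [c d] /(can_inj (@rcons0K m)) [-> ->].
have step1 : csum (gprimal lam tau s) =
    csum (fun t' => csum (fun t1 : int => gprimal lam tau s (rcons0 (t1, t')))).
  rewrite (@csum_bij _ _ _ (fun p : 'rV[int]_m * int => rcons0 (p.2, p.1))
     (fun t => ((runcons0 t).2, (runcons0 t).1))) ?(csum_pair ap') //.
  - by case=> a b; rewrite rcons0K.
  - by move=> t; rewrite -surjective_pairing runcons0K.
pose A1 (n1 : int) := nome (n1%:~R ^+ 2 * tau / (2 * L%:C) + n1%:~R * s1).
pose mix (p : 'rV[int]_m * int) := A1 p.2 * nome (p.2%:~R * (lam1%:C * sg p.1)) * gprimal lam1 tau s' p.1.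
have step2 t' : csum (fun t1 : int => gprimal lam tau s (rcons0 (t1, t'))) =
    I / (Num.sqrt L)%:C * csum (fun n1 : int => mix (t', n1)).
  have [ad e] := P1 L (s1 + lam1%:C * sg t') L0.
  rewrite (eq_csum (gp_split ^~ t')).
  have -> : csum (fun t1 : int => nome (- (L%:C * (t1%:~R + (s1 + lam1%:C * sg t')) ^+ 2 / (2 * tau))) * gprimal lam1 tau s' t') =
     csum (fun t1 : int => gprimal lam1 tau s' t' * nome (- (L%:C * (t1%:~R + (s1 + lam1%:C * sg t')) ^+ 2 / (2 * tau)))).
    by apply: eq_csum => t1; rewrite mulrC.
  rewrite csumZ; last first.
    have := absum_row t' ap'.
    rewrite (_ : (fun u => _) = fun t1 : int => gprimal lam1 tau s' t' * nome (- (L%:C * (t1%:~R + (s1 + lam1%:C * sg t')) ^+ 2 / (2 * tau)))); last first.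
      by apply/funext => t1; rewrite gp_split mulrC.
    have g0 : gprimal lam1 tau s' t' != 0 by exact: nome_neq0.
    move=> /(absumZ (gprimal lam1 tau s' t')^-1); rewrite (_ : (fun i => _) = fun t1 : int => nome (- (L%:C * (t1%:~R + (s1 + lam1%:C * sg t')) ^+ 2 / (2 * tau)))) //.
    by apply/funext => t1; rewrite mulKf.
  rewrite e mulrCA; congr (_ * _); rewrite -csumZ //; apply: eq_csum => n1.
  by rewrite /mix /A1 /= mulrC -nomeD mulrDr addrA.
(* The shift [sg t'] differs from [vsum s'] by an integer, so the mixed factor has the same modulus
   for all [t'], and in absolute value the double family is a product. *)
have amix : absum mix.
  pose b : R := complex.Im (lam1%:C * vsum s').
  have [aA _] := P1 L (s1 + (lam1%:C * vsum s')) L0.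
  apply: absum_le (rsm_prod _ _ (gprimal_absum s' l10 t0) aA) => // -[t' n1] /=.
  rewrite /mix /= cabsM mulrC ler_wpM2l // /A1 -nomeD !cabs_nome ler_expR lerN2.
  rewrite le_eqVlt; apply/orP; left; apply/eqP; congr (_ * _).
  rewrite !Im_add -addrA; congr (_ + _).
  rewrite -!(rmorph_int (@real_complex_def R (Phant R))) !Im_realM -mulrDr; congr (_ * _).
  rewrite Im_add; congr (_ + _); rewrite !Im_realM; congr (_ * _).
  by rewrite /sg /vsum !Im_sum; apply: eq_bigr => i _; rewrite !mxE Im_add Im_int add0r.
have step3 n1 : csum (fun t' => mix (t', n1)) =
   I ^+ m / (Num.sqrt (1 + lam1 * m%:R))%:C * csum (fun n' => gdual mu tau s (rcons0 (n1, n'))).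
  (* The coupling with [n1] is linear in [t'] and becomes a shift of all entries of [s'] by the
     constant [nu]. *)
  pose nu := tau * n1%:~R * mu%:C.
  pose s2 : 'rV[R[i]]_m := \row_j (s' 0 j - nu).
  have muC : mu%:C = lam%:C / D%:C :> R[i] by rewrite rmorphM fmorphV.
  have DC : D%:C = 1 + lam%:C * (m%:R + 1) :> R[i].
    by rewrite /D rmorphD rmorphM /= rmorph_nat -natr1.
  have cL' := cL; have cD' := cD; rewrite LC in cL'; rewrite DC in cD'.
  have sum2 (t' : 'rV[int]_m) : vsum (vC t' + s2) = sg t' - m%:R * nu.
    rewrite /sg /vsum mulr_natl -[X in nu *+ X]card_ord -sumr_const -sumrB; apply: eq_bigr => j _.
    by rewrite !mxE addrA.
  have sq2 (t' : 'rV[int]_m) : vsq (vC t' + s2) = vsq (vC t' + s') - 2 * nu * sg t' + m%:R * nu ^+ 2.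
    have -> : m%:R * nu ^+ 2 = \sum_(j < m) nu ^+ 2 by rewrite sumr_const card_ord mulr_natl.
    rewrite /sg /vsq /vsum mulr_sumr -sumrB -big_split; apply: eq_bigr => j _.
    by rewrite !mxE /=; ring.
  pose E := A1 n1 * nome (m%:R * nu * n1%:~R * lam1%:C / 2).
  have e1 t' : mix (t', n1) = E * gprimal lam1 tau s2 t'.
    rewrite /mix /E /A1 /gprimal /= sum2 sq2 -!nomeD; congr nome.
    rewrite -/(sg t') lam1C /nu muC LC DC.
    by field; rewrite cL' cD' tau0.
  rewrite (eq_csum e1) csumZ; last exact: gprimal_absum.
  rewrite IHm // mu1 mulrCA; congr (_ * _); rewrite -csumZ; last first.
    by rewrite -mu1; exact: gdual_absum.
  apply: eq_csum => n'; rewrite /E /A1 /gdual -!nomeD; congr nome.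
  have -> : vsum (vC (rcons0 (n1, n'))) = n1%:~R + vsum (vC n').
    rewrite /vsum big_ord_recl !mxE unlift_none; congr (_ + _); apply: eq_bigr => j _.
    by rewrite !mxE liftK.
  have -> : vsq (vC (rcons0 (n1, n'))) = n1%:~R ^+ 2 + vsq (vC n').
    rewrite /vsq big_ord_recl !mxE unlift_none; congr (_ + _); apply: eq_bigr => j _.
    by rewrite !mxE liftK.
  have -> : vdot (vC (rcons0 (n1, n'))) s = n1%:~R * s1 + vdot (vC n') s'.
    rewrite /vdot big_ord_recl !mxE unlift_none; congr (_ + _); apply: eq_bigr => j _.
    by rewrite !mxE liftK.
  have -> : vdot (vC n') s2 = vdot (vC n') s' - nu * vsum (vC n').
    rewrite /vdot /vsum mulr_sumr -sumrB; apply: eq_bigr => j _.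
    by rewrite !mxE; ring.
  rewrite lam1C /nu muC LC DC.
  by field; rewrite cL' cD'.
have ad := gdual_absum s l0 t0; rewrite -/D -/mu in ad *.
have ad' : absum (fun p : int * 'rV[int]_m => gdual mu tau s (rcons0 p)).
  apply: absum_inj ad; exact: can_inj (@rcons0K m).
rewrite step1 (eq_csum step2) csumZ; last exact: absum_csum.
rewrite (csum_swap amix) (eq_csum step3) csumZ; last exact: (absum_csum ad').
rewrite -(csum_pair ad') -(@csum_bij _ _ _ (@rcons0 m) (@runcons0 m)) //; last 2 first.
- exact: rcons0K.
- exact: runcons0K.
rewrite mulrA exprS; congr (_ * _).
rewrite -LD sqrtrM ?(ltW L0) // rmorphM invfM /=; ring.
Qed.

End VectorPoisson.

(** * The theta series and its transformation at a rational point *)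

Section ThetaT.
Variable R : realType.
Implicit Types (z w : R[i]) (m c : nat).

Lemma sum_pairs m (F : 'I_m -> 'I_m -> int) : (forall i j, F i j = F j i) ->
  \sum_i \sum_j F i j = \sum_i F i i + 2 * \sum_(i < m) \sum_(j < m | (i < j)%N) F i j.
Proof.
move=> Fs.
have e (i : 'I_m) : \sum_j F i j = F i i + \sum_(j < m | (i < j)%N) F i j + \sum_(j < m | (j < i)%N) F i j.
  rewrite (bigD1 i) //= -addrA; congr (_ + _).
  rewrite (bigID (fun j : 'I_m => (i < j)%N)) /=; congr (_ + _); apply: eq_bigl => j.
    by rewrite -val_eqE /=; case: ltngtP.
  by rewrite -val_eqE /=; case: ltngtP.
rewrite (eq_bigr _ (fun i _ => e i)) !big_split /= -addrA; congr (_ + _).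
rewrite mulr_natl mulr2n; congr (_ + _).
rewrite (exchange_big_dep xpredT) //=; apply: eq_bigr => i _; apply: eq_bigr => j _.
exact: Fs.
Qed.

(** The Gram matrix is thus [1 + J], the case [lam = 1] of [gprimal]. *)
Lemma theta2 m (x : 'rV[int]_m) : 2 * theta x = vsq x + vsum x ^+ 2.
Proof.
rewrite /theta mulrDr expr2 /vsum mulr_suml.
have -> : \sum_i x 0 i * \sum_j x 0 j = \sum_i \sum_j x 0 i * x 0 j.
  by apply: eq_bigr => i _; rewrite mulr_sumr.
rewrite (sum_pairs (F := fun i j => x 0 i * x 0 j)); last by move=> i j; rewrite mulrC.
by rewrite /vsq addrA; congr (_ + _); rewrite mulr_natl mulr2n.
Qed.

Lemma vsumD m (x y : 'rV[int]_m) : vsum (x + y) = vsum x + vsum y.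
Proof. by rewrite /vsum -big_split; apply: eq_bigr => i _; rewrite mxE. Qed.

Lemma vsumZ m (c : int) (x : 'rV[int]_m) : vsum (c *: x) = c * vsum x.
Proof. by rewrite /vsum mulr_sumr; apply: eq_bigr => i _; rewrite mxE. Qed.

Lemma vdotDr m (n x y : 'rV[int]_m) : vdot n (x + y) = vdot n x + vdot n y.
Proof. by rewrite /vdot -big_split; apply: eq_bigr => i _; rewrite mxE mulrDr. Qed.

Lemma vdotZr m (c : int) (n x : 'rV[int]_m) : vdot n (c *: x) = c * vdot n x.
Proof. by rewrite /vdot mulr_sumr; apply: eq_bigr => i _; rewrite mxE mulrCA. Qed.

Lemma vdotC m (n x : 'rV[int]_m) : vdot n x = vdot x n.
Proof. by apply: eq_bigr => i _; rewrite mulrC. Qed.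

Lemma vdot0 m (n : 'rV[int]_m) : vdot 0 n = 0.
Proof. by rewrite /vdot big1 // => i _; rewrite mxE mul0r. Qed.

Lemma thetaD m (x y : 'rV[int]_m) :
  theta (x + y) = theta x + theta y + (vdot x y + vsum x * vsum y).
Proof.
suff : 2 * theta (x + y) = 2 * theta x + 2 * theta y + 2 * (vdot x y + vsum x * vsum y) by lia.
rewrite !theta2 vsumD.
have -> : vsq (x + y) = vsq x + vsq y + 2 * vdot x y.
  rewrite /vsq /vdot mulr_sumr -!big_split /=; apply: eq_bigr => i _; rewrite mxE; ring.
ring.
Qed.

Lemma thetaZ m (c : int) (x : 'rV[int]_m) : theta (c *: x) = c ^+ 2 * theta x.
Proof.
suff : 2 * theta (c *: x) = 2 * (c ^+ 2 * theta x) by lia.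
rewrite mulrCA !theta2 vsumZ exprMn mulrDr; congr (_ + _).
by rewrite /vsq mulr_sumr; apply: eq_bigr => i _; rewrite mxE exprMn.
Qed.

Lemma vsq_ge0 m (x : 'rV[int]_m) : 0 <= vsq x.
Proof. by apply: sumr_ge0 => i _; exact: sqr_ge0. Qed.

Lemma theta_ge m (x : 'rV[int]_m) : vsq x <= 2 * theta x.
Proof. by rewrite theta2 lerDl sqr_ge0. Qed.

Lemma theta_ge0 m (x : 'rV[int]_m) : 0 <= theta x.
Proof. by have := theta_ge x; have := vsq_ge0 x; lia. Qed.

Lemma absum_theta m z : 0 < complex.Im z ->
  absum (fun x : 'rV[int]_m => nome ((theta x)%:~R * z)).
Proof.
move=> z0; apply: (@absum_quad_le _ _ _ 1 (pi * complex.Im z) 0) => //.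
  by rewrite mulr_gt0 ?pi_gt0.
move=> x; rewrite mul1r cabs_nome ler_expR.
rewrite -(rmorph_int (@real_complex_def R (Phant R))) Im_realM.
rewrite (eq_bigr (fun i => - (pi * complex.Im z) * (x 0 i)%:~R ^+ 2)); last first.
  by move=> i _; rewrite mul0r addr0 mulNr.
rewrite -mulr_sumr.
have -> : \sum_i (x 0 i)%:~R ^+ 2 = (vsq x)%:~R :> R.
  by rewrite /vsq rmorph_sum; apply: eq_bigr => i _; rewrite rmorphXn.
have h : (vsq x)%:~R <= 2 * (theta x)%:~R :> R.
  by have := theta_ge x; rewrite -(ler_int R) rmorphM.
rewrite mulNr lerN2 -!mulrA.
have -> : 2 * (pi * ((theta x)%:~R * complex.Im z)) = pi * (complex.Im z * (2 * (theta x)%:~R)) by ring.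
by rewrite ler_wpM2l ?pi_ge0 // ler_wpM2l // ltW.
Qed.

Lemma f_thetaE m z : 0 < complex.Im z ->
  f_theta m z = csum (fun x : 'rV[int]_m => nome ((theta x)%:~R * z)).
Proof.
move=> z0; rewrite /f_theta -(sum_csum (absum_theta m z0)); congr sum.
by apply/funext => x; rewrite nomeMz.
Qed.

Lemma vsumC m (x : 'rV[int]_m) : vsum (vC R x) = (vsum x)%:~R.
Proof. by rewrite /vsum rmorph_sum; apply: eq_bigr => i _; rewrite mxE. Qed.

Lemma vsqC m (x : 'rV[int]_m) : vsq (vC R x) = (vsq x)%:~R.
Proof. by rewrite /vsq rmorph_sum; apply: eq_bigr => i _; rewrite mxE rmorphXn. Qed.

Definition res m c (y : 'rV['I_c]_m) : 'rV[int]_m := map_mx (fun i : 'I_c => (i : nat)%:Z) y.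

Definition gsum m (a : int) c (n : 'rV[int]_m) : R[i] :=
  \sum_(y : 'rV['I_c]_m) nome ((a * theta (res y) + vdot n (res y))%:~R / c%:R).

(** The dual form, given by half of the inverse Gram matrix [1 - J / (m + 1)]. *)
Definition qdual m (n : 'rV[int]_m) : R[i] := ((vsq n)%:~R - (vsum n)%:~R ^+ 2 / m.+1%:R) / 2.

Definition lcomb m c (p : 'rV['I_c.+1]_m * 'rV[int]_m) : 'rV[int]_m := res p.1 + c.+1%:Z *: p.2.

Definition ldec m c (x : 'rV[int]_m) : 'rV['I_c.+1]_m * 'rV[int]_m :=
  (map_mx (fun u : int => inord `|(u %% c.+1)%Z|%N) x, map_mx (fun u : int => (u %/ c.+1)%Z) x).

Lemma lcombK m c : cancel (@lcomb m c) (@ldec m c).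
Proof.
case=> y t; rewrite /ldec /lcomb; congr pair; apply/rowP => i; rewrite !mxE /=.
  rewrite [_ * t 0 i]mulrC addrC modzMDl modz_small ?inord_val //.
  by rewrite lez_nat ltz_nat /= ltn_ord.
rewrite [_ * t 0 i]mulrC addrC divzMDl // divz_small ?addr0 //.
by rewrite lez_nat ltz_nat /= ltn_ord.
Qed.

Lemma ldecK m c : cancel (@ldec m c) (@lcomb m c).
Proof.
move=> x; apply/rowP => i; rewrite !mxE /= inordK; last first.
  by rewrite -ltz_nat gez0_abs ?modz_ge0 // ltz_pmod.
by rewrite gez0_abs ?modz_ge0 // addrC mulrC -divz_eq.
Qed.

Lemma nome_modz c (a b : int) : (0 < c)%N -> (c %| a - b)%Z ->
  nome (a%:~R / c%:R) = nome (b%:~R / c%:R) :> R[i].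
Proof.
move=> c0 /dvdzP[q /eqP]; rewrite subr_eq => /eqP ->.
rewrite rmorphD rmorphM /= mulrDl mulfK ?pnatr_eq0 -?lt0n // addrC.
by rewrite nomeDint.
Qed.

(** The vectors are split into classes modulo [c]: on a class the factor coming from [a / c] is
    constant, and what remains is a shifted Gaussian sum to which [poisson_vec] applies with
    [tau = w / c]. The dual series of all classes have the same exponents, and their phases assemble
    to [gsum]. *)
Lemma theta_transform k (a : int) c w : (0 < c)%N -> 0 < complex.Im w ->
  absum (fun n : 'rV[int]_k.*2 => gsum a c n * nome (qdual n * w / c%:R)) /\
  f_theta k.*2 (a%:~R / c%:R - (c%:R * w)^-1) =
    (w / ('i * c%:R)) ^+ k / (Num.sqrt k.*2.+1%:R)%:C *
    csum (fun n : 'rV[int]_k.*2 => gsum a c n * nome (qdual n * w / c%:R)).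
Proof.
case: c => // c _ w0; set m := k.*2.
have cR : 0 < c.+1%:R^-1 :> R by rewrite invr_gt0 ltr0n.
have c0 : c.+1%:R != 0 :> R[i] by rewrite pnatr_eq0.
have cV : (c.+1%:R^-1 : R)%:C = c.+1%:R^-1 :> R[i] by rewrite fmorphV /= rmorph_nat.
have wn0 : w != 0 by apply: contraTneq w0 => ->; rewrite ltxx.
pose tau := w / c.+1%:R; set z := _ - _.
have tau0 : 0 < complex.Im tau by rewrite /tau mulrC -cV Im_realM mulr_gt0.
have z0 : 0 < complex.Im z.
  rewrite /z invfM -!cV -!(rmorph_int (@real_complex_def R (Phant R))) -rmorphM.
  rewrite Im_add -mulrN Im_realM /= add0r mulr_gt0 //.
  have : 0 < complex.Im w / cabs w ^+ 2 by rewrite divr_gt0 // exprn_gt0 // cabs_gt0.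
  by rewrite cabs_sqr; case: (w) => p q /=; rewrite opprK.
have [I I2 P1] := poisson1 tau0.
pose s (y : 'rV['I_c.+1]_m) : 'rV[R[i]]_m := c.+1%:R^-1 *: vC R (res y).
pose mu : R := 1 / (1 + 1 * m%:R).
have muC : mu%:C = m.+1%:R^-1 :> R[i].
  by rewrite /mu !mul1r fmorphV rmorphD /= rmorph_nat nat1r.
have term y t : nome ((theta (lcomb (y, t)))%:~R * z) =
   nome ((a * theta (res y))%:~R / c.+1%:R) * gprimal 1 tau (s y) t.
  rewrite /z mulrBr mulrA -rmorphM /= nomeB -nomeN.
  congr (_ * _).
    apply: nome_modz => //; rewrite (mulrC a) -mulrBl dvdz_mulr // /lcomb /= thetaD.
    rewrite thetaZ vdotZr vsumZ; set d := c.+1%:Z.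
    have -> : theta (res y) + d ^+ 2 * theta t + (d * vdot (res y) t + vsum (res y) * (d * vsum t)) - theta (res y)
      = (d * theta t + vdot (res y) t + vsum (res y) * vsum t) * d by ring.
    exact: dvdz_mull.
  rewrite /gprimal; congr nome.
  have e : (theta (lcomb (y, t)))%:~R = (vsq (vC R (lcomb (y, t))) + vsum (vC R (lcomb (y, t))) ^+ 2) / 2.
    rewrite vsumC vsqC -rmorphXn -rmorphD /= -theta2 rmorphM /= mulrC mulKf //.
  have e2 : vC R t + s y = c.+1%:R^-1 *: vC R (lcomb (y, t)).
    apply/rowP => i; rewrite !mxE /= rmorphD rmorphM /=.
    by field.
  rewrite e2 e.
  have -> : vsq (c.+1%:R^-1 *: vC R (lcomb (y, t))) = c.+1%:R ^- 2 * vsq (vC R (lcomb (y, t))).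
    by rewrite /vsq mulr_sumr; apply: eq_bigr => i _; rewrite mxE exprMn exprVn.
  have -> : vsum (c.+1%:R^-1 *: vC R (lcomb (y, t))) = c.+1%:R^-1 * vsum (vC R (lcomb (y, t))).
    by rewrite /vsum mulr_sumr; apply: eq_bigr => i _; rewrite mxE.
  move: c0; rewrite /tau rmorph1 mul1r; move: (vsq _) (vsum _) (c.+1%:R) => A B C0 c0.
  by field; rewrite c0 wn0.
have dual y n : nome ((a * theta (res y))%:~R / c.+1%:R) * gdual mu tau (s y) n =
   nome ((a * theta (res y) + vdot n (res y))%:~R / c.+1%:R) * nome (qdual n * w / c.+1%:R).
  rewrite /gdual -!nomeD; congr nome.
  have -> : vdot (vC R n) (s y) = (vdot n (res y))%:~R / c.+1%:R.
    rewrite /vdot rmorph_sum mulr_suml; apply: eq_bigr => i _.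
    by rewrite !mxE rmorphM /=; ring.
  rewrite /qdual vsumC vsqC muC rmorphD /= /tau.
  have m0 : m.+1%:R != 0 :> R[i] by rewrite pnatr_eq0.
  by move: c0 m0; move: (c.+1%:R) (m.+1%:R) => C0 M0 c0 m0; field; rewrite c0 m0.
have adual y : absum (fun n => nome ((a * theta (res y))%:~R / c.+1%:R) * gdual mu tau (s y) n).
  by apply: absumZ; exact: gdual_absum.
have ge n : gsum a c.+1 n * nome (qdual n * w / c.+1%:R) =
    \sum_(y : 'rV['I_c.+1]_m) nome ((a * theta (res y))%:~R / c.+1%:R) * gdual mu tau (s y) n.
  by rewrite /gsum mulr_suml; apply: eq_bigr => y _; rewrite dual.
have gA : absum (fun n : 'rV[int]_m => gsum a c.+1 n * nome (qdual n * w / c.+1%:R)).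
  by rewrite (funext ge); apply: absum_fsum.
pose K : R[i] := (w / ('i * c.+1%:R)) ^+ k / (Num.sqrt m.+1%:R)%:C.
have row y : csum (fun t => nome ((theta (lcomb (y, t)))%:~R * z)) =
    K * csum (fun n => nome ((a * theta (res y))%:~R / c.+1%:R) * gdual mu tau (s y) n).
  transitivity (csum (fun t => nome ((a * theta (res y))%:~R / c.+1%:R) * gprimal 1 tau (s y) t)).
    exact: eq_csum (term y).
  rewrite csumZ; last exact: gprimal_absum.
  rewrite (poisson_vec tau0 P1) // csumZ; last exact: gdual_absum.
  rewrite mulrCA; congr (_ / _ * _).
    (* The dimension is even, so the choice of the root [I] disappears. *)
    by rewrite /m -mul2n exprM I2 /tau invfM mulrA mulrAC.
  by rewrite mul1r nat1r.
have at' : absum (fun p : 'rV['I_c.+1]_m * 'rV[int]_m => nome ((theta (lcomb p))%:~R * z)).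
  apply: (absum_inj (h := @lcomb m c) _ (absum_theta m z0)); exact: can_inj (@lcombK m c).
split=> //; rewrite f_thetaE // -/K.
rewrite (@csum_bij _ _ _ (@lcomb m c) (@ldec m c)); [|exact: lcombK|exact: ldecK|exact: absum_theta].
rewrite (csum_pair at') csum_finType (eq_csum ge) csum_fsum // mulr_sumr.
by apply: eq_bigr => y _; exact: row.
Qed.

End ThetaT.

(** * Legendre and Kronecker symbols *)

Section Legendre.
Variable p : nat.
Hypothesis pr_p : prime p.

Definition leg (x : 'F_p) : int :=
  if x == 0 then 0 else if [exists y : 'F_p, y ^+ 2 == x] then 1 else -1.

Lemma intr_Fp_eq0 (D : int) : ((D%:~R : 'F_p) == 0) = (p %| D)%Z.
Proof.
rewrite dvdzE /= [X in (X %| _)%N]/= (dvdn_pcharf (pchar_Fp pr_p)).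
case: D => n //=; by rewrite NegzE rmorphN /= oppr_eq0.
Qed.

Lemma legendreE (D : int) : legendre D p = leg D%:~R.
Proof. by rewrite /legendre /leg intr_Fp_eq0. Qed.

Lemma leg0 : leg 0 = 0. Proof. by rewrite /leg eqxx. Qed.

Lemma leg_sq x : x != 0 -> leg (x ^+ 2) = 1.
Proof.
move=> x0; rewrite /leg sqrf_eq0 (negbTE x0); case: existsP => // -[]; by exists x.
Qed.

Hypothesis odd_p : odd p.

Lemma Fp2_neq0 : (2 : 'F_p) != 0.
Proof.
rewrite -(dvdn_pcharf (pchar_Fp pr_p)) dvdn_prime2 //.
by apply: contraTneq odd_p => ->.
Qed.

Lemma Fp_exp_pred (x : 'F_p) : x != 0 -> x ^+ p.-1 = 1.
Proof.
move=> x0; apply: (mulfI x0); rewrite -exprS prednK ?prime_gt0 // mulr1.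
by have := mathcomp.field.finfield.expf_card x; rewrite (card_Fp pr_p).
Qed.

Lemma Fp_prim_root : exists w : 'F_p, p.-1.-primitive_root w.
Proof.
have p1 := prime_gt1 pr_p.
have p10 : (0 < p.-1)%N by rewrite -subn1 subn_gt0.
pose rs := [seq x <- enum 'F_p | x != 0].
have h1 : all p.-1.-unity_root rs.
  apply/allP => x; rewrite mem_filter => /andP[x0 _]; apply/unity_rootP.
  exact: Fp_exp_pred.
have h2 : uniq rs by rewrite filter_uniq // enum_uniq.
have h3 : (p.-1 <= size rs)%N.
  rewrite size_filter.
  have := count_predC (pred1 (0 : 'F_p)) (enum 'F_p).
  rewrite -cardE (card_Fp pr_p) (count_uniq_mem _ (enum_uniq _)) mem_enum /= => h.
  by rewrite -[X in (X.-1 <= _)%N]h add1n /=.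
have /hasP[w _ wp] := mathcomp.solvable.cyclic.has_prim_root p10 h1 h2 h3.
by exists w.
Qed.

(** If [w^i] is the square of [w^j], then [2 j] and [i] agree modulo [p - 1], which is even, so [i]
    is even. Multiplicativity of [leg] follows from this description. *)
Lemma leg_prim (w : 'F_p) i : p.-1.-primitive_root w -> leg (w ^+ i) = (-1) ^+ i.
Proof.
move=> wp; have p1 := prime_gt1 pr_p.
have p10 : (0 < p.-1)%N by rewrite -subn1 subn_gt0.
have w0 : w != 0.
  apply/eqP => w0; have := prim_expr_order wp; rewrite w0 expr0n eqn0Ngt p10 => /eqP.
  by rewrite eq_sym oner_eq0.
rewrite /leg expf_eq0 (negbTE w0) andbF -signr_odd.
case: existsP => [[y /eqP ysq]|ne]; last first.
  case: (boolP (odd i)) => // ei; case: ne; exists (w ^+ i./2).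
  by rewrite -exprM muln2 even_halfK.
have y0 : y != 0 by rewrite -sqrf_eq0 ysq expf_eq0 (negbTE w0) andbF.
have [j yj] := prim_rootP wp (Fp_exp_pred y0).
have := ysq; rewrite yj -exprM => /eqP; rewrite (eq_prim_root_expr wp) => /eqP h.
have e2 : (2 %| p.-1)%N by rewrite dvdn2 -subn1 oddB ?odd_p // ltnW.
have : (j * 2 = i %[mod 2])%N.
  by rewrite -(modn_dvdm (j * 2) e2) h modn_dvdm.
by rewrite !modn2 oddM andbF; case: (odd i).
Qed.

Lemma legM x y : leg (x * y) = leg x * leg y.
Proof.
have [->|x0] := eqVneq x 0; first by rewrite mul0r leg0 mul0r.
have [->|y0] := eqVneq y 0; first by rewrite mulr0 leg0 mulr0.
have [w wp] := Fp_prim_root; have p1 := prime_gt1 pr_p.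
have P (u : 'F_p) : u != 0 -> exists i, u = w ^+ i.
  by move=> u0; have [j ->] := prim_rootP wp (Fp_exp_pred u0); exists j.
have [i ->] := P _ x0; have [j ->] := P _ y0.
by rewrite -exprD !leg_prim // exprD.
Qed.

Lemma leg1 : leg 1 = 1.
Proof. by rewrite -[1](expr1n _ 2) leg_sq // oner_neq0. Qed.

Lemma legX x n : leg (x ^+ n) = leg x ^+ n.
Proof. by elim: n => [|n IHn]; rewrite ?expr0 ?leg1 // !exprS legM IHn. Qed.

Lemma leg_sqr x : x != 0 -> leg x ^+ 2 = 1.
Proof. by move=> x0; rewrite -legX leg_sq. Qed.

(* [1 + leg y] is the number of square roots of [y] *)
Lemma sum_square_Fp (V : nzRingType) (E : 'F_p -> V) :
  \sum_x E (x ^+ 2) = \sum_y (1 + (leg y)%:~R) * E y.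
Proof.
rewrite (partition_big (fun x : 'F_p => x ^+ 2) xpredT) //=; apply: eq_bigr => y _.
rewrite (eq_bigr (fun=> E y)); last by move=> x /eqP ->.
rewrite sumr_const -mulr_natl; congr (_ * _).
rewrite /leg; have [->|y0] := eqVneq y 0.
  rewrite addr0 (eq_card (B := pred1 0)) ?card1 // => x.
  by transitivity (x ^+ 2 == 0) => //; rewrite sqrf_eq0.
case: existsP => [[s /eqP sy]|ne].
  have s0 : s != 0 by rewrite -sqrf_eq0 sy.
  rewrite (eq_card (B := pred2 s (- s))) ?card2; last first.
    by move=> x; transitivity (x ^+ 2 == y) => //; rewrite -sy eqf_sqr.
  suff -> : s != - s by rewrite -(natrD _ 1 1).
  by rewrite -addr_eq0 -mulr2n -mulr_natl mulf_neq0 // Fp2_neq0.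
rewrite subrr eq_card0 // => x; transitivity (x ^+ 2 == y) => //.
by apply/negbTE/eqP => xy; apply: ne; exists x; apply/eqP.
Qed.

End Legendre.

(** The symbol at 2 as a function of the residue modulo 8, so that its multiplicativity is a finite
    check. *)
Definition kronecker2_nat (r : nat) : int := if ~~ odd r then 0 else if (r == 1%N) || (r == 7) then 1 else -1.

Lemma kronecker2E (D : int) : kronecker2 D = kronecker2_nat `|(D %% 8)%Z|%N.
Proof.
rewrite /kronecker2 /kronecker2_nat.
have -> : (2 %| D)%Z = ~~ odd `|(D %% 8)%Z|%N by lia.
have -> : ((D %% 8)%Z == 1) = (`|(D %% 8)%Z|%N == 1%N) by lia.
by have -> : ((D %% 8)%Z == 7) = (`|(D %% 8)%Z|%N == 7) by lia.
Qed.

Lemma kronecker2_natM (r s : nat) : (r < 8)%N -> (s < 8)%N -> kronecker2_nat ((r * s) %% 8) = kronecker2_nat r * kronecker2_nat s.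
Proof. by do 8?[case: r => [|r] //]; move=> _; do 8?[case: s => [|s] //]. Qed.

Lemma kronecker2M (D D' : int) : kronecker2 (D * D') = kronecker2 D * kronecker2 D'.
Proof.
rewrite !kronecker2E -kronecker2_natM; try lia.
congr kronecker2_nat; rewrite -modzMm; apply/eqP; rewrite -eqz_nat -modz_nat PoszM.
by rewrite !gez0_abs ?modz_ge0.
Qed.

Lemma kronecker_primeM (D D' : int) p : prime p ->
  kronecker_prime (D * D') p = kronecker_prime D p * kronecker_prime D' p.
Proof.
move=> pp; rewrite /kronecker_prime; case: eqP => [_|p2]; first exact: kronecker2M.
rewrite !(legendreE pp) rmorphM /= legM //.
by case: (even_prime pp).
Qed.

Lemma kronecker_prime_eq0 D p : prime p -> (kronecker_prime D p == 0) = (p %| D)%Z.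
Proof.
move=> pp; rewrite /kronecker_prime; have [->|_] := eqVneq p 2.
  by rewrite /kronecker2; case: ifP => // _; case: ifP.
by rewrite /legendre; case: ifP => // _; case: ifP.
Qed.

Lemma kronecker_prime_sqr D p : prime p -> ~~ (p %| D)%Z -> kronecker_prime D p ^+ 2 = 1.
Proof.
move=> pp; rewrite /kronecker_prime /kronecker2 /legendre; case: eqP => [->|_] /negbTE ->.
  by case: ifP.
by case: ifP.
Qed.

Definition kprod (D : int) (n : nat) : int :=
  \prod_(p <- primes n) kronecker_prime D p ^+ logn p n.

(** A common index range for [a], [b] and [a b] on which multiplicativity is visible; the added
    factors have exponent 0. *)
Lemma kprodE D n M : (0 < n <= M)%N ->
  kprod D n = \prod_(p <- iota 0 M.+1) kronecker_prime D p ^+ logn p n.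
Proof.
move=> /andP[n0 nM]; rewrite /kprod.
have pe : perm_eq (primes n) [seq p <- iota 0 M.+1 | p \in primes n].
  apply: uniq_perm; rewrite ?primes_uniq ?filter_uniq ?iota_uniq // => p.
  rewrite mem_filter mem_iota /= add0n ltnS; case: (boolP (p \in primes n)) => //=.
  rewrite mem_primes => /and3P[_ _ /dvdn_leq pn]; by rewrite (leq_trans (pn n0)).
rewrite (perm_big _ pe) big_filter big_mkcond; apply: eq_bigr => p _.
by case: ifPn => // /negbTE pn; rewrite -logn_gt0 in pn; case: (logn p n) pn.
Qed.

Lemma kprodM D a b : (0 < a)%N -> (0 < b)%N -> kprod D (a * b) = kprod D a * kprod D b.
Proof.
move=> a0 b0; have ab0 : (0 < a * b)%N by rewrite muln_gt0 a0.
rewrite !(@kprodE D _ (a * b)) ?ab0 ?a0 ?b0 ?leq_pmulr ?leq_pmull ?leqnn //.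
rewrite -big_split; apply: eq_bigr => p _ /=.
by rewrite lognM // exprD.
Qed.

Lemma kprodMl D D' n : kprod (D * D') n = kprod D n * kprod D' n.
Proof.
rewrite /kprod -big_split /= !big_seq; apply: eq_bigr => p.
by rewrite mem_primes => /andP[pp _]; rewrite kronecker_primeM // exprMn.
Qed.

Lemma kprod_eq0 D n : (0 < n)%N -> (kprod D n == 0) = ~~ coprime `|D|%N n.
Proof.
move=> n0; apply/idP/idP.
  rewrite /kprod prodf_seq_eq0 => /hasP[p pn /=]; rewrite expf_eq0 => /andP[_].
  move: pn; rewrite mem_primes => /and3P[pp _ pn]; rewrite kronecker_prime_eq0 // => pD.
  apply/negP => /eqP g; have : (p %| gcdn `|D| n)%N by rewrite dvdn_gcd pn andbT.
  by rewrite g dvdn1 => /eqP p1; rewrite p1 in pp.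
move=> nc; have g1 : (1 < gcdn `|D| n)%N.
  by rewrite ltn_neqAle eq_sym nc gcdn_gt0 n0 orbT.
have pp := pdiv_prime g1; have := pdiv_dvd (gcdn `|D| n); rewrite dvdn_gcd => /andP[pD pn].
rewrite /kprod prodf_seq_eq0; apply/hasP; exists (pdiv (gcdn `|D| n)).
  by rewrite mem_primes pp n0.
by rewrite /= expf_eq0 kronecker_prime_eq0 // logn_gt0 mem_primes pp n0 pn dvdzE.
Qed.

Lemma kprod_sqr D n : (0 < n)%N -> coprime `|D|%N n -> kprod D n ^+ 2 = 1.
Proof.
move=> n0 cop; rewrite /kprod -prodrXl big_seq big1 // => p.
rewrite mem_primes => /and3P[pp _ pn]; rewrite -exprM mulnC exprM kronecker_prime_sqr ?expr1n //.
apply/negP => pD; have : (p %| gcdn `|D| n)%N by rewrite dvdn_gcd pn andbT.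
by rewrite (eqP cop) dvdn1 => /eqP p1; rewrite p1 in pp.
Qed.

Lemma kprod1 D : kprod D 1 = 1.
Proof. by rewrite /kprod big_nil. Qed.

Lemma kprod_prime D p : prime p -> kprod D p = kronecker_prime D p.
Proof. by move=> pp; rewrite /kprod primes_prime // big_seq1 logn_prime // eqxx. Qed.

(** For odd [a] this is congruent to 1 modulo 4; [chi a] is the Kronecker symbol of this
    discriminant. *)
Definition dstar (a : nat) : int := (-1) ^+ (a.-1 %/ 2) * a%:Z.

Lemma absz_dstar a : `|dstar a|%N = a.
Proof. by rewrite /dstar abszM absz_sign mul1n. Qed.

Lemma dstar_lt0 a : odd a -> (dstar a < 0) = odd (a.-1 %/ 2).
Proof.
move=> oa; rewrite /dstar -signr_odd; case: (odd _).
  by rewrite mulN1r oppr_lt0 ltz_nat odd_gt0.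
by rewrite mul1r ltNge lez_nat.
Qed.

Lemma dstarM a b : odd a -> odd b -> dstar (a * b) = dstar a * dstar b.
Proof.
move=> oa ob; rewrite /dstar PoszM mulrACA; congr (_ * _).
rewrite -exprD -signr_odd -[in RHS]signr_odd; congr (_ ^+ _); congr nat_of_bool.
have -> : a = (a./2.*2).+1 by have := odd_double_half a; rewrite oa; lia.
have -> : b = (b./2.*2).+1 by have := odd_double_half b; rewrite ob; lia.
move: (a./2) (b./2) => x y.
have -> : (x.*2.+1 * y.*2.+1 = ((x + y + x * y * 2) * 2).+1)%N by rewrite -!muln2; ring.
by rewrite -!muln2 !mulnK // oddD oddM andbF addbF.
Qed.

Lemma chiE a (b : int) : odd a -> chi a b =
  if b == 0 then (a == 1%N)%:Z else
  (if (b < 0) && odd (a.-1 %/ 2) then -1 else 1) * kprod (dstar a) `|b|%N.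
Proof.
move=> oa; rewrite /chi /kronecker -/(dstar a) absz_dstar; case: eqP => // _.
by rewrite /kronecker_sign dstar_lt0.
Qed.

Lemma chi1E b : chi 1 b = 1.
Proof.
rewrite chiE //= ?div0n andbF mul1r; case: eqP => // /eqP b0.
have -> : dstar 1 = 1 by [].
have n0 : (0 < `|b|)%N by rewrite absz_gt0.
rewrite /kprod big_seq big1 // => p; rewrite mem_primes => /andP[pp _].
rewrite /kronecker_prime /legendre; case: eqP => [_|_]; first by rewrite expr1n.
case: ifP => [/[!dvdzE]/=|_].
  by rewrite dvdn1 => /eqP p1; rewrite p1 in pp.
case: existsP => [_|[]]; first by rewrite expr1n.
by exists 1; rewrite expr1n.
Qed.

Lemma chi_nat a n : odd a -> (0 < n)%N -> chi a n%:Z = kprod (dstar a) n.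
Proof. by move=> oa n0; rewrite chiE // eqz_nat -[n == _]negbK -lt0n n0 /= mul1r. Qed.

Lemma chi_1 a : odd a -> chi a 1 = 1.
Proof. by move=> oa; rewrite chi_nat // kprod1. Qed.

Lemma chi_eq0 a b : odd a -> (chi a b == 0) = ~~ coprime a `|b|%N.
Proof.
move=> oa; rewrite chiE //; case: (eqVneq b 0) => [->|b0].
  have -> : coprime a `|0%:Z|%N = (a == 1%N) by rewrite /coprime gcdn0.
  by case: (a == 1%N).
rewrite -(absz_dstar a) -kprod_eq0 ?absz_gt0 //.
by case: ifP => _; rewrite ?mulN1r ?oppr_eq0 ?mul1r absz_dstar.
Qed.

Lemma chi_sqr a b : odd a -> coprime a `|b|%N -> chi a b ^+ 2 = 1.
Proof.
move=> oa cop; rewrite chiE //; case: (eqVneq b 0) cop => [->|b0] cop.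
  by move: cop; rewrite /coprime gcdn0 => ->.
rewrite exprMn kprod_sqr ?absz_gt0 ?absz_dstar //; by case: ifP.
Qed.

Lemma chiMr a b b' : odd a -> chi a (b * b') = chi a b * chi a b'.
Proof.
move=> oa; have [->|a1] := eqVneq a 1%N; first by rewrite !chi1E.
have z : chi a 0 = 0 by apply/eqP; rewrite chi_eq0 // /coprime gcdn0.
have [->|b0] := eqVneq b 0; first by rewrite mul0r z mul0r.
have [->|b'0] := eqVneq b' 0; first by rewrite mulr0 z mulr0.
rewrite !chiE // mulf_eq0 (negbTE b0) (negbTE b'0) /= abszM kprodM ?absz_gt0 //.
rewrite mulrACA; congr (_ * _); case: (odd _); rewrite ?andbT ?andbF ?mulr1 //.
case: (ltrgt0P b) b0 => // bs _; case: (ltrgt0P b') b'0 => // b's _.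
- by rewrite ltNge mulr_ge0 // ltW.
- by rewrite pmulr_rlt0 // b's.
- by rewrite nmulr_rlt0 // b's.
- by rewrite nmulr_rlt0 // ltNge ltW.
Qed.

Lemma chiMl a a' b : odd a -> odd a' -> chi (a * a') b = chi a b * chi a' b.
Proof.
move=> oa oa'; have oaa : odd (a * a') by rewrite oddM oa.
rewrite !chiE //; case: eqP => [_|_].
  by rewrite muln_eq1; case: eqP; case: eqP.
rewrite dstarM // kprodMl mulrACA; congr (_ * _).
rewrite -!dstar_lt0 // dstarM //.
have d0 : dstar a != 0 by rewrite -absz_gt0 absz_dstar odd_gt0.
have d'0 : dstar a' != 0 by rewrite -absz_gt0 absz_dstar odd_gt0.
case: (b < 0); rewrite ?mulr1 //=.
case: (ltrgt0P (dstar a)) d0 => // bs _; case: (ltrgt0P (dstar a')) d'0 => // b's _.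
- by rewrite ltNge mulr_ge0 // ltW.
- by rewrite pmulr_rlt0 // b's.
- by rewrite nmulr_rlt0 // b's.
- by rewrite nmulr_rlt0 // ltNge ltW.
Qed.

Lemma chiN a b : odd a -> chi a (- b) = (-1) ^+ (a.-1 %/ 2) * chi a b.
Proof.
move=> oa; rewrite -[- b]mulN1r chiMr //; congr (_ * _).
rewrite chiE //= kprod1 mulr1 -signr_odd; by case: (odd _).
Qed.

(** * Gauss sums of theta: reduction along coprime factors and squares of primes *)

Section GaussSums.
Variable R : realType.
Implicit Types (c d m : nat).

Definition ze c (a : int) : R[i] := nome (a%:~R / c%:R).

Lemma zeD c a b : ze c (a + b) = ze c a * ze c b.
Proof. by rewrite /ze rmorphD mulrDl nomeD. Qed.

Lemma ze0 c : ze c 0 = 1.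
Proof. by rewrite /ze mul0r nome0. Qed.

Lemma ze_sum c (I : finType) (f : I -> int) : ze c (\sum_i f i) = \prod_i ze c (f i).
Proof. exact: (big_morph (ze c) (@zeD c) (ze0 c)). Qed.

Lemma ze_mod c a b : (0 < c)%N -> (c %| a - b)%Z -> ze c a = ze c b.
Proof. exact: nome_modz. Qed.

Lemma ze_dvd c a : (0 < c)%N -> (c %| a)%Z -> ze c a = 1.
Proof. by move=> c0 ca; rewrite (@ze_mod c a 0) ?subr0 // ze0. Qed.

Lemma zeMl c d a : (0 < d)%N -> ze (c * d) (a * d%:Z) = ze c a.
Proof.
move=> d0; rewrite /ze rmorphM natrM /=; congr nome.
have dR : d%:R != 0 :> R[i] by rewrite pnatr_eq0 -lt0n.
have [->|c0] := eqVneq c 0%N; first by rewrite !mul0r !invr0 !mulr0.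
have cR : c%:R != 0 :> R[i] by rewrite pnatr_eq0.
by field; rewrite cR dR.
Qed.

Lemma sum_ze c n : (0 < c)%N ->
  \sum_(j < c) ze c (n * (j : nat)%:Z) = if (c %| n)%Z then c%:R else 0.
Proof.
move=> c0; rewrite -sum_nome //; apply: eq_bigr => j _.
by rewrite /ze rmorphM /=; congr nome; ring.
Qed.

Definition vcong m c (x y : 'rV[int]_m) : Prop := forall i, (c %| (x 0 i - y 0 i)%R)%Z.

(** Any [c^m] pairwise incongruent vectors represent all classes; the special systems of
    representatives used below enter through this lemma. *)
Lemma sum_res_bij m c (T : finType) (h : T -> 'rV[int]_m) (F : 'rV[int]_m -> R[i]) :
  (0 < c)%N -> #|T| = (c ^ m)%N ->
  (forall x y, vcong c x y -> F x = F y) ->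
  (forall s t, vcong c (h s) (h t) -> s = t) ->
  \sum_(y : 'rV['I_c]_m) F (res y) = \sum_(t : T) F (h t).
Proof.
case: c => // c _ cT Fp hi.
pose r t : 'rV['I_c.+1]_m := (ldec c (h t)).1.
have rE t : vcong c.+1 (res (r t)) (h t).
  move=> i.
  have /rowP/(_ i) e := ldecK c (h t).
  rewrite -[X in _ - X]e /lcomb [X in _ - X]mxE opprD addrA subrr sub0r mxE rpredN; exact: dvdz_mulr.
have rI : injective r.
  move=> s t e; apply: hi => i.
  have := rpredB (rE t i) (rE s i); rewrite e.
  by rewrite (_ : _ - _ = h s 0 i - h t 0 i) //; ring.
have bij : bijective r.
  by apply: inj_card_bij rI _; rewrite card_mx card_ord mul1n cT.
rewrite (reindex r); last exact: onW_bij.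
by apply: eq_bigr => t _; apply: Fp => i; exact: rE.
Qed.

Lemma sum_ord_bij c (T : finType) (h : T -> int) (F : int -> R[i]) :
  (0 < c)%N -> #|T| = c ->
  (forall x y, (c %| x - y)%Z -> F x = F y) ->
  (forall s t, (c %| h s - h t)%Z -> s = t) ->
  \sum_(y < c) F (y : nat)%:Z = \sum_(t : T) F (h t).
Proof.
move=> c0 cT Fp hi.
have := @sum_res_bij 1 c T (fun t => const_mx (h t)) (fun x => F (x 0 0)) c0.
rewrite expn1 => /(_ cT) H; transitivity (\sum_t F ((const_mx (h t) : 'rV[int]_1) 0 0)); last first.
  by apply: eq_bigr => t _; rewrite mxE.
rewrite -H; first last.
- by move=> s t /(_ 0); rewrite !mxE => /hi.
- by move=> x y xy; exact: Fp.
rewrite (reindex (fun y : 'I_c => const_mx y : 'rV['I_c]_1)) /=; last first.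
  exists (fun y : 'rV['I_c]_1 => y 0 0) => [y _|y _]; first by rewrite mxE.
  by apply/rowP => i; rewrite mxE ord1.
by apply: eq_bigr => y _; rewrite !mxE.
Qed.

Lemma sum_ord_shift c (F : int -> R[i]) a : (0 < c)%N ->
  (forall x y, (c %| x - y)%Z -> F x = F y) ->
  \sum_(y < c) F (y : nat)%:Z = \sum_(y < c) F ((y : nat)%:Z + a).
Proof.
move=> c0 Fp; apply: (@sum_ord_bij c _ (fun y : 'I_c => (y : nat)%:Z + a)) => //; first by rewrite card_ord.
move=> s t; rewrite opprD addrACA subrr addr0 -eqz_mod_dvd !modz_small ?lez_nat ?ltz_nat ?ltn_ord //.
by move=> /eqP[] /val_inj.
Qed.

Lemma dvdz_ord c (s t : 'I_c) : (c %| (s : nat)%:Z - (t : nat)%:Z)%Z -> s = t.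
Proof.
rewrite -eqz_mod_dvd !modz_small ?lez_nat ?ltz_nat ?ltn_ord //.
by move=> /eqP[] /val_inj.
Qed.

Lemma sum_ord_scale c (F : int -> R[i]) a : (0 < c)%N -> coprime c `|a|%N ->
  (forall x y, (c %| x - y)%Z -> F x = F y) ->
  \sum_(y < c) F (y : nat)%:Z = \sum_(y < c) F (a * (y : nat)%:Z).
Proof.
move=> c0 ca Fp; apply: (@sum_ord_bij c _ (fun y : 'I_c => a * (y : nat)%:Z)) => //; first by rewrite card_ord.
by move=> s t; rewrite -mulrBr Gauss_dvdzr // => /dvdz_ord.
Qed.

Lemma sum_rV_prod m c (f : 'I_m -> 'I_c -> R[i]) :
  \sum_(y : 'rV['I_c]_m) \prod_i f i (y 0 i) = \prod_i \sum_j f i j.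
Proof.
rewrite bigA_distr_bigA /= (reindex (fun g : {ffun 'I_m -> 'I_c} => \row_i g i)) /=; last first.
  exists (fun y : 'rV['I_c]_m => [ffun i => y 0 i]) => [g _|y _].
    by apply/ffunP => i; rewrite ffunE mxE.
  by apply/rowP => i; rewrite mxE ffunE.
by apply: eq_bigr => g _; apply: eq_bigr => i _; rewrite mxE.
Qed.

Lemma cong_ex m c (x y : 'rV[int]_m) : vcong c x y ->
  exists t, x = y + c%:Z *: t.
Proof.
move=> h; exists (\row_i ((x 0 i - y 0 i)%R %/ c)%Z); apply/rowP => i; rewrite !mxE.
by rewrite mulrC divzK // addrC subrK.
Qed.

Lemma theta_cong m c (x y : 'rV[int]_m) : vcong c x y ->
  (c %| theta x - theta y)%Z.
Proof.
move=> /cong_ex[t ->]; rewrite thetaD thetaZ vdotZr vsumZ; set C := c%:Z.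
rewrite (_ : _ - _ = (C * theta t + vdot y t + vsum y * vsum t) * C); last by ring.
exact: dvdz_mull.
Qed.

Lemma vdot_cong m c (n x y : 'rV[int]_m) : vcong c x y ->
  (c %| vdot n x - vdot n y)%Z.
Proof.
move=> /cong_ex[t ->]; rewrite vdotDr vdotZr addrC addKr; exact: dvdz_mulr.
Qed.

Lemma gsumE m a c (n : 'rV[int]_m) :
  gsum R a c n = \sum_(y : 'rV['I_c]_m) ze c (a * theta (res y) + vdot n (res y)).
Proof. by []. Qed.

Definition qs m (b : int) c : R[i] := \sum_(y : 'rV['I_c]_m) ze c (b * theta (res y)).

Lemma gsum0 m b c : gsum R b c (0 : 'rV[int]_m) = qs m b c.
Proof. by apply: eq_bigr => y _; rewrite vdot0 addr0. Qed.

Lemma qs_res m b c (T : finType) (h : T -> 'rV[int]_m) :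
  (0 < c)%N -> #|T| = (c ^ m)%N ->
  (forall s t, vcong c (h s) (h t) -> s = t) ->
  qs m b c = \sum_(t : T) ze c (b * theta (h t)).
Proof.
move=> c0 cT hi; apply: (@sum_res_bij _ _ _ h (fun x => ze c (b * theta x))) => // x y xy.
apply: ze_mod => //; rewrite -mulrBr dvdz_mull //; exact: theta_cong.
Qed.

Lemma qs1 m b : qs m b 1 = 1.
Proof.
rewrite /qs (bigD1 (const_mx ord0)) //= big1 ?addr0; first by rewrite ze_dvd // dvd1z.
by move=> y /eqP[]; apply/rowP => i; rewrite [y 0 i]ord1 mxE.
Qed.

(** Representatives [d u + c v]: the cross terms of theta are divisible by [c d], so the sum
    factors. *)
Lemma qs_coprime m b c d : (0 < c)%N -> (0 < d)%N -> coprime c d ->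
  qs m b (c * d) = qs m (b * d%:Z) c * qs m (b * c%:Z) d.
Proof.
move=> c0 d0 cd; have cd0 : (0 < c * d)%N by rewrite muln_gt0 c0.
rewrite (@qs_res _ _ _ _ (fun p : 'rV['I_c]_m * 'rV['I_d]_m => d%:Z *: res p.1 + c%:Z *: res p.2)) //.
- rewrite /qs mulr_suml; under [RHS]eq_bigr do rewrite mulr_sumr.
  rewrite pair_big; apply: eq_bigr => -[u v] _ /=.
  have -> : b * theta (d%:Z *: res u + c%:Z *: res v) = b * d * theta (res u) * d + b * c * theta (res v) * c
      + b * (vdot (res v) (res u) + vsum (res u) * vsum (res v)) * (c * d)%N.
    by rewrite thetaD !thetaZ vdotZr !vsumZ (vdotC _ (res v)) vdotZr PoszM; ring.
  rewrite !zeD [X in _ * X]ze_dvd ?mulr1 ?dvdz_mull // zeMl //; congr (_ * _).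
  by rewrite mulnC zeMl.
- by rewrite card_prod !card_mx !card_ord !mul1n expnMn.
move=> [s1 s2] [t1 t2] /= h; congr pair; apply/rowP => i; apply: dvdz_ord.
  have := h i; rewrite PoszM !mxE => /(dvdz_trans (dvdz_mulr _ (dvdzz _))).
  rewrite (_ : _ - _ = d%:Z * ((s1 0 i : nat)%:Z - (t1 0 i : nat)%:Z) + ((s2 0 i : nat)%:Z - (t2 0 i : nat)%:Z) * c); last by ring.
  by rewrite [X in is_true X -> _]rpredDr; [rewrite Gauss_dvdzr|exact: dvdz_mull].
have := h i; rewrite PoszM !mxE => /(dvdz_trans (dvdz_mull _ (dvdzz _))).
rewrite (_ : _ - _ = ((s1 0 i : nat)%:Z - (t1 0 i : nat)%:Z) * d + c%:Z * ((s2 0 i : nat)%:Z - (t2 0 i : nat)%:Z)); last by ring.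
by rewrite [X in is_true X -> _]rpredDl; [rewrite Gauss_dvdzr // coprimez_sym|exact: dvdz_mull].
Qed.

(* [y + vsum y] is the Gram matrix of [theta] applied to [y]; its determinant is [m + 1]. *)
Lemma gram_inj_mod m p (y : 'rV[int]_m) : prime p -> ~~ (p %| m.+1)%N ->
  (forall i, (p %| (y 0 i + vsum y)%R)%Z) -> forall i, (p %| (y 0 i)%R)%Z.
Proof.
move=> pp pN h i.
have : (p %| (\sum_i (y 0 i + vsum y))%R)%Z by apply: rpred_sum => j _; exact: h.
rewrite big_split /= sumr_const card_ord -/(vsum y).
have -> : vsum y + vsum y *+ m = m.+1%:Z * vsum y by rewrite -mulr_natl intS; ring.
rewrite Gauss_dvdzr; last by rewrite coprimezE prime_coprime.
by move=> ps; have := h i; rewrite rpredDr.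
Qed.

(** Representatives [p u + v + p e w]. Modulo [p^2 e] the exponent is affine in [w], and the sum
    over [w] vanishes unless the Gram matrix kills [v] modulo [p], that is, by [gram_inj_mod],
    unless [v = 0]. The values of theta at [p u] then give back the sum modulo [e]. *)
Lemma qs_prime_sq m b p e : prime p -> (0 < e)%N -> ~~ (p %| m.+1)%N -> ~~ (p %| b)%Z ->
  qs m b (p ^ 2 * e) = (p ^ m)%:R * qs m b e.
Proof.
move=> pp e0 pN pb; have p0 := prime_gt0 pp.
have c0 : (0 < p ^ 2 * e)%N by rewrite muln_gt0 expn_gt0 p0.
pose h (q : 'rV['I_e]_m * 'rV['I_p]_m * 'rV['I_p]_m) : 'rV[int]_m :=
  p%:Z *: res q.1.1 + res q.1.2 + (p * e)%N%:Z *: res q.2.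
have cop : coprimez p b by rewrite coprimezE prime_coprime // -dvdzE.
have cE : (p ^ 2 * e)%N%:Z = p%:Z * p * e by rewrite expnS expn1 !PoszM.
rewrite (@qs_res _ _ _ _ h) //; last 2 first.
- rewrite !card_prod !card_mx !card_ord !mul1n -!expnMn; congr (_ ^ _)%N; lia.
- move=> [[s1 s2] s3] [[t1 t2] t3] H.
  have H' i : exists q : int, p%:Z * ((s1 0 i : nat)%:Z - (t1 0 i : nat)%:Z) + ((s2 0 i : nat)%:Z - (t2 0 i : nat)%:Z) + p%:Z * e * ((s3 0 i : nat)%:Z - (t3 0 i : nat)%:Z) = q * (p%:Z * p * e).
    have /dvdzP[q] := H i; rewrite cE /h /= !mxE PoszM => E; exists q; rewrite -E; ring.
  have e2 : s2 = t2.
    apply/rowP => i; apply: dvdz_ord; have [q E] := H' i.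
    apply/dvdzP; exists (q * p * e - ((s1 0 i : nat)%:Z - (t1 0 i : nat)%:Z) - e%:Z * ((s3 0 i : nat)%:Z - (t3 0 i : nat)%:Z)).
    move: E; clear; nia.
  have pZ : p%:Z != 0 by rewrite -lt0n.
  have H2 i : exists q : int, ((s1 0 i : nat)%:Z - (t1 0 i : nat)%:Z) + e%:Z * ((s3 0 i : nat)%:Z - (t3 0 i : nat)%:Z) = q * p * e.
    have [q E] := H' i; exists q; apply: (mulfI pZ); rewrite e2 in E; move: E; clear; nia.
  have e1 : s1 = t1.
    apply/rowP => i; apply: dvdz_ord; have [q E] := H2 i.
    apply/dvdzP; exists (q * p - ((s3 0 i : nat)%:Z - (t3 0 i : nat)%:Z)); move: E; clear; nia.
  have e3 : s3 = t3.
    apply/rowP => i; apply: dvdz_ord; have [q E] := H2 i.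
    have eZ : e%:Z != 0 by rewrite -lt0n.
    apply/dvdzP; exists q; apply: (mulfI eZ); rewrite e1 in E; move: E; clear; nia.
  by rewrite e1 e2 e3.
rewrite -(pair_bigA _ (fun u v => ze (p ^ 2 * e) (b * theta (h (u, v))))) /=.
have inner u : \sum_v ze (p ^ 2 * e) (b * theta (h (u, v))) =
   ze (p ^ 2 * e) (b * theta (p%:Z *: res u.1 + res u.2)) *
   (if [forall i, (p %| (res u.2 0 i + vsum (res u.2))%R)%Z] then (p ^ m)%:R else 0).
  pose y := p%:Z *: res u.1 + res u.2.
  have t1 v : ze (p ^ 2 * e) (b * theta (h (u, v))) = ze (p ^ 2 * e) (b * theta y) *
     \prod_i ze p (b * (res u.2 0 i + vsum (res u.2)) * (v 0 i : nat)%:Z).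
    rewrite /h /= -/y thetaD thetaZ vdotZr vsumZ -addrA mulrDr zeD; congr (_ * _).
    rewrite -ze_sum -(@zeMl p (p * e)) ?muln_gt0 ?p0 // mulnA (_ : (p * p)%N = (p ^ 2)%N) //.
    apply: ze_mod => //; rewrite cE PoszM.
    have -> : \sum_i b * (res u.2 0 i + vsum (res u.2)) * (v 0 i : nat)%:Z =
       b * (vdot (res u.2) (res v) + vsum (res u.2) * vsum (res v)).
      rewrite /vdot [X in _ + _ * X]/vsum mulr_sumr -big_split mulr_sumr; apply: eq_bigr => i _.
      by rewrite !mxE /=; ring.
    have -> : vdot y (res v) = p%:Z * vdot (res u.1) (res v) + vdot (res u.2) (res v).
      by rewrite vdotC vdotDr vdotZr !(vdotC (res v)).
    rewrite vsumD vsumZ.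
    apply/dvdzP; exists (b * (e%:Z * theta (res v) + vdot (res u.1) (res v) + vsum (res u.1) * vsum (res v))).
    ring.
  rewrite (eq_bigr _ (fun v _ => t1 v)) -mulr_sumr; congr (_ * _).
  rewrite (sum_rV_prod (fun i j => ze p (b * (res u.2 0 i + vsum (res u.2)) * (j : nat)%:Z))).
  rewrite (eq_bigr _ (fun i _ => sum_ze (b * (res u.2 0 i + vsum (res u.2))) p0)).
  case: forallP => [H|H].
    rewrite (eq_bigr (fun=> p%:R)) ?prodr_const ?card_ord ?natrX // => i _.
    by rewrite dvdz_mull.
  have /existsP[i Hi] : [exists i, ~~ (p %| (res u.2 0 i + vsum (res u.2))%R)%Z].
    rewrite -negb_forall; apply/negP => /forallP; exact: H.
  by rewrite (bigD1 i) //= Gauss_dvdzr // (negbTE Hi) mul0r.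
rewrite (eq_bigr _ (fun u _ => inner u)).
rewrite -(pair_bigA _ (fun u v => ze (p ^ 2 * e) (b * theta (p%:Z *: res u + res v)) *
   (if [forall i, (p %| (res v 0 i + vsum (res v))%R)%Z] then (p ^ m)%:R else 0))) /=.
rewrite /qs mulr_sumr; apply: eq_bigr => u _.
pose z0 : 'rV['I_p]_m := const_mx (Ordinal p0).
have rz : res z0 = 0 by apply/rowP => i; rewrite !mxE.
rewrite (bigD1 z0) //= big1 ?addr0; last first.
  move=> v /eqP nv; case: ifP => [/forallP H|_]; last by rewrite mulr0.
  case: nv; apply/rowP => i; apply: dvdz_ord.
  have := gram_inj_mod pp pN H i; by rewrite !mxE /= subr0.
rewrite rz; case: ifP => [_|/negP[]]; last first.
  apply/forallP => i; rewrite mxE add0r /vsum big1 // => j _; by rewrite mxE.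
rewrite addr0 thetaZ mulrC; congr (_ * _); rewrite mulnC -(@zeMl e (p ^ 2)) ?expn_gt0 ?p0 //.
by congr ze; rewrite expnS expn1 PoszM; ring.
Qed.

End GaussSums.

(** * Evaluation of the Gauss sums for moduli prime to [N] *)

Section QuadraticGauss.
Variable R : realType.
Implicit Types (c d m : nat).
Local Notation ze := (@ze R).

Definition g1 c (al : int) : R[i] := \sum_(u < c) ze c (al * (u : nat)%:Z ^+ 2).

Lemma ze_poly_per c (al t x y : int) : (0 < c)%N -> (c %| (x - y)%R)%Z ->
  ze c (al * x ^+ 2 + t * x) = ze c (al * y ^+ 2 + t * y).
Proof.
move=> c0 xy; apply: ze_mod => //.
rewrite (_ : _ - _ = (al * (x + y) + t) * (x - y)); last by ring.
exact: dvdz_mull.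
Qed.

Lemma ze_sq_per c (al x y : int) : (0 < c)%N -> (c %| (x - y)%R)%Z ->
  ze c (al * x ^+ 2) = ze c (al * y ^+ 2).
Proof. by move=> c0 xy; have := ze_poly_per al 0 c0 xy; rewrite !mul0r !addr0. Qed.

(** Completing the square, with [ga] an inverse of [4 be] modulo [c]. *)
Lemma g1_linear c be ga t : (0 < c)%N -> (c %| (4 * be * ga - 1)%R)%Z ->
  \sum_(u < c) ze c (be * (u : nat)%:Z ^+ 2 + t * (u : nat)%:Z) = ze c (- ga * t ^+ 2) * g1 c be.
Proof.
move=> c0 h; rewrite /g1 (@sum_ord_shift _ c (fun x => ze c (be * x ^+ 2)) (2 * ga * t)) //; last first.
  by move=> x y; exact: ze_sq_per.
rewrite mulr_sumr; apply: eq_bigr => u _; rewrite -zeD; apply: ze_mod => //.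
have /dvdzP[q E] := h.
apply/dvdzP; exists (- q * ((u : nat)%:Z * t + ga * t ^+ 2)).
move: (u : nat)%:Z => U.
transitivity (- (4 * be * ga - 1) * (U * t + ga * t ^+ 2)); first by ring.
by rewrite E; ring.
Qed.

(** Twice theta is a sum of [m + 1] squares of integers with sum zero, the last integer being
    [- vsum]. Detecting this condition by additive characters gives a product of [m + 1]
    one-dimensional sums for each character; completing the squares there leaves one more quadratic
    sum, over the characters. *)
Lemma qs_square m b c be ga : (0 < c)%N -> (c %| (4 * be * ga - 1)%R)%Z -> (c %| (b - 2 * be)%R)%Z ->
  c%:R * qs R m b c = g1 c be ^+ m.+1 * g1 c (- (m.+1%:Z * ga)).
Proof.
move=> c0 h1 h2; have c0Z : c%:Z != 0 by rewrite -lt0n.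
have -> : g1 c be ^+ m.+1 * g1 c (- (m.+1%:Z * ga)) =
    \sum_(t < c) (\sum_(u < c) ze c (be * (u : nat)%:Z ^+ 2 + (t : nat)%:Z * (u : nat)%:Z)) ^+ m.+1.
  rewrite {2}/g1 mulr_sumr; apply: eq_bigr => t _.
  rewrite (g1_linear _ c0 h1) exprMn mulrC; congr (_ * _).
  rewrite -[X in _ = X ^+ _]/(nome _) -nomeMn; congr nome.
  by rewrite !rmorphM !rmorphN /= !rmorphM /=; ring.
have e2 t : (\sum_(u < c) ze c (be * (u : nat)%:Z ^+ 2 + (t : nat)%:Z * (u : nat)%:Z)) ^+ m.+1 =
   \sum_(y : 'rV['I_c]_m) \sum_(u < c) ze c (be * (vsq (res y) + (u : nat)%:Z ^+ 2)) * ze c ((vsum (res y) + (u : nat)%:Z) * t%:Z).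
  rewrite exprSr -[X in _ ^+ X](card_ord m) -prodr_const.
  rewrite -(sum_rV_prod (fun (i : 'I_m) (u : 'I_c) => ze c (be * (u : nat)%:Z ^+ 2 + t%:Z * (u : nat)%:Z))).
  rewrite mulr_suml; apply: eq_bigr => y _; rewrite mulr_sumr; apply: eq_bigr => u _.
  rewrite -ze_sum -!zeD; congr ze; rewrite big_split /= -!mulr_sumr.
  rewrite (_ : vsq _ = \sum_i (y 0 i : nat)%:Z ^+ 2); last by apply: eq_bigr => i _; rewrite mxE.
  rewrite (_ : vsum _ = \sum_i (y 0 i : nat)%:Z); last by apply: eq_bigr => i _; rewrite mxE.
  ring.
rewrite (eq_bigr _ (fun (t : 'I_c) _ => e2 t)) exchange_big /= /qs mulr_sumr; apply: eq_bigr => y _.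
rewrite exchange_big /=.
have e3 (u : 'I_c) : \sum_(t < c) ze c (be * (vsq (res y) + (u : nat)%:Z ^+ 2)) * ze c ((vsum (res y) + (u : nat)%:Z) * (t : nat)%:Z)
   = ze c (be * (vsq (res y) + (u : nat)%:Z ^+ 2)) * (if (c %| (vsum (res y) + (u : nat)%:Z)%R)%Z then c%:R else 0).
  by rewrite -mulr_sumr sum_ze.
rewrite (eq_bigr _ (fun u _ => e3 u)).
have lt : (`|(- vsum (res y) %% c)%Z|%N < c)%N.
  by rewrite -ltz_nat gez0_abs ?modz_ge0 // ltz_pmod.
pose u0 := Ordinal lt.
have u0E : (c %| (vsum (res y) + (u0 : nat)%:Z)%R)%Z.
  rewrite /= gez0_abs ?modz_ge0 //.
  have := divz_eq (- vsum (res y)) c => E.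
  apply/dvdzP; exists (- (- vsum (res y) %/ c)%Z); lia.
clearbody u0; rewrite (bigD1 u0) //= big1 ?addr0; last first.
  move=> u uu0; case: ifP => [hu|_]; last by rewrite mulr0.
  case/eqP: uu0; apply: dvdz_ord; have := rpredB hu u0E.
  by rewrite (_ : _ - _ = (u : nat)%:Z - (u0 : nat)%:Z) //; ring.
rewrite u0E mulrC; congr (_ * _); apply: ze_mod => //.
have /dvdzP[q1 E1] := h2; have /dvdzP[q2 E2] := u0E.
have t2 := theta2 (res y).
move: E1 E2 t2; move: (u0 : nat)%:Z (theta _) (vsq _) (vsum _) => U T V S E1 E2 t2.
apply/dvdzP; exists (q1 * T + be * (S - U) * q2).
have -> : b = q1 * c + 2 * be by rewrite -E1; ring.
have -> : (q1 * c + 2 * be) * T = q1 * c * T + be * (2 * T) by ring.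
rewrite t2; transitivity (q1 * c * T + be * (S - U) * (S + U)); first by ring.
by rewrite E2; ring.
Qed.

(** Substituting [u + y] for [u] makes the exponent linear in [y], so that summing over [y] leaves
    only [u = 0]. *)
Lemma g1_mulN c (al : int) : (0 < c)%N -> coprime c `|(2 * al)%R|%N -> g1 c al * g1 c (- al) = c%:R.
Proof.
move=> c0 cop; rewrite mulrC /g1 mulr_suml.
transitivity (\sum_(y < c) \sum_(u < c) ze c (al * (u : nat)%:Z ^+ 2) * ze c (2 * al * (u : nat)%:Z * (y : nat)%:Z)).
  apply: eq_bigr => y _.
  rewrite (@sum_ord_shift _ c (fun x => ze c (al * x ^+ 2)) (y : nat)%:Z) //; last first.
    by move=> a b; exact: ze_sq_per.
  rewrite mulr_sumr; apply: eq_bigr => u _; rewrite -!zeD; congr ze; ring.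
rewrite exchange_big /=.
rewrite (bigD1 (Ordinal c0)) //= [X in _ + X]big1 ?addr0.
  rewrite (eq_bigr (fun=> 1)); first by rewrite sumr_const card_ord.
  by move=> i _; rewrite expr0n !(mulr0, mul0r) ze0 mulr1.
move=> u u0; rewrite -mulr_sumr sum_ze //; case: ifP => [|_]; last by rewrite mulr0.
rewrite Gauss_dvdzr // => hu; case/eqP: u0; apply: dvdz_ord; by rewrite subr0.
Qed.

Section OddPrime.
Variable p : nat.
Hypotheses (pp : prime p) (op : odd p).

Lemma intr_FpK (x : 'F_p) : ((x : nat)%:Z%:~R : 'F_p) = x.
Proof. exact: natr_Zp. Qed.

Definition eFp (x : 'F_p) : R[i] := ze p (x : nat)%:Z.

Lemma eFpE (D : int) : eFp D%:~R = ze p D.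
Proof.
apply: ze_mod; rewrite ?prime_gt0 // -(intr_Fp_eq0 pp) rmorphB /= intr_FpK.
by rewrite subrr.
Qed.

Lemma sum_ord_Fp (F : int -> R[i]) : (forall x y, (p %| (x - y)%R)%Z -> F x = F y) ->
  \sum_(u < p) F (u : nat)%:Z = \sum_(x : 'F_p) F (x : nat)%:Z.
Proof.
move=> Fp; apply: sum_ord_bij; rewrite ?prime_gt0 ?card_Fp // => s t.
by rewrite -(intr_Fp_eq0 pp) rmorphB /= !intr_FpK subr_eq0 => /eqP.
Qed.

Lemma g1_Fp (al : int) : g1 p al = \sum_x eFp (al%:~R * x ^+ 2).
Proof.
rewrite /g1 (sum_ord_Fp (F := fun u => ze p (al * u ^+ 2))); last first.
  by move=> x y; apply: ze_sq_per; exact: prime_gt0.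
apply: eq_bigr => x _; by rewrite -eFpE rmorphM rmorphXn /= intr_FpK.
Qed.

Lemma sum_eFp (a : 'F_p) : a != 0 -> \sum_x eFp (a * x) = 0.
Proof.
move=> a0; have p0 := prime_gt0 pp.
rewrite (reindex (fun x => a^-1 * x)) /=; last first.
  exists (fun x => a * x) => x _; by rewrite ?mulVKf ?mulKf.
under eq_bigr do rewrite mulVKf //.
have := sum_ze R 1 p0; rewrite dvdz1 /=.
case: eqP => [p1|_]; first by move: (prime_gt1 pp); rewrite [X in (_ < X)%N](_ : p = 1%N) //; case: p1.
under eq_bigr do rewrite mul1r.
by rewrite (sum_ord_Fp (F := ze p)) // => x y; exact: ze_mod.
Qed.

Lemma g1_leg_sum : g1 p 1 = \sum_y (leg y)%:~R * eFp y.
Proof.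
rewrite g1_Fp; under eq_bigr do rewrite mul1r.
rewrite (sum_square_Fp pp op eFp); under eq_bigr do rewrite mulrDl mul1r.
rewrite big_split /=.
suff -> : \sum_i eFp i = 0 by rewrite add0r.
transitivity (\sum_x eFp (1 * x)); last exact: sum_eFp (oner_neq0 _).
by apply: eq_bigr => i _; rewrite mul1r.
Qed.

(** Squares are counted by [1 + leg], so [g1] is the Gauss sum of the Legendre symbol, and scaling
    the argument only contributes a value of [leg]. *)
Lemma g1_leg (al : int) : ~~ (p %| al)%Z -> g1 p al = (leg (al%:~R : 'F_p))%:~R * g1 p 1.
Proof.
rewrite -(intr_Fp_eq0 pp); set a : 'F_p := al%:~R => a0.
rewrite g1_Fp -/a (sum_square_Fp pp op (fun y => eFp (a * y))).
under eq_bigr do rewrite mulrDl mul1r.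
rewrite big_split /= sum_eFp // add0r g1_leg_sum mulr_sumr.
rewrite (reindex (fun x => a^-1 * x)) /=; last first.
  exists (fun x => a * x) => x _; by rewrite ?mulVKf ?mulKf.
apply: eq_bigr => y _; rewrite mulVKf // mulrA -rmorphM /= -legM //; congr (_%:~R * _).
have -> : a^-1 * y = a * y * (a^-1) ^+ 2 by field.
by rewrite legM // leg_sq ?mulr1 // invr_eq0.
Qed.

Lemma g1_sqr : g1 p 1 ^+ 2 = (leg (-1 : 'F_p))%:~R * p%:R.
Proof.
have p0 := prime_gt0 pp.
have c2 : coprime p 2 by rewrite coprime_sym coprime2n.
rewrite -(g1_mulN (al := 1) p0) // [X in _ = _ * (_ * X)]g1_leg; last first.
  by rewrite dvdzE /= dvdn1; case: eqP (prime_gt1 pp) => // ->.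
have -> : ((-1)%:~R : 'F_p) = -1 by rewrite rmorphN.
have l2 : ((leg (-1 : 'F_p))%:~R : R[i]) ^+ 2 = 1.
  by rewrite -rmorphXn /= leg_sqr // oppr_eq0 oner_neq0.
by transitivity ((leg (-1 : 'F_p))%:~R ^+ 2 * g1 p 1 ^+ 2); [rewrite l2 mul1r|ring].
Qed.

(** In [qs_square], [be] is [b / 2] and [ga] is [1 / (2 b)] modulo [p]. As [m] is even, [g1 p 1]
    occurs to the even power [m + 2], so only its square, known from [g1_sqr], is involved and not
    its sign. *)
Lemma qs_odd_prime k (b : int) : ~~ (p %| b)%Z -> ~~ (p %| k.*2.+1)%N ->
  qs R k.*2 b p = (p ^ k)%:R * (legendre (dstar k.*2.+1) p)%:~R.
Proof.
move=> pb pN; have p0 := prime_gt0 pp; have F2 := Fp2_neq0 pp op.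
have b0 : (b%:~R : 'F_p) != 0 by rewrite (intr_Fp_eq0 pp).
pose be : int := (b%:~R / 2 : 'F_p) : nat; pose ga : int := ((b%:~R * 2)^-1 : 'F_p) : nat.
have beF : be%:~R = b%:~R / 2 :> 'F_p by rewrite /be -[_%:~R]/(_%:R) natr_Zp.
have gaF : ga%:~R = (b%:~R * 2)^-1 :> 'F_p by rewrite /ga -[_%:~R]/(_%:R) natr_Zp.
have h1 : (p %| (4 * be * ga - 1)%R)%Z.
  rewrite -(intr_Fp_eq0 pp) rmorphB !rmorphM /= beF gaF subr_eq0; apply/eqP.
  rewrite (_ : 4%:~R = 2 * 2 :> 'F_p); last by rewrite -natrM.
  by move: F2 b0; move: (2 : 'F_p) (b%:~R : 'F_p) => t u t0 u0; field; rewrite u0 t0.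
have h2 : (p %| (b - 2 * be)%R)%Z.
  by rewrite -(intr_Fp_eq0 pp) rmorphB rmorphM /= beF mulrC divfK // subrr.
have pR : p%:R != 0 :> R[i] by rewrite pnatr_eq0 -lt0n.
apply: (mulfI pR); rewrite (qs_square _ p0 h1 h2).
have N0 : (k.*2.+1%:Z%:~R : 'F_p) != 0 by rewrite (intr_Fp_eq0 pp) dvdzE.
rewrite [g1 p be]g1_leg; last by rewrite -(intr_Fp_eq0 pp) beF mulf_neq0 // invr_eq0.
rewrite [X in _ * X = _]g1_leg; last first.
  by rewrite -(intr_Fp_eq0 pp) rmorphN rmorphM /= gaF oppr_eq0 mulf_neq0 // invr_eq0 mulf_neq0.
set s := leg be%:~R.
have lbe : s ^+ 2 = 1 by rewrite /s leg_sqr // beF mulf_neq0 // invr_eq0.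
have -> : leg ((- (k.*2.+1%:Z * ga))%:~R : 'F_p) = leg (-1 : 'F_p) * leg (k.*2.+1%:Z%:~R : 'F_p) * s.
  rewrite rmorphN rmorphM /= gaF -mulN1r legM // legM // mulrA; congr (_ * _).
  have -> : (b%:~R * 2)^-1 = be%:~R * (b%:~R^-1) ^+ 2 :> 'F_p by rewrite beF; field; rewrite b0.
  by rewrite legM // leg_sq ?mulr1 // invr_eq0.
have -> : legendre (dstar k.*2.+1) p = leg (-1 : 'F_p) ^+ k * leg (k.*2.+1%:Z%:~R : 'F_p).
  rewrite (legendreE pp) /dstar rmorphM rmorphXn rmorphN /= rmorph1 legM // legX //.
  by rewrite (_ : (k.*2 %/ 2)%N = k) // -muln2 mulnK.
set l1 := leg (-1); set lN := leg _%:~R.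
rewrite exprMn natrX !rmorphM /= rmorphXn /=.
have l12 : (l1%:~R : R[i]) ^+ 2 = 1 by rewrite -rmorphXn /= leg_sqr // oppr_eq0 oner_neq0.
have s2 : (s%:~R : R[i]) ^+ 2 = 1 by rewrite -rmorphXn /= lbe.
have -> : s%:~R ^+ k.*2.+1 = s%:~R :> R[i] by rewrite exprS -mul2n exprM s2 expr1n mulr1.
have -> : g1 p 1 ^+ k.*2.+1 = (l1%:~R * p%:R) ^+ k * g1 p 1.
  by rewrite exprSr -mul2n exprM g1_sqr.
have gg := g1_sqr; rewrite -/l1 in gg.
transitivity (s%:~R ^+ 2 * l1%:~R * lN%:~R * (l1%:~R * p%:R) ^+ k * g1 p 1 ^+ 2); first by ring.
rewrite gg s2 exprMn; transitivity (l1%:~R ^+ 2 * p%:R * (p%:R ^+ k * (l1%:~R ^+ k * lN%:~R)) : R[i]); first by ring.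
by rewrite l12 mul1r.
Qed.

End OddPrime.

Lemma ze2 (n : int) : ze 2 n = (-1) ^+ odd `|n|%N.
Proof.
have h : nome (2^-1 : R[i]) = -1.
  have -> : 2^-1 = (2^-1 : R)%:C :> R[i] by rewrite fmorphV /= rmorph_nat.
  rewrite nomeE /= mulr0 oppr0 /cexp /= expR0 !mul1r.
  by rewrite mulrAC divff // mul1r cospi sinpi; apply/eqP; rewrite eq_complex /= !eqxx oppr0 eqxx.
rewrite (@ze_mod R 2 n (odd `|n|%N)) //; last by lia.
rewrite /ze; case: (odd _); last by rewrite mul0r nome0.
by rewrite mul1r h.
Qed.

Lemma odd_triangular s : odd (s * s.+1)./2 = ((s %% 4 == 1) || (s %% 4 == 2))%N.
Proof.
have e := divn_eq s 4; have := ltn_pmod s (isT : 0 < 4)%N.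
move: e; move: (s %/ 4)%N (s %% 4)%N => q t -> r4.
rewrite (_ : ((q * 4 + t) * (q * 4 + t).+1 = (q * (4 * q + 2 * t + 1)).*2.*2 + t * t.+1)%N); last first.
  by rewrite -!muln2; ring.
rewrite halfD odd_double /= add0n doubleK oddD odd_double /=.
by case: t r4 => [|[|[|[|t]]]].
Qed.

(** Theta of a 0-1 vector with [s] ones is [s (s + 1) / 2], whose parity is described by
    [odd_triangular]. Written as a combination of [i^s] and [(-i)^s], the sign can be summed
    coordinate by coordinate. *)
Lemma quarter_turns s : (1 + 'i) / 2 * 'i ^+ s + (1 - 'i) / 2 * (- 'i) ^+ s
  = (-1) ^+ ((s %% 4 == 1) || (s %% 4 == 2))%N :> R[i].
Proof.
have i2 : ('i : R[i]) ^+ 2 = -1 by exact: sqr_i.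
have i4 : ('i : R[i]) ^+ 4 = 1 by rewrite (exprM _ 2 2) i2 sqrrN expr1n.
rewrite [in LHS](divn_eq s 4) !exprD [(s %/ 4 * 4)%N]mulnC !exprM.
have -> : (- 'i) ^+ 4 = 1 :> R[i] by rewrite (exprM _ 2 2) sqrrN i2 sqrrN expr1n.
rewrite i4 !expr1n !mul1r.
have := ltn_pmod s (isT : 0 < 4)%N; move: (s %% 4)%N => t.
case: t => [|[|[|[|t]]]] //= _; rewrite ?expr0 ?expr1.
- by field.
- by rewrite -i2; field.
- by rewrite sqrrN i2; field.
- by transitivity ('i ^+ 4 : R[i]); [field|].
Qed.

Lemma kronecker2_dstar k : kronecker2 (dstar k.*2.+1) = (-1) ^+ ((k %% 4 == 1) || (k %% 4 == 2))%N.
Proof.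
rewrite /dstar /= (_ : (k.*2 %/ 2)%N = k); last by rewrite -muln2 mulnK.
rewrite -signr_odd /kronecker2.
have -> : (2 %| ((-1) ^+ odd k * k.*2.+1%:Z)%R)%Z = false.
  by case: (odd k); rewrite ?mulN1r ?mul1r; lia.
set D := _ * _.
have -> : ((D %% 8)%Z == 1) || ((D %% 8)%Z == 7) = ~~ ((k %% 4 == 1) || (k %% 4 == 2))%N.
  by rewrite /D; case ok: (odd k); rewrite ?mulN1r ?mul1r; lia.
by case: (_ || _).
Qed.

Lemma qs_two k (b : int) : ~~ (2 %| b)%Z ->
  qs R k.*2 b 2 = (2 ^ k)%:R * (kronecker2 (dstar k.*2.+1))%:~R.
Proof.
move=> b2; have i2 : ('i : R[i]) ^+ 2 = -1 by exact: sqr_i.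
have e (y : 'rV['I_2]_k.*2) : ze 2 (b * theta (res y)) =
   (1 + 'i) / 2 * \prod_(i < k.*2) (if (y 0 i : nat) == 0%N then 1 else 'i) +
   (1 - 'i) / 2 * \prod_(i < k.*2) (if (y 0 i : nat) == 0%N then 1 else - 'i).
  pose s := (\sum_i (y 0%R i : nat))%N.
  have pr (w : R[i]) : \prod_(i < k.*2) (if (y 0 i : nat) == 0%N then 1 else w) = w ^+ s.
    rewrite /s -prodrXr; apply: eq_bigr => i _.
    by have := ltn_ord (y 0 i); move: (y 0 i : nat) => [|[|n]].
  rewrite !pr quarter_turns -odd_triangular ze2; congr (_ ^+ nat_of_bool _).
  have t2 : (2 * theta (res y) = s%:Z * (s%:Z + 1)).
    rewrite theta2 mulrDr mulr1 addrC -expr2 /s (big_morph Posz PoszD (erefl _)); congr (_ ^+ _ + _).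
      by apply: eq_bigr => i _; rewrite mxE.
    apply: eq_bigr => i _; rewrite mxE.
    by have := ltn_ord (y 0 i); move: (y 0 i : nat) => [|[|n]].
  have -> : `|(b * theta (res y))%R|%N = (`|b| * (s * s.+1)./2)%N.
    rewrite abszM; congr (_ * _)%N; have t0 := theta_ge0 (res y).
    have : (2 * `|theta (res y)| = s * s.+1)%N.
      by apply/eqP; rewrite -eqz_nat !PoszM gez0_abs // t2 -addn1 PoszD.
    by move: (s * _)%N => S <-; rewrite mul2n doubleK.
  by rewrite oddM; have -> : odd `|b|%N by lia.
have eqs : qs R k.*2 b 2 = (1 + 'i) / 2 * (1 + 'i) ^+ k.*2 + (1 - 'i) / 2 * (1 - 'i) ^+ k.*2.
  rewrite /qs (eq_bigr _ (fun y _ => e y)) big_split /= -!mulr_sumr; congr (_ * _ + _ * _).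
    rewrite (sum_rV_prod (fun (i : 'I_k.*2) (j : 'I_2) => if (j : nat) == 0%N then 1 else 'i : R[i])).
    by rewrite prodr_const card_ord big_ord_recl big_ord1.
  rewrite (sum_rV_prod (fun (i : 'I_k.*2) (j : 'I_2) => if (j : nat) == 0%N then 1 else - 'i : R[i])).
  by rewrite prodr_const card_ord big_ord_recl big_ord1.
have p1 : (1 + 'i) ^+ 2 = 2 * 'i :> R[i] by rewrite sqrrD i2 expr1n mul1r; ring.
have p2 : (1 - 'i) ^+ 2 = 2 * (- 'i) :> R[i] by rewrite sqrrB i2 expr1n mul1r; ring.
rewrite eqs kronecker2_dstar rmorphXn rmorphN /= rmorph1 -quarter_turns -mul2n !exprM p1 p2.
by rewrite !exprMn natrX; ring.
Qed.

(** Induction on [d] through its smallest prime factor: a factor [p^2] contributes [p^(2 k)] and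
    leaves [chi] unchanged, a simple factor [p] splits off by coprimality and is one of the two
    prime cases. *)
Lemma qs_chi k (b : int) d : (0 < d)%N -> coprime d `|b|%N -> coprime d k.*2.+1 ->
  qs R k.*2 b d = (d ^ k)%:R * (chi k.*2.+1 d%:Z)%:~R.
Proof.
have oN : odd k.*2.+1 by rewrite /= odd_double.
elim/ltn_ind: d b => d IHd b d0 db dN.
have [->|d1] := eqVneq d 1%N; first by rewrite qs1 exp1n chi_1 // mulr1.
have d2 : (1 < d)%N by rewrite ltn_neqAle eq_sym d1.
pose p := pdiv d; have pp : prime p by exact: pdiv_prime.
have pd : (p %| d)%N by exact: pdiv_dvd.
clearbody p; have p0 := prime_gt0 pp; have p1 := prime_gt1 pp.
have pN : ~~ (p %| k.*2.+1)%N by rewrite -prime_coprime // (coprime_dvdl pd).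
have pb : ~~ (p %| b)%Z by rewrite dvdzE -prime_coprime // (coprime_dvdl pd).
have [p2d|np2d] := boolP (p ^ 2 %| d)%N.
  have [e dE] := dvdnP p2d; have e0 : (0 < e)%N by move: d0; rewrite dE muln_gt0 => /andP[].
  rewrite dE mulnC qs_prime_sq // IHd //; last 3 first.
  - by rewrite dE ltn_Pmulr // -{1}(exp1n 2) ltn_exp2r.
  - by apply: coprime_dvdl db; rewrite dE dvdn_mulr.
  - by apply: coprime_dvdl dN; rewrite dE dvdn_mulr.
  rewrite PoszM chiMr // (_ : chi _ (p ^ 2)%N = 1); last first.
    by rewrite expnS expn1 PoszM chiMr // -expr2 chi_sqr // coprime_sym prime_coprime.
  by rewrite mul1r mulrA -natrM expnMn -expnM -mul2n.
have [e dE] := dvdnP pd; have e0 : (0 < e)%N by move: d0; rewrite dE muln_gt0 => /andP[].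
have pe : coprime p e.
  rewrite prime_coprime //; apply: contra np2d => pe.
  by rewrite dE expnS expn1 dvdn_pmul2r.
have eb : coprime e `|b|%N by apply: coprime_dvdl db; rewrite dE dvdn_mulr.
have eN : coprime e k.*2.+1 by apply: coprime_dvdl dN; rewrite dE dvdn_mulr.
rewrite dE mulnC qs_coprime // (IHd e) //; last 2 first.
- by rewrite dE ltn_Pmulr.
- by rewrite abszM coprimeMr eb coprime_sym.
have -> : qs R k.*2 (b * e) p = (p ^ k)%:R * (chi k.*2.+1 p)%:~R.
  have pbe : ~~ (p %| (b * e%:Z)%R)%Z.
    by rewrite dvdzE abszM -prime_coprime // coprimeMr pe (coprime_dvdl pd).
  rewrite chi_nat // kprod_prime // /kronecker_prime.
  have [p2|p2] := eqVneq p 2; first by move: pbe; rewrite p2 => pbe; rewrite qs_two.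
  by rewrite qs_odd_prime //; case: (even_prime pp) p2 => // ->.
by rewrite PoszM chiMr // rmorphM /= expnMn natrM; ring.
Qed.

End QuadraticGauss.

(** * Constant terms of expansions graded by an exponent *)

Section QExpansion.
Variables (R : realType) (N : nat) (T : choiceType) (e : T -> nat) (c : T -> R[i]).
Hypothesis N0 : (0 < N)%N.
Hypothesis ac : forall z : R[i], 0 < complex.Im z ->
  absum (fun x => c x * nome ((e x)%:R * (z / N%:R))).

(** Collects the terms of exponent [j]; [T] will be a lattice or a set of pairs of integers. *)
Definition qcoef (j : nat) : R[i] := csum (fun x => if e x == j then c x else 0).

Lemma absum_fiber j : absum (fun x => if e x == j then c x else 0).
Proof.
have i0 : 0 < complex.Im ('i : R[i]) by rewrite /= ltr01.
have h : absum (fun x => if e x == j then c x * nome ((e x)%:R * ('i / N%:R)) else 0).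
  apply: absum_le (ac i0) => x; case: ifP => // _; by rewrite cabs0.
have := absumZ (nome (j%:R * ('i / N%:R)))^-1 h.
rewrite (_ : (fun i => _) = fun x => if e x == j then c x else 0) //.
apply/funext => x; case: eqP => [->|_]; last by rewrite mulr0.
by rewrite mulrC mulfK // nome_neq0.
Qed.

(** Along [z = (t + 1) i] every term of positive exponent tends to 0, and the terms at [t = 0]
    dominate. Uniqueness of this limit allows constant terms to be compared. *)
Lemma qsum_lim :
  cvs (fun t => csum (fun x => c x * nome ((e x)%:R * (t.+1%:R * 'i / N%:R)))) (qcoef 0).
Proof.
have i0 : 0 < complex.Im ('i : R[i]) by rewrite /= ltr01.
have NR : 0 < N%:R :> R by rewrite ltr0n.
have imE t : complex.Im (t.+1%:R * 'i / N%:R : R[i]) = t.+1%:R / N%:R.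
  rewrite -!(rmorph_nat (@real_complex_def R (Phant R))) -fmorphV mulrC mulrA -rmorphM Im_realM /= mulr1 mulrC //.
have cn t x : cabs (nome ((e x)%:R * (t.+1%:R * 'i / N%:R) : R[i])) = expR (- (2 * pi * (e x)%:R * (t.+1%:R / N%:R))).
  rewrite cabs_nome -(rmorph_nat (@real_complex_def R (Phant R)) (e x)) Im_realM imE.
  by rewrite !mulrA.
have [] := @csum_cvs R T (fun t x => c x * nome ((e x)%:R * (t.+1%:R * 'i / N%:R)))
   (fun x => if e x == 0%N then c x else 0) (fun x => cabs (c x * nome ((e x)%:R * ('i / N%:R)))) 0 => //.
- exact: ac.
- move=> t x _; rewrite !cabsM ler_wpM2l //.
  have := cn 0%N x; rewrite mul1r => ->; rewrite cn ler_expR lerN2.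
  by rewrite ler_wpM2l ?mulr_ge0 ?pi_ge0 // ler_wpM2r ?invr_ge0 ?ler1n // ltW.
move=> x; case: eqP => [->|/eqP ex].
  have -> : (fun t => c x * nome (0%:R * (t.+1%:R * 'i / N%:R))) = fun=> c x.
    by apply/funext => t; rewrite mul0r nome0 mulr1.
  exact: cvs_cst.
apply: (@cvs_squeeze _ _ (fun t => cabs (c x) * (N%:R / (2 * pi * (e x)%:R)) / t.+1%:R)).
  move=> t; rewrite cabsM -[leRHS]mulrA ler_wpM2l // cn.
  set y : R := 2 * pi * (e x)%:R * (t.+1%:R / N%:R).
  have ex0 : 0 < (e x)%:R :> R by rewrite ltr0n lt0n.
  have y0 : 0 < y by apply: mulr_gt0; [rewrite !mulr_gt0 ?pi_gt0|rewrite divr_gt0 ?ltr0n].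
  have -> : N%:R / (2 * pi * (e x)%:R) / t.+1%:R = y^-1.
    by rewrite /y [RHS]invfM invf_div [LHS]mulrAC mulrC.
  by rewrite expRN lef_pV2 ?posrE ?expR_gt0 //; apply: le_trans (expR_ge1Dx _); rewrite lerDr.
move=> d d0; exists (Num.truncn (cabs (c x) * (N%:R / (2 * pi * (e x)%:R)) / d)).+1 => t ht.
have t0 : 0 < t.+1%:R :> R by rewrite ltr0n.
rewrite ltr_pdivrMr // -ltr_pdivrMl // mulrC.
apply: lt_le_trans (truncnS_gt _) _; rewrite ler_nat; exact: leq_trans ht (leqnSn _).
Qed.

End QExpansion.

(** * Integer matrices of size two and the slash operator *)

Section Modular2.
Variable R : realType.
Implicit Types (z : R[i]) (g h : 'M[int]_2).

Definition mk2 (a b c d : int) : 'M[int]_2 :=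
  \matrix_(i, j) if i == 0 then (if j == 0 then a else b) else (if j == 0 then c else d).

Lemma mk2E a b c d : (mk2 a b c d 0 0 = a) * (mk2 a b c d 0 1 = b) *
  (mk2 a b c d 1 0 = c) * (mk2 a b c d 1 1 = d).
Proof. by rewrite !mxE. Qed.

Lemma mx2P g h : g 0 0 = h 0 0 -> g 0 1 = h 0 1 -> g 1 0 = h 1 0 -> g 1 1 = h 1 1 -> g = h.
Proof.
move=> e1 e2 e3 e4; apply/matrixP => i j.
have P (u : 'I_2) : u = 0 \/ u = 1.
  by case: u => -[|[|u]] // lt; [left|right]; apply: val_inj.
by case: (P i) => ->; case: (P j) => ->.
Qed.

Lemma det2 g : \det g = g 0 0 * g 1 1 - g 0 1 * g 1 0.
Proof.
have l0 : lift (0 : 'I_2) (0 : 'I_1) = 1 by apply/val_inj.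
have l1 : lift (1 : 'I_2) (0 : 'I_1) = 0 by apply/val_inj.
have o1 : lift ord0 ord0 = 1 :> 'I_2 by apply/val_inj.
rewrite (expand_det_row _ 0) big_ord_recl big_ord1 o1 /cofactor !det_mx11 !mxE l0 l1 /=.
by rewrite expr0 expr1; ring.
Qed.

Lemma mul2E g h i j : (g *m h) i j = g i 0 * h 0 j + g i 1 * h 1 j.
Proof.
have o1 : lift ord0 ord0 = 1 :> 'I_2 by apply/val_inj.
by rewrite mxE big_ord_recl big_ord1 o1.
Qed.

Lemma SL2P g : SL2Z g <-> g 0 0 * g 1 1 - g 0 1 * g 1 0 = 1.
Proof. by rewrite /SL2Z /= det2. Qed.

Lemma SL2M g h : SL2Z g -> SL2Z h -> SL2Z (g *m h).
Proof. by rewrite /SL2Z /= det_mulmx => -> ->; rewrite mulr1. Qed.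

Lemma automorphy_neq0 g z : SL2Z g -> 0 < complex.Im z -> automorphy g z != 0.
Proof.
move=> /SL2P dg z0; apply/eqP => E; move: (congr1 (@complex.Im R) E).
rewrite /automorphy Im_add Im_int addr0 -(rmorph_int (@real_complex_def R (Phant R))) Im_realM /= => /eqP.
rewrite mulf_eq0 (gt_eqF z0) orbF intr_eq0 => /eqP c0.
move: E; rewrite /automorphy c0 mul0r add0r => /eqP; rewrite intr_eq0 => /eqP d0.
by move: dg; rewrite c0 d0 !mulr0 subrr.
Qed.

Lemma Im_moebius g z : SL2Z g -> 0 < complex.Im z -> 0 < complex.Im (moebius g z).
Proof.
move=> sg z0; have a0 := automorphy_neq0 sg z0; move/SL2P: sg => dg.
have c0 : 0 < cabs (automorphy g z) ^+ 2 by rewrite exprn_gt0 // cabs_gt0.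
suff -> : complex.Im (moebius g z) = complex.Im z / cabs (automorphy g z) ^+ 2 by rewrite divr_gt0.
have dgR : (g 0 0)%:~R * (g 1 1)%:~R - (g 0 1)%:~R * (g 1 0)%:~R = 1 :> R.
  by rewrite -!rmorphM -rmorphB /= dg.
move: c0; rewrite /moebius /automorphy cabs_sqr.
rewrite -!(rmorph_int (@real_complex_def R (Phant R))).
move: dgR; move: (g 0 0)%:~R (g 0 1)%:~R (g 1 0)%:~R (g 1 1)%:~R => a b c d dgR.
case: z z0 {a0} => x y /= y0; rewrite !(mul0r, subr0, addr0, oppr0, mulr0, add0r).
move=> /gt_eqF/negbT n0; rewrite -[RHS]mul1r -dgR.
by field.
Qed.

Lemma automorphyM g h z : automorphy h z != 0 ->
  automorphy (g *m h) z = automorphy g (moebius h z) * automorphy h z.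
Proof.
rewrite /moebius /automorphy => a0; rewrite !mul2E !rmorphD !rmorphM /=.
by field.
Qed.

Lemma moebiusM g h z : automorphy h z != 0 -> automorphy g (moebius h z) != 0 ->
  moebius (g *m h) z = moebius g (moebius h z).
Proof.
have mE g' w : moebius g' w = ((g' 0 0)%:~R * w + (g' 0 1)%:~R) / automorphy g' w by [].
move=> a0 b0; rewrite [LHS]mE [RHS]mE automorphyM //.
move: b0; move: (automorphy g _) => B b0; rewrite mE; move: a0; rewrite /automorphy => a0.
by rewrite !mul2E !rmorphD !rmorphM /=; field; rewrite a0 b0.
Qed.

Lemma slashM k (f : R[i] -> R[i]) g h z : SL2Z g -> SL2Z h -> 0 < complex.Im z ->
  slash k f (g *m h) z = automorphy h z ^- k * slash k f g (moebius h z).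
Proof.
move=> sg sh z0; have h0 := automorphy_neq0 sh z0.
have g0 := automorphy_neq0 sg (Im_moebius sh z0).
by rewrite /slash moebiusM // automorphyM // exprMn invfM mulrA [X in X * _ = _]mulrC.
Qed.

End Modular2.

(** * Modularity of theta on [Gamma0 N] and its constant terms *)

Section ThetaGamma0.
Variable R : realType.
Variable k : nat.
Local Notation m := k.*2.
Local Notation N := k.*2.+1.
Local Notation th := (@f_theta R k.*2).
Implicit Types (z w : R[i]) (g : 'M[int]_2) (n : 'rV[int]_k.*2).

(** [N] times the dual form, in a shape that is visibly an integer. *)
Definition qdz n : int := N%:Z * theta n - k.+1%:Z * vsum n ^+ 2.

Lemma qdz2 n : 2 * qdz n = N%:Z * vsq n - vsum n ^+ 2.
Proof.
have -> : N%:Z = 2 * k%:Z + 1 by lia.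
have e : k.+1%:Z = k%:Z + 1 by lia.
by rewrite /qdz mulrBr mulrCA theta2 e (_ : N%:Z = 2 * k%:Z + 1); [ring|lia].
Qed.

(** Lagrange's identity: the difference is half the sum of all [(n_i - n_j)^2]. *)
Lemma vsq_CS n : vsum n ^+ 2 <= m%:Z * vsq n.
Proof.
have : 0 <= \sum_i \sum_j (n 0 i - n 0 j) ^+ 2.
  by apply: sumr_ge0 => i _; apply: sumr_ge0 => j _; exact: sqr_ge0.
suff -> : \sum_i \sum_j (n 0 i - n 0 j) ^+ 2 = 2 * (m%:Z * vsq n - vsum n ^+ 2) by lia.
have e i : \sum_j (n 0 i - n 0 j) ^+ 2 = m%:Z * n 0 i ^+ 2 + vsq n - 2 * vsum n * n 0 i.
  have -> : m%:Z * n 0 i ^+ 2 = \sum_(j < m) n 0 i ^+ 2 by rewrite sumr_const card_ord -mulr_natl natz.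
  rewrite /vsq /vsum mulr_sumr mulr_suml -big_split -sumrB /=; apply: eq_bigr => j _; ring.
rewrite (eq_bigr _ (fun i _ => e i)) sumrB big_split /= -!mulr_sumr sumr_const card_ord -/(vsq n) -/(vsum n).
rewrite -mulr_natl natz; ring.
Qed.

Lemma qdz_ge n : vsq n <= 2 * qdz n.
Proof. by rewrite qdz2 intS mulrDl mul1r; have := vsq_CS n; lia. Qed.

Lemma qdz_ge0 n : 0 <= qdz n.
Proof. by have := qdz_ge n; have := vsq_ge0 n; lia. Qed.

Lemma vsq_eq0 n : vsq n = 0 -> n = 0.
Proof.
move=> /eqP; rewrite /vsq psumr_eq0 => [/allP h|i _]; last exact: sqr_ge0.
by apply/rowP => i; rewrite mxE; apply/eqP; rewrite -sqrf_eq0; apply: h; rewrite mem_index_enum.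
Qed.

Definition qdn n : nat := `|qdz n|%N.

Lemma qdn_eq0 n : (qdn n == 0%N) = (n == 0).
Proof.
apply/eqP/eqP => [h|->].
  apply: vsq_eq0; have := qdz_ge n; have := vsq_ge0 n; move: h; rewrite /qdn; lia.
by rewrite /qdn /qdz /theta /vsum !big1 ?mulr0 ?expr0n ?mulr0 ?subr0 ?addr0 // => i _; rewrite ?mxE ?expr0n //;
  rewrite big1 // => j _; rewrite !mxE mul0r.
Qed.

Lemma qdualE n : qdual R n = (qdn n)%:R / N%:R.
Proof.
have N0 : N%:R != 0 :> R[i] by rewrite pnatr_eq0.
have -> : (qdn n)%:R = (qdz n)%:~R :> R[i].
  by rewrite -[(qdn n)%:R]/((qdn n)%:Z%:~R) /qdn gez0_abs // qdz_ge0.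
have h : 2 * (qdz n)%:~R = N%:R * (vsq n)%:~R - (vsum n)%:~R ^+ 2 :> R[i].
  have := congr1 (fun x : int => x%:~R : R[i]) (qdz2 n).
  by rewrite !(rmorphXn, rmorphB, rmorphM).
rewrite /qdual; move: N0 h; move: (N%:R) ((vsq n)%:~R) ((vsum n)%:~R) ((qdz n)%:~R) => M A B C M0 h.
have -> : A = (2 * C + B ^+ 2) / M by rewrite h subrK mulrC mulKf.
by field; rewrite M0.
Qed.

(** Completing the square modulo [d]. The vector [t] is [c] times the inverse Gram matrix applied to
    [n], integral because [N] divides [c]. Since [b c] is [-1] modulo [d], translating by [t]
    removes the linear term and leaves the dual form of [n] as a phase. *)
Lemma gsum_shift (a b c' : int) d n : (0 < d)%N -> a * d%:Z - b * (N%:Z * c') = 1 ->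
  gsum R b d n = qs R m b d * nome ((N%:Z * c')%:~R * qdual R n / d%:R).
Proof.
move=> d0 det; set c := N%:Z * c' in det *.
pose t : 'rV[int]_m := \row_i (c * n 0 i - c' * vsum n).
have st : vsum t = c' * vsum n.
  have -> : vsum t = c * vsum n - m%:Z * (c' * vsum n).
    rewrite /vsum mulr_sumr -[m%:Z]natz mulr_natl -[X in _ *+ X](card_ord m) -sumr_const -sumrB.
    by apply: eq_bigr => i _; rewrite mxE.
  by rewrite /c intS; ring.
have ty y : vdot y t + vsum y * vsum t = c * vdot n y.
  have e1 : vsum y * (c' * vsum n) = \sum_i y 0 i * (c' * vsum n) by exact: mulr_suml.
  rewrite st e1 /vdot [c * _]mulr_sumr -big_split; apply: eq_bigr => i _ /=.
  by rewrite mxE; ring.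
pose q := c' * qdz n.
have nt : vdot n t = 2 * q.
  have -> : vdot n t = c * vsq n - c' * vsum n ^+ 2.
    rewrite /vdot /vsq mulr_sumr expr2 mulrA {2}/vsum mulr_sumr -sumrB; apply: eq_bigr => i _.
    by rewrite mxE; ring.
  by transitivity (c' * (2 * qdz n)); [rewrite qdz2 /c; ring|rewrite /q; ring].
have tt : theta t = c * q.
  suff : 2 * theta t = 2 * (c * q) by lia.
  rewrite theta2; have -> : vsq t = vdot t t by apply: eq_bigr => i _; rewrite expr2.
  by rewrite expr2 ty nt; ring.
rewrite gsumE (@sum_res_bij _ m d _ (fun y : 'rV['I_d]_m => res y + t) (fun x => ze R d (b * theta x + vdot n x))) //; last 3 first.
- by rewrite card_mx card_ord mul1n.
- move=> x y xy; apply: ze_mod => //.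
  rewrite (_ : _ - _ = b * (theta x - theta y) + (vdot n x - vdot n y)); last by ring.
  by rewrite rpredD ?vdot_cong // dvdz_mull // theta_cong.
- move=> x y xy; apply/rowP => i; apply: dvdz_ord; have := xy i.
  by rewrite !mxE opprD addrACA subrr addr0.
rewrite /qs mulr_suml; apply: eq_bigr => y _.
have -> : nome (c%:~R * qdual R n / d%:R) = ze R d q.
  rewrite /ze; congr nome; congr (_ / _); rewrite qdualE /c /q !rmorphM /=.
  rewrite (_ : (qdz n)%:~R = (qdn n)%:R); last by rewrite -[RHS]/((qdn n)%:Z%:~R) /qdn gez0_abs // qdz_ge0.
  have N0 : N%:R != 0 :> R[i] by rewrite pnatr_eq0.
  rewrite -[N%:~R]/(N%:R); move: N0; move: (N%:R) ((qdn n)%:R) => M A M0; by field.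
rewrite -zeD; apply: ze_mod => //.
rewrite thetaD vdotDr ty nt tt; apply/dvdzP; exists (a * (vdot n (res y) + q)).
transitivity ((b * c + 1) * (vdot n (res y) + q)); first by ring.
by rewrite -det; ring.
Qed.

Lemma theta_S u : 0 < complex.Im u ->
  absum (fun n => nome (qdual R n * u)) /\
  th (- u^-1) = (u / 'i) ^+ k / (Num.sqrt N%:R)%:C * csum (fun n => nome (qdual R n * u)).
Proof.
move=> u0; have [] := @theta_transform R k 0 1 u isT u0.
have e n : gsum R 0 1 n * nome (qdual R n * u / 1%:R) = nome (qdual R n * u).
  rewrite divr1 gsumE -[RHS]mul1r; congr (_ * _).
  rewrite (bigD1 (const_mx ord0)) //= big1 ?addr0; first by rewrite ze_dvd // dvd1z.
  by move=> y /eqP[]; apply/rowP => i; rewrite [y 0 i]ord1 mxE.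
rewrite (funext e) => ha; rewrite mul0r sub0r mul1r mulr1 => hb; split=> //.
Qed.

(** Both sides reduce to the same dual series: the left one by [theta_transform] at the rational
    [b / d], with [w = d u - c] and [u = -1 / z], the right one by [theta_S]. The phase from
    [gsum_shift] turns [w / d] back into [u], and what remains is the Gauss sum modulo [d], which is
    prime to [N]. *)
Lemma theta_Gamma0_pos g z : Gamma0 N g -> 0 < g 1 1 -> 0 < complex.Im z ->
  th (moebius g z) = (chi N (g 1 1))%:~R * automorphy g z ^+ k * th z.
Proof.
move=> [sg /dvdzP[c' cE]] d0 z0; have /SL2P dg := sg.
have [d dE] : exists d : nat, g 1 1 = d%:Z by exists `|(g 1 1)%R|%N; rewrite gez0_abs // ltW.
rewrite dE in d0 dg *; have d0' : (0 < d)%N by rewrite ltz_nat in d0.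
have dR : d%:R != 0 :> R[i] by rewrite pnatr_eq0 -lt0n.
have zn0 : z != 0 by apply: contraTneq z0 => ->; rewrite ltxx.
pose u := - z^-1.
have u0 : 0 < complex.Im u.
  have : 0 < complex.Im z / cabs z ^+ 2 by rewrite divr_gt0 // exprn_gt0 // cabs_gt0.
  by rewrite /u cabs_sqr; case: (z) => p q /=; rewrite opprK.
have un0 : u != 0 by apply: contraTneq u0 => ->; rewrite ltxx.
have zE : z = - u^-1 by rewrite /u invrN invrK opprK.
set c := g 1 0 in cE dg *; set b := g 0 1 in dg *; set a := g 0 0 in dg *.
pose w := d%:R * u - c%:~R.
have w0 : 0 < complex.Im w.
  rewrite /w Im_add -rmorphN /= Im_int addr0 -(rmorph_nat (@real_complex_def R (Phant R))) Im_realM.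
  by rewrite mulr_gt0 // ltr0n.
have wn0 : w != 0 by apply: contraTneq w0 => ->; rewrite ltxx.
have aw : automorphy g z = w / u.
  by rewrite /automorphy -/c dE zE /w -[d%:~R]/(d%:R); field.
have mz : moebius g z = b%:~R / d%:R - (d%:R * w)^-1.
  have dgC : a%:~R * d%:R - b%:~R * c%:~R = 1 :> R[i].
    by rewrite -[d%:R]/(d%:Z%:~R) -!rmorphM -rmorphB /= dg.
  rewrite /moebius aw -/a -/b zE; rewrite [RHS](_ : _ = (b%:~R * w - 1) / (d%:R * w)); last by field; rewrite dR wn0.
  have -> : b%:~R * w - 1 = d%:R * (b%:~R * u - a%:~R) by rewrite /w -[X in _ - X]dgC; ring.
  by field; rewrite wn0 dR un0.
have [a1 e1] := @theta_transform R k b d w d0' w0; have [a2 e2] := theta_S u0.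
have det : a * d%:Z - b * (N%:Z * c') = 1 by rewrite -dg cE; ring.
have gs n : gsum R b d n * nome (qdual R n * w / d%:R) = qs R m b d * nome (qdual R n * u).
  rewrite (gsum_shift _ d0' det) -mulrA -nomeD; congr (_ * nome _).
  rewrite /w cE !rmorphM /=; move: (N%:~R) (c'%:~R) => M C; by field.
rewrite mz e1 (eq_csum gs) csumZ // zE e2 -zE.
have bd : coprime d `|b|%N.
  have : coprimez d b by apply/coprimezP; exists (a, - (N%:Z * c')); rewrite /= -det; ring.
  by rewrite coprimezE.
have Nd : coprime d N.
  have : coprimez d N by apply/coprimezP; exists (a, - (b * c')); rewrite /= -det; ring.
  by rewrite coprimezE.
rewrite qs_chi // natrX aw.
have i0 : ('i : R[i]) != 0 by rewrite eq_complex /= oner_eq0 andbF.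
have -> : (w / ('i * d%:R)) ^+ k = (w / u) ^+ k * (u / 'i) ^+ k / d%:R ^+ k.
  by rewrite -exprMn -exprVn -exprMn; congr (_ ^+ _); field; rewrite i0 dR un0.
have dk : d%:R ^+ k != 0 :> R[i] by rewrite expf_neq0.
move: dk; move: ((w / u) ^+ k) ((u / 'i) ^+ k) (d%:R ^+ k) ((Num.sqrt N%:R)%:C) => X Y D S dk.
rewrite -!mulrA [Y * _]mulrC -!mulrA; rewrite mulrCA.
rewrite [LHS](_ : _ = (D^-1 * D) * ((chi N d)%:~R * (X * (Y * (S^-1 * csum (fun n => nome (qdual R n * u))))))); last by ring.
by rewrite mulVf // mul1r; ring.
Qed.

Lemma theta_Gamma0 g z : (0 < k)%N -> Gamma0 N g -> 0 < complex.Im z ->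
  th (moebius g z) = (chi N (g 1 1))%:~R * automorphy g z ^+ k * th z.
Proof.
move=> k0 Gg z0; case: (ltrgt0P (g 1 1)) => [d0|d0|d0].
- exact: theta_Gamma0_pos.
- have Gg' : Gamma0 N (- g).
    case: Gg => /SL2P sg cg; split; last by rewrite mxE rpredN.
    by apply/SL2P; rewrite !mxE !mulrNN.
  have aN : automorphy (- g) z = - automorphy g z.
    by rewrite /automorphy !mxE !rmorphN /= mulNr -opprD.
  have mN : moebius (- g) z = moebius g z.
    by rewrite /moebius aN !mxE !rmorphN /= mulNr -opprD invrN mulrNN.
  have := theta_Gamma0_pos Gg' _ z0; rewrite mN aN mxE oppr_gt0 => /(_ d0) ->.
  have -> : chi N (- g 1 1) = (-1) ^+ k * chi N (g 1 1).
    rewrite chiN; last by rewrite /= odd_double.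
    by rewrite /= (_ : (m %/ 2)%N = k) // -muln2 mulnK.
  rewrite rmorphM rmorphXn rmorphN /= rmorph1 [(- automorphy _ _) ^+ _]exprNn.
  have s2 : ((-1) ^+ k) ^+ 2 = 1 :> R[i] by rewrite -exprM mulnC exprM sqrrN expr1n expr1n.
  transitivity (((-1) ^+ k) ^+ 2 * ((chi N (g 1 1))%:~R * automorphy g z ^+ k * th z)); first by ring.
  by rewrite s2 mul1r.
(* If the lower right entry is 0, the determinant makes [N] divide 1, contrary to [k > 0]. *)
case: Gg => /SL2P; rewrite d0 mulr0 sub0r => dg /dvdzP[c' cE].
have : (N %| (1 : int)%R)%Z by apply/dvdzP; exists (- g 0 1 * c'); rewrite -dg cE; ring.
by rewrite dvdz1 /=; case: (k) k0.
Qed.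

Lemma theta_i_neq0 : th 'i != 0.
Proof.
have i0 : 0 < complex.Im ('i : R[i]) by rewrite /= ltr01.
rewrite f_thetaE //.
apply: (@csum_pos_neq0 _ _ _ (fun x : 'rV[int]_m => expR (- (2 * pi * (theta x)%:~R))) 0); last exact: absum_theta.
- move=> x; rewrite nomeE -(rmorph_int (@real_complex_def R (Phant R))) /cexp /=.
  by rewrite !(mulr0, mul0r, mulr1, addr0, add0r, subr0, oppr0) cos0 sin0 mulr1 mulr0.
- by move=> x; exact: expR_ge0.
- exact: expR_gt0.
Qed.

(** The matrices [g] and [h = g T1], with [T1] the translation by 1, have lower right entries [d]
    and [d + N]. The transformation law at [i], applied to [h] directly and in two steps to [g] and
    [T1], expresses the same number by the theta value at [i], which is not zero. *)
Lemma chi_perN (d : int) : (0 < k)%N -> chi N (d + N%:Z) = chi N d.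
Proof.
move=> k0; have oN : odd N by rewrite /= odd_double.
case: (boolP (coprime N `|d|%N)) => [cop|ncop]; last first.
  have : chi N d = 0 by apply/eqP; rewrite chi_eq0.
  move=> ->; apply/eqP; rewrite chi_eq0 //; apply: contra ncop => h.
  have : coprimez N (d + N%:Z) by rewrite coprimezE.
  move=> /coprimezP[[u v] /= E]; rewrite -[coprime _ _](coprimezE N%:Z).
  by apply/coprimezP; exists (u + v, v); rewrite /= -E; ring.
have : coprimez N d by rewrite coprimezE.
move=> /coprimezP[[u v] /= E].
have i0 : 0 < complex.Im ('i : R[i]) by rewrite /= ltr01.
have j0 : 0 < complex.Im ('i + 1 : R[i]) by rewrite /= addr0 ltr01.
pose g := mk2 v (- u) N d; pose h := mk2 v (v - u) N (d + N%:Z); pose T1 := mk2 1 1 0 1.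
have Gg : Gamma0 N g by split; [apply/SL2P; rewrite !mk2E -E; ring|rewrite mk2E].
have Gh : Gamma0 N h by split; [apply/SL2P; rewrite !mk2E -E; ring|rewrite mk2E].
have GT : Gamma0 N T1 by split; [apply/SL2P; rewrite !mk2E|rewrite mk2E].
have mT : moebius T1 ('i : R[i]) = 'i + 1 by rewrite /moebius /automorphy !mk2E mulr0z !mulr1z mul1r mul0r add0r divr1.
have ag z : automorphy g (z + 1) = automorphy h z.
  by rewrite /automorphy !mk2E rmorphD /=; ring.
have mg z : moebius g (z + 1) = moebius h z.
  by rewrite /moebius ag !mk2E rmorphN rmorphB /=; congr (_ / _); ring.
have := theta_Gamma0 k0 Gg j0; rewrite mg (theta_Gamma0 k0 Gh i0) -mT (theta_Gamma0 k0 GT i0) mT.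
rewrite ag.
have -> : automorphy T1 ('i : R[i]) = 1 by rewrite /automorphy !mk2E mulr0z mulr1z mul0r add0r.
rewrite !mk2E chi_1 // expr1n !mul1r => /(mulIf theta_i_neq0)/(mulIf _) H.
apply/eqP; rewrite -(eqr_int R[i]); apply/eqP/H.
by rewrite expf_neq0 // automorphy_neq0 //; case: Gh.
Qed.

(** With [w] the automorphy factor, [moebius g z] is [a / c - 1 / (c w)], the shape required by
    [theta_transform]; the translation part of [w] goes into the coefficients. *)
Lemma theta_cusp g : SL2Z g -> 0 < g 1 0 -> exists C : 'rV[int]_m -> R[i],
  [/\ forall z, 0 < complex.Im z -> absum (fun n => C n * nome ((qdn n)%:R * (z / N%:R))),
     C 0 = ('i * (g 1 0)%:~R) ^- k / (Num.sqrt N%:R)%:C * qs R m (g 0 0) `|(g 1 0)%R|%N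
   & forall z, 0 < complex.Im z ->
     th (moebius g z) = automorphy g z ^+ k * csum (fun n => C n * nome ((qdn n)%:R * (z / N%:R)))].
Proof.
move=> sg c0; have /SL2P dg := sg.
have [c cE] : exists c : nat, g 1 0 = c%:Z by exists `|(g 1 0)%R|%N; rewrite gez0_abs // ltW.
have c0' : (0 < c)%N by rewrite cE ltz_nat in c0.
have cR : c%:R != 0 :> R[i] by rewrite pnatr_eq0 -lt0n.
have NR : N%:R != 0 :> R[i] by rewrite pnatr_eq0.
have i0 : ('i : R[i]) != 0 by rewrite eq_complex /= oner_eq0 andbF.
pose K : R[i] := ('i * c%:R) ^- k / (Num.sqrt N%:R)%:C.
pose C0 n : R[i] := gsum R (g 0 0) c n * nome (qdual R n * (g 1 1)%:~R / c%:R).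
have wE z : automorphy g z = c%:R * z + (g 1 1)%:~R by rewrite /automorphy cE.
have ImW z : 0 < complex.Im z -> 0 < complex.Im (automorphy g z).
  move=> z0; rewrite wE Im_add Im_int addr0 -(rmorph_nat (@real_complex_def R (Phant R))) Im_realM.
  by rewrite mulr_gt0 // ltr0n.
have CE z n : C0 n * nome ((qdn n)%:R * (z / N%:R)) = gsum R (g 0 0) c n * nome (qdual R n * automorphy g z / c%:R).
  rewrite /C0 -mulrA -nomeD wE qdualE; congr (_ * nome _).
  by move: NR cR; move: (N%:R) (c%:R) => M c' M0 c'0; field; rewrite M0 c'0.
have aC0 z : 0 < complex.Im z -> absum (fun n => C0 n * nome ((qdn n)%:R * (z / N%:R))).
  move=> z0; rewrite (funext (CE z)).
  by have [] := @theta_transform R k (g 0 0) c _ c0' (ImW z z0).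
exists (fun n => K * C0 n); split.
- move=> z z0; rewrite (_ : (fun n => _) = fun n => K * (C0 n * nome ((qdn n)%:R * (z / N%:R)))).
    by apply: absumZ; exact: aC0.
  by apply/funext => n; rewrite -mulrA.
- rewrite /C0 gsum0 cE /K -[c%:~R]/(c%:R); congr (_ * _).
  rewrite (_ : qdual R 0 = 0) ?mul0r ?nome0 ?mulr1 //.
  by rewrite qdualE; have /eqP -> : qdn 0 == 0%N; rewrite ?qdn_eq0 ?mul0r.
move=> z z0; have a0 := automorphy_neq0 sg z0.
have mz : moebius g z = (g 0 0)%:~R / c%:R - (c%:R * automorphy g z)^-1.
  have dgC : (g 0 0)%:~R * (g 1 1)%:~R - (g 0 1)%:~R * c%:R = 1 :> R[i].
    by rewrite -[c%:R]/(c%:Z%:~R) -cE -!rmorphM -rmorphB /= dg.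
  rewrite [RHS](_ : _ = ((g 0 0)%:~R * automorphy g z - 1) / (c%:R * automorphy g z)); last by field; rewrite cR a0.
  have -> : (g 0 0)%:~R * automorphy g z - 1 = c%:R * ((g 0 0)%:~R * z + (g 0 1)%:~R).
    by rewrite wE -[X in _ - X]dgC; ring.
  by rewrite /moebius; field; rewrite cR a0.
have [_ e1] := @theta_transform R k (g 0 0) c _ c0' (ImW z z0).
rewrite mz e1 -(eq_csum (CE z)).
rewrite (_ : csum (fun n => K * C0 n * _) = K * csum (fun n => C0 n * nome ((qdn n)%:R * (z / N%:R)))); last first.
  by rewrite -csumZ; [apply: eq_csum => n; rewrite -mulrA|exact: aC0].
by rewrite mulrA; congr (_ * _); rewrite /K expr_div_n !mulrA.
Qed.

Lemma qcoef0 (C : 'rV[int]_m -> R[i]) : qcoef (@qdn) C 0 = C 0.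
Proof.
rewrite /qcoef (@csum_fin _ _ _ [fset (0 : 'rV[int]_m)]%fset) ?big_seq_fset1.
  by rewrite qdn_eq0 eqxx.
by move=> n; rewrite inE qdn_eq0 => /negbTE ->.
Qed.

(** The factor [N] accounts for the local variable [nome (z / N)] in which all expansions are
    written. *)
Definition theta_exponent (x : 'rV[int]_m) : nat := (N * `|theta x|)%N.

Lemma theta_qexp z : 0 < complex.Im z ->
  absum (fun x => 1 * nome ((theta_exponent x)%:R * (z / N%:R))) /\
  th z = csum (fun x => 1 * nome ((theta_exponent x)%:R * (z / N%:R))).
Proof.
move=> z0; have NR : N%:R != 0 :> R[i] by rewrite pnatr_eq0.
have e x : 1 * nome ((theta_exponent x)%:R * (z / N%:R)) = nome ((theta x)%:~R * z).
  rewrite mul1r /theta_exponent natrM; congr nome.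
  have -> : (`|theta x|%N)%:R = (theta x)%:~R :> R[i].
    by rewrite -[in RHS](gez0_abs (theta_ge0 x)).
  by move: NR; move: (N%:R) => M M0; field.
rewrite (funext e); split; first exact: absum_theta.
exact: f_thetaE.
Qed.

Lemma theta_qcoef0 : qcoef theta_exponent (fun=> 1) 0 = 1 :> R[i].
Proof.
rewrite /qcoef (@csum_fin _ _ _ [fset (0 : 'rV[int]_m)]%fset) ?big_seq_fset1.
  rewrite /theta_exponent (_ : theta 0 = 0) ?muln0 //.
  by have := thetaZ 0 (0 : 'rV[int]_m); rewrite scale0r expr0n mul0r.
move=> x; rewrite inE => x0; case: eqP => // /eqP; rewrite /theta_exponent muln_eq0 /= absz_eq0 => /eqP t0.
case/eqP: x0; apply: vsq_eq0; have := theta_ge x; have := vsq_ge0 x; lia.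
Qed.

(** For [g] in [Gamma0 N] the expansion of [theta_cusp] must agree with the transformation law;
    comparing constant terms evaluates the Gauss sum modulo [N] itself. Reciprocity ([chi_prime])
    and the sign of the Gauss sum ([gauss_half]) are drawn from this identity. *)
Lemma theta_const (a b d : int) : (0 < k)%N -> a * d - b * N%:Z = 1 ->
  (chi N d)%:~R = ('i * N%:R) ^- k / (Num.sqrt N%:R)%:C * qs R m a N.
Proof.
move=> k0 det; pose g := mk2 a b N d.
have sg : SL2Z g by apply/SL2P; rewrite !mk2E.
have Gg : Gamma0 N g by split; rewrite // mk2E.
have [|C [aC C0 CE]] := theta_cusp sg; first by rewrite mk2E.
have l1 := qsum_lim (isT : 0 < N)%N aC; rewrite qcoef0 C0 !mk2E in l1.
have aq z : 0 < complex.Im z -> absum (fun x => 1 * nome ((theta_exponent x)%:R * (z / N%:R))).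
  by move=> z0; case: (theta_qexp z0).
have l2 := qsum_lim (isT : 0 < N)%N aq; rewrite theta_qcoef0 in l2.
have l3 := cvsZ (chi N d)%:~R l2; rewrite mulr1 in l3.
apply: cvs_unique l3 _; rewrite (_ : (fun t => _) = fun t => csum (fun x => C x * nome ((qdn x)%:R * (t.+1%:R * 'i / N%:R)))) //.
apply/funext => t; have t0 : 0 < complex.Im (t.+1%:R * 'i : R[i]).
  by rewrite -(rmorph_nat (@real_complex_def R (Phant R))) Im_realM /= mulr1 ltr0n.
have [_ <-] := theta_qexp t0.
have a0 : automorphy g (t.+1%:R * 'i : R[i]) ^+ k != 0 by rewrite expf_neq0 // automorphy_neq0.
apply: (mulfI a0); rewrite -(CE _ t0) (theta_Gamma0 k0 Gg t0) mk2E; ring.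
Qed.

(** In [qs_square] the last factor has the coefficient [- N ga], which is 0 modulo [d], so that
    factor is just [d]. *)
Lemma qs_dvd (a : int) d : odd d -> (d %| N)%N -> coprime d `|a|%N ->
  qs R m a d = g1 R d (a * (d.+1./2)%:Z) ^+ N.
Proof.
move=> od dN da; have d0 := odd_gt0 od.
have h2 : (d.+1./2).*2 = d.+1 by rewrite even_halfK //= od.
have : coprimez d (4 * (a * (d.+1./2)%:Z)).
  have -> : 4 * (a * (d.+1./2)%:Z) = 2 * a * d.+1%:Z by rewrite (_ : d.+1%:Z = 2 * (d.+1./2)%:Z); [ring|lia].
  rewrite coprimezE !abszM !coprimeMr da coprimenS andbT /=.
  by rewrite coprime_sym coprime2n od.
move=> /coprimezP[[u ga] /= E].
have dR : d%:R != 0 :> R[i] by rewrite pnatr_eq0 -lt0n.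
apply: (mulfI dR).
rewrite (@qs_square R m a d (a * (d.+1./2)%:Z) ga) //; last 2 first.
- by apply/dvdzP; exists (- u); rewrite -[X in _ - X]E; ring.
- apply/dvdzP; exists (- a); have : 2 * (d.+1./2)%:Z = d%:Z + 1 by lia.
  by move=> e2; transitivity (a - a * (2 * (d.+1./2)%:Z)); [ring|rewrite e2; ring].
rewrite mulrC; congr (_ * _).
rewrite /g1 (eq_bigr (fun=> 1)) ?sumr_const ?card_ord // => u' _.
by rewrite ze_dvd // dvdz_mulr // rpredN dvdz_mulr.
Qed.

End ThetaGamma0.

(** The argument [R] appears because periodicity is obtained analytically, from [chi_perN]. *)
Lemma chi_mod (R : realType) a (b b' : int) : odd a -> (a %| (b - b')%R)%Z -> chi a b = chi a b'.
Proof.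
move=> oa; have [->|a1] := eqVneq a 1%N; first by rewrite !chi1E.
pose k := a./2; have aE : a = k.*2.+1 by rewrite -[LHS]odd_double_half oa.
have k0 : (0 < k)%N by rewrite lt0n; apply: contra_neq a1 => k0; rewrite aE k0.
have per d : chi a (d + a%:Z) = chi a d by rewrite aE; exact: chi_perN R k d k0.
have pern d n : chi a (d + n%:Z * a%:Z) = chi a d.
  elim: n => [|n IHn]; first by rewrite mul0r addr0.
  by rewrite intS mulrDl mul1r addrCA addrC per.
move=> /dvdzP[q /eqP]; rewrite subr_eq => /eqP ->; rewrite addrC.
case: q => n; first exact: pern.
by rewrite -(pern _ n.+1); congr chi; rewrite NegzE; ring.
Qed.

(** * Gauss sums of the characters [chi d] *)

Section CharacterSums.
Variable R : realType.
Implicit Types (c d p : nat).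
Local Notation ze := (@ze R).
Local Notation gq := (@g1 R).

Definition Tsum d (m : int) : R[i] := \sum_(b < d) (chi d (b : nat)%:Z)%:~R * ze d (m * (b : nat)%:Z).

(** This is quadratic reciprocity, as [chi p] is defined by symbols at the primes of its argument.
    Comparing [theta_const] at level [p] for a matrix with diagonal [a], [d] with the same identity
    for [a = d = 1] leaves [leg a] to the odd power [p], and [a] is inverse to [d] modulo [p]. *)
Lemma chi_prime p (d : int) : prime p -> odd p -> chi p d = leg (d%:~R : 'F_p).
Proof.
move=> pp op; case: (boolP (p %| d)%Z) => [pd|npd].
  have /eqP -> : (d%:~R : 'F_p) == 0 by rewrite intr_Fp_eq0.
  by rewrite leg0; apply/eqP; rewrite chi_eq0 // prime_coprime // negbK -[p]/(`|p%:Z|%N) -dvdzE.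
pose k := p./2; have pE : p = k.*2.+1 by rewrite -[LHS]odd_double_half op.
have k0 : (0 < k)%N by rewrite lt0n; apply: contraTneq pp => k0; rewrite pE k0.
have : coprimez p d by rewrite coprimezE prime_coprime // -dvdzE.
move=> /coprimezP[[u a] /= E].
have det : a * d - (- u) * k.*2.+1%:Z = 1 by rewrite -pE -E; ring.
have det1 : 1 * 1 - 0 * k.*2.+1%:Z = 1 by rewrite mul0r subr0.
have pa : ~~ (p %| a)%Z.
  apply/negP => /dvdzP[q aq]; have : (p %| (1 : int)%R)%Z.
    by apply/dvdzP; exists (u + q * d); rewrite -E aq; ring.
  by rewrite dvdz1 /= => /eqP p1; rewrite p1 in pp.
have c1 := theta_const R k0 det; have c2 := theta_const R k0 det1.
have oN : odd k.*2.+1 by rewrite -pE.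
rewrite chi_1 // in c2.
move: c1 c2; rewrite !qs_dvd -?pE //; last 2 first.
- by rewrite coprimen1.
- by rewrite prime_coprime // -[p]/(`|p%:Z|%N) -dvdzE.
have ha : ~~ (p %| (p.+1./2)%:Z)%Z.
  rewrite dvdzE /=; apply/negP => /dvdn_leq; have := prime_gt1 pp; move: op; clear; lia.
have hF : ((p.+1./2)%:Z%:~R : 'F_p) != 0 by rewrite intr_Fp_eq0.
have aF : (a%:~R : 'F_p) != 0 by rewrite intr_Fp_eq0.
have g a' : (a'%:~R : 'F_p) != 0 -> gq p (a' * (p.+1./2)%:Z) = (leg (a'%:~R : 'F_p))%:~R * ((leg ((p.+1./2)%:Z%:~R : 'F_p))%:~R * gq p 1).
  move=> a0; rewrite g1_leg //; last by rewrite -intr_Fp_eq0 // rmorphM /= mulf_neq0.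
  by rewrite rmorphM /= legM // rmorphM /= mulrA.
rewrite !g ?oner_neq0 // rmorph1 leg1 // mul1r => c1 c2.
have la : leg (a%:~R : 'F_p) ^+ p = leg (a%:~R : 'F_p).
  by rewrite [X in _ ^+ X]pE exprS -mul2n exprM leg_sqr // expr1n mulr1.
have : (chi p d)%:~R = (leg (a%:~R : 'F_p))%:~R :> R[i].
  by rewrite c1 [_ ^+ p]exprMn mulrCA -c2 mulr1 -rmorphXn /= la.
move=> /eqP; rewrite eqr_int => /eqP ->.
have ad : (a%:~R : 'F_p) * d%:~R = 1.
  have := congr1 (fun x : int => x%:~R : 'F_p) E; rewrite rmorphD !rmorphM /=.
  by rewrite (_ : p%:~R = 0) ?mulr0 ?add0r //; apply/eqP; rewrite intr_Fp_eq0 // dvdzz.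
have dF : (d%:~R : 'F_p) != 0 by rewrite intr_Fp_eq0.
have := legM pp op (a%:~R : 'F_p) d%:~R; rewrite ad leg1 // => h.
by rewrite -[LHS]mulr1 -(leg_sqr pp op dF) expr2 mulrA -h mul1r.
Qed.

(** A primitive root is a non-residue, and multiplication by it changes the sign of the sum. *)
Lemma sum_leg p : prime p -> odd p -> \sum_(y : 'F_p) (leg y)%:~R = 0 :> R[i].
Proof.
move=> pp op; have [w wp] := Fp_prim_root pp.
have lw : leg w = -1 by have := leg_prim pp op 1 wp; rewrite !expr1.
have w0 : w != 0 by apply: contra_eq_neq lw => ->; rewrite leg0.
set S := \sum_y _; have : S = - S.
  rewrite {1}/S (reindex (fun x => w * x)) /=; last first.
    exists (fun x => w^-1 * x) => x _; by rewrite ?mulVKf ?mulKf.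
  rewrite /S -sumrN; apply: eq_bigr => y _; by rewrite legM // lw mulN1r rmorphN.
move/eqP; rewrite -addr_eq0 -mulr2n -mulr_natl mulf_eq0 pnatr_eq0 /= => /eqP //.
Qed.

Lemma Tsum_Fp p m : prime p -> odd p ->
  Tsum p m = \sum_(y : 'F_p) (leg y)%:~R * eFp R (m%:~R * y).
Proof.
move=> pp op; have p0 := prime_gt0 pp.
rewrite /Tsum (sum_ord_Fp pp (F := fun b => (chi p b)%:~R * ze p (m * b))); last first.
  move=> x y xy; rewrite (chi_mod R op xy); congr (_ * _); apply: ze_mod => //.
  by rewrite -mulrBr dvdz_mull.
apply: eq_bigr => x _; rewrite chi_prime // intr_FpK; congr (_ * _).
by rewrite -(eFpE R pp) rmorphM /= intr_FpK.
Qed.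

Lemma Tsum_prime1 p : prime p -> odd p -> Tsum p 1 = gq p 1.
Proof.
by move=> pp op; rewrite Tsum_Fp // g1_leg_sum //; apply: eq_bigr => y _; rewrite mul1r.
Qed.

Lemma Tsum_prime p m : prime p -> odd p -> Tsum p m = (chi p m)%:~R * Tsum p 1.
Proof.
move=> pp op; rewrite chi_prime // Tsum_prime1 //.
case: (boolP (p %| m)%Z) => [pm|npm].
  have /eqP m0 : (m%:~R : 'F_p) == 0 by rewrite intr_Fp_eq0.
  rewrite Tsum_Fp // m0 leg0 mul0r; transitivity (\sum_(y : 'F_p) (leg y)%:~R : R[i]); last exact: sum_leg.
  apply: eq_bigr => y _.
  by rewrite mul0r -[0]/((0 : int)%:~R) eFpE // ze0 mulr1.
have m0 : (m%:~R : 'F_p) != 0 by rewrite intr_Fp_eq0.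
rewrite Tsum_Fp // g1_leg_sum // mulr_sumr.
rewrite (reindex (fun x => (m%:~R)^-1 * x)) /=; last first.
  exists (fun x => m%:~R * x) => x _; by rewrite ?mulVKf ?mulKf.
apply: eq_bigr => y _; rewrite mulVKf // mulrA -rmorphM /= -legM //; congr (_%:~R * _).
have -> : (m%:~R)^-1 * y = m%:~R * y * ((m%:~R)^-1) ^+ 2 by field.
by rewrite (legM pp op (m%:~R * y)) leg_sq ?mulr1 // invr_eq0.
Qed.

Lemma sum_crt c d (F : int -> R[i]) : (0 < c)%N -> (0 < d)%N -> coprime c d ->
  (forall x y, ((c * d)%N %| (x - y)%R)%Z -> F x = F y) ->
  \sum_(x < c * d) F (x : nat)%:Z =
  \sum_(u < c) \sum_(v < d) F (d%:Z * (u : nat)%:Z + c%:Z * (v : nat)%:Z).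
Proof.
move=> c0 d0 cd Fp; rewrite pair_big /=.
apply: (@sum_ord_bij _ _ _ (fun p : 'I_c * 'I_d => d%:Z * (p.1 : nat)%:Z + c%:Z * (p.2 : nat)%:Z)) => //.
- by rewrite muln_gt0 c0.
- by rewrite card_prod !card_ord.
move=> [s1 s2] [t1 t2] /=; rewrite PoszM => h.
have h1 := dvdz_trans (dvdz_mulr d%:Z (dvdzz c)) h.
have h2 := dvdz_trans (dvdz_mull c%:Z (dvdzz d)) h.
congr pair; apply: dvdz_ord.
  move: h1; rewrite (_ : _ - _ = d%:Z * ((s1 : nat)%:Z - (t1 : nat)%:Z) + ((s2 : nat)%:Z - (t2 : nat)%:Z) * c); last by ring.
  by rewrite [X in is_true X -> _]rpredDr; [rewrite Gauss_dvdzr|exact: dvdz_mull].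
move: h2; rewrite (_ : _ - _ = ((s1 : nat)%:Z - (t1 : nat)%:Z) * d + c%:Z * ((s2 : nat)%:Z - (t2 : nat)%:Z)); last by ring.
by rewrite [X in is_true X -> _]rpredDl; [rewrite Gauss_dvdzr // coprimez_sym|exact: dvdz_mull].
Qed.

Lemma TsumM c d m : odd c -> odd d -> coprime c d ->
  Tsum (c * d) m = (chi c d * chi d c)%:~R * (Tsum c m * Tsum d m).
Proof.
move=> oc od cd; have c0 := odd_gt0 oc; have d0 := odd_gt0 od.
have ocd : odd (c * d) by rewrite oddM oc.
have cd0 : (0 < c * d)%N by rewrite muln_gt0 c0.
rewrite /Tsum (sum_crt (F := fun b => (chi (c * d) b)%:~R * ze (c * d) (m * b))) //; last first.
  move=> x y xy; rewrite (chi_mod R ocd xy); congr (_ * _); apply: ze_mod => //.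
  by rewrite -mulrBr dvdz_mull.
rewrite mulr_suml mulr_sumr; apply: eq_bigr => u _; rewrite mulr_sumr mulr_sumr; apply: eq_bigr => v _.
rewrite chiMl //.
have -> : chi c (d%:Z * (u : nat)%:Z + c%:Z * (v : nat)%:Z) = chi c d * chi c (u : nat)%:Z.
  rewrite -chiMr //; apply: (chi_mod R) => //; rewrite addrC addKr; exact: dvdz_mulr.
have -> : chi d (d%:Z * (u : nat)%:Z + c%:Z * (v : nat)%:Z) = chi d c * chi d (v : nat)%:Z.
  rewrite -chiMr //; apply: (chi_mod R) => //; rewrite addrK; exact: dvdz_mulr.
rewrite mulrDr zeD.
have -> : ze (c * d) (m * (d%:Z * (u : nat)%:Z)) = ze c (m * (u : nat)%:Z).
  by rewrite -(@zeMl R c d) //; congr ze; ring.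
have -> : ze (c * d) (m * (c%:Z * (v : nat)%:Z)) = ze d (m * (v : nat)%:Z).
  by rewrite mulnC -(@zeMl R d c) //; congr ze; ring.
by rewrite !rmorphM /=; ring.
Qed.

Lemma g1M c d al : (0 < c)%N -> (0 < d)%N -> coprime c d ->
  gq (c * d) al = gq c (al * d%:Z) * gq d (al * c%:Z).
Proof.
move=> c0 d0 cd; have cd0 : (0 < c * d)%N by rewrite muln_gt0 c0.
rewrite /g1 (sum_crt (F := fun b => ze (c * d) (al * b ^+ 2))) //; last first.
  by move=> x y xy; exact: ze_sq_per.
rewrite mulr_suml; apply: eq_bigr => u _; rewrite mulr_sumr; apply: eq_bigr => v _.
have -> : al * (d%:Z * (u : nat)%:Z + c%:Z * (v : nat)%:Z) ^+ 2 = al * d * (u : nat)%:Z ^+ 2 * d +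
    al * c * (v : nat)%:Z ^+ 2 * c + 2 * al * (u : nat)%:Z * (v : nat)%:Z * (c * d)%N by rewrite PoszM; ring.
rewrite !zeD [X in _ * X]ze_dvd ?dvdz_mull // mulr1 zeMl //; congr (_ * _).
by rewrite mulnC zeMl.
Qed.

Lemma squarefreeMl c d : squarefree (c * d) -> squarefree d.
Proof. by move=> sq t td; apply: sq; rewrite dvdn_mull. Qed.

Lemma squarefree_coprime c d : (0 < c)%N -> squarefree (c * d) -> coprime c d.
Proof.
move=> c0 sq; rewrite /coprime; apply/eqP; apply: sq; rewrite expnS expn1.
by rewrite dvdn_mul ?dvdn_gcdl ?dvdn_gcdr.
Qed.

(** Both claims are built up one prime factor at a time. The first covers also the [m] not prime to
    [d], because [chi d] is primitive for squarefree [d]; the second identifies the sum over squares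
    with the character sum and so carries the sign found in [gauss_half] over to [Tsum]. *)
Lemma Tsum_main d : odd d -> squarefree d ->
  (forall m, Tsum d m = (chi d m)%:~R * Tsum d 1) /\
  (forall al, coprime d `|al|%N -> gq d al = Tsum d al).
Proof.
elim/ltn_ind: d => d IHd od sq; have d0 := odd_gt0 od.
have [->|d1] := eqVneq d 1%N.
  have T1 m : Tsum 1 m = 1 by rewrite /Tsum big_ord1 chi1E mul1r ze_dvd // dvd1z.
  split=> [m|al _]; first by rewrite !T1 chi1E mul1r.
  by rewrite T1 /g1 big_ord1 ze_dvd // dvd1z.
have d2 : (1 < d)%N by rewrite ltn_neqAle eq_sym d1.
pose p := pdiv d; have pp : prime p by exact: pdiv_prime.
have pd : (p %| d)%N by exact: pdiv_dvd.
clearbody p; have p0 := prime_gt0 pp; have p1 := prime_gt1 pp.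
have [e dE] := dvdnP pd; rewrite mulnC in dE.
have [op oe] : odd p /\ odd e by move: od; rewrite dE oddM => /andP[].
have se : squarefree e by apply: (@squarefreeMl p); rewrite -dE.
have pe : coprime p e by apply: squarefree_coprime; rewrite // -dE.
have [|Te ge] := IHd e _ oe se; first by rewrite dE ltn_Pmull // odd_gt0.
have TM m : Tsum d m = (chi p e * chi e p)%:~R * (Tsum p m * Tsum e m) by rewrite dE TsumM.
have T1 m : Tsum d m = (chi d m)%:~R * Tsum d 1.
  rewrite !TM Tsum_prime // Te dE chiMl // !rmorphM /=; ring.
split=> // al cop.
have cpa : coprime p `|al|%N by apply: coprime_dvdl cop.
have cea : coprime e `|al|%N by apply: coprime_dvdl cop; rewrite dE dvdn_mull.
rewrite dE g1M ?odd_gt0 // -dE.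
have gp b : coprime p `|b|%N -> gq p b = Tsum p b.
  move=> cpb; rewrite Tsum_prime // chi_prime // Tsum_prime1 // g1_leg //.
  by rewrite dvdzE -prime_coprime.
rewrite gp; last by rewrite abszM coprimeMr cpa.
rewrite ge; last by rewrite abszM coprimeMr cea coprime_sym.
rewrite TM Tsum_prime // Te [Tsum p al]Tsum_prime // [Tsum e al]Te !chiMr // !rmorphM /=; ring.
Qed.

Lemma coprime_half d : odd d -> coprime d (d.+1./2).
Proof.
move=> od; have h2 : (d.+1./2).*2 = d.+1 by rewrite even_halfK //= od.
have : coprime d (d.+1./2).*2 by rewrite h2 coprimenS.
by rewrite -mul2n coprimeMr => /andP[].
Qed.

(** Up to sign, [g] is known from [g1_mulN]. The sign comes from [theta_const] at level [d] for the
    identity matrix, which gives [g^d]; as [d] is odd and [g^2] is known, this determines [g]. The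
    coefficient [(d + 1) / 2] is the inverse of 2 modulo [d] that [qs_dvd] produces. *)
Lemma gauss_half d : odd d -> squarefree d ->
  gq d (d.+1./2)%:Z = (- 'i) ^+ d./2 * (Num.sqrt d%:R)%:C.
Proof.
move=> od sq; have d0 := odd_gt0 od.
have [->|d1] := eqVneq d 1%N.
  by rewrite /g1 big_ord1 ze_dvd ?dvd1z // expr0 mul1r sqrtr1.
pose k := d./2; have dE : d = k.*2.+1 by rewrite -[LHS]odd_double_half od.
have k0 : (0 < k)%N by rewrite lt0n; apply: contra_neq d1 => k0; rewrite dE k0.
have [T1 gT] := Tsum_main od sq.
have cop := coprime_half od.
set h := (d.+1./2)%:Z; set g := gq d h.
have gg : g * ((-1) ^+ k * g) = d%:R.
  have -> : (-1) ^+ k * g = gq d (- h).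
    rewrite /g !gT ?abszN // !(T1 (- h)) T1 chiN //= rmorphM rmorphXn rmorphN /= rmorph1 -mulrA.
    by rewrite dE /= -[(k.*2)]muln2 mulnK.
  rewrite g1_mulN // abszM coprimeMr cop andbT /= coprime_sym coprime2n od //.
have g2 : g ^+ 2 = (-1) ^+ k * d%:R.
  have s2 : ((-1) ^+ k) ^+ 2 = 1 :> R[i] by rewrite -exprM mulnC exprM sqrrN expr1n expr1n.
  by rewrite -gg; transitivity (((-1) ^+ k) ^+ 2 * g ^+ 2); [rewrite s2 mul1r|ring].
have det1 : 1 * 1 - 0 * k.*2.+1%:Z = 1 by rewrite mul0r subr0.
have := theta_const R k0 det1; rewrite chi_1 -?dE // qs_dvd -?dE // ?coprimen1 // mul1r -/h -/g.
have -> : g ^+ d = g * ((-1) ^+ k * d%:R ^+ k).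
  rewrite [X in _ ^+ X = _]dE exprS -mul2n exprM g2 exprMn -exprM mulnn.
  by rewrite -[(-1) ^+ (k ^ 2)]signr_odd oddX /= signr_odd.
have sd : (Num.sqrt d%:R)%:C != 0 :> R[i].
  by rewrite -cabs_gt0 cabsR gtr0_norm sqrtr_gt0 ltr0n.
have dR : d%:R ^+ k != 0 :> R[i] by rewrite expf_neq0 // pnatr_eq0 -lt0n.
have i0 : ('i : R[i]) ^+ k != 0 by rewrite expf_neq0 // eq_complex /= oner_eq0 andbF.
rewrite exprMn; move: sd dR i0; set S := (Num.sqrt _)%:C; move: S (d%:R ^+ k) => S D sd dR i0; rewrite mulr1z => e.
have -> : (- 'i) ^+ k = (-1) ^+ k * 'i ^+ k :> R[i] by rewrite -exprMn mulN1r.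
have s2 : (-1) ^+ k * (-1) ^+ k = 1 :> R[i] by rewrite -expr2 -exprM mulnC exprM sqrrN expr1n expr1n.
have e' : g * (-1) ^+ k = 'i ^+ k * S.
  rewrite -[RHS]mulr1 [X in _ = _ * X]e; field; by rewrite i0 sd dR.
by rewrite -mulrA -e' mulrCA s2 mulr1.
Qed.

Lemma Tsum1E d : odd d -> squarefree d -> Tsum d 1 = epsilon R d * (Num.sqrt d%:R)%:C.
Proof.
move=> od sq; have [T1 gT] := Tsum_main od sq; have d0 := odd_gt0 od.
pose k := d./2; have dE : d = k.*2.+1 by rewrite -[LHS]odd_double_half od.
have h2 : (d.+1./2).*2 = d.+1 by rewrite even_halfK //= od.
have cop := coprime_half od.
have := gauss_half od sq; rewrite gT // T1 => e.
(* Passing from the coefficient [1/2] to 1 costs [chi d 2], which turns the power of [-i] into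
   [epsilon]. *)
have c2 : chi d 2 * chi d (d.+1./2)%:Z = 1.
  rewrite -chiMr // -[RHS](chi_1 od); apply: (chi_mod R) => //.
  by rewrite (_ : _ - _ = d%:Z) ?dvdzz //; move: h2; clear; lia.
have -> : Tsum d 1 = (chi d 2)%:~R * ((- 'i) ^+ k * (Num.sqrt d%:R)%:C).
  by rewrite -e mulrA -rmorphM /= c2 mul1r.
rewrite mulrA; congr (_ * _).
rewrite chi_nat // kprod_prime // /kronecker_prime eqxx dE kronecker2_dstar rmorphXn rmorphN /= rmorph1.
have i2 : ('i : R[i]) ^+ 2 = -1 by exact: sqr_i.
rewrite /epsilon.
have -> : (k.*2.+1 %% 4 == 1)%N = (k %% 4 == 0)%N || (k %% 4 == 2)%N by lia.
rewrite [X in (- 'i) ^+ X](divn_eq k 4) exprD [(k %/ 4 * 4)%N]mulnC exprM.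
have -> : (- 'i) ^+ 4 = 1 :> R[i] by rewrite (exprM _ 2 2) sqrrN i2 sqrrN expr1n.
rewrite expr1n mul1r; have := ltn_pmod k (isT : 0 < 4)%N; move: (k %% 4)%N => t.
case: t => [|[|[|[|t]]]] //= _; rewrite ?expr0 ?expr1 ?mulr1 ?mul1r //.
- by rewrite mulrNN mul1r.
- by rewrite sqrrN i2 mulrNN mulr1.
- by rewrite exprS sqrrN i2 mulrNN mulr1.
Qed.

Lemma Tsum1_neq0 d : odd d -> squarefree d -> Tsum d 1 != 0.
Proof.
move=> od sq; rewrite Tsum1E // mulf_neq0 //.
  by rewrite /epsilon; case: ifP => _; rewrite ?oner_neq0 // eq_complex /= oner_eq0 andbF.
by rewrite -cabs_gt0 cabsR gtr0_norm sqrtr_gt0 ltr0n odd_gt0.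
Qed.

(** The origin of [A(d, N)]: it compares the Gauss sum modulo [d e] with the one modulo [d]. By
    [Tsum1E] only signs and values of [epsilon] remain, which are checked on residues modulo 4. *)
Lemma A_coefE d e : odd d -> odd e -> squarefree (d * e) ->
  A_coef R d (d * e) * ((chi e (-1))%:~R * (Num.sqrt e%:R)%:C * Tsum d 1) = Tsum (d * e) 1.
Proof.
move=> od oe sq; have d0 := odd_gt0 od; have e0 := odd_gt0 oe.
have sd : squarefree d by apply: (@squarefreeMl e); rewrite mulnC.
rewrite !Tsum1E ?oddM ?od //.
have -> : (Num.sqrt (d * e)%N%:R)%:C = (Num.sqrt d%:R)%:C * (Num.sqrt e%:R)%:C :> R[i].
  by rewrite -rmorphM /= -sqrtrM // natrM.
rewrite /A_coef mulKn //.
have c1 : chi e (-1) = (-1) ^+ (e.-1 %/ 2) by rewrite chiN // chi_1 // mulr1.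
rewrite c1 rmorphXn rmorphN /= rmorph1.
suff : (-1) ^+ ((d + 1) * (e - 1) %/ 4) * epsilon R e * (-1) ^+ (e.-1 %/ 2) * epsilon R d = epsilon R (d * e).
  by move=> <-; ring.
have i2 : 'i * 'i = -1 :> R[i] by rewrite -expr2; exact: sqr_i.
have m2 : ((d * e) %% 4 = ((d %% 4) * (e %% 4)) %% 4)%N by rewrite modnMm.
rewrite /epsilon m2 -[(-1) ^+ (_ %/ 4)]signr_odd -[(-1) ^+ (_ %/ 2)]signr_odd.
have [de|de] : (e %% 4 = 1 \/ e %% 4 = 3)%N by lia.
  have -> : odd (e.-1 %/ 2) = false by lia.
  have [q qE] : exists q, (d + 1 = 2 * q)%N by exists (d.+1./2); lia.
  have [r rE] : exists r, (e - 1 = 4 * r)%N by exists (e %/ 4)%N; lia.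
  rewrite rE qE mulnCA mulKn // -mulnA oddM /= de muln1 modn_mod.
  by rewrite !expr0 !mul1r.
have -> : odd (e.-1 %/ 2) = true by lia.
have [r rE] : exists r, (e = 4 * r + 3)%N by exists (e %/ 4)%N; lia.
have [q qE] : exists q, (d + 1 = 2 * q)%N by exists (d.+1./2); lia.
have -> : odd ((d + 1) * (e - 1) %/ 4) = odd q.
  rewrite qE rE (_ : (2 * q * (4 * r + 3 - 1) = 4 * (q * (r * 2 + 1)))%N).
    by rewrite mulKn // oddM oddD oddM /= andbF andbT.
  by rewrite (_ : (4 * r + 3 - 1 = 2 * (r * 2 + 1))%N); [ring|lia].
rewrite de /=.
have [dd|dd] : (d %% 4 = 1 \/ d %% 4 = 3)%N by lia.
  have -> : odd q by lia.
  by rewrite dd /= expr1 mulN1r mulrN1 opprK mulr1.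
have -> : odd q = false by lia.
by rewrite dd /= expr0 mul1r expr1 mulrN1 mulNr i2 opprK.
Qed.

End CharacterSums.

(** * Convergence of lattice sums in weight at least 2 *)

Section LatticeSums.
Variable R : realType.
Implicit Types (z u : R[i]).

Lemma absum_offfin (T : choiceType) (f : T -> R[i]) (b : T -> R) (A : {fset T}) :
  (forall i, 0 <= b i) -> rsm b -> (forall i, i \notin A -> cabs (f i) <= b i) -> absum f.
Proof.
move=> b0 sb fb; have af : absum (fun i => if i \in A then f i else 0).
  by apply: (@absum_fin _ _ _ A) => i /negbTE ->.
apply: absum_le (rsmD sb af) => i; case: (boolP (i \in A)) => iA.
  by rewrite lerDr.
by rewrite cabs0 addr0; exact: fb.
Qed.

Definition zball (K : nat) : {fset int} :=
  [fset x | x in [seq Posz n | n <- iota 0 K.+1] ++ [seq Negz n | n <- iota 0 K]]%fset.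

Lemma zballP K (n : int) : n \notin zball K -> (K%:Z < `|n|)%R.
Proof.
apply: contraNT; rewrite -leNgt => nK.
suff : n \in [seq Posz n | n <- iota 0 K.+1] ++ [seq Negz n | n <- iota 0 K].
  by move=> h; apply/imfsetP; exists n.
rewrite mem_cat; case: n nK => n nK; apply/orP.
  by left; apply/mapP; exists n => //; rewrite mem_iota add0n /=; move: nK; lia.
by right; apply/mapP; exists n => //; rewrite mem_iota add0n /=; move: nK; lia.
Qed.

(** Telescoping against [2 / sqrt n]. The exponent [3/2] is half of 3, the decay that differences of
    lattice terms have in weight 2. *)
Lemma rsm_threehalf : rsm (fun n : int => ((1 + `|n|%:~R) * Num.sqrt (1 + `|n|%:~R))^-1 : R).
Proof.
have nat : rsm (fun n : nat => (n.+1%:R * Num.sqrt n.+1%:R)^-1 : R).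
  apply: (@rsm_nat _ _ 3) => [n|n]; first by rewrite invr_ge0 mulr_ge0 ?sqrtr_ge0.
  suff H : \sum_(i < n.+1) (i.+1%:R * Num.sqrt i.+1%:R)^-1 <= 3 - 2 / Num.sqrt n.+1%:R :> R.
    rewrite big_ord_recr /= in H; apply: le_trans (_ : _ <= 3 - 2 / Num.sqrt n.+1%:R) _.
      by apply: le_trans H; rewrite lerDl invr_ge0 mulr_ge0 ?sqrtr_ge0.
    by rewrite gerBl divr_ge0 // sqrtr_ge0.
  elim: n => [|n IHn]; first by rewrite big_ord_recr big_ord0 /= sqrtr1 mulr1 invr1; lra.
  rewrite big_ord_recr /=; apply: le_trans (lerD IHn (lexx _)) _.
  rewrite -addrA lerD2l.
  have s0 : 0 < Num.sqrt n.+1%:R :> R by rewrite sqrtr_gt0 ltr0n.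
  have t0 : 0 < Num.sqrt n.+2%:R :> R by rewrite sqrtr_gt0 ltr0n.
  have s2 : Num.sqrt n.+1%:R ^+ 2 = n.+1%:R :> R by rewrite sqr_sqrtr.
  have t2 : Num.sqrt n.+2%:R ^+ 2 = n.+2%:R :> R by rewrite sqr_sqrtr.
  have st : Num.sqrt n.+2%:R ^+ 2 = Num.sqrt n.+1%:R ^+ 2 + 1 :> R by rewrite s2 t2 natr1.
  rewrite -{1}t2; move: s0 t0 st; move: (Num.sqrt n.+1%:R) (Num.sqrt n.+2%:R) => s t s0 t0 st.
  have st' : s <= t.
    have : s ^+ 2 <= t ^+ 2 by rewrite st lerDl.
    by rewrite ler_pXn2r ?nnegrE ?(ltW s0) ?(ltW t0).
  rewrite -subr_ge0.
  have -> : - (2 / t) - (- (2 / s) + (t ^+ 2 * t)^-1) = (2 * t ^+ 2 * (t - s) - s) / (s * t ^+ 3).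
    by field; rewrite !gt_eqF.
  rewrite divr_ge0 //; last by rewrite mulr_ge0 ?exprn_ge0 // ltW.
  have : (t - s) * (t + s) = 1 by rewrite -subr_sqr st; ring.
  have d0 : 0 <= t - s by rewrite subr_ge0.
  have : (t - s) * ((t + s) * s) <= (t - s) * (2 * t * t) by rewrite ler_wpM2l //; nra.
  by move=> h e; rewrite mulrA e mul1r in h; lra.
apply: rsm_int => [n||].
- by rewrite invr_ge0 mulr_ge0 ?sqrtr_ge0 // addr_ge0 // ler0z.
- by apply: rsm_le nat => n; rewrite /= addrC natr1.
apply: rsm_le nat => n; rewrite NegzE normrN ger0_norm //.
have a : n.+1%:R <= 1 + n.+1%:R :> R by rewrite lerDr.
have p0 : 0 < n.+1%:R :> R by rewrite ltr0n.
rewrite lef_pV2 ?posrE ?mulr_gt0 ?sqrtr_gt0 ?ltr_pwDl //.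
by rewrite ler_pM ?sqrtr_ge0 // ler_wsqrtr.
Qed.

Definition b32 (n : int) : R := ((1 + `|n|%:~R) * Num.sqrt (1 + `|n|%:~R))^-1.

Lemma b32_ge0 n : 0 <= b32 n.
Proof. by rewrite invr_ge0 mulr_ge0 ?sqrtr_ge0 // addr_ge0 // ler0z. Qed.

Lemma rsm_b32 : rsm (fun p : int * int => b32 p.1 * b32 p.2).
Proof. by apply: rsm_prod; try exact: b32_ge0; exact: rsm_threehalf. Qed.

(** By the arithmetic-geometric mean inequality, cubic decay in [1 + |p| + |q|] lies below a product
    of one-variable majorants, so that two-dimensional sums reduce to one-dimensional ones. *)
Lemma b32_lower (p q : int) : (1 + `|p|%:~R + `|q|%:~R) ^- 3 <= b32 p * b32 q :> R.
Proof.
have a0 : 0 <= `|p|%:~R :> R by rewrite ler0z.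
have b0 : 0 <= `|q|%:~R :> R by rewrite ler0z.
rewrite /b32; move: a0 b0; move: (`|p|%:~R : R) (`|q|%:~R : R) => a b a0 b0.
have s0 : 0 < Num.sqrt (1 + a) by rewrite sqrtr_gt0 ltr_pwDl.
have t0 : 0 < Num.sqrt (1 + b) by rewrite sqrtr_gt0 ltr_pwDl.
have s2 : Num.sqrt (1 + a) ^+ 2 = 1 + a by rewrite sqr_sqrtr // addr_ge0.
have t2 : Num.sqrt (1 + b) ^+ 2 = 1 + b by rewrite sqr_sqrtr // addr_ge0.
have ab : 0 < 1 + a + b by rewrite -addrA ltr_pwDl // addr_ge0.
rewrite -invfM lef_pV2 ?posrE ?mulr_gt0 ?exprn_gt0 ?ltr_pwDl //.
have st : Num.sqrt (1 + a) * Num.sqrt (1 + b) <= 1 + a + b.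
  have := sqr_ge0 (Num.sqrt (1 + a) - Num.sqrt (1 + b)); rewrite sqrrB s2 t2.
  have : 1 + a + b >= (1 + a + (1 + b)) / 2 by lra.
  rewrite -mulr_natr; lra.
have -> : (1 + a) * Num.sqrt (1 + a) * ((1 + b) * Num.sqrt (1 + b)) = (Num.sqrt (1 + a) * Num.sqrt (1 + b)) ^+ 3.
  by rewrite -{1}s2 -{1}t2; ring.
by rewrite lerXn2r // nnegrE ?mulr_ge0 ?(ltW s0) ?(ltW t0) ?(ltW ab).
Qed.

(** The imaginary part of [p z + q] controls [p], and its modulus then controls [q]. *)
Lemma cabs_lattice z (p q : int) : 0 < complex.Im z ->
  `|p|%:~R + `|q|%:~R <= (1 + complex.Im z + cabs z) / complex.Im z * cabs (p%:~R * z + q%:~R).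
Proof.
move=> y0; set y := complex.Im z in y0 *; set w := p%:~R * z + q%:~R.
have h1 : `|p|%:~R * y <= cabs w.
  apply: le_trans (Im_le_cabs w); rewrite /w Im_add Im_int addr0.
  by rewrite -(rmorph_int (@real_complex_def R (Phant R))) Im_realM normrM intr_norm (gtr0_norm y0).
have h2 : `|q|%:~R <= cabs w + `|p|%:~R * cabs z.
  have -> : `|q|%:~R = cabs (w - p%:~R * z) by rewrite /w addrC addKr cabs_int.
  by apply: le_trans (cabsB _ _) _; rewrite cabsM cabs_int.
rewrite mulrAC ler_pdivlMr //.
have h3 : `|p|%:~R * y * cabs z <= cabs w * cabs z by rewrite ler_wpM2r.
have h4 : `|q|%:~R * y <= (cabs w + `|p|%:~R * cabs z) * y by rewrite ler_wpM2r // ltW.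
have : 0 <= cabs w by [].
move: h1 h3 h4; move: (cabs w) (cabs z) (`|p|%:~R : R) (`|q|%:~R : R) => W Z P Q; lra.
Qed.

Variable k : nat.
Hypothesis k2 : (1 < k)%N.

(** As the inverse of 0 is 0, the origin of a lattice contributes 0 without being excluded. *)
Definition PP u : R[i] := u ^- k.

Lemma PPM u v : PP (u * v) = PP u * PP v.
Proof. by rewrite /PP exprMn invfM. Qed.

Lemma PPN u : PP (- u) = (-1) ^+ k * PP u.
Proof.
by rewrite -[- u]mulN1r PPM /PP -exprVn invrN invr1.
Qed.

Lemma absum_PP_row a (N : nat) : (0 < N)%N -> absum (fun n : int => PP (a + (N%:Z * n)%:~R)).
Proof.
move=> N0; pose K := (Num.truncn (2 * cabs a + 3)).+1.
have c0 : 0 <= 16 :> R by [].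
apply: (@absum_offfin _ _ _ (zball K) _ (rsmZ c0 (rsm_int_inv_sq R))).
  by move=> n; rewrite mulr_ge0 // invr_ge0 sqr_ge0.
move=> n /zballP nK; pose x : R := `|n|%:~R.
have xK : 2 * cabs a + 3 < x.
  apply: lt_trans (truncnS_gt _) _; rewrite -/K /x -[K%:R]/(K%:Z%:~R) ltr_int //.
have xa : (1 + x) / 4 <= cabs (a + (N%:Z * n)%:~R).
  have : cabs (N%:Z * n)%:~R <= cabs (a + (N%:Z * n)%:~R) + cabs a.
    by rewrite [X in cabs X <= _](_ : _ = a + (N%:Z * n)%:~R - a) ?cabsB // addrC addKr.
  rewrite cabs_int normrM rmorphM /= -/x => h.
  have Nx : x <= N%:~R * x by rewrite ler_peMl // ?ler0z // ler1n.
  have := cabs_ge0 a; rewrite ger0_norm // in h; lra.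
have x0 : 0 < (1 + x) / 4 by rewrite divr_gt0 // ltr_pwDl // ler0z.
rewrite /PP cabsV cabsX; set w := cabs _ in xa *.
have w0 : 0 < w by exact: lt_le_trans xa.
have -> : 16 * (1 + x) ^- 2 = ((1 + x) / 4) ^- 2.
  by field; rewrite gt_eqF // ltr_pwDl // ler0z.
apply: (@le_trans _ _ (w ^- 2)).
  have [w1'|w1'] := leP 1 w.
    by rewrite lef_pV2 ?posrE ?exprn_gt0 // ler_weXn2l.
  exfalso; have := cabs_ge0 a; move: xa xK w1'; clear; lra.
by rewrite lef_pV2 ?posrE ?exprn_gt0 // ler_pXn2r ?nnegrE ?(ltW w0) ?(ltW x0).
Qed.

(** A difference gains one power of [a] over a single term, which makes the sum over a lattice
    absolutely convergent also for [k = 2]. The powers of 2 come from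
    [|a| / 2 <= |a + b| <= 2 |a|]. *)
Lemma PP_diff a b : a != 0 -> 2 * cabs b <= cabs a ->
  cabs (PP (a + b) - PP a) <= k%:R * 2 ^+ (k.*2) * cabs b / cabs a ^+ k.+1.
Proof.
move=> a0 ba; have A0 : 0 < cabs a by rewrite cabs_gt0.
have B0 := cabs_ge0 b.
have u1 : cabs a / 2 <= cabs (a + b).
  have : cabs a <= cabs (a + b) + cabs b.
    by rewrite [X in cabs X <= _](_ : _ = a + b - b) ?cabsB // addrK.
  lra.
have u2 : cabs (a + b) <= 2 * cabs a by apply: le_trans (cabsD _ _) _; lra.
have U0 : 0 < cabs (a + b) by apply: lt_le_trans u1; rewrite divr_gt0.
have un0 : a + b != 0 by rewrite -cabs_gt0.
rewrite /PP; have -> : (a + b) ^- k - a ^- k = (a ^+ k - (a + b) ^+ k) / ((a + b) ^+ k * a ^+ k).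
  by field; rewrite !expf_neq0.
rewrite subrXX cabsM cabsV !cabsM !cabsX.
have -> : cabs (a - (a + b)) = cabs b by rewrite opprD addrA subrr sub0r cabsN.
have S : cabs (\sum_(i < k) a ^+ (k.-1 - i) * (a + b) ^+ i) <= k%:R * (2 * cabs a) ^+ k.-1.
  apply: le_trans (cabs_sum _ _ _) _.
  rewrite mulr_natl -[X in _ *+ X](card_ord k) -sumr_const; apply: ler_sum => i _.
  rewrite cabsM !cabsX; have ik : (i <= k.-1)%N by rewrite -ltnS prednK // (ltnW k2).
  rewrite -[X in _ <= _ ^+ X](subnK ik) exprD ler_pM ?exprn_ge0 //.
    by rewrite lerXn2r ?nnegrE //; lra.
  by rewrite lerXn2r ?nnegrE //; lra.
have V : ((cabs (a + b)) ^+ k * cabs a ^+ k)^-1 <= 2 ^+ k / cabs a ^+ k / cabs a ^+ k.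
  rewrite invfM; rewrite ler_wpM2r ?invr_ge0 ?exprn_ge0 //.
  rewrite -[2 ^+ k / _]invrK invf_div -expr_div_n lef_pV2 ?posrE ?exprn_gt0 ?divr_gt0 //.
  by rewrite lerXn2r ?nnegrE // ?divr_ge0.
apply: le_trans (_ : _ <= cabs b * (k%:R * (2 * cabs a) ^+ k.-1) * (2 ^+ k / cabs a ^+ k / cabs a ^+ k)) _.
  by rewrite ler_pM ?mulr_ge0 ?invr_ge0 ?mulr_ge0 ?exprn_ge0 ?ler_wpM2l.
have -> : cabs b * (k%:R * (2 * cabs a) ^+ k.-1) * (2 ^+ k / cabs a ^+ k / cabs a ^+ k) =
   k%:R * (2 ^+ k.-1 * 2 ^+ k) * cabs b / cabs a ^+ k.+1.
  rewrite exprMn.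
  have -> : cabs a ^+ k = cabs a * cabs a ^+ k.-1 by rewrite -exprS prednK // (ltnW k2).
  have -> : cabs a ^+ k.+1 = cabs a * (cabs a * cabs a ^+ k.-1) by rewrite -exprS prednK ?(ltnW k2) // -exprS.
  have : cabs a ^+ k.-1 != 0 by rewrite expf_neq0 // gt_eqF.
  move: (cabs a ^+ k.-1) (2 ^+ k.-1 : R) (2 ^+ k : R) => X Y Z X0; field.
  by rewrite X0 gt_eqF.
rewrite ler_wpM2r ?invr_ge0 ?exprn_ge0 // ler_wpM2r // ler_wpM2l // -exprD ler_weXn2l //; first by lra.
by rewrite -addnn leq_add2r leq_pred.
Qed.

Lemma absum_PP_diff z b (N : nat) : (0 < N)%N -> 0 < complex.Im z ->
  absum (fun l : int * int => PP (N%:R * (l.1%:~R * z + l.2%:~R) + b) - PP (N%:R * (l.1%:~R * z + l.2%:~R))).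
Proof.
move=> N0 z0; pose D : R := (1 + complex.Im z + cabs z) / complex.Im z.
have D0 : 0 < D by rewrite divr_gt0 //; have := cabs_ge0 z; lra.
(* Outside the square of size [K] the lattice point satisfies [2 |b| + 1 < |a|], so that [PP_diff]
   applies; finitely many terms are left. *)
pose K := (Num.truncn (D * (2 * cabs b + 1))).+1.
pose C : R := k%:R * 2 ^+ (k.*2) * cabs b * (D * 2) ^+ 3.
have C0 : 0 <= C by apply: mulr_ge0; [rewrite !mulr_ge0 ?exprn_ge0|rewrite exprn_ge0 // mulr_ge0 // ltW].
apply: (@absum_offfin _ _ _ (fsetXX (zball K) (zball K)) _ (rsmZ C0 rsm_b32)).
  by move=> p; rewrite mulr_ge0 // mulr_ge0 // b32_ge0.
move=> [p q]; rewrite in_fsetXX negb_and /= => hpq.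
pose M : R := `|p|%:~R + `|q|%:~R.
have P0 : 0 <= `|p|%:~R :> R by rewrite ler0z.
have Q0 : 0 <= `|q|%:~R :> R by rewrite ler0z.
have M1 : D * (2 * cabs b + 1) < M.
  apply: lt_le_trans (truncnS_gt _) _; rewrite -/K -[K%:R]/(K%:Z%:~R) /M.
  case/orP: hpq => /zballP h.
    by apply: le_trans (_ : _ <= `|p|%:~R) _; [rewrite ler_int ltW|rewrite lerDl].
  by apply: le_trans (_ : _ <= `|q|%:~R) _; [rewrite ler_int ltW|rewrite lerDr].
have MM1 : 1 <= M.
  have D1 : 1 <= D by rewrite /D ler_pdivlMr // mul1r; have := cabs_ge0 z; lra.
  have B1 : 1 <= 2 * cabs b + 1 by have := cabs_ge0 b; lra.
  by apply: le_trans (ltW M1); have := ler_pM ler01 ler01 D1 B1; rewrite mulr1.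
set a := N%:R * _; have aM : M <= D * cabs a.
  apply: le_trans (cabs_lattice p q z0) _; rewrite -/D ler_wpM2l ?(ltW D0) // /a cabsM cabs_nat.
  by rewrite ler_peMl // ler1n.
have ab : 2 * cabs b + 1 < cabs a by rewrite -(ltr_pM2l D0); exact: lt_le_trans aM.
have a1 : 1 <= cabs a by have := cabs_ge0 b; lra.
have an0 : a != 0 by rewrite -cabs_gt0; lra.
apply: le_trans (PP_diff an0 _) _; first by lra.
apply: le_trans (_ : _ <= C * (1 + `|p|%:~R + `|q|%:~R) ^- 3) _; last first.
  by rewrite ler_wpM2l // b32_lower.
rewrite /C -[leRHS]mulrA ler_wpM2l ?mulr_ge0 ?exprn_ge0 //.
rewrite -addrA -/M -expr_div_n.
have -> : (cabs a ^+ k.+1)^-1 = (cabs a)^-1 ^+ k.+1 by rewrite exprVn.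
apply: (@le_trans _ _ ((cabs a)^-1 ^+ 3)).
  by apply: ler_wiXn2l => //; rewrite ?invr_ge0 // invf_le1 //; lra.
rewrite lerXn2r ?nnegrE ?invr_ge0 ?mulr_ge0 ?invr_ge0 ?addr_ge0 ?(ltW D0) //; try lra.
rewrite ler_pdivlMr; last by lra.
rewrite ler_pdivrMl; last by lra.
by lra.
Qed.

End LatticeSums.

(** * Weighted Eisenstein series *)

Section Eisenstein.
Variables (R : realType) (k N : nat).
Hypotheses (k2 : (1 < k)%N) (N0 : (0 < N)%N).
Implicit Types (z : R[i]) (v l : int * int) (g : 'M[int]_2) (w : int * int -> R[i]).
Local Notation P := (@PP R k).

Definition ev v z : R[i] := v.1%:~R * z + v.2%:~R.

Definition tr v l : int * int := (N%:Z * l.1 + v.1, N%:Z * l.2 + v.2).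

(** Subtracting the term of the zero class gives absolute convergence for [k = 2]; it drops out of
    [Eis] when the weights sum to zero. *)
Definition Dv v z l : R[i] := P (ev (tr v l) z) - P (ev (tr (0, 0) l) z).

Definition fE v z : R[i] := csum (Dv v z).

Lemma ev_tr v l z : ev (tr v l) z = N%:R * (l.1%:~R * z + l.2%:~R) + ev v z.
Proof. by rewrite /ev /tr /= !rmorphD !rmorphM /=; ring. Qed.

Lemma absum_Dv v z : 0 < complex.Im z -> absum (Dv v z).
Proof.
move=> z0; have := absum_PP_diff k2 (ev v z) N0 z0.
rewrite (_ : (fun l => _) = Dv v z) //; apply/funext => l; rewrite /Dv !ev_tr.
by rewrite [ev (0, 0) z]/ev /= mul0r !addr0.
Qed.

Lemma absum_row2 a z : absum (fun n : int => P (a + (N%:Z * n)%:~R)).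
Proof. exact: absum_PP_row. Qed.

Lemma absum_row1 a z : 0 < complex.Im z -> absum (fun n : int => P ((N%:Z * n)%:~R * z + a)).
Proof.
move=> z0; have zn0 : z != 0 by apply: contraTneq z0 => ->; rewrite ltxx.
have := absumZ (P z) (absum_PP_row k2 (a / z) N0).
rewrite (_ : (fun i => _) = fun n : int => P ((N%:Z * n)%:~R * z + a)) //.
by apply/funext => n; rewrite -PPM; congr PP; field.
Qed.

(** Not a mere reindexing, since the subtracted class is not translated along. In the difference of
    the two sides the subtracted terms cancel; summed in the second coordinate first, both remaining
    families converge separately there, and a translation does not change their sums. *)
Lemma fE_per2 (v1 v2 t : int) z : 0 < complex.Im z -> fE (v1, v2 + N%:Z * t) z = fE (v1, v2) z.
Proof.
move=> z0; apply/eqP; rewrite -subr_eq0 /fE -csumB; try exact: absum_Dv.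
pose F l : R[i] := P (ev (tr (v1, v2 + N%:Z * t) l) z) - P (ev (tr (v1, v2) l) z).
have e : (fun l => Dv (v1, v2 + N%:Z * t) z l - Dv (v1, v2) z l) = F.
  by apply/funext => l; rewrite /Dv /F; ring.
have aF : absum F by rewrite -e; apply: absumB; exact: absum_Dv.
rewrite e (csum_pair aF); apply/eqP/csum0 => l1.
pose a := (N%:Z * l1 + v1)%:~R * z + v2%:~R.
have r1 := absum_row2 a z.
have r2 : absum (fun n : int => P (a + (N%:Z * (n + t))%:~R)).
  by apply: (absum_inj (h := fun n : int => n + t) _ r1); exact: addIr.
transitivity (csum (fun n : int => P (a + (N%:Z * (n + t))%:~R) - P (a + (N%:Z * n)%:~R))).
  apply: eq_csum => n; rewrite /F /ev /tr /a /=; congr (P _ - P _); rewrite !rmorphD !rmorphM /=; ring.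
rewrite csumB // [X in _ - X](@csum_bij _ _ _ (fun n : int => n + t) (fun n => n - t)) ?subrr //.
- by move=> n; rewrite addrK.
- by move=> n; rewrite subrK.
Qed.

(** The same argument with the order of summation exchanged, because now the first coordinate is
    translated. *)
Lemma fE_per1 (v1 v2 t : int) z : 0 < complex.Im z -> fE (v1 + N%:Z * t, v2) z = fE (v1, v2) z.
Proof.
move=> z0; apply/eqP; rewrite -subr_eq0 /fE -csumB; try exact: absum_Dv.
pose F l : R[i] := P (ev (tr (v1 + N%:Z * t, v2) l) z) - P (ev (tr (v1, v2) l) z).
have e : (fun l => Dv (v1 + N%:Z * t, v2) z l - Dv (v1, v2) z l) = F.
  by apply/funext => l; rewrite /Dv /F; ring.
have aF : absum F by rewrite -e; apply: absumB; exact: absum_Dv.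
rewrite e (csum_pair aF) (csum_swap aF); apply/eqP/csum0 => l2.
pose a := v1%:~R * z + (N%:Z * l2 + v2)%:~R.
have r1 := absum_row1 a z0.
have r2 : absum (fun n : int => P ((N%:Z * (n + t))%:~R * z + a)).
  by apply: (absum_inj (h := fun n : int => n + t) _ r1); exact: addIr.
transitivity (csum (fun n : int => P ((N%:Z * (n + t))%:~R * z + a) - P ((N%:Z * n)%:~R * z + a))).
  apply: eq_csum => n; rewrite /F /ev /tr /a /=; congr (P _ - P _); rewrite !rmorphD !rmorphM /=; ring.
rewrite csumB // [X in _ - X](@csum_bij _ _ _ (fun n : int => n + t) (fun n => n - t)) ?subrr //.
- by move=> n; rewrite addrK.
- by move=> n; rewrite subrK.
Qed.

Definition pcong v u : Prop := (N %| (v.1 - u.1)%R)%Z /\ (N %| (v.2 - u.2)%R)%Z.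

Lemma fE_mod v u z : 0 < complex.Im z -> pcong v u -> fE v z = fE u z.
Proof.
case: v u => [v1 v2] [u1 u2] z0 [/= /dvdzP[s E1] /dvdzP[t E2]].
have -> : v1 = u1 + N%:Z * s by rewrite mulrC -E1 addrC subrK.
have -> : v2 = u2 + N%:Z * t by rewrite mulrC -E2 addrC subrK.
by rewrite (fE_per1 u1 (u2 + N%:Z * t) s z0) (fE_per2 u1 u2 t z0).
Qed.

Definition act g v : int * int := (v.1 * g 0 0 + v.2 * g 1 0, v.1 * g 0 1 + v.2 * g 1 1).

Definition adj g := mk2 (g 1 1) (- g 0 1) (- g 1 0) (g 0 0).

Lemma actK g : SL2Z g -> cancel (act g) (act (adj g)).
Proof.
move=> /SL2P dg [c e]; rewrite /act /adj !mk2E /=; congr pair.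
  by rewrite -[RHS]mulr1 -dg; ring.
by rewrite -[RHS]mulr1 -dg; ring.
Qed.

Lemma act_adjK g : SL2Z g -> cancel (act (adj g)) (act g).
Proof.
move=> /SL2P dg [c e]; rewrite /act /adj !mk2E /=; congr pair.
  by rewrite -[RHS]mulr1 -dg; ring.
by rewrite -[RHS]mulr1 -dg; ring.
Qed.

Lemma act_tr g v l : act g (tr v l) = tr (act g v) (act g l).
Proof. by rewrite /act /tr /=; congr pair; ring. Qed.

Lemma ev_moebius g v z : automorphy g z != 0 ->
  ev v (moebius g z) = ev (act g v) z / automorphy g z.
Proof.
move=> a0; rewrite /ev /moebius /act /= !rmorphD !rmorphM /=.
move: a0; rewrite /automorphy => a0; by field.
Qed.

(** The action of [g] permutes the lattice and fixes the zero class, so the subtracted terms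
    transform along with the others. *)
Lemma fE_moebius g v z : SL2Z g -> 0 < complex.Im z ->
  fE v (moebius g z) = automorphy g z ^+ k * fE (act g v) z.
Proof.
move=> sg z0; have a0 := automorphy_neq0 sg z0.
rewrite /fE (@csum_bij _ _ _ (act g) (act (adj g)) (Dv (act g v) z)); [|exact: actK|exact: act_adjK|exact: absum_Dv].
rewrite -csumZ; last first.
  by apply: (absum_inj (h := act g) _ (absum_Dv _ z0)); exact: can_inj (actK sg).
apply: eq_csum => l; rewrite /Dv !ev_moebius // !PPM -mulrBl mulrC.
rewrite [PP k _^-1]/PP exprVn invrK; congr (_ * (P (ev _ z) - P (ev _ z))); rewrite act_tr //.
by rewrite {1}/act /= !mul0r addr0.
Qed.

Lemma sum_act g (F : int * int -> R[i]) : SL2Z g -> (forall v u, pcong v u -> F v = F u) ->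
  \sum_(p : 'I_N * 'I_N) F ((p.1 : nat)%:Z, (p.2 : nat)%:Z) =
  \sum_(p : 'I_N * 'I_N) F (act g ((p.1 : nat)%:Z, (p.2 : nat)%:Z)).
Proof.
move=> sg Fp; have N0Z : N%:Z != 0 by rewrite -lt0n.
pose em (p : 'I_N * 'I_N) := ((p.1 : nat)%:Z, (p.2 : nat)%:Z).
have lt (x : int) : (`|(x %% N)%Z|%N < N)%N.
  by rewrite -ltz_nat gez0_abs ?modz_ge0 // ltz_pmod.
pose rd (v : int * int) : 'I_N * 'I_N := (Ordinal (lt v.1), Ordinal (lt v.2)).
have rdE v : pcong (em (rd v)) v.
  have h (x : int) : (N %| (`|(x %% N)%Z|%N%:Z - x)%R)%Z.
    rewrite gez0_abs ?modz_ge0 //; apply/dvdzP; exists (- (x %/ N)%Z).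
    by have := divz_eq x N; lia.
  by split; exact: h.
have emI p q : pcong (em p) (em q) -> p = q.
  by case: p q => [p1 p2] [q1 q2] [/= h1 h2]; congr pair; apply: dvdz_ord.
have cact h v u : pcong v u -> pcong (act h v) (act h u).
  case: v u => [v1 v2] [u1 u2] [/= a b]; rewrite /pcong /act /=; split.
    rewrite (_ : _ - _ = (v1 - u1) * h 0 0 + (v2 - u2) * h 1 0); last by ring.
    by rewrite rpredD // dvdz_mulr.
  rewrite (_ : _ - _ = (v1 - u1) * h 0 1 + (v2 - u2) * h 1 1); last by ring.
  by rewrite rpredD // dvdz_mulr.
have csym v u : pcong v u -> pcong u v by case=> a b; split; rewrite -opprB rpredN.
have ctr v u x : pcong v u -> pcong u x -> pcong v x.
  move=> [a b] [c d]; split.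
    have -> : v.1 - x.1 = (v.1 - u.1) + (u.1 - x.1) by rewrite addrA subrK.
    exact: rpredD.
  have -> : v.2 - x.2 = (v.2 - u.2) + (u.2 - x.2) by rewrite addrA subrK.
  exact: rpredD.
have bij : bijective (fun p => rd (act g (em p))).
  apply: injF_bij => p q e; apply: emI.
  have h1 : pcong (act g (em p)) (act g (em q)).
    by apply: ctr (csym _ _ (rdE _)) _; rewrite e; exact: rdE.
  by have := cact (adj g) _ _ h1; rewrite !actK.
rewrite (reindex _ (onW_bij _ bij)) /=.
by apply: eq_bigr => p _; apply: Fp; exact: rdE.
Qed.

Definition Eis w z : R[i] :=
  \sum_(p : 'I_N * 'I_N) w ((p.1 : nat)%:Z, (p.2 : nat)%:Z) * fE ((p.1 : nat)%:Z, (p.2 : nat)%:Z) z.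

Lemma Eis_moebius w g z : SL2Z g -> 0 < complex.Im z -> (forall v u, pcong v u -> w v = w u) ->
  Eis w (moebius g z) = automorphy g z ^+ k * Eis (fun v => w (act (adj g) v)) z.
Proof.
move=> sg z0 wp.
have cact h v u : pcong v u -> pcong (act h v) (act h u).
  case: v u => [v1 v2] [u1 u2] [/= a b]; rewrite /pcong /act /=; split.
    rewrite (_ : _ - _ = (v1 - u1) * h 0 0 + (v2 - u2) * h 1 0); last by ring.
    by rewrite rpredD // dvdz_mulr.
  rewrite (_ : _ - _ = (v1 - u1) * h 0 1 + (v2 - u2) * h 1 1); last by ring.
  by rewrite rpredD // dvdz_mulr.
pose F v := w (act (adj g) v) * fE v z.
have Fp v u : pcong v u -> F v = F u.
  by move=> vu; rewrite /F (fE_mod z0 vu) (wp _ _ (cact (adj g) _ _ vu)).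
have H := sum_act sg Fp.
have -> : Eis (fun v => w (act (adj g) v)) z = \sum_(p : 'I_N * 'I_N) F (act g ((p.1 : nat)%:Z, (p.2 : nat)%:Z)).
  exact: H.
rewrite /Eis mulr_sumr; apply: eq_bigr => p _.
rewrite /F (actK sg) (fE_moebius _ sg z0); exact: mulrCA.
Qed.

Definition rsum w (c : int) z : R[i] :=
  \sum_(j < N) w (c, (j : nat)%:Z) * csum (fun n : int => P (c%:~R * z + (j : nat)%:~R + (N%:Z * n)%:~R)).

(** The weights sum to zero, so the subtracted terms cancel and an iterated sum by rows is left.
    Each row converges absolutely, and so by hypothesis does the sum over the rows, without absolute
    convergence of the unsubtracted double sum. *)
Lemma Eis_rows w z : 0 < complex.Im z -> (forall v u, pcong v u -> w v = w u) ->
  \sum_(p : 'I_N * 'I_N) w ((p.1 : nat)%:Z, (p.2 : nat)%:Z) = 0 ->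
  absum (fun c => rsum w c z) -> Eis w z = csum (fun c => rsum w c z).
Proof.
move=> z0 wp w0 ar.
pose W (p : 'I_N * 'I_N) := w ((p.1 : nat)%:Z, (p.2 : nat)%:Z).
pose V (p : 'I_N * 'I_N) : int * int := ((p.1 : nat)%:Z, (p.2 : nat)%:Z).
pose H l : R[i] := \sum_(p : 'I_N * 'I_N) W p * P (ev (tr (V p) l) z).
have aD (p : 'I_N * 'I_N) : absum (fun l => W p * Dv (V p) z l) by apply: absumZ; exact: absum_Dv.
have HE l : H l = \sum_(p : 'I_N * 'I_N) W p * Dv (V p) z l.
  rewrite /Dv; under [RHS]eq_bigr do rewrite mulrBr.
  by rewrite sumrB -mulr_suml [X in X * _](w0 : \sum_p W p = 0) mul0r subr0.
have aH : absum H by rewrite (funext HE); apply: absum_fsum.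
have e1 : Eis w z = csum H.
  rewrite (eq_csum HE) csum_fsum //; apply: eq_bigr => p _.
  by rewrite csumZ //; exact: absum_Dv.
have row (l1 : int) : csum (fun l2 : int => H (l1, l2)) = \sum_(i < N) rsum w (N%:Z * l1 + (i : nat)%:Z) z.
  have aP (p : 'I_N * 'I_N) : absum (fun l2 : int => W p * P (ev (tr (V p) (l1, l2)) z)).
    apply: absumZ; have := absum_row2 ((N%:Z * l1 + (V p).1)%:~R * z + (V p).2%:~R) z.
    rewrite (_ : (fun n => _) = fun l2 : int => P (ev (tr (V p) (l1, l2)) z)) //.
    by apply/funext => n; rewrite /ev /tr /=; congr PP; rewrite !rmorphD !rmorphM /=; ring.
  rewrite /H csum_fsum // -(pair_bigA _ (fun i j => csum (fun l2 : int => W (i, j) * P (ev (tr (V (i, j)) (l1, l2)) z)))) /=.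
  apply: eq_bigr => i _; rewrite /rsum; apply: eq_bigr => j _.
  have -> : w (N%:Z * l1 + (i : nat)%:Z, (j : nat)%:Z) = W (i, j).
    by apply: wp; split => /=; rewrite ?subrr ?dvdz0 // addrK dvdz_mulr.
  rewrite -csumZ; last first.
    exact: absum_row2.
  apply: eq_csum => l2; rewrite /ev /tr /V /=; congr (_ * PP _ _); rewrite !rmorphD !rmorphM /=; ring.
rewrite e1 (csum_pair aH) (eq_csum row).
have lt (x : int) : (`|(x %% N)%Z|%N < N)%N.
  by rewrite -ltz_nat gez0_abs ?modz_ge0 -?lt0n // ltz_pmod.
pose h (p : 'I_N * int) : int := N%:Z * p.2 + (p.1 : nat)%:Z.
pose h' (c : int) : 'I_N * int := (Ordinal (lt c), (c %/ N)%Z).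
have hK : cancel h h'.
  move=> [i n]; rewrite /h /h' /=.
  have i0 : 0 <= (i : nat)%:Z < `|N%:Z| by rewrite lez_nat /= ltz_nat ltn_ord.
  congr pair; last by rewrite mulrC divzMDl -?lt0n // divz_small ?addr0.
  by apply: val_inj; rewrite /= mulrC modzMDl modz_small.
have h'K : cancel h' h.
  move=> c; rewrite /h /h' /= gez0_abs ?modz_ge0 -?lt0n //.
  by rewrite mulrC -divz_eq.
have ah : absum (fun p => rsum w (h p) z) by apply: (absum_inj (h := h) _ ar); exact: can_inj hK.
rewrite [RHS](csum_bij hK h'K ar) [RHS](csum_pair ah) [RHS]csum_finType -[RHS]csum_fsum; last first.
  by move=> i; exact: (absum_row i ah).
by apply: eq_csum => l1; apply: eq_bigr.
Qed.

(** Finite Fourier transform of a row of weights; Lipschitz' formula on each residue class turns a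
    row sum into these coefficients. *)
Definition what w (c : int) (m : nat) : R[i] := \sum_(j < N) w (c, (j : nat)%:Z) * ze R N (m%:Z * (j : nat)%:Z).

Lemma rsum_pos w (c : nat) z : 0 < complex.Im z ->
  rsum w c.+1%:Z z = N%:R ^- k * lipc R k.-1 *
    csum (fun m : nat => m%:R ^+ k.-1 * what w c.+1%:Z m * nome ((c.+1 * m)%N%:R * (z / N%:R))).
Proof.
move=> z0; have NR : N%:R != 0 :> R[i] by rewrite pnatr_eq0 -lt0n.
have kE : k = k.-1.+1 by rewrite prednK // ltnW.
have k10 : (0 < k.-1)%N by rewrite -ltnS -kE.
pose u (j : nat) : R[i] := (c.+1%:R * z + j%:R) / N%:R.
have Imu j : 0 < complex.Im (u j).
  have -> : u j = (c.+1%:R / N%:R : R)%:C * z + (j%:R / N%:R : R)%:C.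
    by rewrite !rmorphM !fmorphV /= !rmorph_nat /u; ring.
  by rewrite Im_add Im_realM /= addr0 mulr_gt0 ?divr_gt0 ?ltr0n.
have L (j : nat) : csum (fun n : int => P (c.+1%:~R * z + j%:~R + (N%:Z * n)%:~R)) =
   N%:R ^- k * lipc R k.-1 * csum (fun m : nat => m%:R ^+ k.-1 * nome (m%:R * u j)).
  have [aL eL] := lipschitz k10 (Imu j); rewrite -kE in aL eL.
  rewrite -mulrA -eL -csumZ //; apply: eq_csum => n.
  rewrite -[LHS]/((c.+1%:R * z + j%:R + (N%:Z * n)%:~R) ^- k) -invfM -exprMn; congr (_ ^- k).
  by rewrite /u rmorphM /= mulrDr [N%:R * (_ / _)]mulrC divfK.
have aM j : absum (fun m : nat => m%:R ^+ k.-1 * nome (m%:R * u j)).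
  have y0 : 0 < 2 * pi * complex.Im (u j) by rewrite !mulr_gt0 ?pi_gt0.
  apply: absum_le (rsm_polyexp k.-1 y0) => m; rewrite cabsM cabsX cabs_nat cabs_nome.
  rewrite -(rmorph_nat (@real_complex_def R (Phant R))) Im_realM mulrCA [m%:R * _]mulrC.
  by rewrite ler_wpM2r ?expR_ge0 // lerXn2r ?nnegrE // ler_nat.
rewrite /rsum (eq_bigr _ (fun (j : 'I_N) _ => congr1 _ (L j))).
under eq_bigr do rewrite mulrCA; rewrite -mulr_sumr; congr (_ * _).
have -> : \sum_(j < N) w (c.+1%:Z, (j : nat)%:Z) * csum (fun m : nat => m%:R ^+ k.-1 * nome (m%:R * u j)) =
   \sum_(j < N) csum (fun m : nat => w (c.+1%:Z, (j : nat)%:Z) * (m%:R ^+ k.-1 * nome (m%:R * u j))).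
  by apply: eq_bigr => j _; rewrite csumZ.
rewrite -csum_fsum; last by move=> j; apply: absumZ; exact: aM.
apply: eq_csum => m; rewrite /what mulr_sumr mulr_suml; apply: eq_bigr => j _.
have -> : nome (m%:R * u j) = ze R N (m%:Z * (j : nat)%:Z) * nome ((c.+1 * m)%N%:R * (z / N%:R)).
  rewrite /ze -nomeD; congr nome; rewrite /u rmorphM natrM /= -[(j : nat)%:~R]/((j : nat)%:R) -[m%:~R]/(m%:R).
  by move: NR; move: (N%:R) (c.+1%:R) => M C NR; field.
by ring.
Qed.

(** By the parity of the weights the rows [c] and [-c] agree, which reduces everything but row 0 to
    the rows where Lipschitz' formula applies. *)
Lemma rsumN w (c : int) z : (forall v u, pcong v u -> w v = w u) ->
  (forall v, w (- v.1, - v.2) = (-1) ^+ k * w v) -> rsum w (- c) z = rsum w c z.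
Proof.
move=> wp wN; rewrite /rsum.
pose F (x : int) : R[i] := w (- c, x) * csum (fun n : int => P ((- c)%:~R * z + x%:~R + (N%:Z * n)%:~R)).
have per c' x y : (N %| (x - y)%R)%Z ->
   csum (fun n : int => P (c'%:~R * z + x%:~R + (N%:Z * n)%:~R)) = csum (fun n : int => P (c'%:~R * z + y%:~R + (N%:Z * n)%:~R)).
  move=> /dvdzP[q E]; rewrite [RHS](@csum_bij _ _ _ (fun n : int => n + q) (fun n => n - q)).
  - apply: eq_csum => n; congr PP; have -> : x = q * N%:Z + y by rewrite -E subrK.
    rewrite !(rmorphD, rmorphM) /=; ring.
  - by move=> n; rewrite addrK.
  - by move=> n; rewrite subrK.
  - exact: absum_row2.
have Fp x y : (N %| (x - y)%R)%Z -> F x = F y.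
  move=> xy; rewrite /F (per _ _ _ xy); congr (_ * _); apply: wp; split => //=.
  by rewrite subrr dvdz0.
have cop : coprime N `|(-1)%R : int|%N by exact: coprimen1.
transitivity (\sum_(j < N) F (-1 * (j : nat)%:Z)); first exact: (sum_ord_scale N0 cop Fp).
apply: eq_bigr => j _; rewrite /F mulN1r.
rewrite (wN (c, (j : nat)%:Z)) /= (@csum_bij _ _ _ (fun n : int => - n) (fun n => - n)); try exact: opprK; last exact: absum_row2.
have e (n : int) : P ((- c)%:~R * z + (- (j : nat)%:Z)%:~R + (N%:Z * - n)%:~R) =
    (-1) ^+ k * P (c%:~R * z + (j : nat)%:~R + (N%:Z * n)%:~R).
  rewrite -PPN; congr PP; rewrite mulrN !rmorphN /= -[(j : nat)%:Z%:~R]/((j : nat)%:~R); ring.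
rewrite (eq_csum e) csumZ; last exact: absum_row2.
have s2 : (-1) ^+ k * (-1) ^+ k = 1 :> R[i] by rewrite -expr2 -exprM mulnC exprM sqrrN expr1n expr1n.
transitivity ((-1) ^+ k * (-1) ^+ k * (w (c, (j : nat)%:Z) * csum (fun n : int => P (c%:~R * z + (j : nat)%:~R + (N%:Z * n)%:~R)))).
  by ring.
by rewrite s2 mul1r.
Qed.

Lemma csum_int_even (F : int -> R[i]) : (forall c, F (- c) = F c) ->
  absum (fun c : nat => F c.+1%:Z) ->
  absum F /\ csum F = F 0 + 2 * csum (fun c : nat => F c.+1%:Z).
Proof.
move=> Fe aF.
pose F1 (c : int) := if c is Posz n.+1 then F c else 0.
pose F2 (c : int) := if c is Negz n then F c else 0.
pose F0 (c : int) := if c == 0 then F c else 0.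
have h1 : cancel (fun n : nat => n.+1%:Z) (fun c : int => `|c|%N.-1) by [].
have h2 : cancel Negz (fun c : int => if c is Negz n then n else 0%N) by [].
have z1 c : (`|c|%N.-1).+1%:Z != c -> F1 c = 0 by case: c => [[|n]|n] //=; rewrite eqxx.
have z2 c : Negz (if c is Negz n then n else 0%N) != c -> F2 c = 0 by case: c => n //=; rewrite eqxx.
have n2 : (fun n : nat => F2 (Negz n)) = fun n => F n.+1%:Z by apply/funext => n; rewrite /F2 NegzE Fe.
have a1 : absum F1 by apply: (@absum_reindex _ _ _ (fun n : nat => n.+1%:Z) (fun c : int => `|c|%N.-1)).
have a2 : absum F2.
  by apply: (@absum_reindex _ _ _ Negz (fun c : int => if c is Negz n then n else 0%N)) => //; rewrite n2.
have c0 c : c \notin [fset (0 : int)]%fset -> F0 c = 0 by rewrite inE /F0 => /negbTE ->.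
have a0 : absum F0 := absum_fin c0.
have E : F = fun c => F0 c + (F1 c + F2 c).
  by apply/funext => -[[|n]|n]; rewrite /F0 /F1 /F2 /= ?addr0 ?add0r.
have -> : csum F = csum (fun c => F0 c + (F1 c + F2 c)) by rewrite {1}E.
split; first by rewrite E; apply: absumD => //; apply: absumD.
rewrite csumD ?csumD //; last exact: absumD.
rewrite (csum_fin c0) big_seq_fset1 /F0 eqxx; congr (_ + _).
rewrite (csum_reindex h1 z1) // (csum_reindex h2 z2) ?n2 //=.
by rewrite mulr_natl mulr2n.
Qed.

Definition ecoef w (p : nat * nat) : R[i] := p.2%:R ^+ k.-1 * what w p.1.+1%:Z p.2.

Lemma absum_ecoef w z : 0 < complex.Im z -> (forall v u, pcong v u -> w v = w u) ->
  absum (fun p : nat * nat => ecoef w p * nome ((p.1.+1 * p.2)%N%:R * (z / N%:R))).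
Proof.
move=> z0 wp.
have [B B0 wB] : exists2 B : R, 0 <= B & forall c m, cabs (what w c m) <= B.
  exists (\sum_(p : 'I_N * 'I_N) cabs (w ((p.1 : nat)%:Z, (p.2 : nat)%:Z))); first exact: sumr_ge0.
  move=> c m; apply: le_trans (cabs_sum _ _ _) _.
  have lt : (`|(c %% N)%Z|%N < N)%N by rewrite -ltz_nat gez0_abs ?modz_ge0 -?lt0n // ltz_pmod.
  rewrite -(pair_bigA _ (fun i j : 'I_N => cabs (w ((i : nat)%:Z, (j : nat)%:Z)))) /= [leRHS](bigD1 (Ordinal lt)) //=.
  rewrite ler_wpDr //; first by apply: sumr_ge0 => i _; exact: sumr_ge0.
  apply: ler_sum => j _; rewrite cabsM [X in _ * X](_ : _ = 1) ?mulr1; last first.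
    rewrite /ze cabs_nome (_ : complex.Im _ = 0) ?mulr0 ?oppr0 ?expR0 //.
    by rewrite -(rmorph_int (@real_complex_def R (Phant R))) -(rmorph_nat (@real_complex_def R (Phant R))) -fmorphV -rmorphM.
  rewrite le_eqVlt; apply/orP; left; apply/eqP; congr cabs; apply: wp; split => /=; rewrite ?subrr ?dvdz0 //.
  rewrite gez0_abs ?modz_ge0 -?lt0n //; apply/dvdzP; exists (c %/ N)%Z; have := divz_eq c N; lia.
pose y : R := 2 * pi * (complex.Im z / N%:R).
have y0 : 0 < y by rewrite !mulr_gt0 ?pi_gt0 ?invr_gt0 ?ltr0n.
have := rsmZ B0 (rsm_prod _ _ (rsm_polyexp 0 y0) (rsm_polyexp k.-1 y0)).
move=> /(_ _ _)/absum_le; apply; last 2 first.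
- by move=> c; rewrite mulr_ge0 ?exprn_ge0 ?expR_ge0.
- by move=> c; rewrite mulr_ge0 ?exprn_ge0 ?expR_ge0.
move=> [c m] /=; rewrite /ecoef /= !cabsM cabsX cabs_nat expr0 mul1r cabs_nome.
(* The terms with [m = 0] vanish since [k > 1]; for [m >= 1] the inequality [c + m <= (c + 1) m]
   separates the two indices. *)
have [->|m0] := eqVneq m 0%N.
  by rewrite expr0n eqn0Ngt -ltnS prednK ?(ltnW k2) // k2 !mul0r !mulr_ge0 ?expR_ge0 ?exprn_ge0.
have -> : complex.Im ((c.+1 * m)%N%:R * (z / N%:R)) = (c.+1 * m)%N%:R * (complex.Im z / N%:R).
  have ImN : complex.Im (z / N%:R) = complex.Im z / N%:R.
    by rewrite mulrC -(rmorph_nat (@real_complex_def R (Phant R))) -fmorphV Im_realM mulrC.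
  by rewrite -(rmorph_nat (@real_complex_def R (Phant R)) (c.+1 * m)) Im_realM ImN.
apply: (@le_trans _ _ (m.+1%:R ^+ k.-1 * B * (expR (- (y * c%:R)) * expR (- (y * m%:R))))); last first.
  rewrite le_eqVlt; apply/orP; left; apply/eqP; ring.
rewrite -expRD; apply: ler_pM; rewrite ?mulr_ge0 ?exprn_ge0 ?expR_ge0 //.
  by apply: ler_pM; rewrite ?exprn_ge0 // lerXn2r ?nnegrE // ler_nat.
rewrite ler_expR -opprD lerN2 -mulrDr.
have -> : 2 * pi * ((c.+1 * m)%N%:R * (complex.Im z / N%:R)) = y * (c.+1 * m)%N%:R by rewrite /y; ring.
rewrite ler_wpM2l ?(ltW y0) // -natrD ler_nat; move: m0; clear; nia.
Qed.

(** Row 0 is the constant term; the rows [c] and [-c] together give the factor 2. *)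
Lemma Eis_expand w z : 0 < complex.Im z -> (forall v u, pcong v u -> w v = w u) ->
  (forall v, w (- v.1, - v.2) = (-1) ^+ k * w v) ->
  \sum_(p : 'I_N * 'I_N) w ((p.1 : nat)%:Z, (p.2 : nat)%:Z) = 0 ->
  Eis w z = \sum_(j < N) w (0, (j : nat)%:Z) * csum (fun n : int => P ((j : nat)%:~R + (N%:Z * n)%:~R)) +
    2 * (N%:R ^- k * lipc R k.-1) *
    csum (fun p : nat * nat => ecoef w p * nome ((p.1.+1 * p.2)%N%:R * (z / N%:R))).
Proof.
move=> z0 wp wN w0; have ae := absum_ecoef z0 wp.
have rE (c : nat) : rsum w c.+1%:Z z = N%:R ^- k * lipc R k.-1 *
   csum (fun m : nat => ecoef w (c, m) * nome (((c, m).1.+1 * (c, m).2)%N%:R * (z / N%:R))) by exact: rsum_pos.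
have ar : absum (fun c : nat => rsum w c.+1%:Z z).
  by rewrite (funext rE); apply: absumZ; exact: (absum_csum ae).
have [aF eF] := @csum_int_even (fun c => rsum w c z) (fun c => rsumN c z wp wN) ar.
have e1 := Eis_rows z0 wp w0 aF.
have e2 : rsum w 0 z = \sum_(j < N) w (0, (j : nat)%:Z) * csum (fun n : int => P ((j : nat)%:~R + (N%:Z * n)%:~R)).
  apply: eq_bigr => j _; apply: (congr1 ( *%R _)); apply: eq_csum => n; by rewrite mul0r add0r.
have e3 : 2 * csum (fun c : nat => rsum w c.+1%:Z z) = 2 * (N%:R ^- k * lipc R k.-1) *
    csum (fun p : nat * nat => ecoef w p * nome ((p.1.+1 * p.2)%N%:R * (z / N%:R))).
  rewrite -mulrA; apply: (congr1 ( *%R 2)); rewrite (csum_pair ae) -csumZ; last exact: (absum_csum ae).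
  by apply: eq_csum => c; rewrite rE.
exact: etrans (etrans e1 eF) (congr2 +%R e2 e3).
Qed.

End Eisenstein.

(** * The L-value at [k] and generalized Bernoulli numbers *)

Section LValue.
Variables (R : realType) (N : nat).
Hypotheses (oN : odd N) (sqN : squarefree N) (N1 : (1 < N)%N).
Let N0 : (0 < N)%N := ltnW N1.

Lemma cvs_sum (I : Type) (r : seq I) (u : I -> nat -> R[i]) (l : I -> R[i]) :
  (forall i, cvs (u i) (l i)) -> cvs (fun n => \sum_(i <- r) u i n) (\sum_(i <- r) l i).
Proof.
move=> h; elim: r => [|i r IHr].
  by rewrite big_nil (_ : (fun n => _) = fun=> 0); [exact: cvs_cst|apply/funext => n; rewrite big_nil].
rewrite big_cons (_ : (fun n => _) = fun n => u i n + \sum_(i <- r) u i n); first exact: cvsD.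
by apply/funext => n; rewrite big_cons.
Qed.

Lemma csum_nat_recl (f : nat -> R[i]) : absum f -> csum f = f 0%N + csum (fun m => f m.+1).
Proof.
move=> af; pose f0 m := if m == 0%N then f m else 0; pose f1 m := if m == 0%N then 0 else f m.
have a1 : absum (fun m => f1 m.+1) by apply: (absum_inj (h := S) _ af) => x y [].
have c0 m : m \notin [fset 0%N]%fset -> f0 m = 0 by rewrite inE /f0 => /negbTE ->.
have z1 m : m.-1.+1 != m -> f1 m = 0 by case: m => //= m; rewrite eqxx.
have a1' : absum f1 by apply: (@absum_reindex _ _ _ S predn).
have -> : csum f = csum (fun m => f0 m + f1 m).
  by apply: eq_csum => -[|m]; rewrite /f0 /f1 /= ?addr0 ?add0r.
rewrite csumD //; last exact: absum_fin c0.
by rewrite (csum_fin c0) big_seq_fset1 (csum_reindex (h := S) (h' := predn) _ z1).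
Qed.

Lemma csum_nat_split (f : nat -> R[i]) n : absum f ->
  csum f = \sum_(m < n) f m + csum (fun m => f (m + n)%N).
Proof.
move=> af; elim: n => [|n IHn].
  by rewrite big_ord0 add0r; apply: eq_csum => m; rewrite addn0.
rewrite IHn big_ord_recr /= -addrA; congr (_ + _); rewrite csum_nat_recl //.
  by congr (_ + _); apply: eq_csum => m; rewrite addSnnS.
by apply: (absum_inj (h := fun m => (m + n)%N) _ af); exact: addIn.
Qed.

Lemma cvs_le u (l : R[i]) (K : R) : cvs u l -> (forall n, cabs (u n) <= K) -> cabs l <= K.
Proof.
move=> ul uK; rewrite leNgt; apply/negP => Kl.
have e0 : 0 < cabs l - K by rewrite subr_gt0.
have [n0 h] := ul _ e0; have := h n0 (leqnn _); have := uK n0.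
have := cabsB (u n0) (u n0 - l); rewrite opprB addrC subrK; lra.
Qed.

(** Points [i / (t + 1)] tending to 0, where the left side of Lipschitz' formula becomes an
    L-value. *)
Definition zt (t : nat) : R[i] := (t.+1%:R^-1)*i.

Lemma Im_zt t : 0 < complex.Im (zt t).
Proof. by rewrite /= invr_gt0 ltr0n. Qed.

Lemma cvs_zt : cvs zt 0.
Proof.
apply: (@cvs_squeeze _ _ (fun t => t.+1%:R^-1)).
  by move=> t; apply: le_trans (cabs_le _) _; rewrite /= normr0 add0r gtr0_norm // invr_gt0 ltr0n.
move=> e e0; exists (Num.truncn e^-1).+1 => t ht.
rewrite invf_plt ?posrE ?ltr0n //; apply: lt_le_trans (truncnS_gt _) _.
by rewrite ler_nat; exact: leq_trans ht (leqnSn _).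
Qed.

Definition qt (t : nat) : R[i] := nome (zt t / N%:R).

Lemma qtE t : qt t = (expR (- (2 * pi * (t.+1%:R^-1 / N%:R))))%:C.
Proof.
rewrite /qt; have -> : zt t / N%:R = (t.+1%:R^-1 / N%:R)*i.
  rewrite -(rmorph_nat (@real_complex_def R (Phant R))) -fmorphV mulrC.
  by apply/eqP; rewrite eq_complex /= !(mul0r, subr0, addr0, mulr0) eqxx /= mulrC.
rewrite nomeE /cexp /= mulr0 cos0 sin0 mulr1 mulr0.
by [].
Qed.

Lemma cabs_qt t : cabs (qt t) < 1.
Proof.
rewrite qtE cabsR ger0_norm ?expR_ge0 // -[X in _ < X]expR0 ltr_expR oppr_lt0.
by rewrite !mulr_gt0 ?pi_gt0 ?invr_gt0 ?ltr0n.
Qed.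

Lemma cvs_qt : cvs qt 1.
Proof.
have NR : 0 < N%:R :> R by rewrite ltr0n.
suff h : cvs (fun t => qt t - 1) 0.
  have := cvsD h (cvs_cst 1); rewrite add0r (_ : (fun n => _) = qt) //.
  by apply/funext => t; rewrite subrK.
pose C : R := 2 * pi / N%:R.
have C0 : 0 < C by rewrite divr_gt0 // mulr_gt0 // pi_gt0.
apply: (@cvs_squeeze _ _ (fun t => C / t.+1%:R)).
  move=> t; rewrite qtE -(rmorph1 (@real_complex_def R (Phant R))) -rmorphB /= cabsR.
  have -> : 2 * pi * (t.+1%:R^-1 / N%:R) = C / t.+1%:R by rewrite /C; ring.
  set y := C / _; have y0 : 0 <= y by rewrite divr_ge0 // ltW.
  have h1 := expR_ge1Dx (- y); have h2 : expR (- y) <= 1 by rewrite -expR0 ler_expR oppr_le0.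
  rewrite ler0_norm; lra.
move=> e e0; exists (Num.truncn (C / e)).+1 => t ht.
rewrite ltr_pdivrMr ?ltr0n // -ltr_pdivrMl // mulrC.
apply: lt_le_trans (truncnS_gt _) _; rewrite ler_nat; exact: leq_trans ht (leqnSn _).
Qed.

Definition fS j t (m : nat) : R[i] := (chi N m)%:~R * m%:R ^+ j * qt t ^+ m.

(** Abel regularisation of the divergent sum of [chi(m) m^j], whose limit is the L-value at [-j]. *)
Definition SS j t : R[i] := csum (fS j t).

Lemma cabs_chi (b : int) : cabs ((chi N b)%:~R : R[i]) <= 1.
Proof.
case: (boolP (coprime N `|b|%N)) => [cop|ncop].
  rewrite -(@expr_le1 _ 2) // -cabsX -rmorphXn /= chi_sqr // cabs1 //.
have /eqP -> : chi N b == 0 by rewrite chi_eq0.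
by rewrite cabs0.
Qed.

Lemma absum_fS j t : absum (fS j t).
Proof.
pose y : R := 2 * pi * (t.+1%:R^-1 / N%:R).
have y0 : 0 < y by rewrite !mulr_gt0 ?pi_gt0 ?invr_gt0 ?ltr0n.
apply: absum_le (rsm_polyexp j y0) => m; rewrite /fS !cabsM !cabsX cabs_nat qtE cabsR.
rewrite ger0_norm ?expR_ge0 // -/y -expRM_natl.
have -> : m%:R * - y = - (y * m%:R) by ring.
rewrite ler_wpM2r ?expR_ge0 //.
apply: (@le_trans _ _ (1 * m%:R ^+ j)); first by rewrite ler_wpM2r ?exprn_ge0 // cabs_chi.
by rewrite mul1r lerXn2r ?nnegrE // ler_nat.
Qed.

Lemma chi_N0 : chi N 0 = 0.
Proof. by apply/eqP; rewrite chi_eq0 // /coprime gcdn0; case: eqP N1 => // ->. Qed.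

(** The terms below [N] are split off and the rest is shifted by [N], under which [chi N] is
    invariant; the binomial expansion of [(m + N)^j] brings in the lower [SS i]. *)
Lemma SS_rec j t : (1 - qt t ^+ N) * SS j t =
  \sum_(a < N) (chi N (a : nat)%:Z)%:~R * (a : nat)%:R ^+ j * qt t ^+ a
  + qt t ^+ N * \sum_(i < j) 'C(j, i)%:R * N%:R ^+ (j - i) * SS i t.
Proof.
have e m : fS j t (m + N)%N = \sum_(i < j.+1) qt t ^+ N * ('C(j, i)%:R * N%:R ^+ (j - i)) * fS i t m.
  rewrite /fS PoszD.
  have -> : chi N (m%:Z + N%:Z) = chi N m by apply: (chi_mod R oN); rewrite addrC addKr dvdzz.
  rewrite natrD [m%:R + _]addrC exprDn exprD !mulr_sumr !mulr_suml.
  by apply: eq_bigr => i _; rewrite -mulr_natr; ring.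
have aS i : absum (fun m => qt t ^+ N * ('C(j, i)%:R * N%:R ^+ (j - i)) * fS i t m) by apply: absumZ; exact: absum_fS.
have E : SS j t = \sum_(a < N) fS j t a + \sum_(i < j.+1) qt t ^+ N * ('C(j, i)%:R * N%:R ^+ (j - i)) * SS i t.
  rewrite /SS (csum_nat_split N (absum_fS j t)); congr (_ + _).
  rewrite (eq_csum e) csum_fsum //; apply: eq_bigr => i _; rewrite csumZ //; exact: absum_fS.
rewrite mulrBl mul1r {1}E big_ord_recr /= binn subnn expr0 !mulr1 addrA addrK; congr (_ + _).
by rewrite mulr_sumr; apply: eq_bigr => i _; rewrite -!mulrA.
Qed.

(** By separability of the Gauss sum, the Fourier transform of [chi N] is a multiple of [chi N]. *)
Lemma SS_lip p t : (0 < p)%N ->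
  \sum_(j < N) (chi N (j : nat)%:Z)%:~R * csum (fun n : int => PP p.+1 (zt t + (j : nat)%:~R + (N%:Z * n)%:~R))
  = N%:R ^- p.+1 * lipc R p * Tsum R N 1 * SS p t.
Proof.
move=> p0; have k2 : (1 < p.+1)%N by [].
pose w (v : int * int) : R[i] := (chi N v.2)%:~R.
have := rsum_pos k2 N0 w 0 (Im_zt t); rewrite /rsum /w /= mul1r => ->.
rewrite -[RHS]mulrA; congr (_ * _); rewrite /SS -csumZ; last exact: absum_fS.
have [TE _] := Tsum_main R oN sqN.
apply: eq_csum => m; rewrite /what /= mul1n nomeMn -/(qt t) /fS.
rewrite -[\sum_(j < N) _]/(Tsum R N m%:Z) TE; ring.
Qed.

(** The sum of [chi(r) r^(-p-1)] over all nonzero integers, twice an L-value when the parities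
    agree; it is kept in residue classes, the shape in which it occurs as a constant term. *)
Definition L2 p : R[i] :=
  \sum_(j < N) (chi N (j : nat)%:Z)%:~R * csum (fun n : int => PP p.+1 ((j : nat)%:~R + (N%:Z * n)%:~R)).

Lemma L2_lim p : (0 < p)%N -> cvs (fun t => N%:R ^- p.+1 * lipc R p * Tsum R N 1 * SS p t) (L2 p).
Proof.
move=> p0; have k2 : (1 < p.+1)%N by [].
apply: (@eq_cvs _ (fun t => \sum_(j < N) (chi N (j : nat)%:Z)%:~R *
    csum (fun n : int => PP p.+1 (zt t + (j : nat)%:~R + (N%:Z * n)%:~R)))).
  by exists 0%N => t _; exact: SS_lip.
apply: (@cvs_sum _ _ (fun (j : 'I_N) t => (chi N (j : nat)%:Z)%:~R *
    csum (fun n : int => PP p.+1 (zt t + (j : nat)%:~R + (N%:Z * n)%:~R)))) => j; have [j0|j0] := posnP j.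
  have c0 : (chi N (j : nat)%:Z)%:~R = 0 :> R[i] by rewrite j0 chi_N0.
  rewrite c0 mul0r; apply: (@eq_cvs _ (fun=> 0)); last exact: cvs_cst.
  by exists 0%N => t _; rewrite mul0r.
apply: cvsZ.
have a0 := absum_PP_row k2 ((j : nat)%:~R : R[i]) N0.
have rn0 (n : int) : ((j : nat)%:~R + (N%:Z * n)%:~R : R[i]) != 0.
  rewrite -rmorphD intr_eq0; apply/eqP => e.
  have : (N %| (j : nat)%:Z)%Z by apply/dvdzP; exists (- n); lia.
  by rewrite dvdzE /= => /(dvdn_leq j0); rewrite leqNgt ltn_ord.
have [||_ h] := @csum_cvs R _ (fun t (n : int) => PP p.+1 (zt t + (j : nat)%:~R + (N%:Z * n)%:~R))
   (fun n : int => PP p.+1 ((j : nat)%:~R + (N%:Z * n)%:~R)) _ 0 a0; last exact: h.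
(* For real [r] adding the purely imaginary [zt t] only increases the modulus, so the limit term
   dominates. *)
- move=> t n _; rewrite /PP !cabsV !cabsX -addrA; set r := _ + _%:~R.
  have r0 : 0 < cabs r by rewrite cabs_gt0 rn0.
  have rI : complex.Im r = 0 by rewrite /r Im_add !Im_int addr0.
  clearbody r; have h : cabs r <= cabs (zt t + r).
    rewrite -(ler_pXn2r (isT : (0 < 2)%N)) ?nnegrE // !cabs_sqr Re_add Im_add rI.
    by rewrite /= add0r addr0 expr0n addr0 lerDl sqr_ge0.
  rewrite lef_pV2 ?posrE ?exprn_gt0 //; last exact: lt_le_trans h.
  by rewrite lerXn2r ?nnegrE.
move=> n; apply: cvsV; first by rewrite expf_neq0.
apply: cvsX; rewrite -[X in cvs _ X]add0r.
rewrite (_ : (fun n0 => _) = fun t => zt t + ((j : nat)%:~R + (N%:Z * n)%:~R)); last by apply/funext => t; rewrite addrA.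
by apply: cvsD; [exact: cvs_zt|exact: cvs_cst].
Qed.

Lemma lipc_neq0 p : lipc R p != 0.
Proof.
by rewrite /lipc mulf_neq0 ?invr_eq0 ?pnatr_eq0 -?lt0n ?fact_gt0 // expf_neq0 // oppr_eq0 tpi_neq0.
Qed.

Lemma sum_chi_N : \sum_(a < N) (chi N (a : nat)%:Z)%:~R = 0 :> R[i].
Proof.
have [TE _] := Tsum_main R oN sqN; transitivity (Tsum R N 0); last by rewrite TE chi_N0 mul0r.
by apply: eq_bigr => a _; rewrite mul0r ze0 mulr1.
Qed.

Lemma qt_neq1 t n : (0 < n)%N -> 1 - qt t ^+ n != 0.
Proof.
move=> n0; rewrite subr_eq0 eq_sym; apply/eqP => /(congr1 (@cabs R)); rewrite cabsX cabs1 => /eqP.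
by rewrite lt_eqF // exprn_ilt1 // ?cabs_qt // -lt0n.
Qed.

(** The recursion divides by [1 - q^N], which tends to 0, so it does not give existence of the
    limits. For [j > 0] this comes from [L2_lim]; for [j = 0] a factor [1 - q] is cancelled
    explicitly, using that the character values sum to zero. *)
Lemma SS_cvs j : exists s, cvs (SS j) s.
Proof.
case: j => [|p].
  pose num t : R[i] := - \sum_(a < N) (chi N (a : nat)%:Z)%:~R * \sum_(i < a) qt t ^+ i.
  pose den t : R[i] := \sum_(i < N) qt t ^+ i.
  have cX i : cvs (fun t => qt t ^+ i) 1 by rewrite -[X in cvs _ X](expr1n _ i); apply: cvsX; exact: cvs_qt.
  have cn : cvs num (- \sum_(a < N) (chi N (a : nat)%:Z)%:~R * \sum_(i < a) 1).
    by apply: cvsN; apply: cvs_sum => a; apply: cvsZ; apply: cvs_sum.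
  have cd : cvs den (\sum_(i < N) 1) by apply: cvs_sum.
  have d0 : \sum_(i < N) 1 != 0 :> R[i] by rewrite sumr_const card_ord pnatr_eq0 -lt0n.
  exists ((- \sum_(a < N) (chi N (a : nat)%:Z)%:~R * \sum_(i < a) 1) * (\sum_(i < N) 1)^-1).
  have := cvsM cn (cvsV d0 cd); rewrite (_ : (fun n => _) = SS 0) //.
  apply/funext => t; have := SS_rec 0 t; rewrite big_ord0 mulr0 addr0.
  have x1 := qt_neq1 t (isT : (0 < 1)%N); have xN := qt_neq1 t N0; rewrite expr1 in x1.
  have dE : 1 - qt t ^+ N = (1 - qt t) * den t.
    by apply: oppr_inj; rewrite opprB subrX1 -mulNr opprB.
  have dn0 : den t != 0 by apply: contraNneq xN => d; rewrite dE d mulr0.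
  have -> : \sum_(a < N) (chi N (a : nat)%:Z)%:~R * (a : nat)%:R ^+ 0 * qt t ^+ a = (1 - qt t) * num t.
    rewrite /num mulrN mulr_sumr -sumrN.
    transitivity (\sum_(a < N) ((chi N (a : nat)%:Z)%:~R * (qt t ^+ a - 1) + (chi N (a : nat)%:Z)%:~R)).
      by apply: eq_bigr => a _; rewrite expr0; ring.
    rewrite big_split /= sum_chi_N addr0; apply: eq_bigr => a _.
    by rewrite subrX1; ring.
  rewrite dE -mulrA => /(mulfI x1) h.
  by rewrite -h mulrC mulKf.
have c0 : N%:R ^- p.+2 * lipc R p.+1 * Tsum R N 1 != 0.
  apply: mulf_neq0; last exact: Tsum1_neq0.
  apply: mulf_neq0; last exact: lipc_neq0.
  by rewrite invr_eq0 expf_neq0 // pnatr_eq0 -lt0n.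
have h := cvsZ (N%:R ^- p.+2 * lipc R p.+1 * Tsum R N 1)^-1 (L2_lim (isT : (0 < p.+1)%N)).
exists ((N%:R ^- p.+2 * lipc R p.+1 * Tsum R N 1)^-1 * L2 p.+1).
by move: h; rewrite (_ : (fun n => _) = SS p.+1) //; apply/funext => t; rewrite mulKf.
Qed.

Local Notation B := (gen_bernoulli R[i] (chi N) N).

(** The coefficient of [t^(n+1)] in the identity [gen_bernoulliP], in which the denominator
    [e^(N t) - 1] has been cleared. *)
Lemma bernoulli_rec n : \sum_(i < n.+1) B i / i`!%:R * (N%:R ^+ (n.+1 - i) / (n.+1 - i)`!%:R)
  = \sum_(1 <= a < N.+1) (chi N a)%:~R * (a%:R ^+ n / n`!%:R).
Proof.
have := congr1 (fun f => f n.+1) (gen_bernoulliP R[i] (chi N) N0).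
rewrite /fps_mul big_ord_recr /= subnn /fps_exp expr0 divr1 subrr mulr0 addr0.
have -> : \sum_(i < n.+2) (i == 1%N :> nat)%:R * (\sum_(1 <= a < N.+1) (chi N a)%:~R * (a%:R ^+ (n.+1 - i) / (n.+1 - i)`!%:R))
   = \sum_(1 <= a < N.+1) (chi N a)%:~R * (a%:R ^+ n / n`!%:R) :> R[i].
  rewrite big_ord_recl mul0r add0r big_ord_recl /= mul1r subSS subn0 [X in _ + X]big1 ?addr0 // => i _.
  by rewrite mul0r.
move=> <-; apply: eq_bigr => i _.
by rewrite (_ : (n.+1 - i == 0)%N = false) ?subr0 //; apply/negbTE; rewrite subn_eq0 -ltnNge.
Qed.

Lemma sum_chi_iota (F : nat -> R[i]) :
  \sum_(1 <= a < N.+1) (chi N a)%:~R * F a = \sum_(a < N) (chi N (a : nat)%:Z)%:~R * F a.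
Proof.
rewrite big_nat_recr //= (_ : chi N N = 0) ?mul0r ?addr0; last first.
  by apply/eqP; rewrite chi_eq0 // /coprime gcdnn; case: eqP N1 => // ->.
rewrite -(big_mkord xpredT (fun a => (chi N a%:Z)%:~R * F a)) [RHS]big_ltn // chi_N0 mul0r add0r //.
Qed.

(** In the limit the left side of [SS_rec] vanishes, and a triangular recursion for the limits [s j]
    is left; it is the one satisfied by [- B_(j+1) / (j+1)]. *)
Lemma SS_bernoulli j : cvs (SS j) (- (B j.+1 / j.+1%:R)).
Proof.
have /choice[s hs] := SS_cvs.
have NR : N%:R != 0 :> R[i] by rewrite pnatr_eq0 -lt0n.
have fn0 n : n`!%:R != 0 :> R[i] by rewrite pnatr_eq0 -lt0n fact_gt0.
have A i : \sum_(a < N) (chi N (a : nat)%:Z)%:~R * (a : nat)%:R ^+ i + \sum_(l < i) 'C(i, l)%:R * N%:R ^+ (i - l) * s l = 0.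
  have cX e : cvs (fun t => qt t ^+ e) 1 by rewrite -[X in cvs _ X](expr1n _ e); apply: cvsX; exact: cvs_qt.
  have h1 : cvs (fun t => (1 - qt t ^+ N) * SS i t) ((1 - 1) * s i).
    by apply: cvsM (hs i); apply: cvsB (cX N); exact: cvs_cst.
  have h2 : cvs (fun t => \sum_(a < N) (chi N (a : nat)%:Z)%:~R * (a : nat)%:R ^+ i * qt t ^+ a
     + qt t ^+ N * \sum_(l < i) 'C(i, l)%:R * N%:R ^+ (i - l) * SS l t)
     (\sum_(a < N) (chi N (a : nat)%:Z)%:~R * (a : nat)%:R ^+ i * 1 + 1 * \sum_(l < i) 'C(i, l)%:R * N%:R ^+ (i - l) * s l).
    apply: cvsD; first by apply: cvs_sum => a; apply: cvsZ.
    by apply: cvsM (cX N) _; apply: cvs_sum => l; apply: cvsZ.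
  rewrite -(funext (SS_rec i)) in h2; have := cvs_unique h1 h2; rewrite subrr mul0r mul1r => /esym h; rewrite -[RHS]h.
  by congr (_ + _); apply: eq_bigr => a _; rewrite mulr1.
have A' i : \sum_(1 <= a < N.+1) (chi N a)%:~R * (a%:R ^+ i / i`!%:R) + \sum_(l < i) s l / l`!%:R * (N%:R ^+ (i - l) / (i - l)`!%:R) = 0.
  have := congr1 (fun x => x / i`!%:R) (A i); rewrite mul0r => h; rewrite sum_chi_iota -[RHS]h mulrDl !mulr_suml; congr (_ + _).
    by apply: eq_bigr => a _; rewrite mulrA.
  apply: eq_bigr => l _; have li : (l <= i)%N by exact: ltnW.
  have := bin_fact li => /(congr1 (fun x : nat => x%:R : R[i])); rewrite !natrM => <-.
  have b0 : 'C(i, l)%:R != 0 :> R[i] by rewrite pnatr_eq0 -lt0n bin_gt0.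
  by field; rewrite b0 !fn0.
(* This removes the index 0 from the Bernoulli recursion, which is then shifted by one against that
   of the [s l]. *)
have B0 : B 0 = 0.
  have := bernoulli_rec 0; rewrite big_ord1 /= divr1 expr1 divr1.
  under eq_bigr do rewrite expr0 divr1; rewrite (sum_chi_iota (fun=> 1)).
  under eq_bigr do rewrite mulr1; rewrite sum_chi_N => /eqP; rewrite mulf_eq0 (negbTE NR) orbF => /eqP //.
have key : s j / j`!%:R + B j.+1 / j.+1`!%:R = 0.
  elim/ltn_ind: j => j IHj.
  have := A' j.+1; rewrite -bernoulli_rec big_ord_recl /= B0 !mul0r add0r -big_split /=.
  rewrite big_ord_recr /= big1 ?add0r; last first.
    move=> i _; have := IHj i (ltn_ord i); rewrite /bump /= add1n subSS => h.
    by rewrite -mulrDl addrC h mul0r.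
  rewrite /bump /= add1n subSS -mulrDl addrC => /eqP; rewrite mulf_eq0 => /orP[/eqP //|].
  by rewrite subSnn expr1 divr1 (negbTE NR).
have -> : - (B j.+1 / j.+1%:R) = s j; last exact: hs.
have h : s j / j`!%:R = - (B j.+1 / j.+1`!%:R) by apply/eqP; rewrite -addr_eq0 key.
have -> : s j = - (B j.+1 / j.+1`!%:R) * j`!%:R by rewrite -h divfK.
rewrite factS natrM; have := fn0 j; have : j.+1%:R != 0 :> R[i] by rewrite pnatr_eq0.
by move: (j.+1%:R) (j`!%:R) => x y x0 y0; field; rewrite x0 y0.
Qed.

(** Two limits of one sequence; in classical terms, the functional equation at an integer. *)
Lemma L2_bernoulli p : (0 < p)%N ->
  L2 p = N%:R ^- p.+1 * lipc R p * Tsum R N 1 * - (B p.+1 / p.+1%:R).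
Proof.
move=> p0; have h := cvsZ (N%:R ^- p.+1 * lipc R p * Tsum R N 1) (SS_bernoulli p).
exact: cvs_unique (L2_lim p0) h.
Qed.

Lemma res_csum (f : int -> R[i]) : absum f ->
  csum f = \sum_(j < N) csum (fun n : int => f ((j : nat)%:Z + N%:Z * n)).
Proof.
move=> af; have lt (x : int) : (`|(x %% N)%Z|%N < N)%N.
  by rewrite -ltz_nat gez0_abs ?modz_ge0 -?lt0n // ltz_pmod.
pose h (p : 'I_N * int) : int := (p.1 : nat)%:Z + N%:Z * p.2.
pose h' (c : int) : 'I_N * int := (Ordinal (lt c), (c %/ N)%Z).
have hK : cancel h h'.
  move=> [i n]; rewrite /h /h' /=.
  have i0 : 0 <= (i : nat)%:Z < `|N%:Z| by rewrite lez_nat /= ltz_nat ltn_ord.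
  congr pair; last by rewrite addrC mulrC divzMDl -?lt0n // divz_small ?addr0.
  by apply: val_inj; rewrite /= addrC mulrC modzMDl modz_small.
have h'K : cancel h' h.
  move=> c; rewrite /h /h' /= gez0_abs ?modz_ge0 -?lt0n //.
  by rewrite addrC mulrC -divz_eq.
have ah : absum (fun p => f (h p)) by apply: (absum_inj (h := h) _ af); exact: can_inj hK.
by rewrite (csum_bij hK h'K af) (csum_pair ah) csum_finType.
Qed.

(** With matching parity the sum is twice [1 + x], where [x] collects the terms from 2 on and is at
    most [3/4] in modulus by comparison with inverse squares. This is what keeps the Bernoulli
    number in the denominator from vanishing. *)
Lemma L2_neq0 p : (0 < p)%N -> (-1) ^+ (N.-1 %/ 2) = (-1) ^+ p.+1 :> int -> L2 p != 0.
Proof.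
move=> p0 par; have k2 : (1 < p.+1)%N by [].
pose F (r : int) : R[i] := (chi N r)%:~R * PP p.+1 r%:~R.
have aP := absum_PP_row k2 (0 : R[i]) (isT : (0 < 1)%N).
have aF : absum F.
  apply: absum_le aP => r; rewrite /F cabsM add0r mul1r -[leRHS]mul1r ler_wpM2r //.
  exact: cabs_chi.
have LF : L2 p = csum F.
  rewrite (res_csum aF); apply: eq_bigr => j _; rewrite -csumZ; last exact: absum_PP_row.
  apply: eq_csum => n; rewrite /F rmorphD /=; congr (_%:~R * _).
  by apply: (chi_mod R oN); rewrite opprD addrA subrr sub0r rpredN dvdz_mulr.
have Fe r : F (- r) = F r.
  rewrite /F chiN // rmorphN /= PPN // par rmorphM rmorphXn rmorphN /= rmorph1.
  have s2 : (-1) ^+ p.+1 * (-1) ^+ p.+1 = 1 :> R[i] by rewrite -expr2 -exprM mulnC exprM sqrrN expr1n expr1n.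
  transitivity ((-1) ^+ p.+1 * (-1) ^+ p.+1 * ((chi N r)%:~R * PP p.+1 (r%:~R : R[i]))); first by ring.
  by rewrite s2 mul1r.
have aN : absum (fun n : nat => F n.+1%:Z) by apply: (absum_inj (h := fun n : nat => n.+1%:Z) _ aF) => x y [].
have [_ E] := csum_int_even Fe aN.
rewrite LF E (_ : F 0 = 0) ?add0r; last by rewrite /F chi_N0 mul0r.
rewrite mulf_neq0 ?pnatr_eq0 // (csum_nat_recl aN).
have -> : F 1 = 1 by rewrite /F chi_1 // /PP expr1n invr1 mulr1.
have aN2 : absum (fun n : nat => F n.+2%:Z) by apply: (absum_inj (h := fun n : nat => n.+2%:Z) _ aF) => x y [].
suff h : cabs (csum (fun n : nat => F n.+2%:Z)) <= 3 / 4.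
  apply/negP => /eqP e; have := cabs1 R; move: h.
  have -> : csum (fun n : nat => F n.+2%:Z) = - 1 by apply/eqP; rewrite -addr_eq0 addrC e.
  by rewrite cabsN => + e1; rewrite e1; lra.
apply: (cvs_le (csum_nat aN2)) => n; rewrite /series /= big_mkord.
apply: le_trans (cabs_sum _ _ _) _.
apply: (@le_trans _ _ (\sum_(i < n.+1) (i.+2%:R ^+ 2)^-1)).
  rewrite big_ord_recr /= ler_wpDr ?invr_ge0 ?exprn_ge0 //; apply: ler_sum => i _.
  have h : (i.+2%:R ^+ p.+1)^-1 <= (i.+2%:R ^+ 2)^-1 :> R.
    by rewrite lef_pV2 ?posrE ?exprn_gt0 ?ltr0n // ler_weXn2l // ler1n.
  rewrite /F cabsM /PP cabsV cabsX -pmulrn cabs_nat; apply: le_trans _ h.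
  by rewrite -[X in _ <= X]mul1r ler_wpM2r ?cabs_chi // invr_ge0 exprn_ge0.
(* Telescoping as in [rsm_inv_sq], with equality at the first term: [1/4 = 3/4 - 1/2]. *)
suff H : \sum_(i < n.+1) (i.+2%:R ^+ 2)^-1 <= 3 / 4 - n.+2%:R^-1 :> R.
  by apply: le_trans H _; rewrite gerBl invr_ge0.
elim: n => [|n IHn]; first by rewrite big_ord_recr big_ord0 /=; lra.
rewrite big_ord_recr /=; apply: le_trans (lerD IHn (lexx _)) _.
rewrite -addrA lerD2l.
have n0 : (0 : R) < n.+2%:R by rewrite ltr0n.
have -> : n.+3%:R = n.+2%:R + 1 :> R by rewrite natr1.
move: (n.+2%:R : R) n0 => x x0.
rewrite -subr_ge0.
have -> : - (x + 1)^-1 - (- x^-1 + ((x + 1) ^+ 2)^-1) = (x * (x + 1) ^+ 2)^-1.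
  by field; rewrite !gt_eqF //; lra.
by rewrite invr_ge0 mulr_ge0 ?sqr_ge0 // ltW.
Qed.

End LValue.

(** * Expansions in [nome (z / N)], differentiability and the cusps of [Gamma0 N] *)

Section CuspExpansions.
Variables (R : realType) (N : nat).
Hypothesis N0 : (0 < N)%N.
Implicit Types (f : R[i] -> R[i]) (a : nat -> R[i]) (z : R[i]) (g : 'M[int]_2).

(** Absolute convergence at every point is part of the notion: it permits termwise operations and
    lets the expansion at a lower point of the half plane serve as a majorant. *)
Definition qexp f a : Prop := forall z, 0 < complex.Im z ->
  absum (fun n : nat => a n * nome (n%:R * (z / N%:R))) /\
  f z = csum (fun n : nat => a n * nome (n%:R * (z / N%:R))).

Lemma eq_qexp f f' a : (forall z, 0 < complex.Im z -> f z = f' z) -> qexp f a -> qexp f' a.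
Proof. by move=> e h z z0; have [h1 h2] := h z z0; split=> //; rewrite -e. Qed.

(** The family is placed on the graph of [e] inside [nat * T]; summing that by the first coordinate
    collects equal exponents. *)
Lemma qexp_csum (T : choiceType) (e : T -> nat) (c : T -> R[i]) :
  (forall z, 0 < complex.Im z -> absum (fun x => c x * nome ((e x)%:R * (z / N%:R)))) ->
  qexp (fun z => csum (fun x => c x * nome ((e x)%:R * (z / N%:R)))) (qcoef e c).
Proof.
move=> ac z z0; pose f (p : nat * T) := if e p.2 == p.1 then c p.2 * nome ((e p.2)%:R * (z / N%:R)) else 0.
have f0 p : (e p.2, p.2) != p -> f p = 0.
  by case: p => j x; rewrite /f xpair_eqE eqxx andbT => /negbTE ->.
have fh : (fun x => f (e x, x)) = fun x => c x * nome ((e x)%:R * (z / N%:R)).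
  by apply/funext => x; rewrite /f /= eqxx.
have hK : cancel (fun x => (e x, x)) (fun p : nat * T => p.2) by [].
have af : absum f.
  by apply: (@absum_reindex _ _ _ (fun x => (e x, x)) (fun p => p.2)) => //; rewrite fh; exact: ac.
have row j : csum (fun x => f (j, x)) = qcoef e c j * nome (j%:R * (z / N%:R)).
  rewrite mulrC -csumZ; last exact: (absum_fiber ac).
  apply: eq_csum => x; rewrite /f /=; case: eqP => [->|_]; last by rewrite mulr0.
  exact: mulrC.
rewrite -(funext row); split; first exact: absum_csum.
by rewrite -(csum_pair af) (csum_reindex hK) // fh //; exact: ac.
Qed.

Lemma qexp_series f a z : qexp f a -> 0 < complex.Im z ->
  cvs (series (fun n => a n * nome (z / N%:R) ^+ n)) (f z).
Proof.
move=> h z0; have [h1 ->] := h z z0.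
have -> : (fun n => a n * nome (z / N%:R) ^+ n) = fun n => a n * nome (n%:R * (z / N%:R)).
  by apply/funext => n; rewrite nomeMn.
exact: csum_nat.
Qed.

Lemma qexpD f f' a a' : qexp f a -> qexp f' a' -> qexp (fun z => f z + f' z) (fun n => a n + a' n).
Proof.
move=> h h' z z0; have [h1 ->] := h z z0; have [h1' ->] := h' z z0.
have -> : (fun n => (a n + a' n) * nome (n%:R * (z / N%:R)))
  = fun n => a n * nome (n%:R * (z / N%:R)) + a' n * nome (n%:R * (z / N%:R)).
  by apply/funext => n; rewrite mulrDl.
by split; [exact: absumD|rewrite csumD].
Qed.

Lemma qexpZ (x : R[i]) f a : qexp f a -> qexp (fun z => x * f z) (fun n => x * a n).
Proof.
move=> h z z0; have [h1 ->] := h z z0.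
have -> : (fun n => x * a n * nome (n%:R * (z / N%:R))) = fun n => x * (a n * nome (n%:R * (z / N%:R))).
  by apply/funext => n; rewrite -mulrA.
by split; [exact: absumZ|rewrite csumZ].
Qed.

Lemma qexp_cst (x : R[i]) : qexp (fun=> x) (fun n => if n == 0%N then x else 0).
Proof.
move=> z z0; set F := fun n : nat => _.
have F0 n : n \notin [fset 0%N]%fset -> F n = 0 by rewrite inE /F => /negbTE ->; rewrite mul0r.
split; first exact: absum_fin F0.
by rewrite (csum_fin F0) big_seq_fset1 /F mul0r nome0 mulr1.
Qed.

Lemma qexp_sum (I : eqType) (r : seq I) (f : I -> R[i] -> R[i]) (a : I -> nat -> R[i]) :
  (forall i, i \in r -> qexp (f i) (a i)) ->
  qexp (fun z => \sum_(i <- r) f i z) (fun n => \sum_(i <- r) a i n).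
Proof.
elim: r => [|i r IHr] h.
  apply: (@eq_qexp (fun=> 0)) => [z _|]; first by rewrite big_nil.
  have -> : (fun n => \sum_(i <- [::]) a i n) = fun n => if n == 0%N then 0 else 0; last exact: qexp_cst.
  by apply/funext => n; rewrite big_nil if_same.
apply: (@eq_qexp (fun z => f i z + \sum_(i <- r) f i z)) => [z _|]; first by rewrite big_cons.
have -> : (fun n => \sum_(j <- i :: r) a j n) = fun n => a i n + \sum_(j <- r) a j n.
  by apply/funext => n; rewrite big_cons.
apply: qexpD; first by apply: h; rewrite mem_head.
by apply: IHr => j jr; apply: h; rewrite in_cons jr orbT.
Qed.

Lemma qexp_shift (j : int) f a : qexp f a ->
  qexp (fun z => f (z + j%:~R)) (fun n => a n * nome (n%:R * (j%:~R / N%:R))).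
Proof.
move=> h z z0; have zj : 0 < complex.Im (z + j%:~R) by rewrite Im_add Im_int addr0.
have [h1 ->] := h _ zj.
have -> : (fun n => a n * nome (n%:R * (j%:~R / N%:R)) * nome (n%:R * (z / N%:R)))
  = fun n => a n * nome (n%:R * ((z + j%:~R) / N%:R)); last by [].
by apply/funext => n; rewrite -mulrA -nomeD; congr (_ * nome _); ring.
Qed.

Lemma cabs_nome_scale n z : cabs (nome (n%:R * (z / N%:R))) = expR (- (2 * pi * (n%:R / N%:R * complex.Im z))).
Proof.
rewrite cabs_nome; congr (expR (- (_ * _))).
have -> : n%:R * (z / N%:R) = ((n%:R / N%:R : R)%:C) * z.
  by rewrite rmorphM fmorphV /= !rmorph_nat; ring.
by rewrite Im_realM.
Qed.

(* The quadratic Taylor remainder of [e^(2 pi i n h / N)] costs a factor [n^2],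
   absorbed by evaluating the absolutely convergent expansion lower down. *)
Lemma qexp_derivative_bound f a z : qexp f a -> 0 < complex.Im z ->
  exists l : R[i], exists2 K : R, 0 < K & forall h, cabs h <= complex.Im z / 4 ->
    cabs (f (z + h) - f z - h * l) <= K * cabs h ^+ 2.
Proof.
move=> F z0; set y := complex.Im z in z0 *.
pose A n := a n * nome (n%:R * (z / N%:R)).
pose x (n : nat) : R := 2 * pi * (n%:R / N%:R).
have x0 n : 0 <= x n by rewrite !mulr_ge0 ?pi_ge0 ?invr_ge0.
(* At half the height the gain is [e^(x y / 2)]; one factor [e^(x y / 4)] is spent on [x^2], the
   other on [e^(x |h|)]. *)
pose z' := z - (y / 2)*i.
have Iz' : complex.Im z' = y / 2.
  by rewrite /z' Im_add -/y (_ : complex.Im (- _) = - (y / 2)) //; lra.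
have z'0 : 0 < complex.Im z' by rewrite Iz' divr_gt0.
have [a' _] := F _ z'0; have [aA fz] := F _ z0.
pose b n := cabs (a n * nome (n%:R * (z' / N%:R))).
have bE n : b n = cabs (A n) * expR (x n * (y / 2)).
  rewrite /b /A !cabsM !cabs_nome_scale Iz' -/y -[RHS]mulrA -expRD; congr (_ * expR _).
  by rewrite /x; move: (n%:R / N%:R) => u; field.
(* From [u^2 / 2 <= e^u] at [u = x y / 4]. *)
pose C : R := 32 / y ^+ 2.
have xC n : x n ^+ 2 <= C * expR (x n * (y / 4)).
  have := expR_ge_pow 2 (mulr_ge0 (x0 n) (ltW (divr_gt0 z0 (ltr0n R 4)))).
  have y2 : 0 < y ^+ 2 by rewrite exprn_gt0.
  rewrite -(@ler_pM2l _ C) ?divr_gt0 //.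
  have -> // : C * ((x n * (y / 4)) ^+ 2 / 2`!%:R) = x n ^+ 2.
  rewrite /C (_ : 2`! = 2%N) //; move: (x n) => u; have : y != 0 by rewrite gt_eqF.
  by move: (y) => v v0; field.
have C0 : 0 < C by rewrite divr_gt0 ?exprn_gt0.
clearbody C.
have xb n : cabs (A n) * (x n ^+ 2 * expR (x n * (y / 4))) <= C * b n.
  rewrite bE [leRHS]mulrCA; apply: ler_wpM2l => //.
  have -> : y / 2 = y / 4 + y / 4 by field.
  rewrite [x n * (_ + _)]mulrDr expRD [leRHS]mulrA; apply: ler_wpM2r; [exact: expR_ge0|exact: xC].
pose B n := (2 * pi)*i * (n%:R / N%:R) * A n.
have cx n : cabs ((2 * pi)*i * (n%:R / N%:R)) = x n.
  rewrite cabsM cabsM cabsV !cabs_nat tpiE !cabsM cabs_nat cabsR ger0_norm ?pi_ge0 //.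
  by rewrite (_ : cabs 'i = 1) ?mulr1 // /cabs /= expr0n add0r expr1n sqrtr1.
have aB : absum B.
  have [K hK] := a'; exists (K + C * K) => D.
  apply: (@le_trans _ _ (\sum_(n <- D) (b n + C * b n))).
    apply: ler_sum => n _; rewrite /B cabsM cx.
    apply: le_trans (_ : cabs (A n) + cabs (A n) * x n ^+ 2 <= _); last first.
      rewrite lerD //.
        by rewrite bE ler_peMr // ge1_expR // mulr_ge0 // divr_ge0 // ltW.
      apply: le_trans (xb n); rewrite ler_wpM2l //.
      by rewrite ler_peMr ?sqr_ge0 // ge1_expR // mulr_ge0 // divr_ge0 // ltW.
    rewrite mulrC -[X in _ <= X + _]mulr1 -mulrDr ler_wpM2l //.
    have := sqr_ge0 (x n - 2^-1); have := x0 n; nra.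
  by rewrite big_split /= -mulr_sumr lerD // ler_wpM2l // ltW.
have [K hK] := a'; have K0 : 0 <= K by have := hK fset0; rewrite big_seq_fset0.
have CK : 0 <= 6 * C * K by rewrite !mulr_ge0 // ltW.
exists (csum B); exists (6 * C * K + 1); first by lra.
move=> h hh; have zh : 0 < complex.Im (z + h).
  rewrite Im_add -/y; have := le_trans (Im_le_cabs h) hh; rewrite ler_norml => /andP[+ _]; lra.
have [aH ->] := F _ zh.
have aB' : absum (fun n => h * B n) by exact: absumZ.
rewrite fz -csumZ // -csumB // -csumB //; last exact: absumB.
apply: (@le_trans _ _ (6 * C * K * cabs h ^+ 2)); last by rewrite ler_wpM2r ?sqr_ge0 // lerDl.
apply: (csum_le (b := fun n => 6 * cabs h ^+ 2 * C * b n)); last first.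
  move=> D; rewrite -mulr_sumr (_ : 6 * C * K * cabs h ^+ 2 = 6 * cabs h ^+ 2 * C * K); last by ring.
  by rewrite ler_wpM2l // !mulr_ge0 ?sqr_ge0 // ltW.
move=> n.
have -> : a n * nome (n%:R * ((z + h) / N%:R)) - a n * nome (n%:R * (z / N%:R)) - h * B n
  = A n * (nome (n%:R / N%:R * h) - 1 - (2 * pi)*i * (n%:R / N%:R * h)).
  have -> : n%:R * ((z + h) / N%:R) = n%:R * (z / N%:R) + n%:R / N%:R * h by ring.
  by rewrite nomeD /B /A; ring.
rewrite cabsM; apply: (@le_trans _ _ (cabs (A n) * (6 * (x n * cabs h) ^+ 2 * expR (x n * cabs h)))).
  rewrite ler_wpM2l //; apply: le_trans (nome_taylor _) _.
  by rewrite !cabsM cabsV !cabs_nat [2 * pi * (_ * cabs h)]mulrA.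
apply: (@le_trans _ _ (6 * cabs h ^+ 2 * (cabs (A n) * (x n ^+ 2 * expR (x n * (y / 4)))))); last first.
  by rewrite -[leRHS]mulrA; apply: ler_wpM2l (xb n); rewrite mulr_ge0 ?sqr_ge0.
rewrite exprMn.
have -> : cabs (A n) * (6 * (x n ^+ 2 * cabs h ^+ 2) * expR (x n * cabs h))
  = 6 * cabs h ^+ 2 * (cabs (A n) * (x n ^+ 2 * expR (x n * cabs h))) by ring.
apply: ler_wpM2l; first by rewrite mulr_ge0 ?sqr_ge0.
apply: ler_wpM2l => //; apply: ler_wpM2l; first exact: sqr_ge0.
by rewrite ler_expR ler_wpM2l.
Qed.

Lemma qexp_derivable f a z : qexp f a -> 0 < complex.Im z -> derivable f z 1.
Proof.
move=> F z0; have [l [K K0 hK]] := qexp_derivative_bound F z0.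
apply/cvg_ex; exists l; apply/cvgrPdist_lt => /= e e0.
have [er eE] : exists2 r : R, 0 < r & e = r%:C.
  move: e0; case: e => er ei; rewrite ltcE /= => /andP[/eqP ei0 er0].
  by exists er => //; apply/eqP; rewrite eq_complex /= eqxx ei0 /=.
move=> eE'; pose d := Num.min (complex.Im z / 4) (er / K).
have d0 : 0 < d by rewrite lt_min !divr_gt0.
exists d%:C => /=; first by rewrite ltcR.
move=> h /=; rewrite sub0r normrN cabsE ltcR lt_min => /andP[h1 h2] h0.
rewrite distrC cabsE eE' ltcR.
have c0 : 0 < cabs h by rewrite cabs_gt0.
have := hK h (ltW h1); rewrite [h *: 1]mulr1 [h + z]addrC => hb.
have -> : h^-1 *: (f (z + h) - f z) - l = h^-1 * (f (z + h) - f z - h * l).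
  by rewrite mulrBr mulKf.
rewrite cabsM cabsV mulrC ltr_pdivrMr //; apply: le_lt_trans hb _.
by rewrite expr2 mulrA ltr_pM2r // mulrC -ltr_pdivlMr.
Qed.

Section Reduction.
Variables (k : nat) (psi : int -> int) (f : R[i] -> R[i]).
Hypothesis sqN : squarefree N.
Hypothesis f_Gamma0 : forall g z, Gamma0 N g -> 0 < complex.Im z ->
  f (moebius g z) = (psi (g 1 1))%:~R * automorphy g z ^+ k * f z.

(** With [d = gcd(c, N)] and [N] squarefree, the cofactor [e = N / d] is prime to [d] and to
    [c / d], hence to [c], so the congruence for the translation [j] is solvable. *)
Lemma cusp_representative g : SL2Z g -> exists d (j : int) gam, [/\ (d %| N)%N, Gamma0 N gam &
  g = gam *m mk2 1 0 d%:Z 1 *m mk2 1 j 0 1].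
Proof.
move=> sg; pose c := g 1 0; pose d := gcdn `|c|%N N.
have d0 : (0 < d)%N by rewrite gcdn_gt0 N0 orbT.
have [e Ne] : exists e, N = (d * e)%N by have /dvdnP[e ->] := dvdn_gcdr `|c|%N N; exists e; rewrite mulnC.
have [c' cE] : exists c', c = c' * d%:Z by apply/dvdzP; rewrite dvdzE /= dvdn_gcdl.
have cde : coprime d e by apply: squarefree_coprime; rewrite -?Ne.
have cce : coprime `|c'|%N e.
  have : gcdn `|c|%N N = d by [].
  move: (d0); clearbody d; rewrite Ne cE abszM absz_nat [(`|c'| * _)%N]mulnC -muln_gcdr => d1 /eqP.
  by rewrite -[X in _ == X]muln1 eqn_pmul2l.
have /coprimezP[[u v] /= uv] : coprimez (c' * d%:Z) e%:Z by rewrite coprimezE abszM coprimeMl cce.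
have det1 : g 0 0 * g 1 1 - g 0 1 * g 1 0 = 1 by apply/SL2P.
(* With [u] an inverse of [c] modulo [e], the lower left entry of [gam] is [d (c' - g11) (1 - u c)],
   divisible by [d e = N]. *)
pose j := u * (g 1 1 - c'); pose gam := g *m mk2 1 (- j) 0 1 *m mk2 1 0 (- d%:Z) 1.
have T1 : SL2Z (mk2 1 (- j) 0 1) by apply/SL2P; rewrite !mk2E; ring.
have T2 : SL2Z (mk2 1 0 (- d%:Z) 1) by apply/SL2P; rewrite !mk2E; ring.
exists d, j, gam; split; first exact: dvdn_gcdr.
  split; first by apply: SL2M => //; apply: SL2M.
  rewrite /gam !mul2E !mk2E -/c cE.
  have -> : (c' * d%:Z * 1 + g 1 1 * 0) * 1 + (c' * d%:Z * - j + g 1 1 * 1) * - d%:Z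
    = d%:Z * ((c' - g 1 1) * (1 - u * (c' * d%:Z))) by rewrite /j; ring.
  have -> : 1 - u * (c' * d%:Z) = v * e%:Z by apply/eqP; rewrite subr_eq addrC uv.
  by rewrite Ne PoszM; apply/dvdzP; exists ((c' - g 1 1) * v); ring.
rewrite /gam -!mulmxA; apply: mx2P; rewrite !mul2E !mk2E; ring.
Qed.

(** A factor from [Gamma0 N] multiplies the expansion by a value of [psi], and a translation
    multiplies the coefficients by roots of unity; the constant term stays zero. *)
Lemma cusp_expansion g :
  (forall d, (d %| N)%N -> exists2 a, a 0%N = 0 & qexp (slash k f (mk2 1 0 d%:Z 1)) a) ->
  SL2Z g -> exists2 a, a 0%N = 0 & qexp (slash k f g) a.
Proof.
move=> H sg; have [d [j [gam [dN G0 gE]]]] := cusp_representative sg.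
have [a a0 qa] := H d dN; have [sgam _] := G0.
have T1 : SL2Z (mk2 1 j 0 1) by apply/SL2P; rewrite !mk2E; ring.
have T2 : SL2Z (mk2 1 0 d%:Z 1) by apply/SL2P; rewrite !mk2E; ring.
exists (fun n => (psi (gam 1 1))%:~R * (a n * nome (n%:R * (j%:~R / N%:R)))).
  by rewrite a0 mul0r mulr0.
have := qexpZ (psi (gam 1 1))%:~R (qexp_shift j qa); apply: eq_qexp => z z0.
have zj : 0 < complex.Im (z + j%:~R) by rewrite Im_add Im_int addr0.
rewrite gE slashM //; last exact: SL2M.
have -> : automorphy (mk2 1 j 0 1) z = 1 by rewrite /automorphy !mk2E mul0r add0r.
have -> : moebius (mk2 1 j 0 1) z = z + j%:~R.
  by rewrite /moebius /automorphy !mk2E mul0r add0r divr1 mul1r.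
rewrite expr1n invr1 mul1r slashM //.
have zd := Im_moebius T2 zj.
rewrite [slash k f gam _]/slash f_Gamma0 // /slash.
have au := automorphy_neq0 sgam zd.
set A := automorphy gam _ in au *; set B := f _; rewrite mulrCA; congr (_ * _).
have Ak : A ^+ k != 0 by rewrite expf_neq0.
rewrite [A ^- k * _]mulrC (_ : _ * A ^+ k * B = (psi (gam 1 1))%:~R * B * A ^+ k); last by ring.
by rewrite mulfK.
Qed.

Lemma cusp_formP :
  (forall d, (d %| N)%N -> exists2 a, a 0%N = 0 & qexp (slash k f (mk2 1 0 d%:Z 1)) a) ->
  cusp_form k N psi f.
Proof.
move=> H; split=> [z z0|g z|g /(cusp_expansion H)[a a0 qa]]; last 2 first.
- exact: f_Gamma0.
- by exists a => // z z0; apply: cvs_cvg; exact: qexp_series qa z0.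
(* Differentiability is read off the expansion at infinity, the case of the identity matrix. *)
have s1 : SL2Z 1%:M by rewrite /SL2Z /= det1.
have [a _ qa] := cusp_expansion H s1; apply: (qexp_derivable (a := a)) z0.
apply: eq_qexp qa => u u0; rewrite /slash /moebius /automorphy !mxE /=.
by rewrite !rmorph0 !rmorph1 mul0r !add0r addr0 mul1r expr1n invr1 mulr1 mul1r.
Qed.

End Reduction.
End CuspExpansions.

(** * The weights attached to a divisor of [N] *)

Section EisensteinWeights.
Variables (R : realType) (p : nat).
Local Notation k := p.+1.
Local Notation N := p.+1.*2.+1.
Hypotheses (p0 : (0 < p)%N) (sqN : squarefree N).

Let oN : odd N. Proof. by rewrite /= odd_double. Qed.
Let N0 : (0 < N)%N. Proof. by []. Qed.
Let N1 : (1 < N)%N. Proof. by []. Qed.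
Let k2 : (1 < k)%N. Proof. by []. Qed.

Lemma odd_dvd_level d : (d %| N)%N -> odd d.
Proof. by move=> /dvdnP[e Ne]; move: oN; rewrite Ne oddM => /andP[]. Qed.

Lemma level_div d : (d %| N)%N -> N = (d * (N %/ d))%N.
Proof. by move=> dN; rewrite mulnC divnK. Qed.

Lemma codvd_level d : (d %| N)%N -> (N %/ d %| N)%N.
Proof. by move=> dN; rewrite {2}(level_div dN) dvdn_mull. Qed.

Lemma squarefree_dvd d : (d %| N)%N -> squarefree d.
Proof. by move=> /dvdnP[e Ne]; apply: (@squarefreeMl e); rewrite -Ne. Qed.

Lemma gt0_dvd d : (d %| N)%N -> (0 < d)%N.
Proof. exact: dvdn_gt0. Qed.

Definition chiw (d : nat) (v : int * int) : int :=
  if (d %| v.1)%Z then chi (N %/ d)%N (v.1 %/ d)%Z * chi d v.2 else 0.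

Definition wgt (d : nat) (v : int * int) : R[i] := (chiw d v)%:~R.

Section Divisor.
Variable d : nat.
Hypothesis dN : (d %| N)%N.
Let e := (N %/ d)%N.
Let Nde : N = (d * e)%N := level_div dN.
Let od : odd d := odd_dvd_level dN.
Let oe : odd e := odd_dvd_level (codvd_level dN).
Let d0 : (0 < d)%N := gt0_dvd dN.
Let e0 : (0 < e)%N := gt0_dvd (codvd_level dN).
Let dz : d%:Z != 0. Proof. by rewrite -lt0n. Qed.
Let cde : coprime d e. Proof. by apply: squarefree_coprime => //; rewrite -Nde. Qed.

Lemma chiw_mul (x y : int) : chiw d (x * d%:Z, y) = chi e x * chi d y.
Proof. by rewrite /chiw /= dvdz_mull // mulzK. Qed.

Lemma chi_level (b : int) : chi N b = chi d b * chi e b.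
Proof. by rewrite {1}Nde chiMl. Qed.

Lemma chiw_per v u : pcong N v u -> chiw d v = chiw d u.
Proof.
move=> [/= h1 h2]; have dzN : (d %| N%:Z)%Z by rewrite dvdzE.
have dd : (d %| v.1)%Z = (d %| u.1)%Z.
  have h : (d %| (v.1 - u.1)%R)%Z := dvdz_trans dzN h1.
  by rewrite -[v.1](subrK u.1) rpredDl.
have h2' : (d %| (v.2 - u.2)%R)%Z := dvdz_trans dzN h2.
rewrite /chiw dd; case: ifP => // du; have dv := dd; rewrite du in dv.
rewrite (chi_mod R od h2'); congr (_ * _); apply: (chi_mod R oe).
rewrite -(@dvdz_mul2r d) // mulrBl !divzK //.
by rewrite mulrC -PoszM -Nde.
Qed.

Lemma chiN1_level : chi N (-1) = (-1) ^+ k.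
Proof. by rewrite chiN // chi_1 // mulr1 /= -muln2 mulnK. Qed.

Lemma chiw_opp v : chiw d (- v.1, - v.2) = (-1) ^+ k * chiw d v.
Proof.
rewrite -chiN1_level chi_level /chiw /= rpredN; case: ifP => [dv|_]; last by rewrite mulr0.
case: v dv => _ y /= /dvdzP[x ->]; rewrite -mulNr !mulzK // -[- x]mulN1r -[- y]mulN1r !chiMr //; ring.
Qed.

(** Representatives [t1 + d t2]: [chi d] sees only [t1], so the sum over [t2] is an orthogonality
    relation that forces [e] to divide [m], and the sum over [t1] is a Gauss sum modulo [d]. *)
Lemma sum_chi_ze (m : nat) :
  \sum_(j < N) (chi d (j : nat)%:Z)%:~R * ze R N (m%:Z * (j : nat)%:Z)
  = if (e %| m)%N then e%:R * (chi d (m %/ e)%N%:Z)%:~R * Tsum R d 1 else 0.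
Proof.
pose h (t : 'I_d * 'I_e) : int := (t.1 : nat)%:Z + d%:Z * (t.2 : nat)%:Z.
pose F (x : int) : R[i] := (chi d x)%:~R * ze R N (m%:Z * x).
have FP x y : (N %| (x - y)%R)%Z -> F x = F y.
  move=> xy; rewrite /F; congr (_%:~R * _).
    by apply: (chi_mod R od); apply: dvdz_trans xy; rewrite dvdzE.
  by apply: ze_mod => //; rewrite -mulrBr dvdz_mull.
have hP s t : (N %| (h s - h t)%R)%Z -> s = t.
  case: s t => [s1 s2] [t1 t2]; rewrite /h /= => H.
  have E1 : s1 = t1.
    apply: dvdz_ord; have : (d %| ((s1 : nat)%:Z + d%:Z * (s2 : nat)%:Z - ((t1 : nat)%:Z + d%:Z * (t2 : nat)%:Z))%R)%Z.
      by apply: dvdz_trans H; rewrite dvdzE.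
    rewrite (_ : _ - _ = ((s1 : nat)%:Z - (t1 : nat)%:Z) + d%:Z * ((s2 : nat)%:Z - (t2 : nat)%:Z)); last by ring.
    by rewrite rpredDr // dvdz_mulr.
  move: H; rewrite E1 (_ : _ - _ = d%:Z * ((s2 : nat)%:Z - (t2 : nat)%:Z)); last by ring.
  by rewrite Nde PoszM dvdz_mul2l // => /dvdz_ord ->.
have cT : #|{: 'I_d * 'I_e}| = N by rewrite card_prod !card_ord -Nde.
have -> : \sum_(j < N) (chi d (j : nat)%:Z)%:~R * ze R N (m%:Z * (j : nat)%:Z) = \sum_(t : 'I_d * 'I_e) F (h t).
  exact: (sum_ord_bij N0 cT FP hP).
have FE (t : 'I_d * 'I_e) : F (h t) = (chi d (t.1 : nat)%:Z)%:~R * ze R N (m%:Z * (t.1 : nat)%:Z) * ze R e (m%:Z * (t.2 : nat)%:Z).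
  rewrite /F /h [m%:Z * _]mulrDr zeD [LHS]mulrA; congr (_%:~R * _ * _).
    by apply: (chi_mod R od); rewrite addrC addKr dvdz_mulr.
  rewrite -(@zeMl R e d) // [(e * d)%N]mulnC -Nde; congr (ze R _ _); ring.
rewrite (eq_bigr _ (fun t _ => FE t)) -(pair_bigA _ (fun (i : 'I_d) (j : 'I_e) => (chi d (i : nat)%:Z)%:~R * ze R N (m%:Z * (i : nat)%:Z) * ze R e (m%:Z * (j : nat)%:Z))) /=.
under eq_bigr do rewrite -mulr_sumr sum_ze //.
rewrite -mulr_suml dvdzE /=; case: ifP => [em|_]; last by rewrite mulr0.
have [TE _] := Tsum_main R od (squarefree_dvd dN).
rewrite [LHS]mulrC -mulrA -TE; congr (_ * _); apply: eq_bigr => i _; congr (_ * _).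
rewrite -(@zeMl R d e) // -Nde; congr (ze R _ _).
by rewrite -{1}(divnK em) PoszM; ring.
Qed.

Lemma what_wgt (c m : nat) : what N (wgt d) c%:Z m =
  if (d %| c)%N && (e %| m)%N then e%:R * (chi e (c %/ d)%N%:Z)%:~R * (chi d (m %/ e)%N%:Z)%:~R * Tsum R d 1 else 0.
Proof.
rewrite /what /wgt /chiw /= dvdzE /=; case: (boolP (d %| c)%N) => dc /=; last first.
  by apply: big1 => j _; rewrite rmorph0 mul0r.
have -> : (c%:Z %/ d%:Z)%Z = (c %/ d)%N by rewrite divz_nat.
transitivity ((chi e (c %/ d)%N%:Z)%:~R * \sum_(j < N) (chi d (j : nat)%:Z)%:~R * ze R N (m%:Z * (j : nat)%:Z)).
  by rewrite mulr_sumr; apply: eq_bigr => j _; rewrite rmorphM /= mulrA.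
by rewrite sum_chi_ze; case: ifP => _; [ring|rewrite mulr0].
Qed.

(** The factor [chi e] sums to zero when [d = 1], the factor [chi d] when [d > 1]. This is the
    condition under which the subtracted zero class drops out. *)
Lemma sum_wgt : \sum_(q : 'I_N * 'I_N) wgt d ((q.1 : nat)%:Z, (q.2 : nat)%:Z) = 0.
Proof.
rewrite -(pair_bigA _ (fun (i j : 'I_N) => wgt d ((i : nat)%:Z, (j : nat)%:Z))) /=.
have whatE (c : 'I_N) : \sum_(j < N) wgt d ((c : nat)%:Z, (j : nat)%:Z) = what N (wgt d) (c : nat)%:Z 0.
  by apply: eq_bigr => j _; rewrite mul0r ze0 mulr1.
rewrite (eq_bigr _ (fun c _ => whatE c)).
have [d1|d1] := eqVneq d 1%N.
  have eN : e = N by rewrite /e d1 divn1.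
  transitivity (\sum_(c < N) e%:R * Tsum R d 1 * (chi N (c : nat)%:Z)%:~R).
    apply: eq_bigr => c _; rewrite what_wgt d1 dvd1n dvdn0 /= divn1 chi1E mulr1 eN; ring.
  by rewrite -mulr_sumr (sum_chi_N R oN sqN N1) mulr0.
apply: big1 => c _; rewrite what_wgt div0n; case: ifP => // _.
have /eqP -> : chi d 0%N%:Z == 0 by rewrite chi_eq0 // /coprime gcdn0.
by rewrite mulr0 mul0r.
Qed.

(** As [N] divides the lower left entry, [c / d] modulo [e] and [j] modulo [d] are just multiplied
    by the two diagonal entries of [g]. These are inverse to each other modulo [d], and [chi d]
    takes the same value on an entry and its inverse. *)
Lemma chiw_Gamma0 g v : Gamma0 N g -> chiw d (act (adj g) v) = chi N (g 1 1) * chiw d v.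
Proof.
move=> [/SL2P sg /= /dvdzP[c' cE]]; case: v => x y.
have NE : N%:Z = d%:Z * e%:Z by rewrite -PoszM -Nde.
rewrite cE NE in sg.
rewrite /act /adj !mk2E /= cE NE.
have cop : coprimez d (g 1 1).
  apply/coprimezP; exists (- (g 0 1 * c' * e%:Z), g 0 0) => /=.
  rewrite -[RHS]sg; ring.
case: (boolP (d %| x)%Z) => [/dvdzP[x' ->]|ndx]; last first.
  rewrite /chiw /= (negbTE ndx) mulr0 ifF //; apply: contraNF ndx.
  rewrite (_ : _ + _ = x * g 1 1 + d%:Z * - (y * c' * e%:Z)); last by ring.
  by rewrite rpredDr; [rewrite Gauss_dvdzl|rewrite dvdz_mulr].
rewrite chiw_mul.
have -> : x' * d%:Z * g 1 1 + y * - (c' * (d%:Z * e%:Z)) = (x' * g 1 1 - y * c' * e%:Z) * d%:Z by ring.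
rewrite chiw_mul.
have -> : chi e (x' * g 1 1 - y * c' * e%:Z) = chi e (x' * g 1 1).
  by apply: (chi_mod R oe); rewrite addrC addKr rpredN dvdz_mull.
have -> : chi d (x' * d%:Z * - g 0 1 + y * g 0 0) = chi d (y * g 0 0).
  by apply: (chi_mod R od); rewrite addrK mulrAC dvdz_mull.
rewrite chi_level !chiMr //.
have h1 : chi d (g 0 0) * chi d (g 1 1) = 1.
  rewrite -chiMr // -(chi_1 od); apply: (chi_mod R od).
  rewrite (_ : _ - 1 = d%:Z * (g 0 1 * c' * e%:Z)); first by rewrite dvdz_mulr.
  by rewrite -sg; ring.
have h2 : chi d (g 1 1) ^+ 2 = 1 by apply: chi_sqr.
have -> : chi d (g 0 0) = chi d (g 1 1).
  by rewrite -[LHS]mulr1 -h2 expr2 mulrA h1 mul1r.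
ring.
Qed.

(** The pairs [(- dl j, j)] are row 0 after transport to the cusp [1 / dl]. Unless [chi d] vanishes
    at [j], the weight requires [d] to divide [dl]; the quotient [f = dl / d] then divides [e], and
    for [f > 1] the factor [chi e] vanishes at a multiple of [f]. *)
Lemma chiw_cusp (dl : nat) (j : int) : (dl %| N)%N ->
  chiw d (- (dl%:Z * j), j) = if d == dl then chi e (-1) * chi N j else 0.
Proof.
move=> dlN; case: eqP => [<-|/eqP ne].
  rewrite -mulrN mulrC chiw_mul chi_level -mulN1r chiMr //; ring.
rewrite /chiw /=; case: ifP => // dj; apply/eqP; rewrite mulf_eq0 !chi_eq0 //.
case: (boolP (coprime d `|j|%N)) => [cj|_]; last by rewrite orbT.
rewrite /= orbF; move: dj; rewrite rpredN Gauss_dvdzl ?coprimezE // dvdzE /= => /dvdnP[f fE].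
have f1 : f != 1%N by apply: contraNneq ne => f1; rewrite fE f1 mul1n.
have fe : (f %| e)%N.
  by move: dlN; rewrite fE Nde mulnC dvdn_pmul2l.
have -> : - (dl%:Z * j) = - (f%:Z * j) * d%:Z by rewrite fE PoszM; ring.
rewrite mulzK //.
apply: contraNN f1 => cop; rewrite -dvdn1 -(eqP cop) dvdn_gcd fe /=.
by rewrite abszN abszM dvdn_mulr.
Qed.

End Divisor.

Lemma wgt_per d v u : (d %| N)%N -> pcong N v u -> wgt d v = wgt d u.
Proof. by move=> dN vu; rewrite /wgt (chiw_per dN vu). Qed.

End EisensteinWeights.

(** * Fourier expansions of the Eisenstein series at the cusps *)

Section EisensteinSeries.
Variables (R : realType) (p : nat).
Local Notation k := p.+1.
Local Notation N := p.+1.*2.+1.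
Hypotheses (p0 : (0 < p)%N) (sqN : squarefree N).

Let oN : odd N. Proof. by rewrite /= odd_double. Qed.
Let N0 : (0 < N)%N. Proof. by []. Qed.
Let N1 : (1 < N)%N. Proof. by []. Qed.
Let k2 : (1 < k)%N. Proof. by []. Qed.
Let NC : N%:R != 0 :> R[i]. Proof. by rewrite pnatr_eq0. Qed.

Local Notation wd := (@wgt R p).
Local Notation E := (@Eis R k N).
Local Notation L := (L2 R N p).

Lemma Eis_qexp (w : int * int -> R[i]) :
  (forall v u, pcong N v u -> w v = w u) ->
  (forall v, w (- v.1, - v.2) = (-1) ^+ k * w v) ->
  \sum_(q : 'I_N * 'I_N) w ((q.1 : nat)%:Z, (q.2 : nat)%:Z) = 0 ->
  exists2 a, a 0%N = \sum_(j < N) w (0, (j : nat)%:Z) *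
      csum (fun n : int => PP k ((j : nat)%:~R + (N%:Z * n)%:~R)) & qexp N (E w) a.
Proof.
move=> w1 w2 w3; set c0 := \sum_(j < N) _.
pose e (q : nat * nat) := (q.1.+1 * q.2)%N.
have h := @qexp_csum R N _ e (ecoef k N w) (fun z z0 => absum_ecoef k2 N0 z0 w1).
have := qexpD (qexp_cst N c0) (qexpZ (2 * (N%:R ^- k * lipc R k.-1)) h).
set a := (fun n : nat => _) => ha; exists a; last first.
  by apply: eq_qexp ha => z z0; rewrite (Eis_expand k2 N0 z0 w1 w2 w3).
rewrite /a eqxx /qcoef csum0 ?mulr0 ?addr0 // => -[x y]; rewrite /e /= mulSn.
case: eqP => // /eqP; rewrite addn_eq0 => /andP[/eqP -> _].
by rewrite /ecoef /= expr0n gtn_eqF // mul0r.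
Qed.

Section Divisor.
Variable d : nat.
Hypothesis dN : (d %| N)%N.
Local Notation e := (N %/ d)%N.
Let Nde : N = (d * e)%N := level_div dN.
Let od : odd d := odd_dvd_level dN.
Let oe : odd e := odd_dvd_level (codvd_level dN).
Let d0 : (0 < d)%N := gt0_dvd dN.
Let e0 : (0 < e)%N := gt0_dvd (codvd_level dN).

(** Slashing by [g] composes the weights with [adj g]; the new weights keep the three properties
    asked for in [Eis_qexp], and the constant term is their row 0. *)
Lemma Eis_slash (dl : nat) : (dl %| N)%N ->
  exists2 a, a 0%N = (if d == dl then (chi e (-1))%:~R * L else 0) &
    qexp N (slash k (E (wd d)) (mk2 1 0 dl%:Z 1)) a.
Proof.
move=> dlN; set g := mk2 1 0 dl%:Z 1.
have sg : SL2Z g by apply/SL2P; rewrite !mk2E; ring.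
have sa : SL2Z (adj g) by apply/SL2P; rewrite /adj !mk2E; ring.
pose w v := wd d (act (adj g) v).
have actE v : act (adj g) v = (v.1 - dl%:Z * v.2, v.2).
  by rewrite /act /adj !mk2E oppr0 mulr0 add0r !mulr1 mulrN [v.2 * _]mulrC.
have w1 v u : pcong N v u -> w v = w u.
  move=> [h1 h2]; apply: wgt_per => //; rewrite !actE; split=> //=.
  rewrite (_ : _ - _ = (v.1 - u.1) - dl%:Z * (v.2 - u.2)); last by ring.
  by rewrite rpredB // dvdz_mull.
have w2 v : w (- v.1, - v.2) = (-1) ^+ k * w v.
  rewrite /w !actE /= /wgt.
  have -> : - v.1 - dl%:Z * - v.2 = - (v.1 - dl%:Z * v.2) by ring.
  by have := chiw_opp dN (v.1 - dl%:Z * v.2, v.2) => /= ->; rewrite rmorphM rmorphXn rmorphN rmorph1.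
have w3 : \sum_(q : 'I_N * 'I_N) w ((q.1 : nat)%:Z, (q.2 : nat)%:Z) = 0.
  by rewrite -(sum_act k2 N0 sa (F := wd d)) ?sum_wgt // => v u; exact: wgt_per.
have [a a0 qa] := Eis_qexp w1 w2 w3; exists a.
  have wE j : w (0, j) = (if d == dl then chi e (-1) * chi N j else 0)%:~R.
    by rewrite /w actE /= sub0r /wgt chiw_cusp.
  rewrite a0; case: eqP wE => _ wE; last by apply: big1 => j _; rewrite wE rmorph0 mul0r.
  by rewrite /L2 mulr_sumr; apply: eq_bigr => j _; rewrite wE rmorphM -mulrA.
apply: eq_qexp qa => z z0; rewrite /slash (Eis_moebius k2 N0) //; last first.
  by move=> v u; exact: wgt_per.
by rewrite mulKf // expf_neq0 // automorphy_neq0.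
Qed.

Lemma Eis_Gamma0 g z : Gamma0 N g -> 0 < complex.Im z ->
  E (wd d) (moebius g z) = (chi N (g 1 1))%:~R * automorphy g z ^+ k * E (wd d) z.
Proof.
move=> Gg z0; have [sg _] := Gg.
rewrite (Eis_moebius k2 N0) //; last by move=> v u; exact: wgt_per.
rewrite [_%:~R * _]mulrC -[RHS]mulrA; congr (_ * _); rewrite /Eis mulr_sumr.
apply: eq_bigr => q _; rewrite mulrA; congr (_ * _).
by rewrite /wgt (chiw_Gamma0 R dN) // rmorphM.
Qed.

Definition dirichlet (q : nat * nat) : R[i] :=
  (chi e q.1.+1%:Z)%:~R * (chi d q.2%:Z)%:~R * q.2%:R ^+ p.

Definition escale : R[i] := e%:R ^+ k * Tsum R d 1.

Lemma escale_neq0 : escale != 0.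
Proof.
by rewrite mulf_neq0 ?Tsum1_neq0 ?expf_neq0 ?pnatr_eq0 -?lt0n //; exact: squarefree_dvd dN.
Qed.

(** By [what_wgt] only pairs with the first index divisible by [d] and the second by [e] contribute;
    on them the exponent has the factor [d e = N], which turns the variable [z / N] into [z]. *)
Lemma Eis_dirichlet z : 0 < complex.Im z ->
  absum (fun q => dirichlet q * nome ((q.1.+1 * q.2)%N%:R * z)) /\
  csum (fun q : nat * nat => ecoef k N (wd d) q * nome ((q.1.+1 * q.2)%N%:R * (z / N%:R))) =
  escale * csum (fun q => dirichlet q * nome ((q.1.+1 * q.2)%N%:R * z)).
Proof.
move=> z0; set f := fun q : nat * nat => ecoef _ _ _ _ * _.
have w1 v u : pcong N v u -> wd d v = wd d u by exact: wgt_per.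
have af : absum f by exact: absum_ecoef.
(* First indices are stored minus one, so multiplication by [d] acts on [q.1 + 1]. *)
pose h (q : nat * nat) := ((d * q.1.+1).-1, (e * q.2)%N).
pose h' (q : nat * nat) := ((q.1.+1 %/ d).-1, (q.2 %/ e)%N).
have hS (q : nat * nat) : (h q).1.+1 = (d * q.1.+1)%N by rewrite /= prednK // muln_gt0 d0.
have hK : cancel h h' by case=> a b; rewrite /h' hS /= !mulKn.
have f0 q : h (h' q) != q -> f q = 0.
  move=> hq; rewrite /f /ecoef what_wgt //; case: ifP => [/andP[dq eq]|_]; last by rewrite mulr0 mul0r.
  case/eqP: hq; case: q dq eq => x y /= dq eq; rewrite /h /h' /= prednK; last by rewrite divn_gt0 // dvdn_leq.
  have -> : (d * (x.+1 %/ d))%N = x.+1 by rewrite mulnC divnK.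
  by have -> : (e * (y %/ e))%N = y by rewrite mulnC divnK.
have fh q : f (h q) = escale * (dirichlet q * nome ((q.1.+1 * q.2)%N%:R * z)).
  rewrite /f /ecoef what_wgt // !hS /= !dvdn_mulr //= !mulKn // /escale /dirichlet.
  have -> : (d * q.1.+1 * (e * q.2))%N%:R * (z / N%:R) = (q.1.+1 * q.2)%N%:R * z.
    have -> : (d * q.1.+1 * (e * q.2))%N = (N * (q.1.+1 * q.2))%N by rewrite {2}Nde; ring.
    by rewrite natrM; move: NC; move: (N%:R : R[i]) => x x0; field.
  by rewrite natrM exprMn exprS; ring.
have afh : absum (fun q => f (h q)) by apply: absum_inj (can_inj hK) af.
have aD : absum (fun q => dirichlet q * nome ((q.1.+1 * q.2)%N%:R * z)).
  have := absumZ escale^-1 afh; rewrite (_ : (fun q => _) = fun q => dirichlet q * nome ((q.1.+1 * q.2)%N%:R * z)) //.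
  by apply/funext => q; rewrite fh mulKf // escale_neq0.
split=> //; rewrite (csum_reindex hK f0 afh) -csumZ //; exact: eq_csum.
Qed.

Lemma sigma_qcoef n : (0 < n)%N ->
  qcoef (fun q : nat * nat => (q.1.+1 * q.2)%N) dirichlet n = sigma R p%:Z (chi e) (chi d) n.
Proof.
move=> n0; pose s := [seq ((n %/ t).-1, t) | t <- divisors n].
have us : uniq s by rewrite map_inj_uniq ?divisors_uniq // => x y [].
rewrite /qcoef (csum_fin (A := seq_fset tt s)); last first.
  case=> x y; rewrite seq_fsetE /= => nin; case: eqP => // xy; case/negP: nin; apply/mapP; exists y.
    by rewrite -dvdn_divisors // -xy dvdn_mull.
  by rewrite -xy mulnK //; move: n0; rewrite -xy muln_gt0 => /andP[].
rewrite (perm_big _ (seq_fset_perm _ _)) /= undup_id // big_map /sigma big_seq [RHS]big_seq.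
apply: eq_bigr => t; rewrite -dvdn_divisors // => tn /=.
have t0 : (0 < t)%N by exact: dvdn_gt0 tn.
have E1 : (n %/ t).-1.+1 = (n %/ t)%N by rewrite prednK // divn_gt0 // dvdn_leq.
by rewrite E1 divnK // eqxx /dirichlet E1 -exprnP.
Qed.

Lemma dirichlet_lim z : 0 < complex.Im z ->
  \big[+%R/0]_(1 <= n <oo) (sigma R p%:Z (chi e) (chi d) n * nome z ^+ n)
  = csum (fun q => dirichlet q * nome ((q.1.+1 * q.2)%N%:R * z)).
Proof.
move=> z0; apply: cvs_lim; pose c (q : nat * nat) := (q.1.+1 * q.2)%N.
have ac u : 0 < complex.Im u -> absum (fun q => dirichlet q * nome ((c q)%:R * (u / 1%:R))).
  by move=> u0; rewrite divr1; have [] := Eis_dirichlet u0.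
have := qexp_series (qexp_csum ac) z0; rewrite divr1.
apply: eq_cvs; exists 1%N => n n1; rewrite /series /= big_ltn //.
have -> : qcoef c dirichlet 0 = 0.
  rewrite /qcoef csum0 // => -[x y]; rewrite /c /= mulSn; case: eqP => // /eqP.
  by rewrite addn_eq0 => /andP[/eqP -> _]; rewrite /dirichlet /= expr0n gtn_eqF // mulr0.
rewrite mul0r add0r big_nat [RHS]big_nat; apply: eq_bigr => i /andP[i1 _].
by rewrite sigma_qcoef.
Qed.

Definition enorm : R[i] := 2 * (N%:R ^- k * lipc R p) * escale.

Lemma enorm_neq0 : enorm != 0.
Proof.
rewrite /enorm mulf_neq0 ?escale_neq0 // mulf_neq0 ?pnatr_eq0 // mulf_neq0 ?lipc_neq0 //.
Qed.

(** Infinity is equivalent to the cusp [1 / N], so only [d = N] has a constant term there. *)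
Lemma Eis_sigma z : 0 < complex.Im z ->
  E (wd d) z = (if d == N then L else 0) +
    enorm * \big[+%R/0]_(1 <= n <oo) (sigma R p%:Z (chi e) (chi d) n * nome z ^+ n).
Proof.
move=> z0; have w1 v u : pcong N v u -> wd d v = wd d u by exact: wgt_per.
have w2 v : wd d (- v.1, - v.2) = (-1) ^+ k * wd d v.
  by rewrite /wgt (chiw_opp dN) rmorphM rmorphXn rmorphN rmorph1.
rewrite (Eis_expand k2 N0 z0 w1 w2 (sum_wgt R sqN dN)) dirichlet_lim //.
have [_ ->] := Eis_dirichlet z0; congr (_ + _); last by rewrite /enorm /= !mulrA.
have wE (j : int) : wd d (0, j) = (if d == N then chi N j else 0)%:~R.
  have -> : wd d (0, j) = wd d (- (N%:Z * j), j).
    by apply: wgt_per => //; split; rewrite /= ?subrr ?dvdz0 // sub0r opprK dvdz_mulr.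
  rewrite /wgt chiw_cusp //; case: eqP => // ->.
  by rewrite divnn /= chi1E mul1r.
case: eqP wE => _ wE; last by apply: big1 => j _; rewrite wE rmorph0 mul0r.
by rewrite /L2; apply: eq_bigr => j _; rewrite wE.
Qed.

End Divisor.
End EisensteinSeries.

(** * Matching the constant terms of theta and the Eisenstein series *)

Section Decomposition.
Variables (R : realType) (p : nat).
Local Notation k := p.+1.
Local Notation N := p.+1.*2.+1.
Hypotheses (p0 : (0 < p)%N) (sqN : squarefree N).

Let oN : odd N. Proof. by rewrite /= odd_double. Qed.
Let N0 : (0 < N)%N. Proof. by []. Qed.
Let N1 : (1 < N)%N. Proof. by []. Qed.
Let k2 : (1 < k)%N. Proof. by []. Qed.
Let NC : N%:R != 0 :> R[i]. Proof. by rewrite pnatr_eq0. Qed.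

Local Notation E d := (@Eis R k N (@wgt R p d)).
Local Notation L := (L2 R N p).
Local Notation B := (gen_bernoulli R[i] (chi N) N k).

Lemma gen_bernoulli_neq0 : B != 0.
Proof.
have par : (-1) ^+ (N.-1 %/ 2) = (-1) ^+ p.+1 :> int by rewrite /= -muln2 mulnK.
have := @L2_neq0 R N oN N1 p p0 par; rewrite L2_bernoulli //.
by apply: contraNneq => ->; rewrite mul0r oppr0 mulr0.
Qed.

Lemma sqrtC_neq0 n : (0 < n)%N -> (Num.sqrt (n%:R : R))%:C != 0.
Proof. by move=> n0; rewrite (fmorph_eq0 (@real_complex_def R (Phant R))) sqrtr_eq0 -ltNge ltr0n. Qed.

Lemma sqrtC_sq n : (Num.sqrt (n%:R : R))%:C ^+ 2 = n%:R.
Proof. by rewrite -rmorphXn /= sqr_sqrtr ?ler0n // rmorph_nat. Qed.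

(** The exponent of [i] in [C(d, N)], split into the [k] from the automorphy factor and the
    contribution of the [N] copies of the Gauss sum in [theta_slash]. *)
Lemma cusp_exponent dl : odd dl -> ((1 - (N * dl)%:Z) %/ 2)%Z = - (k + N * dl./2)%N%:Z.
Proof.
move=> od; have dlE : dl = (dl./2).*2.+1 by rewrite -{1}(odd_double_half dl) od.
have -> : 1 - (N * dl)%N%:Z = - (k + N * dl./2)%N%:Z * 2; last by rewrite mulzK.
by rewrite {1}dlE; move: dl./2 => s; rewrite -!addnn; lia.
Qed.

Lemma i_expN n : 'i ^ (- n%:Z) = (- 'i) ^+ n :> R[i].
Proof.
rewrite -exprnN -exprVn; congr (_ ^+ _).
have i2 : 'i * - 'i = 1 :> R[i] by rewrite mulrN -expr2 sqr_i opprK.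
by have i0 : 'i != 0 :> R[i]; [rewrite eq_complex /= oner_eq0 andbF|rewrite -[RHS](mulKf i0) i2 mulr1].
Qed.

(** The constant term from [theta_cusp] is a Gauss sum modulo [dl]; [qs_dvd] makes it an [N]-th
    power, and [gauss_half] evaluates the base, sign included. *)
Lemma theta_slash dl : (dl %| N)%N ->
  exists2 a, a 0%N = 'i ^ ((1 - (N * dl)%:Z) %/ 2)%Z / (Num.sqrt (N %/ dl)%N%:R)%:C &
    qexp N (slash k (@f_theta R k.*2) (mk2 1 0 dl%:Z 1)) a.
Proof.
move=> dlN; set g := mk2 1 0 dl%:Z 1.
have dl0 : (0 < dl)%N by exact: dvdn_gt0 dlN.
have od := odd_dvd_level dlN; have sqd := squarefree_dvd sqN dlN.
have sg : SL2Z g by apply/SL2P; rewrite !mk2E; ring.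
have g10 : 0 < g 1 0 by rewrite mk2E ltz_nat.
have [C [aC C0 thE]] := @theta_cusp R p.+1 g sg g10.
have := qexp_csum aC; set a := qcoef _ _ => qa; exists a; last first.
  by apply: eq_qexp qa => z z0; rewrite /slash thE // mulKf // expf_neq0 // automorphy_neq0.
rewrite /a qcoef0 C0 !mk2E absz_nat qs_dvd ?coprimen1 // mul1r gauss_half //.
rewrite cusp_exponent // i_expN.
have NE := level_div dlN; move: (N %/ dl)%N NE => e NE.
have e0 : (0 < e)%N by move: N0; rewrite NE muln_gt0 => /andP[].
have sN : (Num.sqrt (N%:R : R))%:C = (Num.sqrt (dl%:R : R))%:C * (Num.sqrt (e%:R : R))%:C.
  by rewrite NE natrM sqrtrM ?ler0n // rmorphM.
rewrite sN [('i * _) ^+ k]exprMn [('i ^+ k * _)^-1]invfM [(_ * _) ^+ N]exprMn.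
have -> : (('i : R[i]) ^+ k)^-1 = (- 'i) ^+ k by rewrite -i_expN -exprnN.
rewrite -exprM [(dl./2 * _)%N]mulnC exprD.
have -> : (Num.sqrt (dl%:R : R))%:C ^+ N = (Num.sqrt (dl%:R : R))%:C * dl%:R ^+ k.
  by rewrite exprS -mul2n exprM sqrtC_sq.
have s1 := sqrtC_neq0 dl0; have s2 := sqrtC_neq0 e0.
have dk : dl%:R ^+ k != 0 :> R[i] by rewrite expf_neq0 // pnatr_eq0 -lt0n.
move: s1 s2 dk.
move: ((Num.sqrt (dl%:R : R))%:C) ((Num.sqrt (e%:R : R))%:C) => x y.
move: ((- 'i) ^+ k) ((- 'i) ^+ (N * dl./2)) => u v.
rewrite -[dl%:~R]/(dl%:R); move: (dl%:R ^+ k) => w x0 y0 w0.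
by field; rewrite x0 y0 w0.
Qed.

Definition eis_coef d : R[i] :=
  C_coef R d N * (N %/ d)%:R ^+ p * ((1 - N%:R) / B).

Lemma epsilon_neq0 c : epsilon R c != 0.
Proof. by rewrite /epsilon; case: ifP => _; rewrite ?oner_eq0 // eq_complex /= oner_eq0 andbF. Qed.

Lemma A_coef_neq0 d : A_coef R d N != 0.
Proof. by rewrite /A_coef mulf_neq0 ?epsilon_neq0 // expf_neq0 // oppr_eq0 oner_eq0. Qed.

(** The identity that dictates [eis_coef]. [A_coefE] trades the Gauss sum modulo [N] in the L-value
    for the one modulo [d] in [enorm], [chi e (-1)] occurs squared, and [1 - N = -2 k] cancels the
    factor 2 of [enorm] and the [- 1 / k] of the L-value. *)
Lemma eis_constant d : (d %| N)%N ->
  eis_coef d / enorm R p d * ((chi (N %/ d)%N (-1))%:~R * L)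
  = 'i ^ ((1 - (N * d)%:Z) %/ 2)%Z / (Num.sqrt (N %/ d)%N%:R)%:C.
Proof.
move=> dN; have NE := level_div dN; have A0 := A_coef_neq0 d.
have od := odd_dvd_level dN; have oe := odd_dvd_level (codvd_level dN).
have sd := squarefree_dvd sqN dN; have se := squarefree_dvd sqN (codvd_level dN).
have e0 := gt0_dvd (codvd_level dN).
rewrite /eis_coef /enorm /escale /C_coef; set I := 'i ^ _.
set A := A_coef R d N in A0 *; move: (N %/ d)%N NE oe se e0 @A A0 => e NE oe se e0 A A0.
have AE : A * ((chi e (-1))%:~R * (Num.sqrt e%:R)%:C * Tsum R d 1) = Tsum R N 1.
  by rewrite /A NE; apply: A_coefE => //; rewrite -NE.
have c2 : (chi e (-1))%:~R * (chi e (-1))%:~R = 1 :> R[i].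
  by rewrite -rmorphM -expr2 chi_sqr // /= coprimen1.
rewrite L2_bernoulli // -AE.
have Nk : 1 - N%:R = - (2 * k%:R) :> R[i] 
  by have -> : N%:R = 2 * k%:R + 1 :> R[i]; [rewrite -natrM mul2n natr1|ring].
have k0 : k%:R != 0 :> R[i] by rewrite pnatr_eq0.
have B0 := gen_bernoulli_neq0; have T0 := Tsum1_neq0 R od sd; have l0 := lipc_neq0 R p.
have s0 := sqrtC_neq0 e0; have sq := sqrtC_sq e.
have Nx : N%:R ^+ k != 0 :> R[i] by rewrite expf_neq0.
have ex : e%:R ^+ p != 0 :> R[i] by rewrite expf_neq0 // pnatr_eq0 -lt0n.
have e1 : e%:R != 0 :> R[i] by rewrite pnatr_eq0 -lt0n.
rewrite Nk [e%:R ^+ k]exprS; move: ex; move: (e%:R ^+ p) => x x0; rewrite -sq.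
clearbody A I; move: c2 A0 B0 T0 l0 s0 Nx k0; clear -x0.
move: (A) (I) ((chi e (-1))%:~R : R[i]) (Tsum R d 1) (lipc R p) ((Num.sqrt e%:R)%:C : R[i]) (N%:R ^+ k : R[i]) (k%:R : R[i]) (gen_bernoulli _ _ _ _ : R[i]).
move=> {}A {}I c T l s n y b c2 A0 b0 T0 l0 s0 n0 y0.
transitivity (c * c * (I / s)); last by rewrite c2 mul1r.
by field; rewrite A0 b0 T0 l0 s0 n0 x0 y0.
Qed.

Definition eisenstein_part z : R[i] := \sum_(d <- divisors N) eis_coef d / enorm R p d * E d z.

Lemma eisenstein_partE z : 0 < complex.Im z -> eisenstein_part z =
  1 + \sum_(d <- divisors N) eis_coef d *
    \big[+%R/0]_(1 <= n <oo) (sigma R p%:Z (chi (N %/ d)) (chi d) n * nome z ^+ n).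
Proof.
move=> z0; rewrite /eisenstein_part.
transitivity (\sum_(d <- divisors N) ((if d == N then 1 else 0) + eis_coef d *
    \big[+%R/0]_(1 <= n <oo) (sigma R p%:Z (chi (N %/ d)) (chi d) n * nome z ^+ n))).
  rewrite big_seq [RHS]big_seq; apply: eq_bigr => d; rewrite -dvdn_divisors // => dN.
  rewrite (Eis_sigma p0 sqN dN z0) mulrDr; congr (_ + _); last first.
    by rewrite mulrA divfK // enorm_neq0.
  case: eqP => [dE|_]; last by rewrite mulr0.
  have := eis_constant dN; rewrite (cusp_exponent (odd_dvd_level dN)) i_expN dE divnn /= chi1E mul1r sqrtr1 divr1 => ->.
  rewrite uphalf_double.
  (* At [d = N] the exponent of [-i] is [k + N k = 2 k (k + 1)], a multiple of 4, so the constant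
     term at infinity is 1. *)
  have -> : (k + N * k)%N = (4 * ((k * k.+1)./2))%N.
    have : odd (k * k.+1) = false by rewrite oddM /= andbN.
    by move=> /negbT /even_halfK; move: (_./2) => h; rewrite -!addnn; lia.
  by rewrite exprM (_ : (- 'i) ^+ 4 = 1) ?expr1n // (exprM _ 2 2) sqrrN sqr_i sqrrN expr1n.
rewrite big_split /=; congr (_ + _).
rewrite (bigD1_seq N) ?divisors_uniq -?dvdn_divisors //= eqxx big1 ?addr0 // => d /negbTE -> //.
Qed.

(** At the cusp [1 / dl] only the summand [d = dl] has a constant term, and by [eis_constant] it
    equals that of theta. *)
Lemma cusp_part : cusp_form k N (chi N) (fun z => @f_theta R k.*2 z - eisenstein_part z).
Proof.
apply: cusp_formP => // [g z Gg z0|dl dlN].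
  rewrite theta_Gamma0 // mulrBr; congr (_ - _).
  rewrite /eisenstein_part mulr_sumr big_seq [RHS]big_seq; apply: eq_bigr => d.
  by rewrite -dvdn_divisors // => dN; rewrite (Eis_Gamma0 p0 dN Gg z0) mulrCA.
set g := mk2 _ _ _ _.
have [a a0 qa] := theta_slash dlN.
have /choice[b hb] : forall d, exists b, d \in divisors N ->
    b 0%N = (if d == dl then (chi (N %/ d) (-1))%:~R * L else 0) /\ qexp N (slash k (E d) g) b.
  move=> d; case: (boolP (d \in divisors N)) => [|_]; last by exists (fun=> 0).
  by rewrite -dvdn_divisors // => dN; have [b b0 qb] := Eis_slash R p0 sqN dN dlN; exists b.
have q2 : qexp N (fun z => \sum_(d <- divisors N) eis_coef d / enorm R p d * slash k (E d) g z)
    (fun n => \sum_(d <- divisors N) eis_coef d / enorm R p d * b d n).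
  by apply: qexp_sum => d /hb[_ h]; exact: qexpZ.
have q3 := qexpD qa (qexpZ (-1) q2).
exists (fun n => a n + -1 * \sum_(d <- divisors N) eis_coef d / enorm R p d * b d n); last first.
  apply: eq_qexp q3 => z z0; rewrite mulN1r /slash mulrBr; congr (_ - _).
  by rewrite /eisenstein_part mulr_sumr; apply: eq_bigr => d _; rewrite mulrCA.
rewrite a0 -(eis_constant dlN) (bigD1_seq dl) ?divisors_uniq -?dvdn_divisors //=.
have [|-> _] := hb dl; first by rewrite -dvdn_divisors.
have -> : \sum_(d <- divisors N | d != dl) eis_coef d / enorm R p d * b d 0%N = 0.
  rewrite big_seq_cond big1 // => d /andP[dN ne].
  by have [-> _] := hb d dN; rewrite (negbTE ne) mulr0.
by rewrite eqxx addr0 mulN1r subrr.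
Qed.

End Decomposition.

Theorem theorem5p3 (R : realType) (N : nat) :
  (0 < N)%N -> squarefree N -> gcdn N 6 = 1%N ->
  exists2 C3 : R[i] -> R[i],
    cusp_form ((N - 1) %/ 2)%N N (chi N) C3 &
    forall z : R[i], upper_half_plane z ->
      f_theta (N - 1)%N z =
        1 + \sum_(d <- divisors N)
              (C_coef R d N
               * (N %/ d)%:R ^ ((N%:Z - 3) %/ 2)%Z
               * ((1 - N%:R) / gen_bernoulli R[i] (chi N) N ((N - 1) %/ 2))
               * \big[+%R/0]_(1 <= n <oo)
                   (sigma R ((N%:Z - 3) %/ 2)%Z (chi (N %/ d)) (chi d) n
                    * nome z ^+ n))
        + C3 z.
Proof.
(* For [N = 1] the weight is 0 and theta is 1; the factor [1 - N] kills the Eisenstein term, and the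
   cusp form is 0. *)
move=> N0 sqN N6; have [->|N1] := eqVneq N 1%N.
  exists (fun=> 0).
    split=> [z _|g z _ _|g _]; [exact: derivable_cst|by rewrite mulr0|].
    exists (fun=> 0) => // z _; apply: cvs_cvg.
    rewrite /slash mulr0; apply: (eq_cvs _ (cvs_cst _)); exists 0%N => n _.
    by rewrite /series /= big1 // => i _; rewrite mul0r.
  move=> z z0; rewrite (_ : divisors 1 = [:: 1%N]) // big_seq1 subrr mul0r mulr0 mul0r !addr0.
  rewrite f_thetaE // (csum_fin (A := [fset 0]%fset)) => [|x]; last by rewrite inE [x]thinmx0 eqxx.
  by rewrite big_seq_fset1 /theta !big_ord0 addr0 mul0r nome0.
have oN : odd N.
  apply: contraT => eN; have : (2 %| gcdn N 6)%N by rewrite dvdn_gcd dvdn2 eN.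
  by rewrite N6.
(* Excluding 3 as well as 1 leaves an odd [N >= 5], that is, weight at least 2, where the Eisenstein
   series converge. *)
have N3 : N != 3%N by apply: contra_eqN N6 => /eqP ->.
have [p p0 NE] : exists2 p, (0 < p)%N & N = p.+1.*2.+1.
  have := odd_double_half N; rewrite oN add1n; case: N./2 => [|[|q]] NE.
  - by rewrite -NE in N1.
  - by rewrite -NE in N3.
  - by exists q.+1.
rewrite NE in sqN *.
exists (fun z => f_theta p.+1.*2 z - eisenstein_part p z).
  by have := cusp_part R p0 sqN; rewrite subn1 /= -muln2 mulnK.
move=> z z0; rewrite subn1 /= eisenstein_partE //.
have -> : ((p.+1.*2.+1%:Z - 3) %/ 2)%Z = p%:Z.
  by rewrite (_ : _ - 3 = p%:Z * 2) ?mulzK //; rewrite -addnn; lia.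
have -> : (p.+1.*2 %/ 2)%N = p.+1 by rewrite -muln2 mulnK.
by rewrite addrC subrK.
Qed.
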